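(* Work over $\overline{\mathbb{Q}}$. (1) The map $\mathbb{A}^1\setminus\{0\}\to\mathcal{M}_3$, $a\mapsto\left[\frac{z^3+a}{az^2}\right]$, is one-to-one. The locus $\mathcal{A}_3(C_3)$ is an irreducible curve of genus zero with one singular point, corresponding to $\mathcal{A}_3(\mathfrak{A}_4)$. (2) The map $\mathbb{A}^1\setminus\{\pm1\}\to\mathcal{M}_3$, $a\mapsto\left[\frac{az^2+1}{z^3+az}\right]$, is two-to-one. The component of $\mathcal{A}_3(D_2)$ given by its image is a smooth irreducible curve of genus zero. (3) The map $\mathbb{A}^1\setminus\{\pm1\}\to\mathcal{M}_3$, $a\mapsto\left[\frac{az^2-1}{z^3-az}\right]$, is six-to-one. The component of $\mathcal{A}_3(D_2)$ given by its image is a smooth irreducible curve of genus zero. (4) The map $\mathbb{A}^2\setminus\{ab=1\}\to\mathcal{M}_3$, $(a,b)\mapsto\left[\frac{z^3+az}{bz^2+1}\right]$, is two-to-one. The component of $\mathcal{A}_3(C_2)$ given by its image is an irreducible rational singular surface. (5) The map $\mathbb{A}^2\setminus\{ab=1\}\to\mathcal{M}_3$, $(a,b)\mapsto\left[\frac{az^2+1}{z^3+bz}\right]$, is four-to-one. The component of $\mathcal{A}_3(C_2)$ given by its image is an irreducible singular surface.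
   Context: $\mathcal{M}_3=\mathrm{Rat}_3/\mathrm{PGL}_2$ is the moduli space of degree $3$ endomorphisms of $\mathbb{P}^1$ up to conjugation $f^\alpha=\alpha^{-1}\circ f\circ\alpha$, and $[f]$ is the class of $f$. $\mathrm{Aut}(f)=\{\alpha\in\mathrm{PGL}_2: f^\alpha=f\}$, and $\mathcal{A}_3(\Gamma)\subset\mathcal{M}_3$ is the set of classes whose automorphism group contains a subgroup isomorphic to $\Gamma$. $C_n$ is cyclic of order $n$, $D_n$ is dihedral of order $2n$, and $\mathfrak{A}_4$ is the alternating group on $4$ letters; $\mathcal{A}_3(\mathfrak{A}_4)$ is the single class of $\frac{z^3-3}{-3z^2}$, which is the member $a=-3$ of the family in (1). Multiplier invariants: for $f$ of degree $d$ and $n\ge1$, the period-$n$ points are the $d^n+1$ solutions of $f^n(z)=z$ counted with multiplicity; the multiplier of such a point $Q$ is $(f^n)'(Q)$ in an affine coordinate, and $\sigma^{(n)}_i$ ($1\le i\le d^n+1$) is the $i$-th elementary symmetric function of these multipliers. These are functions on $\mathcal{M}_d$. The geometric assertions (irreducible, genus, smooth/singular, rational) are about the variety in affine space obtained as the image of the family under the following multiplier invariants, with defining equations found by eliminating the parameters: $(\sigma^{(1)}_1,\sigma^{(1)}_2,\sigma^{(1)}_3)\in\mathbb{A}^3$ in (1), (2), (4); $(\sigma^{(2)}_1,\sigma^{(2)}_2,\sigma^{(2)}_3)\in\mathbb{A}^3$ in (3); and $(\sigma^{(1)}_1,\sigma^{(1)}_2,\sigma^{(1)}_3,\sigma^{(2)}_1,\sigma^{(2)}_2)\in\mathbb{A}^5$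 in (5). *)

(* Defs.v *)
From HB Require Import structures.
From mathcomp Require Export all_boot all_order all_algebra.
From mathcomp Require Export all_fingroup all_solvable all_field.
From mathcomp Require Export fraction.
From mathcomp Require Export mpoly.

Set Implicit Arguments.
Unset Strict Implicit.
Unset Printing Implicit Defensive.

Import Order.TTheory GRing.Theory Num.Theory.
Local Open Scope ring_scope.

(* [algC] is Qbar.  A rational map is a pair (numerator, denominator); the
   point at infinity of P^1 is [None : option algC]. *)
Definition ratmap : Type := ({poly algC} * {poly algC})%type.

Definition is_rat (d : nat) (f : ratmap) : bool :=
  (maxn (size f.1) (size f.2) == d.+1) && coprimep f.1 f.2.

(* Equality of the two rational functions: the pair is only determined up to
   a common nonzero scalar. *)
Definition rateq (f g : ratmap) : Prop :=
  exists2 c : algC, c != 0 & f = (c *: g.1, c *: g.2).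

(* v^d p(u/v), for p of degree at most d *)
Definition hsubst (d : nat) (p u v : {poly algC}) : {poly algC} :=
  \sum_(i < d.+1) p`_i *: (u ^+ i * v ^+ (d - i)).

(* f \o g, where f has degree d *)
Definition ratcomp (d : nat) (f g : ratmap) : ratmap :=
  (hsubst d f.1 g.1 g.2, hsubst d f.2 g.1 g.2).

Definition ratiter (d n : nat) (f : ratmap) : ratmap :=
  iter n (ratcomp d f) ('X, 1).

Definition mobius (A : 'M[algC]_2) : ratmap :=
  (A 0 0 *: 'X + (A 0 1)%:P, A 1 0 *: 'X + (A 1 1)%:P).

Definition ratconj (d : nat) (f : ratmap) (A : 'M[algC]_2) : ratmap :=
  ratcomp 1 (mobius (invmx A)) (ratcomp d f (mobius A)).

(* For f and g of degree d: [f] = [g] in M_d. *)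
Definition conjugate (d : nat) (f g : ratmap) : Prop :=
  exists2 A : 'M[algC]_2, A \in unitmx & rateq g (ratconj d f A).

Definition pgl_eq (A B : 'M[algC]_2) : Prop :=
  exists2 c : algC, c != 0 & A = c *: B.

Definition is_aut (d : nat) (f : ratmap) (A : 'M[algC]_2) : Prop :=
  A \in unitmx /\ rateq (ratconj d f A) f.

(* Subsets of M_d are represented by predicates on maps of degree d.
   [aut_locus d G] is A_d(G); rho chooses matrix representatives for an
   injective homomorphism from G to PGL_2 with image in Aut(f). *)
Definition aut_locus (d : nat) (gT : finGroupType) (G : {group gT})
    (f : ratmap) : Prop :=
  is_rat d f /\
  exists rho : gT -> 'M[algC]_2,
    [/\ forall g, g \in G -> is_aut d f (rho g),
        forall g h, g \in G -> h \in G ->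
          pgl_eq (rho (g * h)%g) (rho g *m rho h) &
        forall g, g \in G -> pgl_eq (rho g) 1%:M -> g = 1%g].

Definition image_in_moduli (d m : nat) (U : 'rV[algC]_m -> Prop)
    (fam : 'rV[algC]_m -> ratmap) (f : ratmap) : Prop :=
  is_rat d f /\ exists2 x, U x & conjugate d (fam x) f.

Definition one_to_one (d m : nat) (U : 'rV[algC]_m -> Prop)
    (fam : 'rV[algC]_m -> ratmap) : Prop :=
  forall x y, U x -> U y -> conjugate d (fam x) (fam y) -> x = y.

(* "n-to-one": over a nonempty Zariski-open set of parameters the fibres have
   exactly n elements.  Fibres over special classes may have another size:
   for (az^2 + 1)/(z^3 + az) the fibre of a is {a, -a}, a point if a = 0. *)
Definition n_to_one (n d m : nat) (U : 'rV[algC]_m -> Prop)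
    (fam : 'rV[algC]_m -> ratmap) : Prop :=
  exists2 H : {mpoly algC[m]}, H != 0 &
    forall x, U x -> H.@[x 0] != 0 ->
      exists s : seq 'rV[algC]_m,
        [/\ uniq s, size s = n &
            forall y, y \in s <-> (U y /\ conjugate d (fam x) (fam y))].

Definition poly_roots (p : {poly algC}) : seq algC :=
  sval (closed_field_poly_normal p).

(* Fixed points, with multiplicity, of a map F of degree D: the roots of the
   form F.1 - z F.2 of degree D + 1. *)
Definition fixed_points (D : nat) (F : ratmap) : seq (option algC) :=
  let P := F.1 - 'X * F.2 in
  [seq Some z | z <- poly_roots P] ++ nseq (D.+2 - size P) None.

Definition ratderiv (F : ratmap) (z : algC) : algC :=
  (F.1^`().[z] * F.2.[z] - F.1.[z] * F.2^`().[z]) / F.2.[z] ^+ 2.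

(* w^D p(1/w) *)
Definition revpoly (D : nat) (p : {poly algC}) : {poly algC} :=
  \poly_(i < D.+1) p`_(D - i).

(* The multiplier of F at a fixed point; at infinity the coordinate is
   w = 1/z, in which F becomes 1/F(1/w). *)
Definition multiplier (D : nat) (F : ratmap) (Q : option algC) : algC :=
  if Q is Some z then ratderiv F z
  else ratderiv (revpoly D F.2, revpoly D F.1) 0.

Definition multipliers (d n : nat) (f : ratmap) : seq algC :=
  let F := ratiter d n f in
  [seq multiplier (d ^ n) F Q | Q <- fixed_points (d ^ n) F].

Definition sigma (d n i : nat) (f : ratmap) : algC :=
  let ms := multipliers d n f in
  (mesym (size ms) algC i).@[tnth (in_tuple ms)].

Definition sigma1_123 (f : ratmap) : 'rV[algC]_3 :=
  \row_(i < 3) sigma 3 1 i.+1 f.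

Definition sigma2_123 (f : ratmap) : 'rV[algC]_3 :=
  \row_(i < 3) sigma 3 2 i.+1 f.

Definition sigma1_123_sigma2_12 (f : ratmap) : 'rV[algC]_5 :=
  \row_(i < 5) (if (i < 3)%N then sigma 3 1 i.+1 f else sigma 3 2 (i - 2) f).

Definition irreducible_set (X : Type) (closed : (X -> Prop) -> Prop)
    (T : X -> Prop) : Prop :=
  (exists x, T x) /\
  forall Z1 Z2 : X -> Prop, closed Z1 -> closed Z2 ->
    (forall x, T x -> Z1 x \/ Z2 x) ->
    (forall x, T x -> Z1 x) \/ (forall x, T x -> Z2 x).

Definition irreducible_component (X : Type) (closed : (X -> Prop) -> Prop)
    (S T : X -> Prop) : Prop :=
  [/\ forall x, T x -> S x,
      irreducible_set closed T &
      forall T' : X -> Prop, irreducible_set closed T' ->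
        (forall x, T x -> T' x) -> (forall x, T' x -> S x) ->
        forall x, T' x -> T x].

Definition coefs (d : nat) (f : ratmap) : 'rV[algC]_(d.+1 + d.+1) :=
  row_mx (\row_i f.1`_i) (\row_i f.2`_i).

(* Closed subsets of M_d = Rat_d / PGL_2 with the quotient topology:
   conjugation-invariant subsets of Rat_d cut out by polynomial equations in
   the coefficients.  Homogeneity need not be imposed on the equations, since
   invariance includes invariance under scaling of the pair. *)
Definition moduli_closed (d : nat) (Z : ratmap -> Prop) : Prop :=
  (forall f g, is_rat d f -> is_rat d g -> conjugate d f g -> Z f -> Z g) /\
  exists E : {mpoly algC[d.+1 + d.+1]} -> Prop,
    forall f, is_rat d f ->
      (Z f <-> forall F, E F -> F.@[coefs d f 0] = 0).

Definition vanishes_on (n : nat) (V : 'rV[algC]_n -> Prop)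
    (F : {mpoly algC[n]}) : Prop :=
  forall P, V P -> F.@[P 0] = 0.

Definition zariski_closure (n : nat) (S : 'rV[algC]_n -> Prop)
    (P : 'rV[algC]_n) : Prop :=
  forall F, vanishes_on S F -> F.@[P 0] = 0.

Definition zariski_closed (n : nat) (Z : 'rV[algC]_n -> Prop) : Prop :=
  forall P, zariski_closure Z P -> Z P.

(* The variety obtained from a subset T of M_d via the invariants s: the zero
   set of the equations found by elimination, that is, the Zariski closure of
   the image. *)
Definition variety_of (n : nat) (s : ratmap -> 'rV[algC]_n)
    (T : ratmap -> Prop) : 'rV[algC]_n -> Prop :=
  zariski_closure (fun P => exists2 f, T f & P = s f).

Definition irreducible_variety (n : nat) (V : 'rV[algC]_n -> Prop) : Prop :=
  zariski_closed V /\ irreducible_set (@zariski_closed n) V.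

Definition alg_independent_on (n r : nat) (V : 'rV[algC]_n -> Prop)
    (F : 'I_r -> {mpoly algC[n]}) : Prop :=
  forall H : {mpoly algC[r]},
    (forall P, V P -> H.@[fun i => (F i).@[P 0]] = 0) -> H = 0.

(* Dimension, as the transcendence degree over k of k[V] (V irreducible) *)
Definition has_dim (n : nat) (V : 'rV[algC]_n -> Prop) (d : nat) : Prop :=
  forall r : nat,
    (exists F : 'I_r -> {mpoly algC[n]}, alg_independent_on V F) <-> (r <= d)%N.

Definition irreducible_curve (n : nat) (V : 'rV[algC]_n -> Prop) : Prop :=
  irreducible_variety V /\ has_dim V 1.

Definition irreducible_surface (n : nat) (V : 'rV[algC]_n -> Prop) : Prop :=
  irreducible_variety V /\ has_dim V 2.

Definition tangent (n : nat) (V : 'rV[algC]_n -> Prop) (P v : 'rV[algC]_n) :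
    Prop :=
  forall F, vanishes_on V F -> \sum_i v 0 i * (F^`M(i)).@[P 0] = 0.

Definition has_tangent_dim (n : nat) (V : 'rV[algC]_n -> Prop)
    (P : 'rV[algC]_n) (r : nat) : Prop :=
  exists2 A : 'M[algC]_(r, n), row_free A &
    forall v : 'rV[algC]_n, tangent V P v <-> (v <= A)%MS.

Definition smooth_at (n : nat) (V : 'rV[algC]_n -> Prop) (P : 'rV[algC]_n) :
    Prop :=
  V P /\ exists2 d, has_dim V d & has_tangent_dim V P d.

Definition singular_at (n : nat) (V : 'rV[algC]_n -> Prop) (P : 'rV[algC]_n) :
    Prop :=
  V P /\ ~ smooth_at V P.

Definition smooth (n : nat) (V : 'rV[algC]_n -> Prop) : Prop :=
  forall P, V P -> smooth_at V P.

Definition singular (n : nat) (V : 'rV[algC]_n -> Prop) : Prop :=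
  exists P, singular_at V P.

(* phi makes K the field of fractions of the coordinate ring of V; the
   k-structure of K is [fun c => phi c%:MP]. *)
Definition is_function_field (n : nat) (V : 'rV[algC]_n -> Prop)
    (K : fieldType) (phi : {rmorphism {mpoly algC[n]} -> K}) : Prop :=
  (forall F, phi F = 0 <-> vanishes_on V F) /\
  (forall x : K, exists F G, phi G != 0 /\ x = phi F / phi G).

(* V, of dimension d, is birational to A^d: its function field is
   k-isomorphic to k(T_1, ..., T_d). *)
Definition rational_variety (n : nat) (V : 'rV[algC]_n -> Prop) : Prop :=
  exists d, has_dim V d /\
  exists phi : {rmorphism {mpoly algC[n]} -> {fraction {mpoly algC[d]}}},
    is_function_field V phi /\ forall c : algC, phi c%:MP = tofrac c%:MP.

(* The places of K/k are the normalized discrete valuations trivial on k;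
   values at 0 are irrelevant.  All places have degree 1, since k is
   algebraically closed. *)
Definition is_place (K : fieldType) (iota : algC -> K) (v : K -> int) : Prop :=
  [/\ forall x y, x != 0 -> y != 0 -> v (x * y) = v x + v y,
      forall x y, x != 0 -> y != 0 -> x + y != 0 ->
        Order.min (v x) (v y) <= v (x + y),
      forall c, c != 0 -> v (iota c) = 0 &
      exists2 x, x != 0 & v x = 1].

Definition same_place (K : fieldType) (v w : K -> int) : Prop :=
  forall x, x != 0 -> v x = w x.

Record divisor (K : fieldType) (iota : algC -> K) := Divisor {
  div_size : nat;
  div_place : 'I_div_size -> K -> int;
  div_coef : 'I_div_size -> int;
  div_placeP : forall i, is_place iota (div_place i);
  div_place_inj : forall i j, same_place (div_place i) (div_place j) -> i = j
}.

Arguments div_place {K iota} d _ _.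
Arguments div_coef {K iota} d _.

Definition div_deg (K : fieldType) (iota : algC -> K) (D : divisor iota) :
    int :=
  \sum_i div_coef D i.

Definition rr_space (K : fieldType) (iota : algC -> K) (D : divisor iota)
    (x : K) : Prop :=
  x != 0 ->
  (forall i, - div_coef D i <= div_place D i x) /\
  (forall w, is_place iota w -> (forall i, ~ same_place w (div_place D i)) ->
    0 <= w x).

Definition rr_dim (K : fieldType) (iota : algC -> K) (D : divisor iota)
    (r : nat) : Prop :=
  exists b : 'I_r -> K,
    (forall i, rr_space D (b i)) /\
    (forall x, rr_space D x ->
      exists! c : 'rV[algC]_r, x = \sum_i iota (c 0 i) * b i).

(* Stichtenoth's definition: the maximum of deg D - l(D) + 1 over all D *)
Definition has_genus (K : fieldType) (iota : algC -> K) (g : nat) : Prop :=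
  (forall (D : divisor iota) r, rr_dim D r ->
     div_deg D - r%:Z + 1 <= g%:Z) /\
  (exists (D : divisor iota) r, rr_dim D r /\ div_deg D - r%:Z + 1 = g%:Z).

Definition curve_genus (n : nat) (V : 'rV[algC]_n -> Prop) (g : nat) : Prop :=
  exists (K : fieldType) (phi : {rmorphism {mpoly algC[n]} -> K}),
    is_function_field V phi /\ has_genus (fun c => phi c%:MP) g.

Definition param1 (x : 'rV[algC]_1) : algC := x 0 0.

Definition dom_ne0 (x : 'rV[algC]_1) : Prop := param1 x != 0.

Definition dom_ne1 (x : 'rV[algC]_1) : Prop :=
  param1 x != 1 /\ param1 x != -1.

Definition dom_ab (x : 'rV[algC]_2) : Prop := x 0 0 * x 0 1 != 1.

Definition famC3 (x : 'rV[algC]_1) : ratmap :=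
  let a := param1 x in ('X^3 + a%:P, a *: 'X^2).

Definition famD2 (x : 'rV[algC]_1) : ratmap :=
  let a := param1 x in (a *: 'X^2 + 1, 'X^3 + a *: 'X).

Definition famD2' (x : 'rV[algC]_1) : ratmap :=
  let a := param1 x in (a *: 'X^2 - 1, 'X^3 - a *: 'X).

Definition famC2 (x : 'rV[algC]_2) : ratmap :=
  let a := x 0 0 in let b := x 0 1 in ('X^3 + a *: 'X, b *: 'X^2 + 1).

Definition famC2' (x : 'rV[algC]_2) : ratmap :=
  let a := x 0 0 in let b := x 0 1 in (a *: 'X^2 + 1, 'X^3 + b *: 'X).

(* The groups C_2, C_3 (written additively), D_2 of order 4, and A_4; ['D_m]
   is the dihedral group of order m. *)
Definition grpC2 : {group 'Z_2} := [set: 'Z_2]%G.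
Definition grpC3 : {group 'Z_3} := [set: 'Z_3]%G.
Definition grpD2 : {group 'D_4} := [set: 'D_4]%G.
Definition grpA4 : {group {perm 'I_4}} := ('Alt_('I_4))%G.

(* Main.v *)
(** On homogeneous coordinates a map of degree 3 is a pair of cubic forms F = (F1, F2), and conjugation
    is F |-> A^-1 o F o A up to a scalar.  Diagonalizing an automorphism of order 2 or 3 brings F to one
    of the normal forms of the families; this gives the loci.  The multipliers are read off explicit
    lists of the fixed points of F and of F o F.

    F is determined by the quartic form Phi = y F1 - x F2 and the quadratic form g = div F, on which
    conjugation acts by substitution.  The families are separated by closed conditions on (Phi, g): the
    invariant J of Phi vanishes on (2), g on (3), J and the joint invariant of Phi and g^2 on (4), and g
    is proportional to the second transvectant of Phi and g on (5); each of these closed sets meets the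
    competing family only inside the given one, so the families are irreducible components.

    Each variety is the closure of the image of a rational parametrization with, except in (5), a
    rational inverse.  A singular point is detected by exhibiting more independent tangent vectors than
    the dimension: at the cusp of (1), and at points of (4) and (5) where two, respectively three,
    sheets of the parametrization meet. *)
Require Import Defs.
From mathcomp Require Import alt extremal ring zify.
From Stdlib Require Import Classical ClassicalEpsilon FunctionalExtensionality PropExtensionality.

Set Implicit Arguments.
Unset Strict Implicit.
Unset Printing Implicit Defensive.

Import Order.TTheory GRing.Theory Num.Theory.
Local Open Scope ring_scope.

(** The ideal of a variety is never computed. A variety is the closure of a parametrized image, so a
    polynomial vanishes on it exactly when its pullback to the parameters is zero; irreducibility,
    dimension and function field are read off that pullback. Tangent spaces are bounded above by a
    few explicit equations and below by curves in the image.

    The families are not shown to be closed in the moduli space; this is why components are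
    separated by closed sets that may be larger than the families.

    Families (2) and (3) are the lines a = b and a = - b of (5), the second after rescaling, so one
    computation of spectra serves all three. Its result depends only on [kap] and [eta]. The line a
    = - b is kap = 4; a symmetric group on three letters acts on the parameter of (3), which
    explains both the number six there and the triple point in (5). The double point in (4) lies on
    its line a = b, where a and (3 - a) / (1 + a) give conjugate maps. *)

Notation k := algC.

Lemma predext (T : Type) (P Q : T -> Prop) : (forall x, P x <-> Q x) -> P = Q.
Proof.
by move=> PQ; apply: functional_extensionality => x; apply: propositional_extensionality.
Qed.

(** * Multivariate polynomials *)

(** Facts about evaluations and derivations need checking only on constants, variables, sums and
    products. *)
Lemma mpoly_ring_ind n (P : {mpoly k[n]} -> Prop) :
  (forall c, P c%:MP) -> (forall i, P 'X_i) ->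
  (forall p q, P p -> P q -> P (p + q)) -> (forall p q, P p -> P q -> P (p * q)) ->
  forall p, P p.
Proof.
move=> PC PX PD PM; elim/mpolyind => [|c m p _ _ Pp]; first by rewrite -mpolyC0.
apply: PD => //; rewrite -mul_mpolyC; apply: (PM) => //; rewrite mpolyXE_id.
have P1 : P 1 by rewrite -mpolyC1.
apply: (big_ind P) => // i _; elim: (m i) => [|j IH]; first by rewrite expr0.
by rewrite exprS; apply: PM.
Qed.

Lemma poly_eq0_fun (p : {poly k}) : (forall x, p.[x] = 0) -> p = 0.
Proof.
move=> p0; apply/eqP/negPn/negP => pn0.
have := @max_poly_roots _ p [seq i%:R | i <- iota 0 (size p)] pn0.
rewrite size_map size_iota ltnn => H; suff: false by []; apply: H.
  by apply/allP => x _; apply/rootP/p0.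
rewrite map_inj_uniq ?iota_uniq // => i j /eqP.
by rewrite eqr_nat => /eqP.
Qed.

Lemma poly_eq0_cofinite (p q : {poly k}) :
  q != 0 -> (forall x, q.[x] != 0 -> p.[x] = 0) -> p = 0.
Proof.
move=> qn0 pq0; apply/eqP; rewrite -(mulIr_eq0 _ (mulIf qn0)); apply/eqP.
apply: poly_eq0_fun => x; rewrite hornerM.
by have [->|/pq0 ->] := eqVneq q.[x] 0; rewrite ?mulr0 ?mul0r.
Qed.

(** Induction on the number of variables: [muni] regards [p] as a polynomial in the last variable,
    whose coefficients vanish as functions and so, inductively, as polynomials. *)
Lemma mpoly_eq0_fun n (p : {mpoly k[n]}) : (forall v, p.@[v] = 0) -> p = 0.
Proof.
elim: n p => [|n IH] p p0.
  by move: (p0 (fun=> 0)); rewrite (nvar0_mpolyC p) mevalC => ->; rewrite mpolyC0.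
pose m' (m : 'X_{1.. n.+1}) : 'X_{1.. n} := [multinom m (widen_ord (leqnSn n) i) | i < n].
have m'_inj (m1 m2 : 'X_{1.. n.+1}) : m1 ord_max = m2 ord_max -> m' m1 = m' m2 -> m1 = m2.
  move=> eqmax eqm'; apply/mnmP => i; have [->//|neq] := eqVneq i ord_max.
  have lti : (i < n)%N by rewrite ltn_neqAle -ltnS ltn_ord andbT; apply: contraNneq neq => e; apply/eqP/val_inj.
  have /mnmP /(_ (Ordinal lti)) := eqm'; rewrite !mnmE.
  by rewrite (_ : widen_ord _ _ = i) //; apply/val_inj.
have uni0 : muni p = 0.
  apply/polyP => j; rewrite coef0; apply: IH => v.
  pose u : {poly k} := map_poly (meval v) (muni p).
  suff -> : ((muni p)`_j).@[v] = u`_j.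
    suff -> : u = 0 by rewrite coef0.
    (* The valuation that extends [v] by the value [x] of the last variable. *)
    apply: poly_eq0_fun => x; rewrite -[RHS](p0 (fun i => oapp v x (insub (val i) : option 'I_n))).
    rewrite mevalE /u muniE rmorph_sum horner_sum; apply: eq_bigr => m _.
    rewrite /= map_polyZ map_polyXn hornerZ hornerXn /= mevalZ mevalX -mulrA; congr (_ * _).
    rewrite big_ord_recr /= insubF ?ltnn //=; congr (_ * _); apply: eq_bigr => i _.
    by rewrite mnmE /= insubT //= => lti; rewrite (_ : Sub _ _ = i) //; apply/val_inj.
  by rewrite coef_map.
apply/mpolyP => m; rewrite mcoeff0.
have [mp|/memN_msupp_eq0 //] := boolP (m \in msupp p).
have := congr1 (fun u : {poly {mpoly k[n]}} => u`_(m ord_max)@_(m' m)) uni0.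
rewrite muniE coef0 mcoeff0 coef_sum raddf_sum /= (bigD1_seq m) //=.
rewrite big1 => [|m1 neq].
  by rewrite addr0 coefZ coefXn eqxx mulr1 mcoeffZ mcoeffX eqxx mulr1.
rewrite coefZ coefXn; case: eqP => [e|_]; last by rewrite mulr0 mcoeff0.
rewrite mulr1 mcoeffZ mcoeffX; case: eqP => [e'|_]; last by rewrite mulr0.
by case/eqP: neq; apply: m'_inj.
Qed.

Lemma mpoly_eq0_open n (p q : {mpoly k[n]}) :
  q != 0 -> (forall v, q.@[v] != 0 -> p.@[v] = 0) -> p = 0.
Proof.
move=> qn0 pq0; apply/eqP; rewrite -(mulIr_eq0 _ (mulIf qn0)); apply/eqP.
apply: mpoly_eq0_fun => x; rewrite mevalM.
by have [->|/pq0 ->] := eqVneq q.@[x] 0; rewrite ?mulr0 ?mul0r.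
Qed.

(** All exponents of a monomial of degree below B are below B, so counting a box is enough. *)
Lemma card_bmultinom m B : (#|{: 'X_{1..m < B}}| <= B ^ m)%N.
Proof.
case: B => [|B].
  by rewrite eq_card0 // => x; have := bmdeg x; rewrite ltn0.
pose f (b : 'X_{1..m < B.+1}) := [ffun i : 'I_m => inord (b i) : 'I_B.+1].
have finj : injective f.
  move=> b1 b2 /ffunP e; apply/val_inj/mnmP => i; have := e i; rewrite !ffunE.
  move/(congr1 val); rewrite /= !inordK //.
    by apply: leq_ltn_trans (bmdeg b2); rewrite mdegE (bigD1 i) //= leq_addr.
  by apply: leq_ltn_trans (bmdeg b1); rewrite mdegE (bigD1 i) //= leq_addr.
by rewrite -(card_codom finj) (leq_trans (max_card _)) // card_ffun !card_ord.
Qed.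

Lemma msize_expr_le n (p : {mpoly k[n]}) D e : (msize p <= D.+1 -> msize (p ^+ e) <= (e * D).+1)%N.
Proof.
move=> pD; elim: e => [|e IH]; first by rewrite expr0 msize1.
have [->|pn0] := eqVneq p 0; first by rewrite expr0n /= msize0.
have [e0|en0] := eqVneq (p ^+ e) 0; first by rewrite exprS e0 mulr0 msize0.
rewrite exprS msizeM // mulSn.
have := leq_add pD IH; case: (msize p) => [|a]; case: (msize (p ^+ e)) => [|b] //=; lia.
Qed.

Lemma msizeM_le2 n (p q : {mpoly k[n]}) a b :
  (msize p <= a.+1 -> msize q <= b.+1 -> msize (p * q) <= (a + b).+1)%N.
Proof.
move=> pa qb.
have [->|pn0] := eqVneq p 0; first by rewrite mul0r msize0.
have [->|qn0] := eqVneq q 0; first by rewrite mulr0 msize0.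
by rewrite msizeM //; move: pa qb; case: (msize p) => [|?]; case: (msize q) => [|?] //=; lia.
Qed.

(* Counting: the [N ^ r] monomials in the [P i / q] with exponents below [N]
   are, over a common denominator, polynomials of degree [O(N)] in [m] variables. *)
Lemma alg_dependence m r (q : {mpoly k[m]}) (P : 'I_r -> {mpoly k[m]}) : (m < r)%N ->
  exists2 H : {mpoly k[r]}, H != 0 &
    forall x, q.@[x] != 0 -> H.@[fun i => (P i).@[x] / q.@[x]] = 0.
Proof.
move=> mr.
pose D := maxn (msize q) (\max_i msize (P i)).
have qD : (msize q <= D.+1)%N by rewrite leqW // leq_maxl.
have PD i : (msize (P i) <= D.+1)%N.
  by rewrite leqW // leq_max (leq_bigmax (F := fun i => msize (P i))) orbT.
(* Since B <= N (r D + 1) and N exceeds (r D + 1) ^ m, one gets B ^ m < N ^ (m + 1) <= N ^ r: there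
   are more exponent vectors than monomials of degree below B. *)
pose N := ((r * D).+1 ^ m).+1; pose B := (r * (N * D)).+1.
pose E : finType := {ffun 'I_r -> 'I_N}.
(* The monomial of exponent [e] in the P i / q, times the common denominator q ^ (N r). *)
pose W (e : E) := \prod_i (P i ^+ e i * q ^+ (N - e i)).
have WB e : (msize (W e) <= B)%N.
  rewrite /W /B -[X in (X * (N * D))%N](card_ord r) -sum1_card big_distrl /=.
  apply: (big_ind2 (fun (p : {mpoly k[m]}) s => (msize p <= s.+1)%N)).
  - by rewrite msize1.
  - by move=> p a p' b; apply: msizeM_le2.
  - move=> i _; rewrite mul1n; have le : (e i <= N)%N by rewrite ltnW.
    have -> : (N * D = e i * D + (N - e i) * D)%N by rewrite -mulnDl subnKC.
    by apply: msizeM_le2; apply: msize_expr_le.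
pose M := \matrix_(i < #|E|, j < #|{: 'X_{1..m < B}}|) (W (enum_val i))@_(enum_val j).
have rkM : (\rank M < #|E|)%N.
  apply: leq_ltn_trans (rank_leq_col M) _; apply: leq_ltn_trans (card_bmultinom _ _) _.
  rewrite card_ffun !card_ord.
  have BN : (B <= N * (r * D).+1)%N by rewrite /B; nia.
  have le : (B ^ m <= (N * (r * D).+1) ^ m)%N.
    by clearbody B N; case: (m) => [|j]; rewrite ?expn0 ?leq_exp2r.
  apply: leq_ltn_trans le _; rewrite expnMn.
  apply: (@leq_trans (N ^ m.+1)); last exact: leq_pexp2l.
  by rewrite expnSr ltn_pmul2l // expn_gt0.
have kern : kermx M != 0 by rewrite -mxrank_eq0 mxrank_ker -lt0n subn_gt0.
have [i0 row0] : exists i, row i (kermx M) != 0.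
  by apply/existsP; apply: contraNT kern; rewrite negb_exists => /forallP H; apply/eqP/row_matrixP => i; rewrite row0; apply/eqP; rewrite -[_ == _]negbK.
set c := row i0 (kermx M) in row0.
have cM : c *m M = 0 by apply/sub_kermxP; rewrite row_sub.
pose mon (e : E) : 'X_{1.. r} := [multinom (e i : nat) | i < r].
exists (\sum_i c 0 i *: 'X_[mon (enum_val i)]).
  apply: contraNneq row0 => H0; apply/eqP/rowP => j; rewrite [RHS]mxE.
  have := congr1 (mcoeff (mon (enum_val j))) H0; rewrite mcoeff0 raddf_sum /= (bigD1 j) //=.
  rewrite big1 => [|j' neq]; first by rewrite addr0 mcoeffZ mcoeffX eqxx mulr1.
  rewrite mcoeffZ mcoeffX; case: eqP => [e|_]; last by rewrite mulr0.
  case/eqP: neq; apply: enum_val_inj; apply/ffunP => i; apply/val_inj.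
  by have /mnmP/(_ i) := e; rewrite !mnmE.
move=> x qx; rewrite raddf_sum /=.
have comb0 : \sum_i c 0 i *: W (enum_val i) = 0.
  apply/mpolyP => mm; rewrite mcoeff0 raddf_sum /=.
  have [lt|ge] := ltnP (mdeg mm) B.
    have e : \sum_i c 0 i * M i (enum_rank (BMultinom lt)) = 0.
      by have /matrixP/(_ 0 (enum_rank (BMultinom lt))) := cM; rewrite [LHS]mxE [RHS]mxE.
    rewrite -[RHS]e; apply: eq_bigr => i _.
    by rewrite mcoeffZ [M _ _]mxE enum_rankK.
  rewrite big1 // => i _; rewrite mcoeffZ memN_msupp_eq0 ?mulr0 //.
  by apply: msize_mdeg_ge; apply: leq_trans ge; apply: WB.
apply: (mulIf (expf_neq0 (N * r) qx)); rewrite mul0r mulr_suml -[RHS](meval0 x) -comb0 raddf_sum /=.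
apply: eq_bigr => i _; rewrite !mevalZ -mulrA; congr (_ * _); rewrite mevalX rmorph_prod /=.
rewrite exprM -[X in _ * _ ^+ X](card_ord r) -prodr_const -big_split /=; apply: eq_bigr => j _.
rewrite mnmE rmorphM !rmorphXn /= expr_div_n.
have le : (enum_val i j <= N)%N by rewrite ltnW.
have -> : q.@[x] ^+ N = q.@[x] ^+ (enum_val i j) * q.@[x] ^+ (N - enum_val i j) by rewrite -exprD subnKC.
by rewrite mulrA mulfVK ?expf_neq0.
Qed.

(** * Parametrized varieties *)

Lemma fracE (R : idomainType) (x : {fraction R}) :
  exists a b : R, b != 0 /\ x = tofrac a / tofrac b.
Proof.
elim/quotW: x => x; exists x.1, x.2; split; first exact: denom_ratioP.
have dn := denom_ratioP x.
apply/eqP; rewrite !piE /= /FracField.mulf /FracField.invf !numden_Ratio ?oner_eq0 //.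
by rewrite mulr1 mul1r FracField.Ratio_numden.
Qed.

(** The pullback of functions along the parametrization p / q. *)
Lemma gphi_exists n m (p : 'I_n -> {mpoly k[m]}) (q : {mpoly k[m]}) :
  exists phi : {rmorphism {mpoly k[n]} -> {fraction {mpoly k[m]}}},
    (forall c, phi c%:MP = tofrac c%:MP) /\ (forall i, phi 'X_i = tofrac (p i) / tofrac q).
Proof.
exists (mmap (@tofrac {mpoly k[m]} \o @mpolyC m k) (fun i => tofrac (p i) / tofrac q)).
by split=> [c|i] /=; [rewrite mmapC | rewrite mmapX mmap1U].
Qed.

Section Param.
Variables (n m : nat) (p : 'I_n -> {mpoly k[m]}) (q : {mpoly k[m]}).
Hypothesis qn0 : q != 0.

Definition gpt (x : 'I_m -> k) : 'rV[k]_n := \row_i ((p i).@[x] / q.@[x]).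
Definition gimage (P : 'rV[k]_n) : Prop := exists2 x, q.@[x] != 0 & P = gpt x.
Definition gvar : 'rV[k]_n -> Prop := zariski_closure gimage.

Variables (K : fieldType) (tf : {rmorphism {mpoly k[m]} -> K}).
Hypothesis tf_eq0 : forall a, (tf a == 0) = (a == 0).
Hypothesis tf_frac : forall x : K, exists a b, b != 0 /\ x = tf a / tf b.
Variable gphi : {rmorphism {mpoly k[n]} -> K}.
Hypothesis gphiC : forall c, gphi c%:MP = tf c%:MP.
Hypothesis gphiX : forall i, gphi 'X_i = tf (p i) / tf q.

Lemma tfq : tf q != 0.
Proof. by rewrite tf_eq0. Qed.

(** The same numerator [P] serves for the values on the image and for the pullback in [K]; this
    links vanishing on the image with vanishing in [K]. *)
Lemma clear_denom F : exists N P,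
  (forall x, q.@[x] != 0 -> F.@[gpt x 0] * q.@[x] ^+ N = P.@[x]) /\
  gphi F * tf q ^+ N = tf P.
Proof.
elim/mpoly_ring_ind: F => [c|i|F G [N [P [H1 H2]]] [N' [P' [H1' H2']]]|F G [N [P [H1 H2]]] [N' [P' [H1' H2']]]].
- exists 0%N, c%:MP; split => [x _|]; first by rewrite expr0 mulr1 !mevalC.
  by rewrite expr0 mulr1 gphiC.
- exists 1%N, (p i); split => [x qx|]; first by rewrite expr1 mevalXU mxE mulfVK.
  by rewrite expr1 gphiX mulfVK // tfq.
- exists (N + N')%N, (P * q ^+ N' + P' * q ^+ N); split => [x qx|].
    by rewrite !mevalD !mevalM !rmorphXn /= -H1 // -H1' // exprD; ring.
  by rewrite rmorphD [RHS]rmorphD !rmorphM !rmorphXn /= -H2 -H2' exprD; ring.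
exists (N + N')%N, (P * P'); split => [x qx|].
  by rewrite !mevalM -H1 // -H1' // exprD; ring.
by rewrite rmorphM [RHS]rmorphM -H2 -H2' exprD; ring.
Qed.

Lemma gvar_gpt x : q.@[x] != 0 -> gvar (gpt x).
Proof. by move=> qx F; apply; exists x. Qed.

Lemma vanishes_gvar F :
  vanishes_on gvar F <-> forall x, q.@[x] != 0 -> F.@[gpt x 0] = 0.
Proof.
split=> [H x qx|H P]; first exact/H/gvar_gpt.
by apply=> _ [x qx ->]; apply: H.
Qed.

Lemma gphi_eq0 F : gphi F = 0 <-> vanishes_on gvar F.
Proof.
have [N [P [H1 H2]]] := clear_denom F; rewrite vanishes_gvar; split => H.
  move=> x qx; apply: (mulIf (expf_neq0 N qx)); rewrite mul0r H1 //.
  by move: H2; rewrite H mul0r => /esym/eqP; rewrite tf_eq0 => /eqP ->; rewrite meval0.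
apply: (mulIf (expf_neq0 N tfq)); rewrite mul0r H2; apply/eqP; rewrite tf_eq0; apply/eqP.
by apply: mpoly_eq0_open qn0 _ => x qx; rewrite -H1 // H // mul0r.
Qed.

Lemma gvar_closed : zariski_closed gvar.
Proof. by move=> P H F HF; apply: H => Q; apply. Qed.

(** By [gphi_eq0] the ideal of the variety is the kernel of a morphism to a field, hence prime. A
    closed set that does not contain the variety has an equation outside this kernel. *)
Lemma gvar_irreducible : irreducible_variety gvar.
Proof.
split; first exact: gvar_closed.
split.
  have [x qx] : exists x, q.@[x] <> 0.
    apply: not_all_ex_not => H; case/eqP: qn0; exact: mpoly_eq0_fun.
  by exists (gpt x); apply: gvar_gpt; apply/eqP.
have sep Z : zariski_closed Z -> ~ (forall P, gvar P -> Z P) ->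
    exists2 F, (forall P, Z P -> F.@[P 0] = 0) & gphi F <> 0.
  move=> Zc nZ; have [P HP] := not_all_ex_not _ _ nZ; have [VP ZP] := imply_to_and _ _ HP.
  have ncl : ~ zariski_closure Z P by move=> /Zc.
  have [F HF] := not_all_ex_not _ _ ncl; have [FZ FP] := imply_to_and _ _ HF.
  by exists F => // /gphi_eq0 /(_ _ VP).
move=> Z1 Z2 c1 c2 cov; have [|n1] := classic (forall P, gvar P -> Z1 P); first by left.
have [|n2] := classic (forall P, gvar P -> Z2 P); first by right.
have [F1 v1 /eqP f1] := sep _ c1 n1; have [F2 v2 /eqP f2] := sep _ c2 n2.
have /eqP[] : gphi (F1 * F2) != 0 by rewrite rmorphM mulf_neq0.
apply/gphi_eq0 => P /cov[/v1|/v2] e; rewrite mevalM e ?mul0r ?mulr0 //.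
Qed.

(** Over a common power of [q] the pullbacks of the F i are polynomials in m variables, so
    [alg_dependence] applies as soon as r > m. *)
Lemma gvar_dim_le r : (exists F : 'I_r -> {mpoly k[n]}, alg_independent_on gvar F) -> (r <= m)%N.
Proof.
case=> F ind; rewrite leqNgt; apply/negP => mr.
have /(fin_all_exists (U := fun _ => (nat * {mpoly k[m]})%type)) [NP HNP] : forall i, exists NP : nat * {mpoly k[m]},
    forall x, q.@[x] != 0 -> (F i).@[gpt x 0] * q.@[x] ^+ NP.1 = NP.2.@[x].
  by move=> i; have [N [P [H _]]] := clear_denom (F i); exists (N, P).
(* The common exponent of [q]. *)
pose M := \max_i (NP i).1.
have leK i : ((NP i).1 <= M)%N by exact: (leq_bigmax (F := fun i => (NP i).1)).
have [H Hn0 Hv] := alg_dependence (q ^+ M) (fun i => (NP i).2 * q ^+ (M - (NP i).1)) mr.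
case/eqP: Hn0; apply: ind => P VP.
rewrite -[LHS](_ : (H \mPo [tuple F i | i < r]).@[P 0] = _); last first.
  by rewrite comp_mpoly_meval; apply: meval_eq => i; rewrite tnth_mktuple.
move: P VP; apply/vanishes_gvar => x qx.
rewrite comp_mpoly_meval -[RHS](Hv x); last by rewrite rmorphXn expf_neq0.
apply: meval_eq => i; rewrite tnth_mktuple mevalM -HNP // !rmorphXn /=.
have -> : q.@[x] ^+ M = q.@[x] ^+ (NP i).1 * q.@[x] ^+ (M - (NP i).1) by rewrite -exprD subnKC.
by field; rewrite !expf_neq0.
Qed.

(** If the F i take almost every tuple of values on the image, a relation among some of them
    vanishes on a nonempty open set and is therefore trivial. *)
Lemma gvar_dim (F : 'I_m -> {mpoly k[n]}) (h : {mpoly k[m]}) : h != 0 ->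
  (forall y, h.@[y] != 0 -> exists2 x, q.@[x] != 0 & forall i, (F i).@[gpt x 0] = y i) ->
  has_dim gvar m.
Proof.
move=> hn0 dom r; split; first exact: gvar_dim_le.
move=> rm; exists (fun i => F (widen_ord rm i)) => H HV.
pose H' := H \mPo [tuple 'X_(widen_ord rm i) | i < r] : {mpoly k[m]}.
have H'E y : H'.@[y] = H.@[fun i => y (widen_ord rm i)].
  by rewrite comp_mpoly_meval; apply: meval_eq => i; rewrite tnth_mktuple mevalXU.
have H'0 : H' = 0.
  apply: mpoly_eq0_open hn0 _ => y /dom [x qx Fx]; rewrite H'E -[RHS](HV _ (gvar_gpt qx)).
  by apply: meval_eq => i; rewrite Fx.
apply: mpoly_eq0_fun => v.
have := H'E (fun i => oapp v 0 (insub (val i) : option 'I_r)); rewrite H'0 meval0 => ->.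
apply: meval_eq => i; rewrite /= insubT //= => lti; congr v; exact: val_inj.
Qed.

(** Ratios of pullbacks are stable under the ring operations, so it suffices to express the
    parameters themselves. *)
Lemma gvar_function_field (F G : 'I_m -> {mpoly k[n]}) :
  (forall i, gphi (G i) != 0 /\ tf 'X_i = gphi (F i) / gphi (G i)) ->
  is_function_field gvar gphi.
Proof.
move=> gen; split=> [f|x]; first exact: gphi_eq0.
have ratio (a : {mpoly k[m]}) : exists f g, gphi g != 0 /\ tf a = gphi f / gphi g.
  elim/mpoly_ring_ind: a => [c|i|a b [f [g [gn e]]] [f' [g' [gn' e']]]|a b [f [g [gn e]]] [f' [g' [gn' e']]]].
  - by exists c%:MP, 1; rewrite rmorph1 oner_eq0 divr1 gphiC.
  - by exists (F i), (G i).
  - exists (f * g' + f' * g), (g * g'); rewrite rmorphM mulf_neq0 //; split=> //.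
    by rewrite !rmorphD !rmorphM e e' addf_div.
  exists (f * f'), (g * g'); rewrite rmorphM mulf_neq0 //; split=> //.
  by rewrite !rmorphM e e' mulf_div.
have [a [b [bn0 ->]]] := tf_frac x.
have [f [g [gn e]]] := ratio a; have [f' [g' [gn' e']]] := ratio b.
exists (f * g'), (g * f').
have fn' : gphi f' != 0.
  by apply: contraNneq bn0 => f0; move: e'; rewrite f0 mul0r => /eqP; rewrite tf_eq0.
rewrite !rmorphM mulf_neq0 //; split=> //.
by rewrite e e' invf_div mulf_div.
Qed.

End Param.

Section Wrappers.
Variables (n m : nat) (p : 'I_n -> {mpoly k[m]}) (q : {mpoly k[m]}).
Hypothesis qn0 : q != 0.

Lemma gvar_irreducible_variety : irreducible_variety (gvar p q).
Proof.
have [phi [phiC phiX]] := gphi_exists p q.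
exact: (gvar_irreducible qn0 (@tofrac_eq0 _) phiC phiX).
Qed.

Lemma gvar_has_dim (F : 'I_m -> {mpoly k[n]}) (h : {mpoly k[m]}) : h != 0 ->
  (forall y, h.@[y] != 0 -> exists2 x, q.@[x] != 0 & forall i, (F i).@[gpt p q x 0] = y i) ->
  has_dim (gvar p q) m.
Proof.
have [phi [phiC phiX]] := gphi_exists p q.
exact: (gvar_dim qn0 (@tofrac_eq0 _) phiC phiX).
Qed.

End Wrappers.

(** * Tangent spaces *)

(** First-order expansion along the curve t |-> P + t^e w(t) / Q(t), with the denominator cleared so
    that the remainder is visibly t^(2e) times a polynomial. *)
Lemma taylor n (P : 'rV[k]_n) (w : 'I_n -> {poly k}) (Q : {poly k}) (e : nat) F :
  exists N (R : {poly k}), forall t, Q.[t] != 0 ->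
    (F.@[fun i => P 0 i + t ^+ e * ((w i).[t] / Q.[t])] - F.@[P 0]
      - t ^+ e * \sum_i (w i).[t] / Q.[t] * (F^`M(i)).@[P 0]) * Q.[t] ^+ N
    = t ^+ (e + e) * R.[t].
Proof.
elim/mpoly_ring_ind: F => [c|j|F G [N [R HR]] [N' [R' HR']]|F G [N [R HR]] [N' [R' HR']]].
- exists 0%N, 0 => t _; rewrite !mevalC big1 => [|i _]; last by rewrite mderivC meval0 mulr0.
  by rewrite horner0; ring.
- exists 0%N, 0 => t _; rewrite !mevalXU (bigD1 j) //= big1 => [|i neq].
    rewrite mderivX mnmE eqxx scale1r (_ : (U_(j) - U_(j))%MM = 0%MM); last first.
      by apply/mnmP => i; rewrite mnmBE subnn mnm0E.
    by rewrite mpolyX0 meval1 horner0; ring.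
  by rewrite mderivX mnmE (negbTE (_ : j != i)) ?scale0r ?meval0 ?mulr0 // eq_sym.
- exists (N + N')%N, (R * Q ^+ N' + R' * Q ^+ N) => t Qt.
  rewrite !mevalD hornerD !hornerM !horner_exp exprD mulrDr !mulrA -HR // -HR' //.
  rewrite (eq_bigr (fun i => (w i).[t] / Q.[t] * (F^`M(i)).@[P 0] + (w i).[t] / Q.[t] * (G^`M(i)).@[P 0])).
    by rewrite big_split /=; ring.
  by move=> i _; rewrite mderivD mevalD mulrDr.
pose dF t := \sum_i (w i).[t] / Q.[t] * (F^`M(i)).@[P 0].
pose dG t := \sum_i (w i).[t] / Q.[t] * (G^`M(i)).@[P 0].
pose pF := \sum_i (F^`M(i)).@[P 0] *: w i; pose pG := \sum_i (G^`M(i)).@[P 0] *: w i.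
have dFE t : Q.[t] != 0 -> dF t * Q.[t] = pF.[t].
  move=> Qt; rewrite /dF /pF horner_sum mulr_suml; apply: eq_bigr => i _.
  by rewrite hornerZ; field.
have dGE t : Q.[t] != 0 -> dG t * Q.[t] = pG.[t].
  move=> Qt; rewrite /dG /pG horner_sum mulr_suml; apply: eq_bigr => i _.
  by rewrite hornerZ; field.
pose a := F.@[P 0]; pose b := G.@[P 0].
(* F G = (a + t^e dF + eF)(b + t^e dG + eG) *)
exists (N + N' + 2)%N, ((R * Q ^+ N' * (b *: Q + 'X^e * pG) + R' * Q ^+ N * (a *: Q + 'X^e * pF)) * Q
   + 'X^(e + e) * R * R' * Q ^+ 2 + pF * pG * Q ^+ (N + N')) => t Qt.
have := HR t Qt; have := HR' t Qt; rewrite -/(dF t) -/(dG t) -/a -/b.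
rewrite (eq_bigr (fun i => a * ((w i).[t] / Q.[t] * (G^`M(i)).@[P 0]) + b * ((w i).[t] / Q.[t] * (F^`M(i)).@[P 0]))); last first.
  by move=> i _; rewrite mderivM mevalD !mevalM -/a -/b; ring.
rewrite big_split /= -!mulr_sumr -/(dF t) -/(dG t) !mevalM -/a -/b.
set f := F.@[_]; set g := G.@[_] => HG HF.
rewrite !(hornerD, hornerM, hornerZ, hornerXn, horner_exp) -dFE // -dGE //.
have -> : (f * g - a * b - t ^+ e * (a * dG t + b * dF t)) =
  (f - a - t ^+ e * dF t) * (b + t ^+ e * dG t) + (g - b - t ^+ e * dG t) * (a + t ^+ e * dF t)
  + (f - a - t ^+ e * dF t) * (g - b - t ^+ e * dG t) + t ^+ e * t ^+ e * dF t * dG t by ring.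
move: HF HG; set EF := f - a - _; set EG := g - b - _ => HF HG.
clearbody EF EG.
rewrite !mulrDl !exprD.
have -> : EF * (b + t ^+ e * dG t) * (Q.[t] ^+ N * Q.[t] ^+ N' * Q.[t] ^+ 2) =
  (EF * Q.[t] ^+ N) * (b + t ^+ e * dG t) * Q.[t] ^+ N' * Q.[t] ^+ 2 by ring.
have -> : EG * (a + t ^+ e * dF t) * (Q.[t] ^+ N * Q.[t] ^+ N' * Q.[t] ^+ 2) =
  (EG * Q.[t] ^+ N') * (a + t ^+ e * dF t) * Q.[t] ^+ N * Q.[t] ^+ 2 by ring.
have -> : EF * EG * (Q.[t] ^+ N * Q.[t] ^+ N' * Q.[t] ^+ 2) =
  (EF * Q.[t] ^+ N) * (EG * Q.[t] ^+ N') * Q.[t] ^+ 2 by ring.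
by rewrite HF HG !exprD; ring.
Qed.

(** If F vanishes along P + t^e w / Q, its linear term t^e (dF . w) is divisible by t^(2e) up to a
    unit at 0, so dF . w is divisible by t^e and the first e coefficients of w are all tangent. For
    e = 1 this is the velocity; for e = 2 a cusp yields two vectors. *)
Lemma tangent_curve n (V : 'rV[k]_n -> Prop) (P : 'rV[k]_n) (w : 'I_n -> {poly k})
    (Q h : {poly k}) (e : nat) :
  h != 0 -> Q.[0] != 0 ->
  (forall t, Q.[t] != 0 -> h.[t] != 0 -> V (\row_i (P 0 i + t ^+ e * ((w i).[t] / Q.[t])))) ->
  forall j, (j < e)%N -> tangent V P (\row_i (w i)`_j).
Proof.
move=> hn0 Q0 HV j je F FV.
have Qn0 : Q != 0 by apply: contraNneq Q0 => ->; rewrite horner0.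
have [N [R HR]] := taylor P w Q e F.
pose c i := (F^`M(i)).@[P 0].
pose S := \sum_i c i *: w i.
(* The value t = 0 may be excluded by [h]; vanishing at P comes from a polynomial identity in t that
   holds outside finitely many values. *)
have FP : F.@[P 0] = 0.
  pose t0 : {poly k} := 'X^e.
  have e0 : (0 < e)%N by case: e je {HV HR t0}.
  suff /(congr1 (fun u : {poly k} => u.[0])) : F.@[P 0] *: Q ^+ N.+1 + 'X^e * S * Q ^+ N + 'X^(e + e) * R * Q = 0.
    rewrite !(hornerD, hornerM, hornerZ, hornerXn, horner_exp) horner0 !expr0n addn_eq0 !(gtn_eqF e0) /=.
    rewrite !mul0r !addr0 => /eqP; rewrite mulf_eq0 expf_eq0 (negbTE Q0) andbF orbF => /eqP.
    by [].
  apply: (@poly_eq0_cofinite _ (Q * h)); first by rewrite mulf_neq0.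
  move=> t; rewrite hornerM mulf_eq0 negb_or => /andP[Qt ht].
  have := HR t Qt; have := FV _ (HV t Qt ht); rewrite (meval_eq (v2 := fun i => P 0 i + t ^+ e * ((w i).[t] / Q.[t]))) => [->|i]; last by rewrite mxE.
  rewrite !(hornerD, hornerM, hornerZ, hornerXn, horner_exp) => <-.
  rewrite /S horner_sum !mulr_sumr.
  rewrite (eq_bigr (fun i => t ^+ e * ((w i).[t] / Q.[t] * c i) * Q.[t])).
    by rewrite -mulr_suml; rewrite exprS; ring.
  by move=> i _; rewrite hornerZ; field.
have SQ : S * Q ^+ N = - ('X^e * R * Q).
  apply/eqP; rewrite -subr_eq0 opprK; apply/eqP.
  apply: (@poly_eq0_cofinite _ ('X * (Q * h))); first by rewrite !mulf_neq0 ?polyX_eq0.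
  move=> t; rewrite !hornerM hornerX !mulf_eq0 !negb_or => /and3P[tn0 Qt ht].
  have := HR t Qt; have := FV _ (HV t Qt ht); rewrite (meval_eq (v2 := fun i => P 0 i + t ^+ e * ((w i).[t] / Q.[t]))) => [->|i]; last by rewrite mxE.
  rewrite FP subr0 sub0r => H; apply: (mulfI (expf_neq0 e tn0)); rewrite mulr0.
  rewrite !(hornerD, hornerM, hornerZ, hornerXn, horner_exp) mulrDr !mulrA -exprD -H.
  rewrite /S horner_sum !mulr_sumr.
  rewrite (eq_bigr (fun i => t ^+ e * ((w i).[t] / Q.[t] * c i) * Q.[t])).
    by rewrite -mulr_suml; ring.
  by move=> i _; rewrite hornerZ; field.
(* Q(0) != 0 makes ['X^e] coprime to the power of Q. *)
have dvd : 'X^e %| S.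
  rewrite -(Gauss_dvdpl _ (_ : coprimep 'X^e (Q ^+ N))).
    by rewrite SQ dvdpNr -mulrA dvdp_mulr.
  rewrite coprimep_expl // coprimep_expr // coprimep_sym.
  have -> : ('X : {poly k}) = 'X - 0%:P by rewrite subr0.
  by rewrite coprimep_XsubC.
have -> : \sum_i (\row_i0 (w i0)`_j) 0 i * (F^`M(i)).@[P 0] = S`_j.
  by rewrite coef_sum; apply: eq_bigr => i _; rewrite mxE coefZ mulrC.
by have /dvdpP[u ->] := dvd; rewrite coefMXn je.
Qed.

Lemma tangentZ n (V : 'rV[k]_n -> Prop) P c v : tangent V P v -> tangent V P (c *: v).
Proof.
move=> T F /T H; rewrite (eq_bigr (fun i => c * (v 0 i * (F^`M(i)).@[P 0]))).
  by rewrite -mulr_sumr H mulr0.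
by move=> i _; rewrite mxE mulrA.
Qed.

Lemma smooth_at1 n (V : 'rV[k]_n -> Prop) P w :
  V P -> has_dim V 1 -> w != 0 -> tangent V P w ->
  (forall v, tangent V P v -> exists c, v = c *: w) -> smooth_at V P.
Proof.
move=> VP dV wn0 Tw H; split=> //; exists 1%N => //; exists w.
  by rewrite /row_free rank_rV wn0.
move=> v; split=> [/H [c ->]|/sub_rVP [c ->]]; first exact: scalemx_sub.
exact: tangentZ.
Qed.

Lemma has_dim_inj n (V : 'rV[k]_n -> Prop) d d' : has_dim V d -> has_dim V d' -> d = d'.
Proof.
move=> H H'; apply/eqP; rewrite eqn_leq.
have /H' -> := (H d).2 (leqnn d).
by have /H -> := (H' d').2 (leqnn d').
Qed.

Lemma singular_atP n (V : 'rV[k]_n -> Prop) P d (B : 'M[k]_(d.+1, n)) :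
  V P -> has_dim V d -> row_free B -> (forall i, tangent V P (row i B)) ->
  singular_at V P.
Proof.
move=> VP dV Bfree TB; split=> // -[_ [d' /(has_dim_inj dV) <- [A Afree HA]]].
have /mxrankS : (B <= A)%MS by apply/row_subP => i; apply/HA.
by move: Bfree Afree; rewrite /row_free => /eqP -> /eqP ->; rewrite ltnn.
Qed.

(** * The rational function field has genus zero *)

Section Genus.
Variables (K : fieldType) (iota : {rmorphism k -> K}) (T : K).
Hypothesis transT : forall p : {poly k}, (map_poly iota p).[T] = 0 -> p = 0.
Hypothesis genT : forall x : K, exists p q : {poly k},
  q != 0 /\ x = (map_poly iota p).[T] / (map_poly iota q).[T].

(** By [transT] and [genT] the field [K] is the rational function field in [T], and [pev] embeds the
    polynomial ring in it. *)
Definition pev (p : {poly k}) : K := (map_poly iota p).[T].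

Lemma pevD p q : pev (p + q) = pev p + pev q.
Proof. by rewrite /pev rmorphD hornerD. Qed.

Lemma pevM p q : pev (p * q) = pev p * pev q.
Proof. by rewrite /pev rmorphM hornerM. Qed.

Lemma pevC c : pev c%:P = iota c.
Proof. by rewrite /pev map_polyC hornerC. Qed.

Lemma pev_eq0 p : (pev p == 0) = (p == 0).
Proof.
apply/eqP/eqP => [/transT //|->]; by rewrite -[0]/(0%:P) pevC rmorph0.
Qed.

Lemma pev_inj p q : pev p = pev q -> p = q.
Proof.
by move=> e; apply/eqP; rewrite -subr_eq0 -pev_eq0 /pev rmorphB hornerD hornerN -!/(pev _) e subrr.
Qed.

Lemma place1 v : is_place iota v -> v 1 = 0.
Proof. by case=> _ _ /(_ 1 (oner_neq0 _)); rewrite rmorph1. Qed.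

Lemma placeV v x : is_place iota v -> x != 0 -> v x^-1 = - v x.
Proof.
move=> pv xn0; have [vM _ _ _] := pv; apply/eqP; rewrite -addr_eq0 addrC.
by rewrite -vM ?invr_eq0 // divff // place1.
Qed.

Lemma placeN v x : is_place iota v -> x != 0 -> v (- x) = v x.
Proof.
move=> [vM _ vC _] xn0; rewrite -mulN1r vM ?oppr_eq0 ?oner_eq0 //.
by rewrite -[-1](rmorphN1 iota) vC ?add0r // oppr_eq0 oner_eq0.
Qed.

(** The strict case of the ultrametric inequality, obtained by writing x as (x + y) - y. *)
Lemma place_lt v x y : is_place iota v -> x != 0 -> y != 0 -> v x < v y ->
  x + y != 0 /\ v (x + y) = v x.
Proof.
move=> pv xn0 yn0 lt; have [vM vD vC _] := pv.
have xy : x + y != 0.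
  apply: contraTneq lt => /eqP; rewrite addr_eq0 => /eqP ->.
  by rewrite placeN // ltxx.
split=> //; apply/eqP; rewrite eq_le; apply/andP; split.
  have := vD (x + y) (- y) xy; rewrite oppr_eq0 addrK => /(_ yn0 xn0).
  by rewrite placeN // ge_min => /orP[//|]; rewrite leNgt lt.
by have := vD _ _ xn0 yn0 xy; rewrite (minElt (v x) (v y)) lt.
Qed.

Lemma Tsub_neq0 a : T - iota a != 0.
Proof.
have -> : T - iota a = pev ('X - a%:P).
  by rewrite /pev map_polyXsubC hornerXsubC.
by rewrite pev_eq0 polyXsubC_eq0.
Qed.

Lemma pev_prod (rs : seq k) : pev (\prod_(z <- rs) ('X - z%:P)) = \prod_(z <- rs) (T - iota z).
Proof.
by rewrite /pev rmorph_prod horner_prod; apply: eq_bigr => z _; rewrite /= map_polyXsubC hornerXsubC.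
Qed.

Lemma place_prod v (rs : seq k) : is_place iota v ->
  v (\prod_(z <- rs) (T - iota z)) = \sum_(z <- rs) v (T - iota z).
Proof.
move=> pv; have [vM _ _ _] := pv; elim: rs => [|z rs IH]; first by rewrite !big_nil place1.
rewrite !big_cons vM ?IH ?Tsub_neq0 // prodf_seq_neq0; apply/allP => y _; exact: Tsub_neq0.
Qed.

Lemma pevE p : p != 0 -> exists rs : seq k,
  p = lead_coef p *: \prod_(z <- rs) ('X - z%:P) /\ size p = (size rs).+1.
Proof.
move=> pn0; have [rs e] := closed_field_poly_normal p; exists rs; split=> //.
by rewrite e size_scale ?lead_coef_eq0 // size_prod_XsubC.
Qed.

Lemma place_pev v p rs : is_place iota v -> p != 0 ->
  p = lead_coef p *: \prod_(z <- rs) ('X - z%:P) ->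
  v (pev p) = \sum_(z <- rs) v (T - iota z).
Proof.
move=> pv pn0 ->; have [vM _ vC _] := pv; rewrite -mul_polyC pevM pevC pev_prod vM.
- by rewrite vC ?lead_coef_eq0 // add0r place_prod.
- by rewrite fmorph_eq0 lead_coef_eq0.
by rewrite prodf_seq_neq0; apply/allP => y _; exact: Tsub_neq0.
Qed.

Lemma mup_const (a c : k) : c != 0 -> mup a c%:P = 0%N.
Proof.
move=> cn0; apply/eqP; rewrite -leqn0 mup_leq ?polyC_eq0 // expr1 dvdp_XsubCl /root hornerC //.
Qed.

(* The centre of a place: a point of the projective line. *)
Definition centre (v : K -> int) (c : option k) :=
  forall a, v (T - iota a) = if c is Some b then (a == b)%:R else -1.

(** Polynomials split into linear factors, so the values at the T - a determine the place on all of
    them. *)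
Lemma place_fin v c : is_place iota v -> centre v c -> forall p, p != 0 ->
  v (pev p) = if c is Some a then (mup a p)%:R else - ((size p).-1)%:R.
Proof.
move=> pv cv p pn0; have [rs [e sz]] := pevE pn0.
rewrite (place_pev pv pn0 e) sz /=.
case: c cv => [a|] cv.
  have -> : mup a p = count_mem a rs.
    have -> : mup a p = mup a ((lead_coef p)%:P * \prod_(z <- rs) ('X - z%:P)) by rewrite mul_polyC -e.
    have prn0 : \prod_(z <- rs) ('X - z%:P) != 0 :> {poly k} by rewrite monic_neq0 ?monic_prod_XsubC.
    by rewrite mupM ?polyC_eq0 ?lead_coef_eq0 // mup_const ?lead_coef_eq0 // mu_prod_XsubC.
  rewrite -sum1_count natr_sum [RHS]big_mkcond; apply: eq_bigr => z _.
  by rewrite cv /=; case: eqP.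
rewrite (eq_bigr (fun _ => -1)) => [|z _]; last exact: cv.
rewrite big_const_seq count_predT; elim: (size rs) => [|j IH] /=; first by rewrite oppr0.
by rewrite IH -[j.+1]add1n natrD opprD.
Qed.

Lemma intmul1 (m d : int) : m * d = 1 -> `|d|%N = 1%N.
Proof. by move/(congr1 absz); rewrite abszM => /eqP; rewrite muln_eq1 => /andP[_ /eqP]. Qed.

(** The T - a differ by constants, which have value 0. By [place_lt] either one of them is positive
    and the others are 0, or all have the same negative value, or all are 0. Since the value 1 is
    attained, the nonzero value must be 1 or -1, and the last case cannot occur. *)
Lemma place_centre v : is_place iota v -> exists c, centre v c.
Proof.
move=> pv; have [vM vD vC [x xn0 vx]] := pv.
have cst a b : a != b -> iota (a - b) != 0 by rewrite fmorph_eq0 subr_eq0.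
have shift a b : T - iota b = iota (a - b) + (T - iota a) by rewrite rmorphB; ring.
have pos a b : a != b -> 0 < v (T - iota a) -> v (T - iota b) = 0.
  move=> ab va; have abn0 : a - b != 0 by rewrite subr_eq0.
  have [|_ e] := place_lt pv (cst _ _ ab) (Tsub_neq0 a); first by rewrite vC.
  by rewrite (shift a) e vC.
have neg a b : v (T - iota a) < 0 -> v (T - iota b) = v (T - iota a).
  have [->//|ab va] := eqVneq a b; have abn0 : a - b != 0 by rewrite subr_eq0.
  have [|_ e] := place_lt pv (Tsub_neq0 a) (cst _ _ ab); first by rewrite vC.
  by rewrite (shift a) addrC e.
(* every value of v is a multiple of the values at the T - iota z, and 1 is a value *)
have one (d : int) (f : k -> int) : (forall z, v (T - iota z) = f z * d) -> exists m : int, m * d = 1.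
  move=> fd; have [p [q [qn0 xE]]] := genT x.
  have pn0 : p != 0.
    by apply: contraNneq xn0 => p0; rewrite xE p0 rmorph0 horner0 mul0r.
  have [rs [e _]] := pevE pn0; have [rs' [e' _]] := pevE qn0.
  exists (\sum_(z <- rs) f z - \sum_(z <- rs') f z).
  rewrite -vx xE -/(pev p) -/(pev q) vM ?invr_eq0 ?pev_eq0 // placeV ?pev_eq0 //.
  rewrite (place_pev pv pn0 e) (place_pev pv qn0 e') mulrBl !mulr_suml.
  by congr (_ - _); apply: eq_bigr => z _.
have [[a va]|none] := classic (exists a, 0 < v (T - iota a)).
  exists (Some a) => b; have [->|ba] := eqVneq b a; last by rewrite (pos a) // eq_sym.
  have fE z : v (T - iota z) = (z == a)%:R * v (T - iota a).
    by have [->|za] := eqVneq z a; rewrite ?mul1r // mul0r (pos a) // eq_sym.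
  by have [m /intmul1] := one _ _ fE; rewrite mulr1n; move: va; move: (v _) => d; lia.
have [[a va]|none'] := classic (exists a, v (T - iota a) < 0).
  exists None => b; rewrite (neg a) //.
  have fE z : v (T - iota z) = 1 * v (T - iota a) by rewrite mul1r (neg a).
  by have [m /intmul1] := one _ _ fE; move: va; move: (v _) => d; lia.
have z0 a : v (T - iota a) = 0.
  case: (ltgtP (v (T - iota a)) 0) => // h; first by case: none'; exists a.
  by case: none; exists a.
have fE z : v (T - iota z) = 0 * 0 by rewrite mulr0.
by have [m] := one _ _ fE; rewrite mulr0.
Qed.

Lemma place_ratio v c p q : is_place iota v -> centre v c -> p != 0 -> q != 0 ->
  v (pev p / pev q) = (if c is Some a then (mup a p)%:R else - ((size p).-1)%:R)
                    - (if c is Some a then (mup a q)%:R else - ((size q).-1)%:R).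
Proof.
move=> pv cv pn0 qn0; have [vM _ _ _] := pv.
by rewrite vM ?invr_eq0 ?pev_eq0 // placeV ?pev_eq0 // !(place_fin pv cv).
Qed.

Lemma ratioE x : exists pq : {poly k} * {poly k}, pq.2 != 0 /\ x = pev pq.1 / pev pq.2.
Proof. by have [p [q H]] := genT x; exists (p, q). Qed.

Lemma centre_same v w c : is_place iota v -> is_place iota w -> centre v c -> centre w c ->
  same_place v w.
Proof.
move=> pv pw cv cw x xn0; have [[p q] /= [qn0 xE]] := ratioE x.
have pn0 : p != 0 by apply: contraNneq xn0 => p0; rewrite xE p0 -[0]/(0%:P) pevC rmorph0 mul0r.
by rewrite xE (place_ratio pv cv) // (place_ratio pw cw).
Qed.

Lemma mup_add (a : k) (p q : {poly k}) : p != 0 -> q != 0 -> p + q != 0 ->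
  (minn (mup a p) (mup a q) <= mup a (p + q))%N.
Proof.
move=> pn0 qn0 pqn0; rewrite mup_geq // dvdp_add // -mup_geq //; [exact: geq_minl|exact: geq_minr].
Qed.

Definition ordc (c : option k) (p : {poly k}) : int :=
  if c is Some a then (mup a p)%:R else - ((size p).-1)%:R.

Lemma ordcM c p q : p != 0 -> q != 0 -> ordc c (p * q) = ordc c p + ordc c q.
Proof.
case: c => [a|] pn0 qn0 /=; first by rewrite mupM // natrD.
rewrite -opprD -natrD size_mul //; congr (- _%:R).
by move: pn0 qn0; rewrite -!size_poly_gt0; case: (size p) => // i; case: (size q) => //= j; lia.
Qed.

Lemma ordcD c p q : p != 0 -> q != 0 -> p + q != 0 ->
  Order.min (ordc c p) (ordc c q) <= ordc c (p + q).
Proof.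
case: c => [a|] pn0 qn0 pqn0 /=.
  by rewrite ge_min !ler_nat -geq_min mup_add.
have := size_polyD p q; rewrite leq_max => /orP[] h; rewrite ge_min !lerN2 !ler_nat; apply/orP.
  by left; rewrite -!subn1 leq_sub2r.
by right; rewrite -!subn1 leq_sub2r.
Qed.

Lemma ordcC c (a : k) : a != 0 -> ordc c a%:P = 0.
Proof.
by move=> an0; case: c => [b|] /=; rewrite ?mup_const ?size_polyC ?an0 // oppr0.
Qed.

Lemma ordcX c (a : k) : ordc c ('X - a%:P) = if c is Some b then (a == b)%:R else -1.
Proof.
case: c => [b|] /=; last by rewrite size_XsubC.
have -> : 'X - a%:P = \prod_(z <- [:: a]) ('X - z%:P) by rewrite big_seq1.
by rewrite mu_prod_XsubC /= addn0.
Qed.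

Lemma min_shift (a b a' b' s : int) :
  Order.min (a + b') (a' + b) <= s -> Order.min (a - b) (a' - b') <= s - (b + b').
Proof. by rewrite !ge_min => /orP[] h; apply/orP; [left|right]; lia. Qed.

Lemma ratio_neq0 x : x != 0 -> exists p q, [/\ p != 0, q != 0 & x = pev p / pev q].
Proof.
move=> xn0; have [[p q] /= [qn0 xE]] := ratioE x; exists p, q; split=> //.
by apply: contraNneq xn0 => p0; rewrite xE p0 -[0]/(0%:P) pevC rmorph0 mul0r.
Qed.

(** The order of the numerator minus that of the denominator, for a chosen fraction;
    cross-multiplication shows that the choice does not matter. *)
Lemma place_exists c : exists2 v, is_place iota v & centre v c.
Proof.
pose pq x := proj1_sig (constructive_indefinite_description _ (ratioE x)).
have pqE x : (pq x).2 != 0 /\ x = pev (pq x).1 / pev (pq x).2.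
  exact: proj2_sig (constructive_indefinite_description _ (ratioE x)).
pose v x := ordc c (pq x).1 - ordc c (pq x).2.
have vE p q : p != 0 -> q != 0 -> v (pev p / pev q) = ordc c p - ordc c q.
  move=> pn0 qn0; rewrite /v; have [] := pqE (pev p / pev q).
  case: (pq _) => p' q' /= q'n0 e.
  have p'n0 : p' != 0.
    apply: contraNneq pn0 => p'0; move: e; rewrite p'0 -[pev 0]/(pev 0%:P) pevC rmorph0 mul0r.
    by move/eqP; rewrite mulf_eq0 invr_eq0 !pev_eq0 (negbTE qn0) orbF.
  have : p * q' = p' * q.
    by apply: pev_inj; rewrite !pevM; apply/eqP; rewrite -eqr_div ?pev_eq0 // e.
  by move/(congr1 (ordc c)); rewrite !ordcM // => H; lia.
have vsub a : v (T - iota a) = if c is Some b then (a == b)%:R else -1.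
  have -> : T - iota a = pev ('X - a%:P) / pev 1%:P.
    by rewrite pevC rmorph1 divr1 /pev map_polyXsubC hornerXsubC.
  by rewrite vE ?polyXsubC_eq0 ?polyC_eq0 ?oner_eq0 // ordcX ordcC ?oner_eq0 // subr0.
exists v => //; split.
- move=> x y /ratio_neq0[p [q [pn0 qn0 ->]]] /ratio_neq0[p' [q' [p'n0 q'n0 ->]]].
  by rewrite mulf_div -!pevM !vE ?mulf_neq0 // !ordcM //; lia.
- move=> x y /ratio_neq0[p [q [pn0 qn0 ->]]] /ratio_neq0[p' [q' [p'n0 q'n0 ->]]].
  rewrite addf_div ?pev_eq0 // -!pevM -pevD => sn0.
  have sn : p * q' + p' * q != 0.
    by apply: contraNneq sn0 => ->; rewrite -[0]/(0%:P) pevC rmorph0 mul0r.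
  rewrite !vE ?mulf_neq0 //.
  have := ordcD c (mulf_neq0 pn0 q'n0) (mulf_neq0 p'n0 qn0) sn; rewrite !ordcM //.
  exact: min_shift.
- move=> b bn0; have -> : iota b = pev b%:P / pev 1%:P by rewrite !pevC rmorph1 divr1.
  by rewrite vE ?polyC_eq0 ?oner_eq0 // !ordcC ?oner_eq0.
have [[b cE]|cE] : (exists b, c = Some b) \/ c = None by case: (c) => [b|]; [left; exists b|right].
  by exists (T - iota b); rewrite ?Tsub_neq0 // vsub cE eqxx.
exists (pev 1%:P / pev ('X - 0%:P)).
  by rewrite mulf_neq0 ?invr_eq0 ?pev_eq0 ?polyXsubC_eq0 ?polyC_eq0 ?oner_eq0.
by rewrite vE ?polyXsubC_eq0 ?polyC_eq0 ?oner_eq0 // ordcC ?oner_eq0 // ordcX cE.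
Qed.

Lemma place_ordc v c p q : is_place iota v -> centre v c -> p != 0 -> q != 0 ->
  v (pev p / pev q) = ordc c p - ordc c q.
Proof. exact: place_ratio. Qed.

Lemma placeXz v x (z : int) : is_place iota v -> x != 0 -> v (x ^ z) = z * v x.
Proof.
move=> pv xn0; have [vM _ _ _] := pv.
have pos (j : nat) : v (x ^+ j) = j%:Z * v x.
  elim: j => [|j IH]; first by rewrite expr0 place1 // mul0r.
  by rewrite exprS vM ?expf_neq0 // IH -[j.+1]addn1 PoszD mulrDl mul1r addrC.
case: z => j; first exact: pos.
by rewrite -[x ^ Negz j]/((x ^+ j.+1)^-1) placeV ?expf_neq0 // pos NegzE mulNr.
Qed.

Lemma bound_inf (t : int) (sz M : nat) :
  (sz <= M.+1)%N -> - t <= - (sz.-1)%:R - (t - Posz M).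
Proof. by rewrite natz => h; lia. Qed.

(** If D has degree M >= 0, the polynomials of degree at most M, divided by a suitable [G], lie in
    L(D), which gives M + 1 independent elements. For negative degree the inequality is
    immediate. *)
Lemma genus0_le (D : divisor iota) r : rr_dim D r -> div_deg D - r%:Z + 1 <= 0.
Proof.
case=> b [_ span]; have [|] := leP 0 (div_deg D); last by lia.
case DM : (div_deg D) => [M|//] _.
suff : (M < r)%N by lia.
pose cP (i : 'I_(div_size D)) := proj1_sig (constructive_indefinite_description _ (place_centre (div_placeP i))).
have cPE i : centre (div_place D i) (cP i).
  exact: proj2_sig (constructive_indefinite_description _ (place_centre (div_placeP i))).
have c_inj i j : cP i = cP j -> i = j.
  move=> e; apply: (@div_place_inj _ _ D); apply: (centre_same (c := cP i)) => //; try exact: div_placeP.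
  by rewrite e.
pose g i := if cP i is Some a then (T - iota a) ^ (div_coef D i) else 1.
have gn0 i : g i != 0.
  by rewrite /g; case: (cP i) => [a|]; rewrite ?oner_eq0 ?expfz_neq0 ?Tsub_neq0.
(* Its order is the coefficient of D at every finite point. The coefficient at infinity is left out
   of the product, which is why the order there is [s None - div_deg D]. *)
pose G := \prod_i g i.
have Gn0 : G != 0 by apply/prodf_neq0.
pose s c := \sum_(i | cP i == c) div_coef D i.
have wG w c : is_place iota w -> centre w c ->
    w G = if c is Some _ then s c else s None - div_deg D.
  move=> pw cw; have [wM _ _ _] := pw.
  have -> : w G = \sum_i w (g i).
    rewrite /G; suff [] : w (\prod_i g i) = \sum_i w (g i) /\ \prod_i g i != 0 by [].
    apply: (big_ind2 (fun x z => w x = z /\ x != 0)) => [|x1 z1 x2 z2 [<- n1] [<- n2]|i _].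
    - by rewrite place1 // oner_eq0.
    - by rewrite wM // mulf_neq0.
    - by [].
  have wg i : w (g i) = if cP i is Some a then div_coef D i * (if c is Some b then (a == b)%:R else -1) else 0.
    rewrite /g; case: (cP i) => [a|]; last by rewrite place1.
    by rewrite placeXz ?Tsub_neq0 // cw.
  rewrite (eq_bigr _ (fun i _ => wg i)); case: c cw {wg} => [b0|] cw.
    rewrite /s [RHS]big_mkcond; apply: eq_bigr => i _; case: (cP i) => [a|] //=.
    by rewrite [Some a == _](inj_eq Some_inj); case: eqP; rewrite ?mulr1 ?mulr0.
  rewrite /div_deg (bigID (fun i => cP i == None)) /= big1 ?add0r; last by move=> i /eqP ->.
  rewrite (bigID (fun i => cP i == None) _ (fun i => div_coef D i)) /= /s opprD addNKr.
  by rewrite -sumrN; apply: eq_bigr => i; case: (cP i) => [a|] // _; rewrite mulrN1.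
have s_out c : (forall i, cP i != c) -> s c = 0.
  by move=> H; rewrite /s big1 // => i /eqP e; case/eqP: (H i).
have s_in i : s (cP i) = div_coef D i.
  by rewrite /s (eq_bigl (pred1 i)) ?big_pred1_eq // => j; apply/eqP/eqP => [/c_inj|->].
have inrr (u : 'rV[k]_M.+1) : rr_space D (pev (rVpoly u) / G).
  move=> yn0; have hn0 : rVpoly u != 0.
    by apply: contraNneq yn0 => ->; rewrite -[0]/(0%:P) pevC rmorph0 mul0r.
  have bound w c : is_place iota w -> centre w c -> - s c <= w (pev (rVpoly u) / G).
    move=> pw cw; have [wM _ _ _] := pw.
    rewrite wM ?invr_eq0 ?pev_eq0 // placeV // (wG w c) // (place_fin pw cw) //.
    case: c {cw} => [b0|]; first by rewrite lerDr ler0n.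
    have hs : (size (rVpoly u) <= M.+1)%N by exact: size_poly.
    by rewrite DM; exact: bound_inf.
  split=> [i|w pw nw]; first by rewrite -s_in; apply: bound => //; exact: div_placeP.
  have [c cw] := place_centre pw; rewrite -[0]oppr0 -(s_out c); first exact: bound.
  move=> i; apply/eqP => e; apply: (nw i); apply: (centre_same (c := c)) => //; first exact: div_placeP.
  by rewrite -e.
have coord (j : 'I_M.+1) : exists c : 'rV[k]_r, pev (rVpoly (delta_mx 0 j)) / G = \sum_i iota (c 0 i) * b i.
  by have [c [e _]] := span _ (inrr (delta_mx 0 j)); exists c.
have [f fE] := fin_all_exists coord.
(* With at most M spanning elements, the M + 1 powers of [T] divided by [G] would be linearly
   dependent. *)
rewrite ltnNge; apply/negP => rM.
pose B := \matrix_(j < M.+1) f j.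
have kern : kermx B != 0 by rewrite -mxrank_eq0 mxrank_ker -lt0n subn_gt0 (leq_ltn_trans (rank_leq_col _)).
have [i0 row0] : exists i, row i (kermx B) != 0.
  by apply/existsP; apply: contraNT kern; rewrite negb_exists => /forallP H; apply/eqP/row_matrixP => i; rewrite row0; apply/eqP; rewrite -[_ == _]negbK.
set u := row i0 (kermx B) in row0.
have uB : u *m B = 0 by apply/sub_kermxP; rewrite row_sub.
case/eqP: row0; rewrite -[u]rVpolyK; suff -> : rVpoly u = 0 by rewrite linear0.
apply/eqP; rewrite -pev_eq0 -(mulIr_eq0 _ (mulIf (invr_neq0 Gn0))); apply/eqP.
have -> : pev (rVpoly u) = \sum_j iota (u 0 j) * pev (rVpoly (delta_mx 0 j)).
  rewrite {1}(row_sum_delta u) linear_sum /pev /= rmorph_sum horner_sum; apply: eq_bigr => j _.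
  by rewrite linearZ /= map_polyZ hornerZ.
rewrite mulr_suml (eq_bigr (fun j => \sum_i iota (u 0 j * B j i) * b i)) => [|j _]; last first.
  rewrite -mulrA fE mulr_sumr; apply: eq_bigr => i _.
  by rewrite [B j i]mxE rmorphM mulrA.
rewrite exchange_big big1 // => i _; rewrite -mulr_suml -rmorph_sum.
by have /matrixP/(_ 0 i) := uB; rewrite [LHS]mxE [RHS]mxE => ->; rewrite rmorph0 mul0r.
Qed.

(** For the zero divisor, L(0) consists of the constants: a root of the denominator of a reduced
    fraction is a pole, and a nonconstant polynomial has a pole at infinity. *)
Lemma genus0_eq : exists (D : divisor iota) r, rr_dim D r /\ div_deg D - r%:Z + 1 = 0.
Proof.
pose D := @Divisor K iota 0 (fun i => fun _ => 0) (fun _ => 0)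
   (fun i => False_ind _ (Bool.diff_false_true (ltn_ord i))) (fun i _ _ => False_ind _ (Bool.diff_false_true (ltn_ord i))).
exists D, 1%N; split; last by rewrite /div_deg big_ord0.
exists (fun _ => 1); split=> [_|x].
  by move=> _; split=> [[]//|w pw _]; rewrite place1.
have uniq_c (c c' : 'rV[k]_1) : x = \sum_(i < 1) iota (c 0 i) * 1 -> x = \sum_(i < 1) iota (c' 0 i) * 1 ->
    c = c'.
  rewrite !big_ord1 !mulr1 => -> /fmorph_inj e; apply/rowP => i; rewrite ord1; exact: e.
suff H : rr_space D x -> exists c, x = iota c.
  move=> /H [c xE]; exists c%:M; split; first by rewrite big_ord1 mulr1 mxE mulr1n.
  by move=> c' xE'; apply: uniq_c xE'; rewrite big_ord1 mulr1 mxE mulr1n.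
move=> rx; have [->|xn0] := eqVneq x 0; first by exists 0; rewrite rmorph0.
have {rx} vx v : is_place iota v -> 0 <= v x by move=> pv; apply: (rx xn0).2 => // -[].
have [p0 [q0 [p0n q0n xE]]] := ratio_neq0 xn0.
pose d := gcdp p0 q0; have dn0 : d != 0 by rewrite gcdp_eq0 (negbTE p0n).
have cop : coprimep (p0 %/ d) (q0 %/ d) by rewrite coprimep_div_gcd // p0n.
have p0E : p0 = p0 %/ d * d by rewrite divpK // dvdp_gcdl.
have q0E : q0 = q0 %/ d * d by rewrite divpK // dvdp_gcdr.
move: cop p0E q0E; clearbody d; move: (p0 %/ d) (q0 %/ d) => p q cop p0E q0E.
have pn0 : p != 0 by apply: contraNneq p0n => z; rewrite p0E z mul0r.
have qn0 : q != 0 by apply: contraNneq q0n => z; rewrite q0E z mul0r.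
have {}xE : x = pev p / pev q by rewrite xE p0E q0E !pevM -mulf_div divff ?pev_eq0 // mulr1.
have /size_poly1P [c cn0 qE] : size q == 1%N.
  apply/negPn/negP => /closed_rootP [a qa].
  have [v pv cv] := place_exists (Some a); have := vx v pv.
  rewrite xE (place_ordc pv cv) //= subr_ge0 ler_nat.
  have mup0 (r : {poly k}) : r != 0 -> (0 < mup a r)%N = root r a.
    by move=> rn0; rewrite mup_geq // expr1 dvdp_XsubCl.
  have lt : (0 < mup a q)%N by rewrite mup0.
  move=> /(leq_trans lt); rewrite mup0 // => pa.
  by move: (coprimep_root cop pa); rewrite (rootP qa) eqxx.
have [v pv cv] := place_exists None; have := vx v pv.
rewrite xE (place_ordc pv cv) // qE ordcC // subr0 /= oppr_ge0 => sz.
have /size1_polyC -> : (size p <= 1)%N by move: sz; rewrite lern0; case: (size p) => [|[|]].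
by exists (p`_0 / c); rewrite !pevC fmorph_div.
Qed.

Theorem has_genus0 : has_genus iota 0.
Proof. by split; [exact: genus0_le | exact: genus0_eq]. Qed.

End Genus.

(** * Homogeneous evaluation and conjugacy *)

(** The form of degree [D] attached to [p]. The degree is an argument because one of the two
    components of a rational map may have lower degree than the map. *)
Definition hev (D : nat) (p : {poly k}) (x y : k) : k :=
  \sum_(i < D.+1) p`_i * x ^+ i * y ^+ (D - i).

Lemma hev_horner D (p : {poly k}) x : (size p <= D.+1)%N -> hev D p x 1 = p.[x].
Proof.
move=> sz; rewrite (horner_coef_wide _ sz); apply: eq_bigr => i _.
by rewrite expr1n mulr1.
Qed.

Lemma hevZ D p c x y : hev D p (c * x) (c * y) = c ^+ D * hev D p x y.
Proof.
rewrite /hev mulr_sumr; apply: eq_bigr => i _.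
have -> : c ^+ D = c ^+ i * c ^+ (D - i) by rewrite -exprD subnKC // -ltnS.
by rewrite !exprMn; ring.
Qed.

Lemma hev_lin D a p b q x y : hev D (a *: p + b *: q) x y = a * hev D p x y + b * hev D q x y.
Proof.
rewrite /hev !mulr_sumr -big_split; apply: eq_bigr => i _.
by rewrite coefD !coefZ /=; ring.
Qed.

Lemma hev_scale D a p x y : hev D (a *: p) x y = a * hev D p x y.
Proof. by rewrite -[a *: p]addr0 -(scale0r 0) hev_lin mul0r addr0. Qed.

Lemma hev_inj D (p q : {poly k}) : (size p <= D.+1)%N -> (size q <= D.+1)%N ->
  (forall x, hev D p x 1 = hev D q x 1) -> p = q.
Proof.
move=> sp sq H; apply/eqP; rewrite -subr_eq0; apply/eqP/poly_eq0_fun => x.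
by rewrite hornerD hornerN -(hev_horner _ sp) -(hev_horner _ sq) H subrr.
Qed.

Lemma hev3E p x y : hev 3 p x y =
  p`_0 * y ^+ 3 + p`_1 * x * y ^+ 2 + p`_2 * x ^+ 2 * y + p`_3 * x ^+ 3.
Proof.
rewrite /hev !big_ord_recl big_ord0 /= /bump /= !expr0 !expr1 !mulr1 addr0 !addrA.
by rewrite !addn0 ?add1n.
Qed.

Lemma horner_hsubst D p u v z : (hsubst D p u v).[z] = hev D p u.[z] v.[z].
Proof.
rewrite /hsubst horner_sum; apply: eq_bigr => i _.
by rewrite hornerZ hornerM !horner_exp mulrA.
Qed.

Lemma size_hsubst D e (p u v : {poly k}) : (size u <= e.+1)%N -> (size v <= e.+1)%N ->
  (size (hsubst D p u v) <= (D * e).+1)%N.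
Proof.
move=> su sv; rewrite /hsubst; apply: (leq_trans (size_sum _ _ _)).
apply/bigmax_leqP => i _; apply: (leq_trans (size_scale_leq _ _)).
apply: (leq_trans (size_polyMleq _ _)).
have := size_poly_exp_leq u i; have := size_poly_exp_leq v (D - i).
have le : (i <= D)%N by rewrite -ltnS.
have -> : (D * e = e * i + e * (D - i))%N by rewrite -mulnDr subnKC // mulnC.
have lu : ((size u).-1 * i <= e * i)%N by rewrite leq_mul2r; apply/orP; right; lia.
have lv : ((size v).-1 * (D - i) <= e * (D - i))%N by rewrite leq_mul2r; apply/orP; right; lia.
lia.
Qed.

(** The form with x fixed, as a polynomial in y; it serves to pass from y != 0 to y = 0. *)
Definition hpoly (D : nat) (p : {poly k}) (x : k) : {poly k} :=
  \sum_(i < D.+1) (p`_i * x ^+ i) *: 'X^(D - i).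

Lemma horner_hpoly D p x y : (hpoly D p x).[y] = hev D p x y.
Proof.
by rewrite /hpoly horner_sum; apply: eq_bigr => i _; rewrite hornerZ hornerXn.
Qed.

(** For y != 0 one dehomogenizes; both sides are polynomials in y, so the identity extends to y =
    0. *)
Lemma hev_hsubst D e (p u v : {poly k}) x y : (size u <= e.+1)%N -> (size v <= e.+1)%N ->
  hev (D * e) (hsubst D p u v) x y = hev D p (hev e u x y) (hev e v x y).
Proof.
move=> su sv; rewrite -horner_hpoly -(horner_hpoly e u) -(horner_hpoly e v) -horner_hsubst.
congr (_.[y]); apply/eqP; rewrite -subr_eq0; apply/eqP.
apply: (@poly_eq0_cofinite _ 'X); first by rewrite polyX_eq0.
move=> z; rewrite hornerX => zn0; rewrite hornerD hornerN horner_hsubst !horner_hpoly.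
have norm n q : hev n q x z = z ^+ n * hev n q (x / z) 1.
  by rewrite -hevZ mulr1 mulrCA divff // mulr1.
rewrite !norm hevZ -exprM mulnC; apply/eqP; rewrite subr_eq0; apply/eqP; congr (_ * _).
by rewrite mulnC hev_horner ?size_hsubst // horner_hsubst !hev_horner.
Qed.

Definition cv (x y : k) : 'cV[k]_2 := \col_i (if i == 0 then x else y).

Lemma cvE (v : 'cV[k]_2) : v = cv (v 0 0) (v 1 0).
Proof.
apply/colP => i; rewrite mxE; case: eqP => [->//|].
case: i => [[|[|[]]]] // lt ne; first by case: ne; apply/val_inj.
by congr (v _ _); apply/val_inj.
Qed.

Lemma cv0 x y : cv x y 0 0 = x. Proof. by rewrite mxE. Qed.
Lemma cv1 x y : cv x y 1 0 = y. Proof. by rewrite mxE. Qed.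

Lemma cv_inj x y x' y' : cv x y = cv x' y' -> x = x' /\ y = y'.
Proof.
move=> e; split; first by have /matrixP/(_ 0 0) := e; rewrite !cv0.
by have /matrixP/(_ 1 0) := e; rewrite !cv1.
Qed.

Lemma cvZ c x y : c *: cv x y = cv (c * x) (c * y).
Proof. by rewrite [LHS]cvE !mxE. Qed.

Definition mk2 (a b c d : k) : 'M[k]_2 :=
  \matrix_(i, j) (if i == 0 then if j == 0 then a else b else if j == 0 then c else d).

Lemma mk2E (A : 'M[k]_2) : A = mk2 (A 0 0) (A 0 1) (A 1 0) (A 1 1).
Proof.
apply/matrixP => i j; rewrite mxE.
case: i => [[|[|[]]]] //= li; case: j => [[|[|[]]]] //= lj;
  by congr (A _ _); apply/val_inj.
Qed.

Lemma mul_mk2_cv a b c d x y : mk2 a b c d *m cv x y = cv (a * x + b * y) (c * x + d * y).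
Proof.
by rewrite [LHS]cvE !mxE !big_ord_recl !big_ord0 !mxE /= !addr0.
Qed.

Lemma mul_mk2 a b c d a' b' c' d' : mk2 a b c d *m mk2 a' b' c' d' =
  mk2 (a * a' + b * c') (a * b' + b * d') (c * a' + d * c') (c * b' + d * d').
Proof.
by rewrite [LHS]mk2E !mxE !big_ord_recl !big_ord0 !mxE /= !addr0.
Qed.

Lemma mk2Z e a b c d : e *: mk2 a b c d = mk2 (e * a) (e * b) (e * c) (e * d).
Proof. by rewrite [LHS]mk2E !mxE. Qed.

Lemma mk2_1 : mk2 1 0 0 1 = 1%:M.
Proof. by rewrite [RHS]mk2E !mxE. Qed.

Lemma mk2_inj a b c d a' b' c' d' : mk2 a b c d = mk2 a' b' c' d' ->
  [/\ a = a', b = b', c = c' & d = d'].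
Proof.
move/matrixP => e; have := (e 0 0, e 0 1, e 1 0, e 1 1).
by rewrite !mxE /= => -[[[-> ->] ->] ->].
Qed.

Lemma det_mk2 a b c d : \det (mk2 a b c d) = a * d - b * c.
Proof.
rewrite (expand_det_row _ 0) !big_ord_recl big_ord0 /cofactor !det_mx11 !mxE /=.
by rewrite /bump /= !expr0 expr1; ring.
Qed.

Lemma unit_mk2 a b c d : (mk2 a b c d \in unitmx) = (a * d - b * c != 0).
Proof. by rewrite unitmxE det_mk2 unitfE. Qed.

Definition ev (D : nat) (f : ratmap) (v : 'cV[k]_2) : 'cV[k]_2 :=
  cv (hev D f.1 (v 0 0) (v 1 0)) (hev D f.2 (v 0 0) (v 1 0)).

Lemma ev_cv D f x y : ev D f (cv x y) = cv (hev D f.1 x y) (hev D f.2 x y).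
Proof. by rewrite /ev cv0 cv1. Qed.

Lemma evZ D f c v : ev D f (c *: v) = c ^+ D *: ev D f v.
Proof. by rewrite (cvE v) cvZ !ev_cv !hevZ cvZ. Qed.

Definition sized (D : nat) (f : ratmap) : Prop :=
  (size f.1 <= D.+1)%N /\ (size f.2 <= D.+1)%N.

Lemma ev_inj D f g : sized D f -> sized D g -> (forall v, ev D f v = ev D g v) -> f = g.
Proof.
case: f g => [f1 f2] [g1 g2] [/= s1 s2] [/= t1 t2] H.
by congr (_, _); apply: (hev_inj (D := D)) => // x; have := H (cv x 1);
  rewrite !ev_cv => /cv_inj[].
Qed.

Definition rscale (c : k) (f : ratmap) : ratmap := (c *: f.1, c *: f.2).

Lemma ev_rscale D c f v : ev D (rscale c f) v = c *: ev D f v.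
Proof. by rewrite /ev cvZ !hev_scale. Qed.

Lemma sized_rscale D c f : sized D f -> sized D (rscale c f).
Proof. by case=> s1 s2; split; apply: leq_trans (size_scale_leq _ _) _. Qed.

Lemma rateqE f g : rateq f g <-> exists2 c, c != 0 & f = rscale c g.
Proof. by []. Qed.

Lemma sized_mobius A : sized 1 (mobius A).
Proof.
split; rewrite /mobius /=; apply: (leq_trans (size_polyD _ _)); rewrite geq_max.
  rewrite (leq_trans (size_scale_leq _ _)) ?size_polyX //=; exact: leq_trans (size_polyC_leq1 _) _.
rewrite (leq_trans (size_scale_leq _ _)) ?size_polyX //=; exact: leq_trans (size_polyC_leq1 _) _.
Qed.

Lemma ev_mobius A v : ev 1 (mobius A) v = A *m v.
Proof.
rewrite (cvE v) {2}(mk2E A) ev_cv mul_mk2_cv /hev !big_ord_recl !big_ord0 /=.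
by rewrite !coefD !coefZ !coefX !coefC /= /bump /=; congr cv; ring.
Qed.

Lemma sized_ratcomp D e f g : sized e g -> sized (D * e) (ratcomp D f g).
Proof. by case=> s1 s2; split; apply: size_hsubst. Qed.

Lemma ev_ratcomp D e f g v : sized e g -> ev (D * e) (ratcomp D f g) v = ev D f (ev e g v).
Proof. by case=> s1 s2; rewrite /ev cv0 cv1 !hev_hsubst. Qed.

Lemma sized_ratconj D f A : sized D (ratconj D f A).
Proof.
have H := sized_ratcomp D f (sized_mobius A); rewrite muln1 in H.
by have := sized_ratcomp 1 (mobius (invmx A)) H; rewrite mul1n.
Qed.

Lemma ev_ratconj D f A v : ev D (ratconj D f A) v = invmx A *m ev D f (A *m v).
Proof.
have H := sized_ratcomp D f (sized_mobius A).
have := ev_ratcomp D f v (sized_mobius A); rewrite muln1 in H *.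
by have := ev_ratcomp 1 (mobius (invmx A)) v H; rewrite mul1n ev_mobius ev_mobius => -> ->.
Qed.

(* [A^-1 o f o A = g] up to a scalar, on homogeneous coordinates *)
Definition crel (D : nat) (A : 'M[k]_2) (f g : ratmap) : Prop :=
  exists2 c, c != 0 & forall v, ev D f (A *m v) = c *: (A *m ev D g v).

Lemma crel_rateq D A f g : A \in unitmx -> sized D g ->
  rateq g (ratconj D f A) <-> crel D A f g.
Proof.
move=> uA sg; rewrite rateqE; split=> [[c cn0 ->]|[c cn0 H]].
  exists c^-1; first by rewrite invr_eq0.
  by move=> v; rewrite ev_rscale ev_ratconj -scalemxAr mulKVmx // scalerA mulVf // scale1r.
exists c^-1; first by rewrite invr_eq0.
apply: (ev_inj (D := D)) => // [|v]; first exact/sized_rscale/sized_ratconj.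
by rewrite ev_rscale ev_ratconj H -scalemxAr mulKmx // scalerA mulVf // scale1r.
Qed.

Lemma conjugateP D f g : sized D g ->
  conjugate D f g <-> exists2 A, A \in unitmx & crel D A f g.
Proof.
by move=> sg; split=> -[A uA H]; exists A => //; apply/crel_rateq.
Qed.

Lemma rateq_sym f g : rateq f g -> rateq g f.
Proof.
case=> c cn0 ->; exists c^-1; rewrite ?invr_eq0 //; case: g => g1 g2 /=.
by rewrite !scalerA mulVf // !scale1r.
Qed.

Lemma is_autP D f A : sized D f -> is_aut D f A <-> A \in unitmx /\ crel D A f f.
Proof.
move=> sf; split=> -[uA H]; split=> //; first by apply/crel_rateq => //; exact: rateq_sym.
by apply: rateq_sym; apply/crel_rateq.
Qed.

Lemma crel1 D f : crel D 1%:M f f.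
Proof. by exists 1; rewrite ?oner_neq0 // => v; rewrite !mul1mx scale1r. Qed.

Lemma crelM D A B f g h : crel D A f g -> crel D B g h -> crel D (A *m B) f h.
Proof.
case=> a an0 H [b bn0 H']; exists (a * b); rewrite ?mulf_neq0 // => v.
by rewrite -mulmxA H H' -scalemxAr scalerA mulmxA.
Qed.

Lemma crelV D A f g : A \in unitmx -> crel D A f g -> crel D (invmx A) g f.
Proof.
move=> uA [a an0 H]; exists a^-1; rewrite ?invr_eq0 // => v.
have := H (invmx A *m v); rewrite mulKVmx // => ->.
by rewrite -scalemxAr mulKmx // scalerA mulVf // scale1r.
Qed.

Lemma conjugate_refl D f : sized D f -> conjugate D f f.
Proof. by move=> sf; apply/conjugateP => //; exists 1%:M; [exact: unitmx1|exact: crel1]. Qed.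

Lemma conjugate_sym D f g : sized D f -> sized D g -> conjugate D f g -> conjugate D g f.
Proof.
move=> sf sg /conjugateP[] // A uA H; apply/conjugateP => //; exists (invmx A).
  by rewrite unitmx_inv.
exact: crelV.
Qed.

Lemma conjugate_trans D f g h : sized D g -> sized D h ->
  conjugate D f g -> conjugate D g h -> conjugate D f h.
Proof.
move=> sg sh /conjugateP[] // A uA H /conjugateP[] // B uB H'; apply/conjugateP => //.
by exists (A *m B); [rewrite unitmx_mul uA | exact: crelM H H'].
Qed.

Lemma hev_infty D p x : hev D p x 0 = p`_D * x ^+ D.
Proof.
rewrite /hev big_ord_recr /= subnn expr0 mulr1 big1 ?add0r // => i _.
by rewrite -[(D - i)%N]prednK ?subn_gt0 // exprS mul0r mulr0.
Qed.

(** Coprimality excludes common zeros at finite points, and the condition that the larger degree be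
    exactly D excludes one at infinity. *)
Lemma is_ratP D f : (0 < D)%N -> is_rat D f <->
  sized D f /\ forall v, ev D f v = 0 -> v = 0.
Proof.
move=> D0; case: f => p q; rewrite /is_rat /sized /=; split.
  case/andP=> /eqP mx cop; have [sp sq] : (size p <= D.+1)%N /\ (size q <= D.+1)%N.
    by rewrite -mx leq_maxl leq_maxr.
  split=> // v; rewrite (cvE v) ev_cv /=; move: (v 0 0) (v 1 0) => x y.
  have -> : 0 = cv 0 0 by rewrite [LHS]cvE !mxE.
  case/cv_inj; have [->|yn0] := eqVneq y 0.
    rewrite !hev_infty; have [->//|xn0] := eqVneq x 0.
    move/eqP; rewrite mulf_eq0 expf_eq0 (negbTE xn0) andbF orbF => /eqP pD.
    move/eqP; rewrite mulf_eq0 expf_eq0 (negbTE xn0) andbF orbF => /eqP qD.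
    have drop (r : {poly k}) : (size r <= D.+1)%N -> r`_D = 0 -> (size r <= D)%N.
      move=> sr rD; apply/leq_sizeP => j; rewrite leq_eqVlt => /orP[/eqP <- //|lt].
      by apply: nth_default; apply: leq_trans sr _.
    by have := geq_max D (size p) (size q); rewrite mx !drop // ltnn.
  have norm (r : {poly k}) : (size r <= D.+1)%N -> hev D r x y = y ^+ D * r.[x / y].
    by move=> sr; rewrite -(hev_horner _ sr) -hevZ mulr1 mulrCA divff // mulr1.
  rewrite !norm // => /eqP; rewrite mulf_eq0 expf_eq0 (negbTE yn0) andbF orFb => px.
  move/eqP; rewrite mulf_eq0 expf_eq0 (negbTE yn0) andbF orFb => qx.
  by have := coprimep_root cop px; rewrite qx.
case=> -[sp sq] H; apply/andP; split.
  rewrite eqn_leq geq_max sp sq leqNgt ltnS geq_max; apply/negP => /andP[sp' sq'].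
  have : cv 1 0 = 0.
    apply: H; rewrite ev_cv !hev_infty !(nth_default _ sp') !(nth_default _ sq') !mul0r.
    by rewrite [RHS]cvE !mxE.
  by move/matrixP/(_ 0 0); rewrite !mxE /= => /eqP; rewrite oner_eq0.
apply: Pdiv.ClosedField.root_coprimep => x /rootP px; apply/eqP => qx.
have : cv x 1 = 0.
  by apply: H; rewrite ev_cv !hev_horner //= px qx [RHS]cvE !mxE.
by move/matrixP/(_ 1 0); rewrite !mxE /= => /eqP; rewrite oner_eq0.
Qed.

Lemma is_rat_sized D f : (0 < D)%N -> is_rat D f -> sized D f.
Proof. by move=> D0 /is_ratP[]. Qed.

Lemma is_rat_conj D f g A : (0 < D)%N -> A \in unitmx -> is_rat D f -> sized D g ->
  crel D A f g -> is_rat D g.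
Proof.
move=> D0 uA /is_ratP[] // sf Hf sg [c cn0 H]; apply/is_ratP => //; split=> // v v0.
have := H v; rewrite v0 mulmx0 scaler0 => /Hf; move/(congr1 (mulmx (invmx A))).
by rewrite mulKmx // mulmx0.
Qed.

Lemma conjugate_is_rat D f g : (0 < D)%N -> is_rat D f -> conjugate D f g -> is_rat D g.
Proof.
move=> D0 rf [A uA e]; have sg : sized D g.
  by case/rateqE: e => c _ ->; exact/sized_rscale/sized_ratconj.
by apply: (is_rat_conj D0 uA rf sg); apply/crel_rateq.
Qed.

(** * Multipliers *)

(** By Euler's formula this is the dehomogenized partial derivative in y of the form of degree d + 1
    attached to [p]. *)
Definition dyp (d : nat) (p : {poly k}) : {poly k} := d.+1%:R *: p - 'X * p^`().

Lemma coef_dyp d p i : (i <= d.+1)%N -> (dyp d p)`_i = (d.+1 - i)%:R * p`_i.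
Proof.
move=> le; rewrite /dyp coefB coefZ coefXM natrB // mulrBl; congr (_ - _).
by case: i le => [|i] _ /=; rewrite ?mul0r // coef_deriv mulr_natl.
Qed.

Lemma deriv_hsubst d p u w :
  (hsubst d.+1 p u w)^`() = hsubst d p^`() u w * u^`() + hsubst d (dyp d p) u w * w^`().
Proof.
rewrite /hsubst raddf_sum /=.
rewrite (eq_bigr (fun i : 'I_d.+2 => p`_i *: (u ^+ i.-1 *+ i * w ^+ (d.+1 - i)) * u^`() +
   p`_i *: (u ^+ i * (w ^+ (d.+1 - i).-1 *+ (d.+1 - i))) * w^`())); last first.
  move=> i _; rewrite derivZ derivM !deriv_exp -!mul_polyC.
  move: (p`_i)%:P (u ^+ i) (w ^+ (d.+1 - i)) (u ^+ i.-1) (w ^+ (d.+1 - i).-1) (u^`()) (w^`())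
    (nat_of_ord i) (d.+1 - i)%N => c0 A B A' B' du dw n1 n2.
  by ring.
rewrite big_split /= -!mulr_suml; congr (_ * _ + _ * _).
  rewrite big_ord_recl /= mulr0n mul0r scaler0 add0r; apply: eq_bigr => i _.
  by rewrite /bump /= add1n coef_deriv subSS mulrnAl -scalerMnr scalerMnl.
rewrite big_ord_recr /= subnn mulr0n mulr0 scaler0 addr0; apply: eq_bigr => i _.
rewrite coef_dyp; last by rewrite ltnW // ltnS ltnW.
have lt : (i <= d)%N by rewrite -ltnS.
by rewrite subSn //= mulrnAr -scalerMnr scalerMnl mulr_natl.
Qed.

(** The index [d] is one less than the degree of [f]; it is the degree of the partial
    derivatives. *)
Definition jac (d : nat) (f : ratmap) (v : 'cV[k]_2) : 'M[k]_2 :=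
  let e p := hev d p (v 0 0) (v 1 0) in
  mk2 (e f.1^`()) (e (dyp d f.1)) (e f.2^`()) (e (dyp d f.2)).

Lemma dir_deriv d p x y s t :
  (hsubst d.+1 p (x%:P + s *: 'X) (y%:P + t *: 'X))^`().[0] =
  hev d p^`() x y * s + hev d (dyp d p) x y * t.
Proof.
have D z r : (z%:P + r *: 'X : {poly k})^`().[0] = r.
  by rewrite derivD derivC derivZ derivX add0r hornerZ hornerC mulr1.
have E z r : (z%:P + r *: 'X : {poly k}).[0] = z.
  by rewrite hornerD hornerC hornerZ hornerX mulr0 addr0.
by rewrite deriv_hsubst hornerD !hornerM !D !horner_hsubst !E.
Qed.

(* The Jacobian matrix is determined by the derivatives along lines. *)
Lemma jacP d f v (M : 'M[k]_2) :
  (forall w, exists P1 P2 : {poly k},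
     (forall t, ev d.+1 f (v + t *: w) = cv P1.[t] P2.[t]) /\
     cv P1^`().[0] P2^`().[0] = M *m w) ->
  jac d f v = M.
Proof.
rewrite (cvE v); move: (v 0 0) (v 1 0) => x y H.
have key s t : jac d f (cv x y) *m cv s t = M *m cv s t.
  have [P1 [P2 [HP <-]]] := H (cv s t).
  have line r : cv x y + r *: cv s t = cv (x + r * s) (y + r * t).
    by rewrite cvZ [LHS]cvE !mxE.
  have P1E : P1 = hsubst d.+1 f.1 (x%:P + s *: 'X) (y%:P + t *: 'X).
    apply/eqP; rewrite -subr_eq0; apply/eqP/poly_eq0_fun => r.
    have := HP r; rewrite line ev_cv => /cv_inj[e _]; rewrite hornerD hornerN -e horner_hsubst.
    by rewrite !(hornerD, hornerC, hornerZ, hornerX) ![_ * r]mulrC subrr.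
  have P2E : P2 = hsubst d.+1 f.2 (x%:P + s *: 'X) (y%:P + t *: 'X).
    apply/eqP; rewrite -subr_eq0; apply/eqP/poly_eq0_fun => r.
    have := HP r; rewrite line ev_cv => /cv_inj[_ e]; rewrite hornerD hornerN -e horner_hsubst.
    by rewrite !(hornerD, hornerC, hornerZ, hornerX) ![_ * r]mulrC subrr.
  by rewrite P1E P2E !dir_deriv /jac cv0 cv1 mul_mk2_cv.
have := (key 1 0, key 0 1); rewrite (mk2E (jac _ _ _)) (mk2E M) !mul_mk2_cv.
by rewrite !(mulr1, mulr0, addr0, add0r) => -[/cv_inj[-> ->] /cv_inj[-> ->]].
Qed.

Lemma jac_dir d f v w : exists P1 P2 : {poly k},
  (forall t, ev d.+1 f (v + t *: w) = cv P1.[t] P2.[t]) /\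
  cv P1^`().[0] P2^`().[0] = jac d f v *m w.
Proof.
rewrite (cvE v) (cvE w); move: (v 0 0) (v 1 0) (w 0 0) (w 1 0) => x y s t.
exists (hsubst d.+1 f.1 (x%:P + s *: 'X) (y%:P + t *: 'X)).
exists (hsubst d.+1 f.2 (x%:P + s *: 'X) (y%:P + t *: 'X)); split=> [r|].
  have -> : cv x y + r *: cv s t = cv (x + r * s) (y + r * t) by rewrite cvZ [LHS]cvE !mxE.
  by rewrite ev_cv !horner_hsubst !(hornerD, hornerC, hornerZ, hornerX) ![_ * r]mulrC.
by rewrite !dir_deriv /jac cv0 cv1 mul_mk2_cv.
Qed.

Lemma jac_crel d A f g c : A \in unitmx ->
  (forall v, ev d.+1 f (A *m v) = c *: (A *m ev d.+1 g v)) ->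
  forall v, jac d f (A *m v) = c *: (A *m jac d g v *m invmx A).
Proof.
move=> uA H v; apply: jacP => w.
have [P1 [P2 [HP dP]]] := jac_dir d g v (invmx A *m w).
exists ((c * A 0 0) *: P1 + (c * A 0 1) *: P2), ((c * A 1 0) *: P1 + (c * A 1 1) *: P2).
split=> [t|].
  have -> : A *m v + t *: w = A *m (v + t *: (invmx A *m w)).
    by rewrite mulmxDr -scalemxAr mulKVmx.
  rewrite H HP {1}(mk2E A) mul_mk2_cv cvZ !(hornerD, hornerZ).
  by congr cv; ring.
rewrite -scalemxAl -!mulmxA -dP (mk2E A) !mxE /= mul_mk2_cv cvZ !derivD !derivZ !(hornerD, hornerZ).
by congr cv; ring.
Qed.

Lemma jac_ratcomp d e f g v : sized e.+1 g ->
  jac (d.+1 * e.+1).-1 (ratcomp d.+1 f g) v = jac d f (ev e.+1 g v) *m jac e g v.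
Proof.
move=> sg; apply: jacP => w.
have -> : ((d.+1 * e.+1).-1.+1 = d.+1 * e.+1)%N by [].
have [P1 [P2 [HP dP]]] := jac_dir e g v w.
exists (hsubst d.+1 f.1 P1 P2), (hsubst d.+1 f.2 P1 P2); split=> [t|].
  by rewrite ev_ratcomp // HP ev_cv !horner_hsubst.
have P0 : ev e.+1 g v = cv P1.[0] P2.[0] by rewrite -HP scale0r addr0.
by rewrite -mulmxA -dP P0 /jac cv0 cv1 mul_mk2_cv !deriv_hsubst !(hornerD, hornerM) !horner_hsubst.
Qed.

(* [det J_F / D]; at a fixed point [F v = l v] the multiplier is this over [l ^ 2]. *)
Definition mnum (d : nat) (f : ratmap) (v : 'cV[k]_2) : k := \det (jac d f v) / d.+1%:R.

Lemma natrS_neq0 d : d.+1%:R != 0 :> k.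
Proof. by rewrite pnatr_eq0. Qed.

Lemma mnumZ d f s v : mnum d f (s *: v) = s ^+ (d + d) * mnum d f v.
Proof.
rewrite /mnum (cvE v) cvZ /jac !cv0 !cv1 !hevZ !det_mk2 exprD; ring.
Qed.

Lemma mnum_crel d A f g c : A \in unitmx ->
  (forall v, ev d.+1 f (A *m v) = c *: (A *m ev d.+1 g v)) ->
  forall v, mnum d f (A *m v) = c ^+ 2 * mnum d g v.
Proof.
move=> uA H v; rewrite /mnum (jac_crel uA H) detZ !det_mulmx det_inv.
have dA : \det A != 0 by rewrite -unitfE -unitmxE.
move: (natrS_neq0 d); move: (d.+1%:R : k) => N Nn0.
by field; rewrite ?Nn0 ?dA.
Qed.

(** By Euler's formula v is an eigenvector of the Jacobian matrix with eigenvalue (d + 1) l; the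
    other eigenvalue is l times the multiplier. This form treats infinity like any other point. *)
Definition is_mult (d : nat) (f : ratmap) (v : 'cV[k]_2) (m : k) : Prop :=
  exists2 l, l != 0 & ev d.+1 f v = l *: v /\ mnum d f v = m * l ^+ 2.

Lemma is_mult_crel d A f g v m : A \in unitmx -> crel d.+1 A f g ->
  is_mult d g v m -> is_mult d f (A *m v) m.
Proof.
move=> uA [c cn0 H] [l ln0 [Hv Hm]]; exists (c * l); first by rewrite mulf_neq0.
split; first by rewrite H Hv -scalemxAr scalerA.
by rewrite (mnum_crel uA H) Hm; ring.
Qed.

(** The chain rule along a cycle v -> u -> v. Taking u = v is allowed and gives the square of the
    multiplier at a fixed point. *)
Lemma is_mult_comp f v u l l' m m' : sized 3 f -> l != 0 -> l' != 0 ->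
  ev 3 f v = l *: u -> ev 3 f u = l' *: v ->
  mnum 2 f v = m * l ^+ 2 -> mnum 2 f u = m' * l' ^+ 2 ->
  is_mult 8 (ratcomp 3 f f) v (m * m').
Proof.
move=> sf ln0 l'n0 Hv Hu mv mu; exists (l ^+ 3 * l'); first by rewrite mulf_neq0 ?expf_neq0.
split.
  by rewrite -[9%N]/(3 * 3)%N ev_ratcomp // Hv evZ Hu scalerA.
have := mnumZ 2 f l u; rewrite mu /mnum -[8%N]/((3 * 3).-1)%N jac_ratcomp // det_mulmx Hv.
set X := \det _; set Y := \det _.
have -> : Y = m * l ^+ 2 * 3%:R by rewrite -mv /mnum -/Y divfK // natrS_neq0.
move=> /(canRL (divfK (natrS_neq0 2))) ->.
have -> : 9%:R = 3%:R * 3%:R :> k by rewrite -natrM.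
by field.
Qed.

Definition detc (u v : 'cV[k]_2) : k := u 0 0 * v 1 0 - u 1 0 * v 0 0.

Lemma detc_cv x y x' y' : detc (cv x y) (cv x' y') = x * y' - y * x'.
Proof. by rewrite /detc !cv0 !cv1. Qed.

Lemma detc_mul A u v : detc (A *m u) (A *m v) = \det A * detc u v.
Proof.
rewrite (mk2E A) (cvE u) (cvE v) !mul_mk2_cv !detc_cv det_mk2; ring.
Qed.

Lemma detcZl c u v : detc (c *: u) v = c * detc u v.
Proof. by rewrite /detc !mxE; ring. Qed.

Definition mults (d : nat) (F : ratmap) : seq k :=
  [seq multiplier d.+1 F Q | Q <- fixed_points d.+1 F].

(* [s] lists the fixed points, with multiplicity, and their multipliers. *)
Definition mdata (d : nat) (f : ratmap) (s : seq ('cV[k]_2 * k)) : Prop :=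
  [/\ size s = d.+2,
      (exists2 c, c != 0 & forall v, detc (ev d.+1 f v) v = c * \prod_(p <- s) detc v p.1) &
      forall p, p \in s -> p.1 != 0 /\ is_mult d f p.1 p.2].

Lemma cv_eq0 x y : (cv x y == 0) = (x == 0) && (y == 0).
Proof.
have -> : 0 = cv 0 0 :> 'cV[k]_2 by rewrite [LHS]cvE !mxE.
by apply/eqP/andP => [/cv_inj[-> ->]|[/eqP -> /eqP ->]].
Qed.

Lemma ratderiv_mnum d f z : sized d.+1 f ->
  mnum d f (cv z 1) = f.1^`().[z] * f.2.[z] - f.1.[z] * f.2^`().[z].
Proof.
case=> s1 s2; have sd (p : {poly k}) : (size p <= d.+2)%N -> (size p^`() <= d.+1)%N.
  move=> sp; apply/leq_sizeP => j lj; rewrite coef_deriv nth_default ?mul0rn //.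
  by apply: leq_trans sp _.
have sdy (p : {poly k}) : (size p <= d.+2)%N -> (size (dyp d p) <= d.+1)%N.
  move=> sp; apply/leq_sizeP => j; rewrite leq_eqVlt => /orP[/eqP <-|lj].
    by rewrite coef_dyp // subnn mul0r.
  rewrite /dyp coefB coefZ coefXM; case: j lj => // j lj; rewrite coef_deriv /=.
  by rewrite (nth_default _ (leq_trans sp _)) // mulr0 mul0rn subrr.
rewrite /mnum /jac cv0 cv1 !hev_horner ?sd ?sdy // det_mk2 /dyp !(hornerD, hornerN, hornerZ, hornerM, hornerX).
by move: (natrS_neq0 d); move: (d.+1%:R : k) => N Nn0; field.
Qed.

Lemma multiplier_fin d f a b m : sized d.+1 f -> b != 0 ->
  is_mult d f (cv a b) m -> multiplier d.+1 f (Some (a / b)) = m.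
Proof.
move=> sf bn0 [l ln0 [Hv Hm]]; rewrite /multiplier /ratderiv -(ratderiv_mnum _ sf).
set z := a / b.
have vE : cv a b = b *: cv z 1 by rewrite cvZ mulr1 /z mulrCA divff // mulr1.
have F2 : f.2.[z] * b ^+ d = l.
  move: Hv; rewrite vE evZ ev_cv !cvZ => /cv_inj[_].
  rewrite hev_horner ?sf.2 // mulr1 exprS => H; apply: (mulIf bn0); rewrite -H; ring.
move: Hm; rewrite vE mnumZ -F2 exprD => Hm.
have bd : b ^+ d != 0 by rewrite expf_neq0.
have F2n0 : f.2.[z] != 0 by move: ln0; rewrite -F2 mulf_eq0 negb_or => /andP[].
have -> : mnum d f (cv z 1) = m * f.2.[z] ^+ 2.
  by apply: (mulfI (mulf_neq0 bd bd)); rewrite Hm; ring.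
by rewrite mulfK // expf_neq0.
Qed.

(** In the coordinate 1 / z only the two top coefficients of each component enter, and fixing
    infinity kills the top coefficient of the denominator. *)
Lemma multiplier_inf d f a m : a != 0 ->
  is_mult d f (cv a 0) m -> multiplier d.+1 f None = m.
Proof.
move=> an0 [l ln0 [Hv Hm]]; rewrite /multiplier /ratderiv.
have vE : cv a 0 = a *: cv 1 0 by rewrite cvZ mulr1 mulr0.
have ad : a ^+ d != 0 by rewrite expf_neq0.
move: Hv Hm; rewrite vE evZ mnumZ ev_cv /mnum /jac cv0 cv1 !hev_infty !expr1n !mulr1 !cvZ.
rewrite det_mk2 !coef_dyp ?leqnSn // subSn // subnn !coef_deriv => /cv_inj[].
rewrite mulr1 !mulr0 => H1 /eqP; rewrite mulf_eq0 expf_eq0 (negbTE an0) andbF orFb => /eqP F2 Hm.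
have F1 : f.1`_d.+1 * a ^+ d = l by apply: (mulIf an0); rewrite -H1 exprS; ring.
have c0 p : (revpoly d.+1 p).[0] = p`_d.+1.
  by rewrite horner_coef0 /revpoly coef_poly /= subn0.
have c1 p : (revpoly d.+1 p)^`().[0] = p`_d.
  by rewrite horner_coef0 coef_deriv /revpoly coef_poly /= subSS subn0.
rewrite /= !c0 !c1 F2 mul0r subr0.
have F1n0 : f.1`_d.+1 != 0 by move: ln0; rewrite -F1 mulf_eq0 negb_or => /andP[].
move: Hm; rewrite F2 -F1 mul0rn mulr0 subr0 mul1r exprD => Hm.
have E : f.2`_d * f.1`_d.+1 = m * f.1`_d.+1 ^+ 2.
  apply: (mulfI (mulf_neq0 ad ad)); transitivity (m * (f.1`_d.+1 * a ^+ d) ^+ 2); last by ring.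
  by rewrite -Hm mulrnAl -mulr_natr mulfK ?natrS_neq0 // [f.2`_d * _]mulrC.
by rewrite E mulfK // expf_neq0.
Qed.

Lemma eq_perm (s t : seq k) : s = t -> perm_eq s t.
Proof. by move->. Qed.

(** The finite points of the list are the roots of F.1 - z F.2, with multiplicities given by the
    factorization; the remaining points are copies of infinity, as many as the degree of F.1 - z F.2
    falls short. *)
Lemma mults_mdata d f s : sized d.+1 f -> mdata d f s ->
  perm_eq (mults d f) [seq p.2 | p <- s].
Proof.
move=> sf [sz [c cn0 Hc] Hs].
pose P := f.1 - 'X * f.2.
pose fin (p : 'cV[k]_2 * k) := p.1 1 0 != 0.
pose s1 := filter fin s; pose s2 := filter (predC fin) s.
have PE : exists2 c', c' != 0 & P = c' *: \prod_(p <- s1) ('X - (p.1 0 0 / p.1 1 0)%:P).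
  exists (c * \prod_(p <- s1) p.1 1 0 * \prod_(p <- s2) - p.1 0 0).
    rewrite !mulf_neq0 // prodf_seq_neq0; apply/allP => p; rewrite mem_filter /= => /andP[fp ps] //.
    have [+ _] := Hs p ps; rewrite {1}(cvE p.1) cv_eq0 negb_and oppr_eq0.
    by move: fp; rewrite /fin negbK => ->; rewrite orbF.
  apply/eqP; rewrite -subr_eq0; apply/eqP/poly_eq0_fun => x; apply/eqP.
  rewrite hornerD hornerN subr_eq0 hornerZ horner_prod; apply/eqP.
  transitivity (detc (ev d.+1 f (cv x 1)) (cv x 1)).
    rewrite ev_cv detc_cv !hev_horner ?sf.1 ?sf.2 // /P !(hornerD, hornerN, hornerM, hornerX).
    by ring.
  rewrite Hc -!mulrA; congr (_ * _).
  rewrite -(perm_big _ (permEl (perm_filterC fin s))) big_cat /= -/s1 -/s2.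
  have -> : \prod_(p <- s2) detc (cv x 1) p.1 = \prod_(p <- s2) - p.1 0 0.
    rewrite big_seq [RHS]big_seq; apply: eq_bigr => p; rewrite mem_filter /= /fin negbK => /andP[/eqP p0 _].
    by rewrite {1}(cvE p.1) detc_cv p0 mulr0 mul1r add0r.
  have -> : \prod_(p <- s1) detc (cv x 1) p.1 =
      \prod_(p <- s1) p.1 1 0 * \prod_(p <- s1) ('X - (p.1 0 0 / p.1 1 0)%:P).[x].
    rewrite -big_split /= big_seq [RHS]big_seq; apply: eq_bigr => p; rewrite mem_filter /fin => /andP[p1 _].
    by rewrite {1}(cvE p.1) detc_cv !hornerE; field.
  by ring.
have {PE} [c' c'n0 PE] := PE.
have szP : size P = (size s1).+1.
  by rewrite PE size_scale // -(big_map (fun p : 'cV[k]_2 * k => p.1 0 0 / p.1 1 0) predT (fun z => 'X - z%:P)) size_prod_XsubC size_map.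
have rootsP : perm_eq (poly_roots P) [seq p.1 0 0 / p.1 1 0 | p : 'cV[k]_2 * k <- s1].
  rewrite /poly_roots; case: closed_field_poly_normal => rs /= rsE.
  apply: prod_XsubC_eq; rewrite big_map.
  have lc : lead_coef P = c'.
    by rewrite PE lead_coefZ (monicP _) ?mulr1 // -(big_map (fun p : 'cV[k]_2 * k => p.1 0 0 / p.1 1 0) predT (fun z => 'X - z%:P)) monic_prod_XsubC.
  by apply: (scalerI c'n0); rewrite -PE -{1}lc -rsE.
rewrite /mults /fixed_points -/P szP map_cat.
have -> : (d.+3 - (size s1).+1)%N = size s2.
  by have := count_predC fin s; rewrite -!size_filter -/s1 -/s2 sz; lia.
apply: (@perm_trans _ ([seq p.2 | p <- s1] ++ [seq p.2 | p <- s2])); last first.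
  by rewrite -map_cat; apply: perm_map; rewrite (permEl (perm_filterC fin s)).
apply: perm_cat.
  apply: (perm_trans (perm_map _ (perm_map _ rootsP))).
  apply: eq_perm; rewrite -!map_comp; apply/eq_in_map => p.
  rewrite mem_filter => /andP[fp ps]; have [_ mp] := Hs p ps.
  by move: mp; rewrite {1}(cvE p.1) /= => /(multiplier_fin sf fp).
apply: eq_perm; rewrite map_nseq.
apply: (@eq_from_nth _ 0); rewrite ?size_nseq ?size_map // => i lt.
rewrite nth_nseq lt (nth_map (0, 0)) //.
have := mem_nth (0, 0) lt; set p := nth _ _ _; rewrite mem_filter /fin /= negbK => /andP[/eqP p0 ps].
have [pn0 mp] := Hs p ps; move: pn0 mp; rewrite (cvE p.1) p0 cv_eq0 eqxx andbT.
exact: multiplier_inf.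
Qed.

Lemma mdata_crel d A f g s : A \in unitmx -> crel d.+1 A f g -> mdata d f s ->
  exists2 s', mdata d g s' & [seq p.2 | p <- s'] = [seq p.2 | p <- s].
Proof.
move=> uA rel [sz [c cn0 Hc] Hs].
exists [seq (invmx A *m p.1, p.2) | p <- s]; last by rewrite -map_comp.
have dA : \det A != 0 by rewrite -unitfE -unitmxE.
split; first by rewrite size_map.
  have [e en0 He] := rel.
  exists ((e * \det A)^-1 * c * \prod_(p <- s) \det A).
    by rewrite !mulf_neq0 ?invr_eq0 ?mulf_neq0 // prodf_seq_neq0; apply/allP.
  move=> v; have := Hc (A *m v); rewrite He detcZl detc_mul => H.
  move: (mulf_neq0 en0 dA); rewrite mulrA in H; move: H; set E := e * \det A => H En0; clearbody E.
  apply: (mulfI En0); rewrite H big_map !mulrA divff // mul1r -!mulrA.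
  congr (_ * _); rewrite -big_split /=; apply: eq_bigr => p _.
  by rewrite -detc_mul mulKVmx.
move=> _ /mapP[p ps ->] /=; have [pn0 mp] := Hs p ps; split.
  by apply: contraNneq pn0 => e; rewrite -(mulKVmx uA p.1) e mulmx0.
apply: (is_mult_crel (f := g) (g := f)) mp; first by rewrite unitmx_inv.
exact: crelV.
Qed.

(** Elementary symmetric functions in a recursive form that [/=] evaluates on explicit lists. *)
Fixpoint es (i : nat) (s : seq k) : k :=
  match i, s with
  | 0, _ => 1
  | _.+1, [::] => 0
  | j.+1, x :: s' => es i s' + x * es j s'
  end.

Lemma es_gt i s : (size s < i)%N -> es i s = 0.
Proof.
elim: s i => [|x s IH] [|i] //= lt; rewrite !IH ?mulr0 ?addr0 //.
exact: ltnW.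
Qed.

Lemma es_coef i s : (i <= size s)%N ->
  es i s = (-1) ^+ i * (\prod_(c <- s) ('X - c%:P))`_(size s - i).
Proof.
elim: s i => [|x s IH] [|i] //=.
- by rewrite big_nil mul1r coef1.
- move=> _; rewrite subn0 expr0 mul1r -[(size s).+1]/(size (x :: s)).
  rewrite -[X in _`_X]/(size (x :: s)).+1.-1 -(size_prod_XsubC (x :: s) id) -/(lead_coef _).
  by rewrite (monicP (monic_prod_XsubC _ _ _)).
rewrite ltnS => le; rewrite big_cons mulrBl coefB coefCM coefXM subSS (IH i) //.
case: ltngtP le => // [lt|->] _; last by rewrite subnn /= es_gt // !exprS; ring.
rewrite IH // gtn_eqF ?subn_gt0 //= subnS !exprS; ring.
Qed.

Lemma es_perm i s s' : perm_eq s s' -> es i s = es i s'.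
Proof.
move=> p; have [le|gt] := leqP i (size s).
  by rewrite !es_coef -?(perm_size p) // (perm_big _ p).
by rewrite !es_gt -?(perm_size p).
Qed.

Lemma sigma_es d n i f s : perm_eq (multipliers d n f) s -> (i <= size s)%N ->
  sigma d n i f = es i s.
Proof.
move=> p le; rewrite /sigma -(es_perm i p).
have lt : (i < (size (multipliers d n f)).+1)%N by rewrite ltnS (perm_size p).
have := mroots_coeff (in_tuple (multipliers d n f)) (Ordinal lt) => /= H.
rewrite es_coef; last by rewrite -ltnS.
by rewrite H mulrA -expr2 sqrr_sign mul1r.
Qed.

Lemma ratiter1 f : sized 3 f -> ratiter 3 1 f = f.
Proof.
move=> sf; have sX : sized 1 ('X, 1).
  by split; rewrite /= ?size_polyX ?size_poly1.
apply: (ev_inj (D := 3)) => // [|v]; first exact: (sized_ratcomp 3 f sX).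
rewrite [LHS](ev_ratcomp 3 f v sX); congr ev; rewrite (cvE v) ev_cv /hev !big_ord_recl !big_ord0 /=.
by rewrite !coefX !coef1 /bump /=; congr cv; ring.
Qed.

Lemma multipliers1 f : sized 3 f -> multipliers 3 1 f = mults 2 f.
Proof. by move=> sf; rewrite /multipliers (ratiter1 sf). Qed.

Lemma multipliers2 f : sized 3 f -> multipliers 3 2 f = mults 8 (ratcomp 3 f f).
Proof.
move=> sf; rewrite /multipliers.
by rewrite -[ratiter 3 2 f]/(ratcomp 3 f (ratiter 3 1 f)) (ratiter1 sf).
Qed.

Lemma crel_iter2 A f g : sized 3 f -> sized 3 g -> crel 3 A f g ->
  crel 9 A (ratcomp 3 f f) (ratcomp 3 g g).
Proof.
move=> sf sg [c cn0 H]; exists (c ^+ 3 * c); first by rewrite mulf_neq0 ?expf_neq0.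
by move=> v; rewrite -[9%N]/(3 * 3)%N !ev_ratcomp // H evZ H scalerA.
Qed.

Lemma multipliers1_conj f g s : sized 3 f -> sized 3 g -> conjugate 3 f g ->
  mdata 2 f s -> perm_eq (multipliers 3 1 g) [seq p.2 | p <- s].
Proof.
move=> sf sg /(conjugateP _ sg)[A uA rel] /(mdata_crel uA rel) [s' H <-].
by rewrite multipliers1 //; apply: mults_mdata.
Qed.

Lemma multipliers2_conj f g s : sized 3 f -> sized 3 g -> conjugate 3 f g ->
  mdata 8 (ratcomp 3 f f) s -> perm_eq (multipliers 3 2 g) [seq p.2 | p <- s].
Proof.
move=> sf sg /(conjugateP _ sg)[A uA rel] /(mdata_crel uA (crel_iter2 sf sg rel)) [s' H <-].
by rewrite multipliers2 //; apply: mults_mdata => //; exact: (sized_ratcomp 3 g sg).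
Qed.

(** * The families *)

Definition mapC3 (a : k) : ratmap := ('X^3 + a%:P, a *: 'X^2).
Definition mapC2 (a b : k) : ratmap := ('X^3 + a *: 'X, b *: 'X^2 + 1).
(** The line a = b is family (2), and b = - a is family (3) after rescaling the coordinate. *)
Definition mapC2' (a b : k) : ratmap := (a *: 'X^2 + 1, 'X^3 + b *: 'X).
Definition mapD2' (a : k) : ratmap := (a *: 'X^2 - 1, 'X^3 - a *: 'X).

Definition coefsE := (coefD, coefN, coefZ, coefXn, coefX, coef1, coefC).

Lemma ev_mapC3 a x y : ev 3 (mapC3 a) (cv x y) = cv (x ^+ 3 + a * y ^+ 3) (a * x ^+ 2 * y).
Proof. by rewrite ev_cv !hev3E !coefsE /=; congr cv; ring. Qed.

Lemma ev_mapC2 a b x y :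
  ev 3 (mapC2 a b) (cv x y) = cv (x ^+ 3 + a * x * y ^+ 2) (b * x ^+ 2 * y + y ^+ 3).
Proof. by rewrite ev_cv !hev3E !coefsE /=; congr cv; ring. Qed.

Lemma ev_mapC2' a b x y :
  ev 3 (mapC2' a b) (cv x y) = cv (a * x ^+ 2 * y + y ^+ 3) (x ^+ 3 + b * x * y ^+ 2).
Proof. by rewrite ev_cv !hev3E !coefsE /=; congr cv; ring. Qed.

Lemma ev_mapD2' a x y :
  ev 3 (mapD2' a) (cv x y) = cv (a * x ^+ 2 * y - y ^+ 3) (x ^+ 3 - a * x * y ^+ 2).
Proof. by rewrite ev_cv !hev3E !coefsE /=; congr cv; ring. Qed.

Lemma sizedP (p q : {poly k}) : (forall j, p`_j.+4 = 0) -> (forall j, q`_j.+4 = 0) -> sized 3 (p, q).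
Proof.
by move=> P Q; split; apply/leq_sizeP => -[|[|[|[|j]]]] // _.
Qed.

Lemma sized_mapC3 a : sized 3 (mapC3 a).
Proof. by apply: sizedP => j; rewrite !coefsE /= ?mulr0 ?addr0 ?oppr0. Qed.
Lemma sized_mapC2 a b : sized 3 (mapC2 a b).
Proof. by apply: sizedP => j; rewrite !coefsE /= ?mulr0 ?addr0 ?oppr0. Qed.
Lemma sized_mapC2' a b : sized 3 (mapC2' a b).
Proof. by apply: sizedP => j; rewrite !coefsE /= ?mulr0 ?addr0 ?oppr0. Qed.
Lemma sized_mapD2' a : sized 3 (mapD2' a).
Proof. by apply: sizedP => j; rewrite !coefsE /= ?mulr0 ?subrr ?subr0. Qed.

Lemma is_ratP_cv f : sized 3 f ->
  (forall x y, hev 3 f.1 x y = 0 -> hev 3 f.2 x y = 0 -> x = 0 /\ y = 0) -> is_rat 3 f.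
Proof.
move=> sf H; apply/is_ratP => //; split=> // v; rewrite (cvE v) ev_cv => /eqP.
by rewrite cv_eq0 => /andP[/eqP e1 /eqP e2]; apply/eqP; rewrite cv_eq0; have [-> ->] := H _ _ e1 e2; rewrite eqxx.
Qed.

Lemma cube0 (x : k) : x ^+ 3 = 0 -> x = 0.
Proof. by move/eqP; rewrite expf_eq0 => /eqP. Qed.

Lemma rat_mapC3 (a : k) : a != 0 -> is_rat 3 (mapC3 a).
Proof.
move=> an0; apply: is_ratP_cv (sized_mapC3 a) _ => x y.
have := ev_mapC3 a x y; rewrite ev_cv => /cv_inj[-> ->] e1 /eqP.
rewrite !mulf_eq0 (negbTE an0) /= orbb => /orP[/eqP x0|/eqP y0].
  split=> //; move: e1; rewrite x0 expr0n /= add0r => /eqP; rewrite mulf_eq0 (negbTE an0) => /eqP.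
  exact: cube0.
by split=> //; apply: cube0; rewrite -e1 y0 expr0n mulr0 addr0.
Qed.

Lemma rat_mapC2 (a b : k) : a * b != 1 -> is_rat 3 (mapC2 a b).
Proof.
move=> ab; apply: is_ratP_cv (sized_mapC2 a b) _ => x y.
have := ev_mapC2 a b x y; rewrite ev_cv => /cv_inj[-> ->] e1 e2.
have [x0|xn0] := eqVneq x 0.
  by split=> //; apply: cube0; rewrite -e2 x0; ring.
have [y0|yn0] := eqVneq y 0.
  by split=> //; apply: cube0; rewrite -e1 y0; ring.
have h1 : x ^+ 2 + a * y ^+ 2 = 0 by apply: (mulfI xn0); rewrite mulr0 -e1; ring.
have h2 : b * x ^+ 2 + y ^+ 2 = 0 by apply: (mulfI yn0); rewrite mulr0 -e2; ring.
case/eqP: ab; apply/eqP; rewrite -subr_eq0; apply/eqP.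
apply: (mulIf (expf_neq0 2 xn0)); rewrite mul0r.
transitivity (a * (b * x ^+ 2 + y ^+ 2) - (x ^+ 2 + a * y ^+ 2)); first by ring.
by rewrite h1 h2; ring.
Qed.

Lemma rat_mapC2' (a b : k) : a * b != 1 -> is_rat 3 (mapC2' a b).
Proof.
move=> ab; apply: is_ratP_cv (sized_mapC2' a b) _ => x y.
have := ev_mapC2' a b x y; rewrite ev_cv => /cv_inj[-> ->] e1 e2.
have [x0|xn0] := eqVneq x 0.
  by split=> //; apply: cube0; rewrite -e1 x0; ring.
have [y0|yn0] := eqVneq y 0.
  by split=> //; apply: cube0; rewrite -e2 y0; ring.
have h1 : x ^+ 2 + b * y ^+ 2 = 0 by apply: (mulfI xn0); rewrite mulr0 -e2; ring.
have h2 : a * x ^+ 2 + y ^+ 2 = 0 by apply: (mulfI yn0); rewrite mulr0 -e1; ring.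
case/eqP: ab; apply/eqP; rewrite -subr_eq0; apply/eqP.
apply: (mulIf (expf_neq0 2 xn0)); rewrite mul0r.
transitivity (b * (a * x ^+ 2 + y ^+ 2) - (x ^+ 2 + b * y ^+ 2)); first by ring.
by rewrite h1 h2; ring.
Qed.

Lemma sqr_neq1 (a : k) : a != 1 -> a != -1 -> a * a != 1.
Proof.
move=> a1 a2; rewrite -subr_eq0 (_ : a * a - 1 = (a - 1) * (a + 1)); last by ring.
by rewrite mulf_eq0 subr_eq0 addr_eq0 negb_or a1.
Qed.

Lemma conj_mk (a b c d e : k) f g : sized 3 g -> a * d - b * c != 0 -> e != 0 ->
  (forall x y, ev 3 f (cv (a * x + b * y) (c * x + d * y)) =
     cv (e * (a * hev 3 g.1 x y + b * hev 3 g.2 x y)) (e * (c * hev 3 g.1 x y + d * hev 3 g.2 x y))) ->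
  conjugate 3 f g.
Proof.
move=> sg dn0 en0 H; apply/conjugateP => //; exists (mk2 a b c d); first by rewrite unit_mk2.
by exists e => // v; rewrite (cvE v) mul_mk2_cv H ev_cv mul_mk2_cv cvZ.
Qed.

Ltac hevsimp L := have := L; rewrite ev_cv => /cv_inj[-> ->].

Lemma i2 : 'i * 'i = -1 :> k.
Proof. by rewrite -expr2 sqrCi. Qed.

Lemma conj_C2'_neg (a b : k) : conjugate 3 (mapC2' a b) (mapC2' (- a) (- b)).
Proof.
apply: (@conj_mk 'i 0 0 1 (- 'i)) (sized_mapC2' _ _) _ _ _.
- by rewrite mulr0 subr0 mulr1 neq0Ci.
- by rewrite oppr_eq0 neq0Ci.
move=> x y; hevsimp (ev_mapC2' (- a) (- b) x y); rewrite ev_mapC2'.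
congr cv.
  transitivity (a * ('i * 'i) * x ^+ 2 * y + y ^+ 3); first by ring.
  transitivity (- ('i * 'i) * ((- a) * x ^+ 2 * y + y ^+ 3)); last by ring.
  by rewrite i2; ring.
transitivity (('i * 'i) * 'i * x ^+ 3 + b * 'i * x * y ^+ 2); first by ring.
by rewrite i2; ring.
Qed.

Lemma conj_C2'_swap (a b : k) : conjugate 3 (mapC2' a b) (mapC2' b a).
Proof.
apply: (@conj_mk 0 1 1 0 1) (sized_mapC2' _ _) _ (oner_neq0 _) _.
  by rewrite mul0r sub0r mulr1 oppr_eq0 oner_neq0.
by move=> x y; hevsimp (ev_mapC2' b a x y); rewrite ev_mapC2'; congr cv; ring.
Qed.

Lemma conj_C2_swap (a b : k) : conjugate 3 (mapC2 a b) (mapC2 b a).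
Proof.
apply: (@conj_mk 0 1 1 0 1) (sized_mapC2 _ _) _ (oner_neq0 _) _.
  by rewrite mul0r sub0r mulr1 oppr_eq0 oner_neq0.
by move=> x y; hevsimp (ev_mapC2 b a x y); rewrite ev_mapC2; congr cv; ring.
Qed.

(** For a = b the map commutes with both - z and - 1 / z. The coordinate change i (z + 1) / (z - 1)
    turns the second of these into a sign change, for which the map is of the other normal form. *)
Lemma conj_C2_diag (a : k) : a != 1 ->
  conjugate 3 (mapC2 a a) (mapC2' (- (a + 3) / (a - 1)) (- (a + 3) / (a - 1))).
Proof.
move=> a1; have am1 : a - 1 != 0 by rewrite subr_eq0.
apply: (@conj_mk 'i 'i 1 (-1) (a - 1)) (sized_mapC2' _ _) _ (am1) _.
  by rewrite mulrN1 mulr1 -opprD oppr_eq0 -mulr2n mulrn_eq0 /= neq0Ci.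
move=> x y; hevsimp (ev_mapC2' (- (a + 3) / (a - 1)) (- (a + 3) / (a - 1)) x y); rewrite ev_mapC2.
congr cv.
  transitivity ('i * (x + y) * (('i * 'i) * (x + y) ^+ 2 + a * (x - y) ^+ 2)); first by ring.
  by rewrite i2; field.
transitivity ((x - y) * (a * ('i * 'i) * (x + y) ^+ 2 + (x - y) ^+ 2)); first by ring.
by rewrite i2; field.
Qed.

Lemma exists_root4 : exists l : k, l ^+ 4 = -1.
Proof. by exists (4.-root (-1)); rewrite rootCK. Qed.

Lemma conj_C2'_D2' a l : l ^+ 4 = -1 -> conjugate 3 (mapC2' a (- a)) (mapD2' (- a * l ^+ 2)).
Proof.
move=> l4; have ln0 : l != 0.
  by apply: contra_eq_neq l4 => ->; rewrite expr0n eq_sym oppr_eq0 oner_neq0.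
apply: (@conj_mk l 0 0 1 (l ^+ 3)) (sized_mapD2' _) _ (expf_neq0 3 ln0) _.
  by rewrite mulr0 subr0 mulr1.
move=> x y; hevsimp (ev_mapD2' (- a * l ^+ 2) x y); rewrite ev_mapC2'; congr cv.
  transitivity (- (-1) * (a * l ^+ 2 * x ^+ 2 * y + y ^+ 3)); first by ring.
  by rewrite -l4; ring.
transitivity (l ^+ 3 * x ^+ 3 + (-1) * a * l * x * y ^+ 2); first by ring.
by rewrite -l4; ring.
Qed.

(* [mapD2'] is the line [b = - a] of [mapC2'], rescaled by a square root of [i]. *)
Lemma D2'_diag a : exists2 m, - (m * m) = a * a & conjugate 3 (mapC2' m (- m)) (mapD2' a).
Proof.
have [l l4] := exists_root4; have l4' : l ^+ 2 * l ^+ 2 = -1 by rewrite -exprD.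
exists (a * l ^+ 2).
  by transitivity (- (a * a) * (l ^+ 2 * l ^+ 2)); [ring | rewrite l4'; ring].
have := conj_C2'_D2' (a * l ^+ 2) l4; rewrite (_ : - (a * l ^+ 2) * l ^+ 2 = a) //.
by transitivity (- a * (l ^+ 2 * l ^+ 2)); [ring | rewrite l4'; ring].
Qed.

Lemma conj_D2'_neg (a : k) : conjugate 3 (mapD2' a) (mapD2' (- a)).
Proof.
apply: (@conj_mk 'i 0 0 1 (- 'i)) (sized_mapD2' _) _ _ _.
- by rewrite mulr0 subr0 mulr1 neq0Ci.
- by rewrite oppr_eq0 neq0Ci.
move=> x y; hevsimp (ev_mapD2' (- a) x y); rewrite ev_mapD2'; congr cv.
  transitivity (a * ('i * 'i) * x ^+ 2 * y - y ^+ 3); first by ring.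
  transitivity (- ('i * 'i) * ((- a) * x ^+ 2 * y - y ^+ 3)); last by ring.
  by rewrite i2; ring.
transitivity (('i * 'i) * 'i * x ^+ 3 - a * 'i * x * y ^+ 2); first by ring.
by rewrite i2; ring.
Qed.

(** The conjugation is by (z + 1) / (z - 1). On the parameter it acts as an involution, which
    together with a |-> - a generates the group of order six behind the six-to-one statement. *)
Lemma conj_D2'_rot (a : k) : a != 1 -> conjugate 3 (mapD2' a) (mapD2' ((a + 3) / (a - 1))).
Proof.
move=> a1; have am1 : a - 1 != 0 by rewrite subr_eq0.
apply: (@conj_mk 1 1 1 (-1) (a - 1)) (sized_mapD2' _) _ (am1) _.
  by rewrite mulrN1 mulr1 -opprD oppr_eq0 -mulr2n mulrn_eq0 /= oner_neq0.
by move=> x y; hevsimp (ev_mapD2' ((a + 3) / (a - 1)) x y); rewrite ev_mapD2'; congr cv; field.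
Qed.

(** * Multipliers of the families *)

Lemma mnum2E f x y : mnum 2 f (cv x y) =
  ((f.1`_3 * 3%:R * x ^+ 2 + f.1`_2 * 2%:R * x * y + f.1`_1 * y ^+ 2) *
   (f.2`_2 * x ^+ 2 + f.2`_1 * 2%:R * x * y + f.2`_0 * 3%:R * y ^+ 2) -
   (f.1`_2 * x ^+ 2 + f.1`_1 * 2%:R * x * y + f.1`_0 * 3%:R * y ^+ 2) *
   (f.2`_3 * 3%:R * x ^+ 2 + f.2`_2 * 2%:R * x * y + f.2`_1 * y ^+ 2)) / 3%:R.
Proof.
have h2 p : hev 2 p x y = p`_0 * y ^+ 2 + p`_1 * x * y + p`_2 * x ^+ 2.
  rewrite /hev !big_ord_recl big_ord0 /= /bump /= !expr0 !expr1 !mulr1 addr0 !addrA.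
  by rewrite !addn0 ?add1n.
have d0 p : (dyp 2 p)`_0 = 3%:R * p`_0 by rewrite coef_dyp.
have d1 p : (dyp 2 p)`_1 = 2%:R * p`_1 by rewrite coef_dyp.
have d2 p : (dyp 2 p)`_2 = p`_2 by rewrite coef_dyp // mul1r.
rewrite /mnum /jac cv0 cv1 det_mk2 !h2 !d0 !d1 !d2 !coef_deriv !mulr1n.
move: (f.1`_0) (f.1`_1) (f.1`_2) (f.1`_3) (f.2`_0) (f.2`_1) (f.2`_2) (f.2`_3).
by move=> p0 p1 p2 p3 q0 q1 q2 q3; congr (_ / _); ring.
Qed.

Lemma sqrt_exists (x : k) : exists z, z ^+ 2 = x.
Proof. by exists (sqrtC x); rewrite sqrtCK. Qed.

Lemma quad_exists (s p : k) : exists z w, z + w = s /\ z * w = p.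
Proof.
have [d dE] := sqrt_exists (s ^+ 2 - 4%:R * p).
exists ((s + d) / 2%:R), ((s - d) / 2%:R); split; first by field.
transitivity ((s ^+ 2 - d ^+ 2) / 4%:R); first by field.
by rewrite dE; field.
Qed.

Lemma quad_root (s p z w : k) : z + w = s -> z * w = p -> z ^+ 2 - s * z + p = 0.
Proof. by move=> <- <-; ring. Qed.

(** [kap] and [eta] are unchanged when (a, b) is swapped or negated. The fixed-point spectrum of
    [mapC2' a b] depends on [kap] alone, the period-2 spectrum on both. *)
Definition kap (a b : k) : k := (4%:R + (a - b) ^+ 2) / (1 - a * b).
Definition eta (a b : k) : k := 8%:R / (1 - a * b).

(** The quartic is the fixed-point equation. It is even in z, as is [m]: fixed points come in pairs
    with equal multipliers. *)
Lemma fixC2'_mult (a b z : k) : a * b != 1 -> z ^+ 4 - (a - b) * z ^+ 2 - 1 = 0 ->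
  let l := z * (z ^+ 2 + b) in let m := (2%:R * a - b - 3%:R * z ^+ 2) / (z ^+ 2 + b) in
  [/\ l != 0, ev 3 (mapC2' a b) (cv z 1) = l *: cv z 1 & mnum 2 (mapC2' a b) (cv z 1) = m * l ^+ 2].
Proof.
move=> ab rel l m.
have zb : z ^+ 2 + b != 0.
  apply: contraNneq ab => e; rewrite -subr_eq0; apply/eqP.
  transitivity ((z ^+ 4 - (a - b) * z ^+ 2 - 1) - (z ^+ 2 + b) * (z ^+ 2 - a)); first by ring.
  by rewrite rel e; ring.
have zn0 : z != 0.
  apply: contraNneq (oner_neq0 k) => z0; rewrite -oppr_eq0 -rel z0; apply/eqP; ring.
split; first by rewrite mulf_neq0.
  rewrite ev_mapC2' cvZ; congr cv; last by rewrite /l; ring.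
  apply/eqP; rewrite -subr_eq0; apply/eqP.
  transitivity (- (z ^+ 4 - (a - b) * z ^+ 2 - 1)); first by rewrite /l; ring.
  by rewrite rel oppr0.
apply/eqP; rewrite -subr_eq0; apply/eqP.
transitivity ((b - 3%:R * z ^+ 2 * 0) * (z ^+ 4 - (a - b) * z ^+ 2 - 1) +
   (3%:R * z ^+ 2) * (z ^+ 4 - (a - b) * z ^+ 2 - 1)); last by rewrite rel; ring.
by rewrite mnum2E !coefsE /= /l /m; field.
Qed.

(** The map is odd, so each solution of f(t) = - t gives a 2-cycle formed by t and - t; the quartic
    is that equation. *)
Lemma cycC2'_mult (a b t : k) : a * b != 1 -> t ^+ 4 + (a + b) * t ^+ 2 + 1 = 0 ->
  let l := t * (t ^+ 2 + b) in let m := (2%:R * a + b + 3%:R * t ^+ 2) / (t ^+ 2 + b) in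
  [/\ l != 0, ev 3 (mapC2' a b) (cv t 1) = l *: cv (- t) 1 & mnum 2 (mapC2' a b) (cv t 1) = m * l ^+ 2].
Proof.
move=> ab rel l m.
have zb : t ^+ 2 + b != 0.
  apply: contraNneq ab => e; rewrite -subr_eq0; apply/eqP.
  transitivity ((t ^+ 2 + b) * (t ^+ 2 + a) - (t ^+ 4 + (a + b) * t ^+ 2 + 1)); first by ring.
  by rewrite rel e; ring.
have tn0 : t != 0.
  by apply: contraNneq (oner_neq0 k) => z0; rewrite -rel z0; apply/eqP; ring.
split; first by rewrite mulf_neq0.
  rewrite ev_mapC2' cvZ; congr cv; last by rewrite /l; ring.
  apply/eqP; rewrite -subr_eq0; apply/eqP.
  transitivity (t ^+ 4 + (a + b) * t ^+ 2 + 1); first by rewrite /l; ring.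
  exact: rel.
apply/eqP; rewrite -subr_eq0; apply/eqP.
transitivity (- (b + 3%:R * t ^+ 2) * (t ^+ 4 + (a + b) * t ^+ 2 + 1)); last by rewrite rel; ring.
by rewrite mnum2E !coefsE /= /l /m; field.
Qed.

Lemma is_multI f v l m : l != 0 -> ev 3 f v = l *: v -> mnum 2 f v = m * l ^+ 2 -> is_mult 2 f v m.
Proof. by move=> *; exists l. Qed.

Definition fixC2'_list (z w u v : k) : seq ('cV[k]_2 * k) :=
  [:: (cv z 1, u); (cv (- z) 1, u); (cv w 1, v); (cv (- w) 1, v)].

Lemma cv1_neq0 x : cv x 1 != 0.
Proof. by rewrite cv_eq0 oner_eq0 andbF. Qed.

Lemma mult_cycC2'_sqr (a b t : k) : a * b != 1 -> t ^+ 4 + (a + b) * t ^+ 2 + 1 = 0 ->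
  let m := (2%:R * a + b + 3%:R * t ^+ 2) / (t ^+ 2 + b) in
  is_mult 8 (ratcomp 3 (mapC2' a b) (mapC2' a b)) (cv t 1) (m * m).
Proof.
move=> ab rel m; have [l0 e1 m1] := cycC2'_mult ab rel.
have rel' : (- t) ^+ 4 + (a + b) * (- t) ^+ 2 + 1 = 0 by rewrite -rel; ring.
have [l0' e1' m1'] := cycC2'_mult ab rel'.
have E : (- t) ^+ 2 = t ^+ 2 by ring.
rewrite E opprK in l0' e1' m1'.
by apply: (is_mult_comp (u := cv (- t) 1)) e1 e1' m1 m1' => //; exact: sized_mapC2'.
Qed.

Lemma mult_fixC2'_sqr (a b z : k) : a * b != 1 -> z ^+ 4 - (a - b) * z ^+ 2 - 1 = 0 ->
  let m := (2%:R * a - b - 3%:R * z ^+ 2) / (z ^+ 2 + b) in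
  is_mult 8 (ratcomp 3 (mapC2' a b) (mapC2' a b)) (cv z 1) (m * m).
Proof.
move=> ab rel m; have [l0 e1 m1] := fixC2'_mult ab rel.
exact: (is_mult_comp (sized_mapC2' _ _) l0 l0 e1 e1 m1 m1).
Qed.

(** The ten points of period 2 are 0 and infinity, which are exchanged, the four fixed points, and
    the four solutions of f(t) = - t. *)
Lemma mapC2'_mdata (a b : k) : a * b != 1 -> exists u v w1 w2,
  [/\ u + v = 2%:R - 2%:R * kap a b /\ u * v = 1 + 2%:R * kap a b,
      w1 + w2 = eta a b + 6%:R - 2%:R * kap a b /\ w1 * w2 = w1 + w2 + 3%:R,
      exists2 s, mdata 2 (mapC2' a b) s & [seq p.2 | p <- s] = [:: u; u; v; v] &
      exists2 s, mdata 8 (ratcomp 3 (mapC2' a b) (mapC2' a b)) s &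
        [seq p.2 | p <- s] =
          [:: a * b; a * b; u * u; u * u; v * v; v * v; w1 * w1; w1 * w1; w2 * w2; w2 * w2]].
Proof.
move=> ab; have dl : 1 - a * b != 0 by rewrite subr_eq0 eq_sym.
have dl' : a * b - 1 != 0 by rewrite subr_eq0.
(* Z1, Z2 are the squares of the fixed points and T1, T2 those of the solutions of f(t) = - t; below
   only their sums and products matter. *)
have [Z1 [Z2 [Zs Zp]]] := quad_exists (a - b) (-1).
have [T1 [T2 [Ts Tp]]] := quad_exists (- (a + b)) 1.
have [z zE] := sqrt_exists Z1; have [w wE] := sqrt_exists Z2.
have [t tE] := sqrt_exists T1; have [r rE] := sqrt_exists T2.
have zrel : z ^+ 4 - (a - b) * z ^+ 2 - 1 = 0.
  by rewrite -(quad_root Zs Zp) -zE; ring.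
have wrel : w ^+ 4 - (a - b) * w ^+ 2 - 1 = 0.
  by rewrite -(quad_root (etrans (addrC _ _) Zs) (etrans (mulrC _ _) Zp)) -wE; ring.
have trel : t ^+ 4 + (a + b) * t ^+ 2 + 1 = 0.
  by rewrite -(quad_root Ts Tp) -tE; ring.
have rrel : r ^+ 4 + (a + b) * r ^+ 2 + 1 = 0.
  by rewrite -(quad_root (etrans (addrC _ _) Ts) (etrans (mulrC _ _) Tp)) -rE; ring.
have opp4 (x c d : k) : (- x) ^+ 4 + c * (- x) ^+ 2 + d = x ^+ 4 + c * x ^+ 2 + d by ring.
have opp4' (x c d : k) : (- x) ^+ 4 - c * (- x) ^+ 2 - d = x ^+ 4 - c * x ^+ 2 - d by ring.
have sqrN' (x : k) : (- x) ^+ 2 = x ^+ 2 by ring.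
have zrel' := zrel; rewrite -opp4' in zrel'; have wrel' := wrel; rewrite -opp4' in wrel'.
have trel' := trel; rewrite -opp4 in trel'; have rrel' := rrel; rewrite -opp4 in rrel'.
pose u := (2%:R * a - b - 3%:R * z ^+ 2) / (z ^+ 2 + b).
pose v := (2%:R * a - b - 3%:R * w ^+ 2) / (w ^+ 2 + b).
pose w1 := (2%:R * a + b + 3%:R * t ^+ 2) / (t ^+ 2 + b).
pose w2 := (2%:R * a + b + 3%:R * r ^+ 2) / (r ^+ 2 + b).
have DZ : (Z1 + b) * (Z2 + b) = a * b - 1.
  transitivity (Z1 * Z2 + b * (Z1 + Z2) + b ^+ 2); first by ring.
  by rewrite Zs Zp; ring.
have DT : (T1 + b) * (T2 + b) = 1 - a * b.
  transitivity (T1 * T2 + b * (T1 + T2) + b ^+ 2); first by ring.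
  by rewrite Ts Tp; ring.
have DZn : (Z1 + b) * (Z2 + b) != 0 by rewrite DZ -oppr_eq0 opprB.
have DTn : (T1 + b) * (T2 + b) != 0 by rewrite DT.
have [z1b z2b] : Z1 + b != 0 /\ Z2 + b != 0 by move: DZn; rewrite mulf_eq0 negb_or => /andP.
have [t1b t2b] : T1 + b != 0 /\ T2 + b != 0 by move: DTn; rewrite mulf_eq0 negb_or => /andP.
exists u, v, w1, w2; rewrite /u /v /w1 /w2 zE wE tE rE /kap /eta.
split.
- split; rewrite ?addf_div ?mulf_div // DZ.
    transitivity ((2%:R * (2%:R * a - b) * b + (2%:R * a - b) * (Z1 + Z2) - 6%:R * (Z1 * Z2) - 3%:R * b * (Z1 + Z2)) / (a * b - 1)).
      by congr (_ / _); ring.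
    by rewrite Zs Zp; field; rewrite ?dl ?dl'.
  transitivity (((2%:R * a - b) ^+ 2 - 3%:R * (2%:R * a - b) * (Z1 + Z2) + 9%:R * (Z1 * Z2)) / (a * b - 1)).
    by congr (_ / _); ring.
  by rewrite Zs Zp; field; rewrite ?dl ?dl'.
- have S : (2%:R * a + b + 3%:R * T1) / (T1 + b) + (2%:R * a + b + 3%:R * T2) / (T2 + b) =
      8%:R / (1 - a * b) + 6%:R - 2%:R * ((4%:R + (a - b) ^+ 2) / (1 - a * b)).
    rewrite addf_div // DT.
    transitivity ((2%:R * (2%:R * a + b) * b + (2%:R * a + b) * (T1 + T2) + 6%:R * (T1 * T2) + 3%:R * b * (T1 + T2)) / (1 - a * b)).
      by congr (_ / _); ring.
    by rewrite Ts Tp; field.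
  split=> //; rewrite S mulf_div DT.
  transitivity (((2%:R * a + b) ^+ 2 + 3%:R * (2%:R * a + b) * (T1 + T2) + 9%:R * (T1 * T2)) / (1 - a * b)).
    by congr (_ / _); ring.
  by rewrite Ts Tp; field.
- exists (fixC2'_list z w u v); last by rewrite /= /u /v zE wE.
  split=> //.
    exists (-1); first by rewrite oppr_eq0 oner_neq0.
    move=> V; rewrite (cvE V) ev_mapC2' !big_cons big_nil /= !detc_cv.
    move: (V 0 0) (V 1 0) => x y.
    transitivity (- (x ^+ 4 - (Z1 + Z2) * x ^+ 2 * y ^+ 2 + (Z1 * Z2) * y ^+ 4)).
      by rewrite Zs Zp; ring.
    by rewrite -zE -wE; ring.
  move=> p; rewrite !inE => /or4P[] /eqP -> /=; (split; first exact: cv1_neq0).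
  + by have [l0 e1 m1] := fixC2'_mult ab zrel; apply: is_multI l0 e1 m1.
  + by have [l0 e1 m1] := fixC2'_mult ab zrel'; move: m1; rewrite sqrN'; apply: is_multI; rewrite -?e1 // -sqrN'.
  + by have [l0 e1 m1] := fixC2'_mult ab wrel; apply: is_multI l0 e1 m1.
  + by have [l0 e1 m1] := fixC2'_mult ab wrel'; move: m1; rewrite sqrN'; apply: is_multI; rewrite -?e1 // -sqrN'.
exists [:: (cv 1 0, a * b); (cv 0 1, a * b); (cv z 1, u * u); (cv (- z) 1, u * u); (cv w 1, v * v);
   (cv (- w) 1, v * v); (cv t 1, w1 * w1); (cv (- t) 1, w1 * w1); (cv r 1, w2 * w2); (cv (- r) 1, w2 * w2)];
  last by rewrite /= /u /v /w1 /w2 zE wE tE rE.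
split=> //.
  exists (a * b - 1); first by rewrite -oppr_eq0 opprB.
  move=> V; rewrite -[9%N]/(3 * 3)%N ev_ratcomp; last exact: sized_mapC2'.
  rewrite (cvE V) !ev_mapC2' !big_cons big_nil /= !detc_cv.
  move: (V 0 0) (V 1 0) => x y.
  transitivity ((1 - a * b) * x * y * (x ^+ 4 - (Z1 + Z2) * x ^+ 2 * y ^+ 2 + (Z1 * Z2) * y ^+ 4) *
     (x ^+ 4 - (T1 + T2) * x ^+ 2 * y ^+ 2 + (T1 * T2) * y ^+ 4)).
    by rewrite Zs Zp Ts Tp; ring.
  by rewrite -zE -wE -tE -rE; ring.
have e10 : ev 3 (mapC2' a b) (cv 1 0) = 1 *: cv 0 1.
  by rewrite ev_mapC2' cvZ; congr cv; ring.
have e01 : ev 3 (mapC2' a b) (cv 0 1) = 1 *: cv 1 0.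
  by rewrite ev_mapC2' cvZ; congr cv; ring.
have m10 : mnum 2 (mapC2' a b) (cv 1 0) = - a * 1 ^+ 2.
  by rewrite mnum2E !coefsE /=; field.
have m01 : mnum 2 (mapC2' a b) (cv 0 1) = - b * 1 ^+ 2.
  by rewrite mnum2E !coefsE /=; field.
move=> p; rewrite !inE => /orP[|/orP[|/orP[|/orP[|/orP[|/orP[|/orP[|/orP[|/orP[|]]]]]]]]] /eqP -> /=;
  (split; first by rewrite ?cv1_neq0 // cv_eq0 oner_eq0).
- have -> : a * b = (- a) * (- b) by ring.
  by apply: (is_mult_comp (u := cv 0 1)) e10 e01 m10 m01; rewrite ?oner_neq0 //; exact: sized_mapC2'.
- have -> : a * b = (- b) * (- a) by ring.
  by apply: (is_mult_comp (u := cv 1 0)) e01 e10 m01 m10; rewrite ?oner_neq0 //; exact: sized_mapC2'.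
- exact: mult_fixC2'_sqr.
- by have := mult_fixC2'_sqr ab zrel'; rewrite /= sqrN'.
- exact: mult_fixC2'_sqr.
- by have := mult_fixC2'_sqr ab wrel'; rewrite /= sqrN'.
- exact: mult_cycC2'_sqr.
- by have := mult_cycC2'_sqr ab trel'; rewrite /= sqrN'.
- exact: mult_cycC2'_sqr.
- by have := mult_cycC2'_sqr ab rrel'; rewrite /= sqrN'.
Qed.

(** Besides 0 and infinity the fixed points satisfy (1 - b) z^2 = 1 - a. Taking homogeneous square
    roots covers a = 1 and b = 1, where they merge with 0 or infinity. *)
Lemma mapC2_mdata (a b : k) : a * b != 1 ->
  let u := (3%:R - 2%:R * a - 2%:R * b + a * b) / (1 - a * b) in
  exists2 s, mdata 2 (mapC2 a b) s & [seq p.2 | p <- s] = [:: a; b; u; u].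
Proof.
move=> ab u; have dl : 1 - a * b != 0 by rewrite subr_eq0 eq_sym.
have [x0 x0E] := sqrt_exists (1 - a); have [y0 y0E] := sqrt_exists (1 - b).
exists [:: (cv 0 1, a); (cv 1 0, b); (cv x0 y0, u); (cv (- x0) y0, u)] => //.
split=> //.
  exists (-1); first by rewrite oppr_eq0 oner_neq0.
  move=> V; rewrite (cvE V) ev_mapC2 !big_cons big_nil /= !detc_cv.
  move: (V 0 0) (V 1 0) => x y.
  transitivity (x * y * ((1 - b) * x ^+ 2 - (1 - a) * y ^+ 2)); first by ring.
  by rewrite -x0E -y0E; ring.
have n0 : ~~ ((x0 == 0) && (y0 == 0)).
  apply: contraNN ab => /andP[/eqP xz /eqP yz]; move: x0E y0E; rewrite xz yz expr0n /=.
  by move=> /esym/eqP; rewrite subr_eq0 => /eqP <- /esym/eqP; rewrite subr_eq0 => /eqP <-; rewrite mulr1.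
have e2 : (-1) ^+ 2 = 1 :> k by ring.
have key e : e ^+ 2 = 1 -> is_mult 2 (mapC2 a b) (cv (e * x0) y0) u.
  move=> {}e2; apply: (is_multI (l := 1 - a * b)) => //.
    rewrite ev_mapC2 cvZ; congr cv.
      transitivity (e * x0 * (e ^+ 2 * x0 ^+ 2 + a * y0 ^+ 2)); first by ring.
      by rewrite e2 x0E y0E; ring.
    transitivity (y0 * (b * (e ^+ 2 * x0 ^+ 2) + y0 ^+ 2)); first by ring.
    by rewrite e2 x0E y0E; ring.
  transitivity (b * (e ^+ 2 * x0 ^+ 2) ^+ 2 + (3%:R - a * b) * (e ^+ 2 * x0 ^+ 2) * y0 ^+ 2 + a * (y0 ^+ 2) ^+ 2).
    by rewrite mnum2E !coefsE /=; field.
  by rewrite e2 x0E y0E /u; field.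
move=> p; rewrite !inE => /or4P[] /eqP -> /=.
- split; first exact: cv1_neq0.
  apply: (is_multI (l := 1)); rewrite ?oner_neq0 //.
    by rewrite ev_mapC2 cvZ; congr cv; ring.
  by rewrite mnum2E !coefsE /=; field.
- split; first by rewrite cv_eq0 oner_eq0.
  apply: (is_multI (l := 1)); rewrite ?oner_neq0 //.
    by rewrite ev_mapC2 cvZ; congr cv; ring.
  by rewrite mnum2E !coefsE /=; field.
- by split; [rewrite cv_eq0 | have := key 1 (expr1n _ _); rewrite mul1r].
- by split; [rewrite cv_eq0 oppr_eq0 | have := key (-1) e2; rewrite mulN1r].
Qed.

Lemma cube_root_exists (x : k) : exists z, z ^+ 3 = x.
Proof. by exists (3.-root x); rewrite rootCK. Qed.

Lemma omega_exists : exists w : k, w ^+ 2 + w + 1 = 0.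
Proof.
have [z [w [s p]]] := quad_exists (-1) 1; exists z.
by have := quad_root s p => <-; ring.
Qed.

Lemma omega3 (w : k) : w ^+ 2 + w + 1 = 0 -> w ^+ 3 = 1.
Proof.
move=> e; apply/eqP; rewrite -subr_eq0; apply/eqP.
by transitivity ((w - 1) * (w ^+ 2 + w + 1)); [ring | rewrite e mulr0].
Qed.

(** The finite fixed points satisfy (1 - a) z^3 = - a. Homogeneous cube roots cover a = 1, where all
    four fixed points are at infinity. *)
Lemma mapC3_mdata (a : k) : a != 0 ->
  let u := 3%:R / a - 2%:R in
  exists2 s, mdata 2 (mapC3 a) s & [seq p.2 | p <- s] = [:: a; u; u; u].
Proof.
move=> an0 u; have [w we] := omega_exists; have w3 := omega3 we.
have [x0 x0E] := cube_root_exists (- a); have [y0 y0E] := cube_root_exists (1 - a).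
have x0n : x0 != 0.
  by apply: contraNneq an0 => z; rewrite -oppr_eq0 -x0E z expr0n.
exists [:: (cv 1 0, a); (cv x0 y0, u); (cv (w * x0) y0, u); (cv (w ^+ 2 * x0) y0, u)] => //.
split=> //.
  exists (-1); first by rewrite oppr_eq0 oner_neq0.
  move=> V; rewrite (cvE V) ev_mapC3 !big_cons big_nil /= !detc_cv.
  move: (V 0 0) (V 1 0) => x y.
  transitivity (y * ((1 - a) * x ^+ 3 - (- a) * y ^+ 3)); first by ring.
  rewrite -y0E -x0E; set X := x * y0; set Y := y * x0.
  transitivity (y * (X ^+ 3 - Y ^+ 3)); first by rewrite /X /Y; ring.
  transitivity (y * (X ^+ 3 - (w ^+ 2 + w + 1) * X ^+ 2 * Y + w * (w ^+ 2 + w + 1) * X * Y ^+ 2 - w ^+ 3 * Y ^+ 3)).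
    by rewrite we w3; ring.
  by rewrite /X /Y; ring.
have key e : e ^+ 3 = 1 -> cv (e * x0) y0 != 0 /\ is_mult 2 (mapC3 a) (cv (e * x0) y0) u.
  move=> e3; have en0 : e != 0.
    by apply: contraNneq (oner_neq0 k) => z; rewrite -e3 z expr0n.
  split; first by rewrite cv_eq0 mulf_eq0 (negbTE en0) (negbTE x0n).
  apply: (is_multI (l := a * (e * x0) ^+ 2)); first by rewrite mulf_neq0 ?expf_neq0 ?mulf_neq0.
    rewrite ev_mapC3 cvZ; congr cv.
    transitivity (e ^+ 3 * x0 ^+ 3 + a * y0 ^+ 3); first by ring.
    transitivity (a * (e ^+ 3 * x0 ^+ 3)); last by ring.
    by rewrite e3 x0E y0E; ring.
  transitivity (a * (e * x0) * ((e ^+ 3 * x0 ^+ 3) - 2%:R * a * y0 ^+ 3)).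
    by rewrite mnum2E !coefsE /=; field.
  transitivity ((3%:R - 2%:R * a) * a * (e * x0) * (e ^+ 3 * x0 ^+ 3)); last by rewrite /u; field.
  by rewrite e3 x0E y0E; ring.
move=> p; rewrite !inE => /or4P[] /eqP -> /=.
- split; first by rewrite cv_eq0 oner_eq0.
  apply: (is_multI (l := 1)); rewrite ?oner_neq0 //.
    by rewrite ev_mapC3 cvZ; congr cv; ring.
  by rewrite mnum2E !coefsE /=; field.
- by have := key 1 (expr1n _ _); rewrite mul1r.
- exact: key.
- by apply: key; rewrite -exprM mulnC exprM w3 expr1n.
Qed.

(** * Automorphisms *)

Lemma pgl_refl A : pgl_eq A A.
Proof. by exists 1; rewrite ?oner_neq0 // scale1r. Qed.

Lemma pgl_sym A B : pgl_eq A B -> pgl_eq B A.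
Proof.
by case=> c cn0 ->; exists c^-1; rewrite ?invr_eq0 // scalerA mulVf // scale1r.
Qed.

Lemma pgl_trans A B C : pgl_eq A B -> pgl_eq B C -> pgl_eq A C.
Proof.
case=> c cn0 -> [d dn0 ->]; exists (c * d); rewrite ?mulf_neq0 //.
by rewrite scalerA.
Qed.

Lemma pgl_mul A B C D : pgl_eq A B -> pgl_eq C D -> pgl_eq (A *m C) (B *m D).
Proof.
case=> c cn0 -> [d dn0 ->]; exists (c * d); rewrite ?mulf_neq0 //.
by rewrite -scalemxAl -scalemxAr scalerA.
Qed.

Lemma three_neq0 : 1 + 1 + 1 != 0 :> k.
Proof. by rewrite (_ : 1 + 1 + 1 = 3%:R) ?pnatr_eq0 //; ring. Qed.

(** The columns of [P] are eigenvectors, written with whichever off-diagonal entry is nonzero. *)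
Lemma diag_exists (a b c d al be : k) :
  al + be = a + d -> al * be = a * d - b * c -> al != be ->
  exists2 P, P \in unitmx & mk2 a b c d *m P = P *m mk2 al 0 0 be.
Proof.
move=> tr dt ne.
have sub : al - be != 0 by rewrite subr_eq0.
have al0 : al ^+ 2 - (a + d) * al + (a * d - b * c) = 0 by rewrite -tr -dt; ring.
have be0 : be ^+ 2 - (a + d) * be + (a * d - b * c) = 0 by rewrite -tr -dt; ring.
have zero (x y : k) : x - y = 0 -> x = y by move/eqP; rewrite subr_eq0 => /eqP.
have [bz|bn] := eqVneq b 0; last first.
  exists (mk2 b b (al - a) (be - a)).
    rewrite unit_mk2 (_ : _ - _ = b * (be - al)); last by ring.
    by rewrite mulf_neq0 // -opprB oppr_eq0.
  rewrite !mul_mk2; congr mk2; apply: zero; try ring.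
    by transitivity (- (al ^+ 2 - (a + d) * al + (a * d - b * c))); [ring | rewrite al0 oppr0].
  by transitivity (- (be ^+ 2 - (a + d) * be + (a * d - b * c))); [ring | rewrite be0 oppr0].
have [cz|cn] := eqVneq c 0; last first.
  exists (mk2 (al - d) (be - d) c c).
    rewrite unit_mk2 (_ : _ - _ = c * (al - be)); last by ring.
    by rewrite mulf_neq0.
  rewrite !mul_mk2; congr mk2; apply: zero; try ring.
    by transitivity (- (al ^+ 2 - (a + d) * al + (a * d - b * c))); [ring | rewrite al0 oppr0].
  by transitivity (- (be ^+ 2 - (a + d) * be + (a * d - b * c))); [ring | rewrite be0 oppr0].
have /eqP : (al - a) * (al - d) = 0 by rewrite -al0 bz; ring.
rewrite mulf_eq0 !subr_eq0 => /orP[] /eqP e.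
  exists 1%:M; first exact: unitmx1.
  have ed : d = be by apply: (addrI al); rewrite tr e.
  by rewrite mulmx1 mul1mx bz cz e ed.
have ed : a = be by apply: (addrI al); rewrite tr e addrC.
exists (mk2 0 1 1 0); first by rewrite unit_mk2 mulr0 sub0r mulr1 oppr_eq0 oner_neq0.
by rewrite !mul_mk2 bz cz e ed; congr mk2; ring.
Qed.

(** In the square and the cube of a 2 by 2 matrix the off-diagonal entries and the difference of the
    diagonal ones are b, c and a - d times a common factor X. If the power is scalar and the matrix
    is not, X = 0. *)
Lemma not_scalar_entry (a b c d X : k) : mk2 a b c d \in unitmx -> ~ pgl_eq (mk2 a b c d) 1%:M ->
  b * X = 0 -> c * X = 0 -> (a - d) * X = 0 -> X = 0.
Proof.
rewrite unit_mk2 => u nsc /eqP bX /eqP cX /eqP aX; apply/eqP; apply: contra_notT nsc => Xn.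
move: bX cX aX; rewrite !mulf_eq0 (negbTE Xn) !orbF subr_eq0 => /eqP bz /eqP cz /eqP ad.
exists d; last by rewrite -mk2_1 mk2Z bz cz ad; congr mk2; ring.
by move: u; rewrite bz ad mul0r subr0 mulf_eq0 negb_or => /andP[].
Qed.

(** The common factor in A ^ 2 is the trace, so the eigenvalues are opposite. *)
Lemma involution_diag A : A \in unitmx -> pgl_eq (A *m A) 1%:M -> ~ pgl_eq A 1%:M ->
  exists P be, [/\ P \in unitmx, be != 0 & A *m P = P *m mk2 (- be) 0 0 be].
Proof.
rewrite (mk2E A); move: (A 0 0) (A 0 1) (A 1 0) (A 1 1) => a b c d u [e en0].
rewrite mul_mk2 -mk2_1 mk2Z => /mk2_inj[e1 e2 e3 e4]; rewrite mk2_1 => nsc.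
have tr0 : a + d = 0.
  apply: (not_scalar_entry u nsc).
  - by transitivity (a * b + b * d); [ring | rewrite e2 mulr0].
  - by transitivity (c * a + d * c); [ring | rewrite e3 mulr0].
  by transitivity ((a * a + b * c) - (c * b + d * d)); [ring | rewrite e1 e4 subrr].
have [be beE] := sqrt_exists (- (a * d - b * c)).
have ben0 : be != 0.
  by move: u; rewrite unit_mk2; apply: contraNneq => z; rewrite -oppr_eq0 -beE z expr0n.
have [P uP HP] : exists2 P, P \in unitmx & mk2 a b c d *m P = P *m mk2 (- be) 0 0 be.
  apply: diag_exists; [by rewrite addNr | by rewrite mulNr -expr2 beE opprK | by rewrite eqNr].
by exists P, be.
Qed.

(** The common factor in A ^ 3 is the square of the trace minus the determinant; its vanishing makes
    the ratio of the eigenvalues a primitive cube root of unity. *)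
Lemma order3_diag A : A \in unitmx -> pgl_eq (A *m A *m A) 1%:M -> ~ pgl_eq A 1%:M ->
  exists P be z, [/\ P \in unitmx, be != 0, z ^+ 2 + z + 1 = 0 & A *m P = P *m mk2 (z * be) 0 0 be].
Proof.
rewrite (mk2E A); move: (A 0 0) (A 0 1) (A 1 0) (A 1 1) => a b c d u [e en0].
rewrite !mul_mk2 -mk2_1 mk2Z => /mk2_inj[e1 e2 e3 e4]; rewrite mk2_1 => nsc.
have X0 : a ^+ 2 + a * d + d ^+ 2 + b * c = 0.
  apply: (not_scalar_entry u nsc).
  - by rewrite -[RHS](mulr0 e) -e2; ring.
  - by rewrite -[RHS](mulr0 e) -e3; ring.
  by rewrite -[RHS](subrr (e * 1)) -{1}e1 -e4; ring.
have D : a * d - b * c = (a + d) ^+ 2.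
  by apply/eqP; rewrite -subr_eq0; apply/eqP; rewrite -[RHS]oppr0 -X0; ring.
have [al [be [s p]]] := quad_exists (a + d) (a * d - b * c).
have pn0 : al * be != 0 by move: u; rewrite unit_mk2 p.
move: (pn0); rewrite mulf_eq0 negb_or => /andP[aln0 ben0].
have z0 : (al / be) ^+ 2 + al / be + 1 = 0.
  transitivity (((al + be) ^+ 2 - al * be) / be ^+ 2); first by field.
  by rewrite s p D subrr mul0r.
have ne : al != be.
  by apply: contraPneq z0 => ->; rewrite divff // expr1n => /eqP; exact/negP/three_neq0.
have [P uP HP] := diag_exists s p ne.
by exists P, be, (al / be); split=> //; rewrite divfK.
Qed.

Lemma cubic0 (c0 c1 c2 c3 : k) : (forall x, c0 + c1 * x + c2 * x ^+ 2 + c3 * x ^+ 3 = 0) ->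
  [/\ c0 = 0, c1 = 0, c2 = 0 & c3 = 0].
Proof.
move=> H; pose p := c0%:P + c1 *: 'X + c2 *: 'X^2 + c3 *: 'X^3.
have p0 : p = 0.
  apply: poly_eq0_fun => x; rewrite -[RHS](H x) /p.
  by rewrite !(hornerD, hornerZ, hornerXn, hornerX, hornerC).
have E i : p`_i = 0 by rewrite p0 coef0.
have := (E 0%N, E 1%N, E 2%N, E 3%N); rewrite /p !coefsE /=.
by rewrite !(mulr0, mulr1, addr0, add0r) => -[[[-> ->] ->] ->].
Qed.

(** A diagonal matrix multiplies each monomial by a weight; a coefficient survives only if its
    weight is e al in the numerator or e be in the denominator. *)
Lemma crel_diag_coefs f al be : crel 3 (mk2 al 0 0 be) f f ->
  exists2 e, e != 0 & forall i, (i < 4)%N ->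
    f.1`_i * (al ^+ i * be ^+ (3 - i)) = e * al * f.1`_i /\
    f.2`_i * (al ^+ i * be ^+ (3 - i)) = e * be * f.2`_i.
Proof.
case=> e en0 H; exists e => //.
pose c (p : {poly k}) u i := p`_i * (al ^+ i * be ^+ (3 - i)) - e * u * p`_i.
have zero (x y : k) : x - y = 0 -> x = y by move/eqP; rewrite subr_eq0 => /eqP.
have H' x : hev 3 f.1 (al * x) be = e * (al * hev 3 f.1 x 1) /\
            hev 3 f.2 (al * x) be = e * (be * hev 3 f.2 x 1).
  have := H (cv x 1); rewrite mul_mk2_cv !ev_cv mul_mk2_cv cvZ !mul0r !addr0 !add0r mulr1.
  by case/cv_inj.
have [a0 a1 a2 a3] : [/\ c f.1 al 0%N = 0, c f.1 al 1%N = 0, c f.1 al 2%N = 0 & c f.1 al 3%N = 0].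
  apply: cubic0 => x; have [/eqP + _] := H' x; rewrite -subr_eq0 => /eqP <-.
  by rewrite /c !hev3E; ring.
have [b0 b1 b2 b3] : [/\ c f.2 be 0%N = 0, c f.2 be 1%N = 0, c f.2 be 2%N = 0 & c f.2 be 3%N = 0].
  apply: cubic0 => x; have [_ /eqP +] := H' x; rewrite -subr_eq0 => /eqP <-.
  by rewrite /c !hev3E; ring.
by case=> [|[|[|[|]]]] // _; split; apply: zero.
Qed.

Lemma crel_mk a b c d e f g : e != 0 ->
  (forall x y, ev 3 f (cv (a * x + b * y) (c * x + d * y)) =
     cv (e * (a * hev 3 g.1 x y + b * hev 3 g.2 x y)) (e * (c * hev 3 g.1 x y + d * hev 3 g.2 x y))) ->
  crel 3 (mk2 a b c d) f g.
Proof.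
by move=> en0 H; exists e => // v; rewrite (cvE v) mul_mk2_cv H ev_cv mul_mk2_cv cvZ.
Qed.

Lemma rat_mapC2_inv (a b : k) : is_rat 3 (mapC2 a b) -> a * b != 1.
Proof.
move=> /is_ratP[] // _ H; apply/eqP => ab.
have [x xE] := sqrt_exists (- a).
suff : cv x 1 = 0 by apply/eqP; exact: cv1_neq0.
apply: H; rewrite ev_mapC2; apply/eqP; rewrite cv_eq0; apply/andP; split; apply/eqP.
  by transitivity (x * (x ^+ 2 + a)); [ring | rewrite xE addNr mulr0].
by rewrite xE expr1n mulr1 mulrN mulrC ab addNr.
Qed.

Lemma rat_mapC2'_inv (a b : k) : is_rat 3 (mapC2' a b) -> a * b != 1.
Proof.
move=> /is_ratP[] // _ H; apply/eqP => ab.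
have [x xE] := sqrt_exists (- b).
suff : cv x 1 = 0 by apply/eqP; exact: cv1_neq0.
apply: H; rewrite ev_mapC2'; apply/eqP; rewrite cv_eq0; apply/andP; split; apply/eqP.
  by rewrite xE expr1n mulr1 mulrN ab addNr.
by transitivity (x * (x ^+ 2 + b)); [ring | rewrite xE addNr mulr0].
Qed.

Lemma crel_ratconj f P : P \in unitmx -> crel 3 P f (ratconj 3 f P).
Proof.
move=> uP; apply/crel_rateq => //; first exact: sized_ratconj.
by exists 1; rewrite ?oner_neq0 //; case: (ratconj _ _ _) => u v /=; rewrite !scale1r.
Qed.

Lemma crel_conj f g P A : P \in unitmx -> crel 3 P f g -> crel 3 A f f ->
  crel 3 (invmx P *m A *m P) g g.
Proof. by move=> uP H HA; apply: crelM (crelM (crelV uP H) HA) H. Qed.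

Lemma diag_normal f A P al be : is_rat 3 f -> is_aut 3 f A -> P \in unitmx ->
  A *m P = P *m mk2 al 0 0 be ->
  let f1 := ratconj 3 f P in
  [/\ is_rat 3 f1, crel 3 P f f1 & crel 3 (mk2 al 0 0 be) f1 f1].
Proof.
move=> rf; have sf := is_rat_sized (isT : (0 < 3)%N) rf.
move=> /(is_autP _ sf)[uA HA] uP AP f1; have H := crel_ratconj f uP.
split=> //; first exact: (is_rat_conj _ uP rf (sized_ratconj _ _ _) H).
by have := crel_conj uP H HA; rewrite -mulmxA AP mulKmx.
Qed.

Lemma rat_at10 f : is_rat 3 f -> ~~ ((f.1`_3 == 0) && (f.2`_3 == 0)).
Proof.
case/is_ratP => // _ H; apply/negP => /andP[/eqP e1 /eqP e2].
have : cv 1 0 = 0 by apply: H; apply/eqP; rewrite ev_cv cv_eq0 !hev_infty e1 e2 mul0r eqxx.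
by move/eqP; rewrite cv_eq0 oner_eq0.
Qed.

Lemma rat_at01 f : is_rat 3 f -> ~~ ((f.1`_0 == 0) && (f.2`_0 == 0)).
Proof.
case/is_ratP => // _ H; apply/negP => /andP[/eqP e1 /eqP e2].
have : cv 0 1 = 0.
  apply: H; apply/eqP; rewrite ev_cv cv_eq0 !hev3E e1 e2.
  by apply/andP; split; apply/eqP; ring.
by move/eqP; rewrite cv_eq0 oner_eq0 andbF.
Qed.

Lemma eq_factor (x y p : k) : x != y -> p * x = y * p -> p = 0.
Proof.
move=> ne /eqP; rewrite [y * p]mulrC -subr_eq0 -mulrBr mulf_eq0 => /orP[/eqP //|].
by rewrite subr_eq0 (negbTE ne).
Qed.

Lemma aut2_normal f A : is_rat 3 f -> is_aut 3 f A -> pgl_eq (A *m A) 1%:M -> ~ pgl_eq A 1%:M ->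
  exists Q g be, [/\ Q \in unitmx, crel 3 Q f g, be != 0, A *m Q = Q *m mk2 (- be) 0 0 be &
    exists a b, a * b != 1 /\ (g = mapC2 a b \/ g = mapC2' a b)].
Proof.
move=> rf autA A2 nA.
have uA : A \in unitmx by case: autA.
have [P [be [uP ben0 AP]]] := involution_diag uA A2 nA.
have [] := diag_normal rf autA uP AP; set f1 := ratconj 3 f P => rf1 H1 HD.
have [e en0 He] := crel_diag_coefs HD.
move: (rat_at10 rf1) (rat_at01 rf1) He; case: f1 rf1 H1 HD => p q rf1 H1 HD /= n10 n01 He.
have scale l : l != 0 -> mk2 l 0 0 1 \in unitmx by move=> ln0; rewrite unit_mk2 mulr1 mulr0 subr0.
have b2 : be ^+ 2 != 0 by rewrite expf_neq0.
have fin l g : l != 0 -> crel 3 (mk2 l 0 0 1) (p, q) g -> sized 3 g ->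
    [/\ P *m mk2 l 0 0 1 \in unitmx, crel 3 (P *m mk2 l 0 0 1) f g,
        A *m (P *m mk2 l 0 0 1) = P *m mk2 l 0 0 1 *m mk2 (- be) 0 0 be & is_rat 3 g].
  move=> ln0 Hg sg; have ul := scale l ln0; split.
  - by rewrite unitmx_mul uP ul.
  - exact: crelM H1 Hg.
  - by rewrite mulmxA AP -!mulmxA !mul_mk2; congr (_ *m _); congr mk2; ring.
  exact: (is_rat_conj _ ul rf1 sg Hg).
(* Weights are signs: for this [e] the numerator is odd and the denominator even, otherwise the
   parities are exchanged. *)
have [eb|eb] := eqVneq e (be ^+ 2).
  have neq : - be ^+ 2 != be ^+ 2 by rewrite eqNr.
  have neq' : be ^+ 2 != - be ^+ 2 by rewrite eq_sym.
  have p0 : p`_0 = 0.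
    have [h _] := He 0%N isT; apply: (eq_factor neq); apply: (mulfI ben0); move: h; rewrite /= eb => h.
    by transitivity (- (p`_0 * ((- be) ^+ 0 * be ^+ 3))); [ring | rewrite h; ring].
  have p2 : p`_2 = 0.
    have [h _] := He 2%N isT; apply: (eq_factor neq); apply: (mulfI ben0); move: h; rewrite /= eb => h.
    by transitivity (- (p`_2 * ((- be) ^+ 2 * be ^+ 1))); [ring | rewrite h; ring].
  have q1 : q`_1 = 0.
    have [_ h] := He 1%N isT; apply: (eq_factor neq); apply: (mulfI ben0); move: h; rewrite /= eb => h.
    by transitivity (q`_1 * ((- be) ^+ 1 * be ^+ 2)); [ring | rewrite h; ring].
  have q3 : q`_3 = 0.
    have [_ h] := He 3%N isT; apply: (eq_factor neq); apply: (mulfI ben0); move: h; rewrite /= eb => h.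
    by transitivity (q`_3 * ((- be) ^+ 3 * be ^+ 0)); [ring | rewrite h; ring].
  move: n10 n01; rewrite p0 q3 !eqxx andbT /= => p3n q0n.
  (* Rescaling the coordinate by [l] makes the coefficients of x^3 and y^3 equal, up to a common
     factor. *)
  have [l lE] := sqrt_exists (q`_0 / p`_3).
  have ln0 : l != 0.
    by apply: contraNneq (mulf_neq0 q0n (invr_neq0 p3n)) => z; rewrite -lE z expr0n.
  have Hg : crel 3 (mk2 l 0 0 1) (p, q) (mapC2 (p`_1 / q`_0) (q`_2 / p`_3)).
    apply: (crel_mk (e := q`_0)) => // x y.
    hevsimp (ev_mapC2 (p`_1 / q`_0) (q`_2 / p`_3) x y); rewrite ev_cv !hev3E /= p0 p2 q1 q3; congr cv.
      transitivity (p`_1 * l * x * y ^+ 2 + p`_3 * l * l ^+ 2 * x ^+ 3); first by ring.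
      by rewrite lE; field; rewrite q0n p3n.
    transitivity (q`_0 * y ^+ 3 + q`_2 * l ^+ 2 * x ^+ 2 * y); first by ring.
    by rewrite lE; field; rewrite p3n.
  have [u r eqA rg] := fin l _ ln0 Hg (sized_mapC2 _ _).
  exists (P *m mk2 l 0 0 1), (mapC2 (p`_1 / q`_0) (q`_2 / p`_3)), be; split=> //.
  by exists (p`_1 / q`_0), (q`_2 / p`_3); split; [exact: rat_mapC2_inv | left].
have eb' : be ^+ 2 != e by rewrite eq_sym.
have p1 : p`_1 = 0.
  have [h _] := He 1%N isT; apply: (eq_factor eb'); apply: (mulfI ben0); move: h => /= h.
  by transitivity (- (p`_1 * ((- be) ^+ 1 * be ^+ 2))); [ring | rewrite h; ring].
have p3 : p`_3 = 0.
  have [h _] := He 3%N isT; apply: (eq_factor eb'); apply: (mulfI ben0); move: h => /= h.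
  by transitivity (- (p`_3 * ((- be) ^+ 3 * be ^+ 0))); [ring | rewrite h; ring].
have q0 : q`_0 = 0.
  have [_ h] := He 0%N isT; apply: (eq_factor eb'); apply: (mulfI ben0); move: h => /= h.
  by transitivity (q`_0 * ((- be) ^+ 0 * be ^+ 3)); [ring | rewrite h; ring].
have q2 : q`_2 = 0.
  have [_ h] := He 2%N isT; apply: (eq_factor eb'); apply: (mulfI ben0); move: h => /= h.
  by transitivity (q`_2 * ((- be) ^+ 2 * be ^+ 1)); [ring | rewrite h; ring].
move: n10 n01; rewrite p3 q0 !eqxx andbT /= => q3n p0n.
have [l lE] : exists l, l ^+ 4 = p`_0 / q`_3 by exists (4.-root (p`_0 / q`_3)); rewrite rootCK.
have ln0 : l != 0.
  by apply: contraNneq (mulf_neq0 p0n (invr_neq0 q3n)) => z; rewrite -lE z expr0n.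
pose a := p`_2 * l ^+ 2 / p`_0; pose b := q`_1 / (q`_3 * l ^+ 2).
have p0E : p`_0 = l ^+ 4 * q`_3 by rewrite lE divfK.
have Hg : crel 3 (mk2 l 0 0 1) (p, q) (mapC2' a b).
  apply: (crel_mk (e := q`_3 * l ^+ 3)); first by rewrite mulf_neq0 ?expf_neq0.
  move=> x y; hevsimp (ev_mapC2' a b x y); rewrite ev_cv !hev3E /= p1 p3 q0 q2 /a /b p0E; congr cv.
    by field; rewrite ln0 q3n.
  by field; rewrite ln0 q3n.
have [u r eqA rg] := fin l _ ln0 Hg (sized_mapC2' _ _).
exists (P *m mk2 l 0 0 1), (mapC2' a b), be; split=> //.
by exists a, b; split; [exact: rat_mapC2'_inv | right].
Qed.

(** With eigenvalue ratio z, the weight of a monomial depends on its exponent modulo 3. For t = z ^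
    2 the map has the shape of [mapC3]; otherwise absence of a common zero at infinity forces t = 1,
    where it has that shape after exchanging 0 and infinity. *)
Lemma aut3_mapC3 f A : is_rat 3 f -> is_aut 3 f A -> pgl_eq (A *m A *m A) 1%:M -> ~ pgl_eq A 1%:M ->
  exists2 a, a != 0 & conjugate 3 (mapC3 a) f.
Proof.
move=> rf autA A3 nA; have sf := is_rat_sized (isT : (0 < 3)%N) rf.
have uA : A \in unitmx by case: autA.
have [P [be [z [uP ben0 ze AP]]]] := order3_diag uA A3 nA.
have [] := diag_normal rf autA uP AP; set f1 := ratconj 3 f P => rf1 H1 HD.
have [e en0 He] := crel_diag_coefs HD.
have z3 := omega3 ze.
have zn0 : z != 0 by apply: contraNneq (oner_neq0 k) => z0; rewrite -ze z0; apply/eqP; ring.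
have z1 : z != 1.
  by apply: contraPneq ze => ->; rewrite expr1n => /eqP; exact/negP/three_neq0.
have z2 : z ^+ 2 != 1.
  by apply: contraNneq z1 => h; rewrite -z3 exprS h mulr1.
have zz2 : z ^+ 2 != z.
  by apply: contraNneq z1 => h; apply/eqP/(mulfI zn0); rewrite -expr2 h mulr1.
pose t := e / be ^+ 2.
have b2 : be ^+ 2 != 0 by rewrite expf_neq0.
have eE : e = t * be ^+ 2 by rewrite /t divfK.
have Hp i : (i < 4)%N -> f1.1`_i * z ^+ i = t * z * f1.1`_i /\ f1.2`_i * z ^+ i = t * f1.2`_i.
  move=> lt; have [h1 h2] := He i lt; have b3 : be ^+ 3 != 0 by rewrite expf_neq0.
  have bb : be ^+ 3 = be ^+ i * be ^+ (3 - i) by rewrite -exprD subnKC // -ltnS.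
  split; apply: (mulIf b3).
    transitivity (f1.1`_i * ((z * be) ^+ i * be ^+ (3 - i))); first by rewrite bb exprMn; ring.
    by rewrite h1 eE; ring.
  transitivity (f1.2`_i * ((z * be) ^+ i * be ^+ (3 - i))); first by rewrite bb exprMn; ring.
  by rewrite h2 eE; ring.
have norm (p q : {poly k}) g0 : is_rat 3 g0 ->
  (forall x y, ev 3 g0 (cv x y) = cv (p`_3 * x ^+ 3 + p`_0 * y ^+ 3) (q`_2 * x ^+ 2 * y)) ->
  exists2 a, a != 0 & conjugate 3 (mapC3 a) g0.
  move=> rg0 Hev; have [sg0 nz] := (is_ratP g0 (isT : (0 < 3)%N)).1 rg0.
  have vanish x y : p`_3 * x ^+ 3 + p`_0 * y ^+ 3 = 0 -> q`_2 * x ^+ 2 * y = 0 -> (x == 0) && (y == 0).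
    move=> h1 h2; have /eqP : cv x y = 0 by apply: nz; rewrite Hev h1 h2; apply/eqP; rewrite cv_eq0 eqxx.
    by rewrite cv_eq0.
  have p3n : p`_3 != 0.
    apply/eqP => p3; have := vanish 1 0; rewrite p3 oner_eq0 /= => H.
    by suff: false by []; apply: H; ring.
  have p0n : p`_0 != 0.
    apply/eqP => p0; have := vanish 0 1; rewrite p0 oner_eq0 andbF => H.
    by suff: false by []; apply: H; ring.
  have q2n : q`_2 != 0.
    apply/eqP => q2; have [x xE] := cube_root_exists (- (p`_0 / p`_3)).
    have := vanish x 1; rewrite q2 xE oner_eq0 andbF => H.
    by suff: false by []; apply: H; [field; rewrite ?p3n | ring].
  have [l lE] := cube_root_exists (p`_0 / q`_2).
  have ln0 : l != 0.
    by apply: contraNneq (mulf_neq0 p0n (invr_neq0 q2n)) => l0; rewrite -lE l0 expr0n.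
  have an0 : q`_2 / p`_3 != 0 by rewrite mulf_neq0 ?invr_eq0.
  exists (q`_2 / p`_3) => //; apply: conjugate_sym => //; first exact: sized_mapC3.
  have p0E : p`_0 = l ^+ 3 * q`_2 by rewrite lE divfK.
  apply: (@conj_mk l 0 0 1 (p`_3 * l ^+ 2)); rewrite ?mulf_neq0 ?expf_neq0 //.
  - exact: sized_mapC3.
  - by rewrite mulr1 mulr0 subr0.
  move=> x y; hevsimp (ev_mapC3 (q`_2 / p`_3) x y); rewrite Hev p0E; congr cv; by field; rewrite ?p3n.
have [a an0 Ha] : exists2 a, a != 0 & conjugate 3 (mapC3 a) f1; last first.
  exists a => //; apply: (conjugate_trans _ _ Ha) => //; first exact: sized_ratconj.
  by apply/conjugateP => //; exists (invmx P); [rewrite unitmx_inv | exact: crelV].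
have [t2|tn2] := eqVneq t (z ^+ 2).
  apply: (norm f1.1 f1.2) => // x y; rewrite ev_cv !hev3E.
  have tz : t * z = 1 by rewrite t2 -exprSr.
  have p1 : f1.1`_1 = 0.
    by apply: (eq_factor z1); rewrite -[1]tz -[in LHS](expr1 z); have [-> _] := Hp 1%N isT.
  have p2 : f1.1`_2 = 0.
    by apply: (eq_factor z2); rewrite -[1]tz; have [-> _] := Hp 2%N isT.
  have q0 : f1.2`_0 = 0.
    by apply: (@eq_factor 1 (z ^+ 2)); [rewrite eq_sym | have [_] := Hp 0%N isT; rewrite expr0 t2].
  have q1 : f1.2`_1 = 0.
    by apply: (@eq_factor z (z ^+ 2)); [rewrite eq_sym | have [_] := Hp 1%N isT; rewrite expr1 t2].
  have q3 : f1.2`_3 = 0.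
    by apply: (@eq_factor 1 (z ^+ 2)); [rewrite eq_sym | have [_] := Hp 3%N isT; rewrite z3 t2].
  by rewrite p1 p2 q0 q1 q3; congr cv; ring.
have tz : t * z != 1.
  by apply: contraNneq tn2 => h; apply/eqP/(mulIf zn0); rewrite h -exprSr z3.
have p3 : f1.1`_3 = 0.
  by apply: (@eq_factor 1 (t * z)); [rewrite eq_sym | have [+ _] := Hp 3%N isT; rewrite z3].
have p0 : f1.1`_0 = 0.
  by apply: (@eq_factor 1 (t * z)); [rewrite eq_sym | have [+ _] := Hp 0%N isT; rewrite expr0].
have q3n : f1.2`_3 != 0 by have := rat_at10 rf1; rewrite p3 eqxx.
have t1 : t = 1.
  by apply: (mulIf q3n); have [_ <-] := Hp 3%N isT; rewrite z3 mulrC.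
have p2 : f1.1`_2 = 0.
  by apply: (@eq_factor (z ^+ 2) z) => //; have [-> _] := Hp 2%N isT; rewrite t1 mul1r.
have q1 : f1.2`_1 = 0.
  by apply: (@eq_factor z 1) => //; have [_] := Hp 1%N isT; rewrite t1 expr1.
have q2 : f1.2`_2 = 0.
  by apply: (@eq_factor (z ^+ 2) 1) => //; have [_] := Hp 2%N isT; rewrite t1.
(* The map in the coordinate 1 / z. *)
pose g0 : ratmap := (f1.2`_0 *: 'X^3 + (f1.2`_3)%:P, f1.1`_1 *: 'X^2).
have sg0 : sized 3 g0 by apply: sizedP => j; rewrite !coefsE /= ?mulr0 ?addr0.
have evg0 x y : ev 3 g0 (cv x y) = cv (g0.1`_3 * x ^+ 3 + g0.1`_0 * y ^+ 3) (g0.2`_2 * x ^+ 2 * y).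
  by rewrite ev_cv !hev3E !coefsE /=; congr cv; ring.
have cg : conjugate 3 f1 g0.
  apply: (@conj_mk 0 1 1 0 1); rewrite ?oner_neq0 ?mul0r ?sub0r ?mulr1 ?oppr_eq0 ?oner_neq0 //.
  move=> x y; have := evg0 x y; rewrite ev_cv => /cv_inj[-> ->].
  rewrite ev_cv !hev3E p0 p2 p3 q1 q2 !coefsE /=; congr cv; ring.
have rg0 := conjugate_is_rat (isT : (0 < 3)%N) rf1 cg.
have [a an0 Ha] := norm g0.1 g0.2 g0 rg0 evg0.
exists a => //; apply: (conjugate_trans _ _ Ha) => //; first exact: sized_ratconj.
by apply: conjugate_sym => //; exact: sized_ratconj.
Qed.

(** Matrices commuting in PGL_2 commute up to a scalar [e]. If e = 1 the second matrix is diagonal,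
    hence trivial or equal to the first in PGL_2; otherwise its diagonal vanishes. *)
Lemma commuting_involution (be a b c d : k) : be != 0 -> mk2 a b c d \in unitmx ->
  pgl_eq (mk2 (- be) 0 0 be *m mk2 a b c d) (mk2 a b c d *m mk2 (- be) 0 0 be) ->
  pgl_eq (mk2 a b c d *m mk2 a b c d) 1%:M ->
  ~ pgl_eq (mk2 a b c d) 1%:M -> ~ pgl_eq (mk2 a b c d) (mk2 (- be) 0 0 be) ->
  [/\ a = 0, d = 0, b != 0 & c != 0].
Proof.
move=> ben0; rewrite unit_mk2 => u [e en0]; rewrite !mul_mk2 mk2Z => /mk2_inj[e1 e2 e3 e4].
case=> r rn0; rewrite -mk2_1 mk2Z => /mk2_inj[r1 r2 r3 r4]; rewrite mk2_1 => n1 nD.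
have [E1|En] := eqVneq e 1.
  exfalso; have two : 2%:R != 0 :> k by rewrite pnatr_eq0.
  have b0 : b = 0.
    apply/eqP; have : 2%:R * be * b = 0 by transitivity (e * (a * 0 + b * be) - (- be * b + 0 * d)); [rewrite E1; ring | rewrite e2 subrr].
    by move/eqP; rewrite !mulf_eq0 (negbTE two) (negbTE ben0).
  have c0 : c = 0.
    apply/eqP; have : 2%:R * be * c = 0 by transitivity ((0 * a + be * c) - e * (c * - be + d * 0)); [rewrite E1; ring | rewrite e3 subrr].
    by move/eqP; rewrite !mulf_eq0 (negbTE two) (negbTE ben0).
  move: u; rewrite b0 mul0r subr0 mulf_eq0 negb_or => /andP[an0 dn0].
  have : (a - d) * (a + d) = 0.
    by transitivity ((a * a + b * c) - (c * b + d * d)); [ring | rewrite r1 r4 subrr].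
  move/eqP; rewrite mulf_eq0 subr_eq0 addr_eq0 => /orP[] /eqP ad.
    by apply: n1; exists d => //; rewrite -mk2_1 mk2Z b0 c0 ad; congr mk2; ring.
  apply: nD; exists (d / be); first by rewrite mulf_neq0 ?invr_eq0.
  by rewrite mk2Z b0 c0 ad; congr mk2; field.
have a0 : a = 0.
  apply: (eq_factor (x := 1) (y := e)); first by rewrite eq_sym.
  apply: (mulfI ben0); transitivity (- (- be * a + 0 * c)); first by ring.
  by rewrite e1; ring.
have d0 : d = 0.
  apply: (eq_factor (x := 1) (y := e)); first by rewrite eq_sym.
  apply: (mulfI ben0); transitivity (0 * b + be * d); first by ring.
  by rewrite e4; ring.
split=> //; first by apply: contraNneq u => ->; rewrite a0; apply/eqP; ring.
by apply: contraNneq u => ->; rewrite a0; apply/eqP; ring.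
Qed.

(** The automorphism exchanges the fixed points 0 and infinity, whose multipliers are a0 and b0. *)
Lemma antidiag_mapC2 (a0 b0 b c : k) : b != 0 -> c != 0 ->
  crel 3 (mk2 0 b c 0) (mapC2 a0 b0) (mapC2 a0 b0) -> a0 = b0.
Proof.
move=> bn0 cn0 [e en0 H].
have H' x y := H (cv x y).
have h := H' 0 1; have h1 := H' 1 1.
move: h h1; rewrite !ev_mapC2 !mul_mk2_cv !ev_mapC2 !cvZ => /cv_inj[h _] /cv_inj[h1 _].
have eb : e = b ^+ 2 by apply: (mulfI bn0); symmetry; move: h => h; rewrite -[RHS]mulr1; apply: etrans (etrans h _); ring.
have h2 : a0 * c ^+ 2 = e * b0.
  apply: (mulfI bn0); transitivity ((0 * 1 + b * 1) ^+ 3 + a0 * (0 * 1 + b * 1) * (c * 1 + 0 * 1) ^+ 2 - b ^+ 3); first by ring.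
  by rewrite h1 eb; ring.
have h3 : c ^+ 2 = e.
  have := H (cv 1 0); rewrite !ev_mapC2 !mul_mk2_cv !ev_mapC2 !cvZ => /cv_inj[_ h3].
  by apply: (mulfI cn0); rewrite -[RHS]mulr1; apply: etrans (etrans h3 _); ring.
by apply: (mulfI en0); rewrite -h2 h3 mulrC.
Qed.

(** The values at 0 and infinity give (b c) ^ 2 = e ^ 2 for the matrix entries; the sign of b c / e
    separates the two cases. *)
Lemma antidiag_mapC2' (a0 b0 b c : k) : b != 0 -> c != 0 ->
  crel 3 (mk2 0 b c 0) (mapC2' a0 b0) (mapC2' a0 b0) -> a0 = b0 \/ a0 = - b0.
Proof.
move=> bn0 cn0 [e en0 H].
have h10 := H (cv 1 0); have h01 := H (cv 0 1); have h11 := H (cv 1 1).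
move: h10 h01 h11; rewrite !ev_mapC2' !mul_mk2_cv !ev_mapC2' !cvZ => /cv_inj[h1 _] /cv_inj[_ h2] /cv_inj[h3 h4].
have E1 : c ^+ 3 = e * b by apply: etrans (etrans h1 _); ring.
have E2 : b ^+ 3 = e * c by apply: etrans (etrans h2 _); ring.
have E3 : a0 * (b * c) = e * b0.
  apply: (mulfI bn0).
  transitivity (a0 * (0 * 1 + b * 1) ^+ 2 * (c * 1 + 0 * 1) + (c * 1 + 0 * 1) ^+ 3 - c ^+ 3); first by ring.
  by rewrite h3 E1; ring.
have sq : (b * c - e) * (b * c + e) = 0.
  apply: (mulfI bn0); apply: (mulfI cn0); rewrite !mulr0.
  by transitivity (b ^+ 3 * c ^+ 3 - e ^+ 2 * b * c); [ring | rewrite E1 E2; ring].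
move/eqP: sq; rewrite mulf_eq0 subr_eq0 addr_eq0 => /orP[] /eqP bc; [left|right]; apply: (mulfI en0).
  by rewrite -E3 bc mulrC.
by rewrite mulrN -E3 bc; ring.
Qed.

(** * Automorphism loci *)

Definition row2 (a b : k) : 'rV[k]_2 := \row_i (if i == 0 then a else b).
Definition par1 (a : k) : 'rV[k]_1 := \row_i a.

Lemma par1E a : param1 (par1 a) = a. Proof. by rewrite /param1 mxE. Qed.

Lemma row20 a b : row2 a b 0 0 = a. Proof. by rewrite mxE. Qed.
Lemma row21 a b : row2 a b 0 1 = b. Proof. by rewrite mxE. Qed.

Lemma famC3E x : famC3 x = mapC3 (param1 x). Proof. by []. Qed.
Lemma famD2E x : famD2 x = mapC2' (param1 x) (param1 x). Proof. by []. Qed.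
Lemma famD2'E x : famD2' x = mapD2' (param1 x). Proof. by []. Qed.
Lemma famC2E x : famC2 x = mapC2 (x 0 0) (x 0 1). Proof. by []. Qed.
Lemma famC2'E x : famC2' x = mapC2' (x 0 0) (x 0 1). Proof. by []. Qed.

Lemma sizedR f : is_rat 3 f -> sized 3 f. Proof. exact: is_rat_sized. Qed.

Lemma imC3P f : image_in_moduli 3 dom_ne0 famC3 f <->
  is_rat 3 f /\ exists2 a, a != 0 & conjugate 3 (mapC3 a) f.
Proof.
split=> -[rf]; first by case=> x ux c; split=> //; exists (param1 x).
by case=> a an0 c; split=> //; exists (par1 a); rewrite /dom_ne0 ?famC3E par1E.
Qed.

Lemma imD2P f : image_in_moduli 3 dom_ne1 famD2 f <->
  is_rat 3 f /\ exists2 a, a * a != 1 & conjugate 3 (mapC2' a a) f.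
Proof.
split=> -[rf].
  by case=> x [u1 u2] c; split=> //; exists (param1 x) => //; apply: sqr_neq1.
case=> a an0 c; split=> //; exists (par1 a); rewrite /dom_ne1 ?famD2E par1E //.
split; apply: contraNneq an0 => ->; rewrite ?mulr1 // mulrNN mulr1 //.
Qed.

Lemma imD2'P f : image_in_moduli 3 dom_ne1 famD2' f <->
  is_rat 3 f /\ exists2 a, a * a != 1 & conjugate 3 (mapD2' a) f.
Proof.
split=> -[rf].
  by case=> x [u1 u2] c; split=> //; exists (param1 x) => //; apply: sqr_neq1.
case=> a an0 c; split=> //; exists (par1 a); rewrite /dom_ne1 ?famD2'E par1E //.
split; apply: contraNneq an0 => ->; rewrite ?mulr1 // mulrNN mulr1 //.
Qed.

Lemma imC2P f : image_in_moduli 3 dom_ab famC2 f <->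
  is_rat 3 f /\ exists a b, a * b != 1 /\ conjugate 3 (mapC2 a b) f.
Proof.
split=> -[rf].
  by case=> x u c; split=> //; exists (x 0 0), (x 0 1).
case=> a [b [u c]]; split=> //.
by exists (row2 a b); rewrite /dom_ab ?famC2E row20 row21.
Qed.

Lemma imC2'P f : image_in_moduli 3 dom_ab famC2' f <->
  is_rat 3 f /\ exists a b, a * b != 1 /\ conjugate 3 (mapC2' a b) f.
Proof.
split=> -[rf].
  by case=> x u c; split=> //; exists (x 0 0), (x 0 1).
case=> a [b [u c]]; split=> //.
by exists (row2 a b); rewrite /dom_ab ?famC2'E row20 row21.
Qed.

Lemma rat_mapD2' (a : k) : a * a != 1 -> is_rat 3 (mapD2' a).
Proof.
move=> aa; have [m mm c] := D2'_diag a.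
by apply: conjugate_is_rat c => //; apply: rat_mapC2'; rewrite mulrN mm.
Qed.

Lemma imD2'_C2' f : image_in_moduli 3 dom_ne1 famD2' f <->
  is_rat 3 f /\ exists2 a, - (a * a) != 1 & conjugate 3 (mapC2' a (- a)) f.
Proof.
rewrite imD2'P; split=> -[rf [a an c]]; split=> //; have sf := sizedR rf.
  have [m mm c'] := D2'_diag a; exists m; first by rewrite mm.
  exact: (conjugate_trans (sized_mapD2' a) sf c' c).
have [l l4] := exists_root4; exists (- a * l ^+ 2).
  rewrite (_ : - a * l ^+ 2 * (- a * l ^+ 2) = - (a * a)) //.
  transitivity (a * a * l ^+ 4); first by ring.
  by rewrite l4 mulrN1.
apply: (conjugate_trans (sized_mapC2' _ _) sf _ c).
by apply: conjugate_sym (conj_C2'_D2' a l4); [exact: sized_mapC2' | exact: sized_mapD2'].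
Qed.

Lemma aut_locus_conj (gT : finGroupType) (G : {group gT}) f g :
  is_rat 3 g -> conjugate 3 f g -> aut_locus 3 G f -> aut_locus 3 G g.
Proof.
move=> rg /(conjugateP _ (sizedR rg))[P uP HP] [rf [rho [Ha Hm Hi]]]; split=> //.
exists (fun x => invmx P *m rho x *m P); split.
- move=> x /Ha /(is_autP _ (sizedR rf))[ux Hx]; apply/(is_autP _ (sizedR rg)).
  by split; [rewrite !unitmx_mul unitmx_inv uP ux | exact: (crel_conj uP HP Hx)].
- move=> x y xG yG; have [c cn0 ->] := Hm x y xG yG; exists c => //.
  by rewrite -scalemxAr -scalemxAl !mulmxA mulmxK // -!mulmxA.
move=> x xG [c cn0 e]; apply: Hi => //; exists c => //.
have := congr1 (fun M => P *m M *m invmx P) e.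
by rewrite !mulmxA mulmxK // mulmxV // mul1mx -scalemxAr mulmx1 -scalemxAl mulmxV.
Qed.

Lemma rho1 (gT : finGroupType) (G : {group gT}) f (rho : gT -> 'M[k]_2) :
  (forall g, g \in G -> is_aut 3 f (rho g)) ->
  (forall g h, g \in G -> h \in G -> pgl_eq (rho (g * h)%g) (rho g *m rho h)) ->
  pgl_eq (rho 1%g) 1%:M.
Proof.
move=> Ha Hm; have [u1 _] := Ha 1%g (group1 G).
have [c cn0] := Hm 1%g 1%g (group1 G) (group1 G); rewrite mulg1 => e.
exists c^-1; first by rewrite invr_eq0.
have := congr1 (mulmx (invmx (rho 1%g))) e; rewrite -scalemxAr mulKmx // mulVmx // => ->.
by rewrite scalerA mulVf // scale1r.
Qed.

Lemma locus_cyclic (gT : finGroupType) (G : {group gT}) f g : aut_locus 3 G f -> g \in G -> g != 1%g ->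
  exists A, [/\ is_aut 3 f A, ~ pgl_eq A 1%:M,
    ((g * g)%g = 1%g -> pgl_eq (A *m A) 1%:M) & ((g * g * g)%g = 1%g -> pgl_eq (A *m A *m A) 1%:M)].
Proof.
case=> rf [rho [Ha Hm Hi]] gG gn1; exists (rho g); have r1 := rho1 Ha Hm; split.
- exact: Ha.
- by move=> /(Hi g gG) e; rewrite e eqxx in gn1.
- by move=> gg; apply: pgl_trans (pgl_sym (Hm g g gG gG)) _; rewrite gg.
move=> ggg; apply: pgl_trans (pgl_mul (pgl_sym (Hm g g gG gG)) (pgl_refl _)) _.
apply: pgl_trans (pgl_sym (Hm _ _ _ _)) _ => //; first by rewrite groupM.
by rewrite ggg.
Qed.

Lemma locus_C2P f : aut_locus 3 grpC2 f <->
  image_in_moduli 3 dom_ab famC2 f \/ image_in_moduli 3 dom_ab famC2' f.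
Proof.
rewrite imC2P imC2'P; split.
  move=> H; have rf : is_rat 3 f by case: H.
  have gn1 : (1%R : 'Z_2) != 1%g by [].
  have [A [autA nA A2 _]] := locus_cyclic H (in_setT (1%R : 'Z_2)) gn1.
  have gg : ((1%R : 'Z_2) * 1%R)%g = 1%g by apply/val_inj.
  have [Q [g [be [uQ HQ _ _ [a [b [ab gE]]]]]]] := aut2_normal rf autA (A2 gg) nA.
  have cg : conjugate 3 g f.
    apply/(conjugateP _ (sizedR rf)); exists (invmx Q); first by rewrite unitmx_inv.
    exact: crelV.
  by case: gE cg => -> cg; [left|right]; split=> //; exists a, b.
have key g : is_rat 3 g -> crel 3 (mk2 (-1) 0 0 1) g g -> is_rat 3 f -> conjugate 3 g f ->
    aut_locus 3 grpC2 f.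
  move=> rg Hg rf c; apply: (aut_locus_conj rf c); split=> //.
  have uD : mk2 (-1) 0 0 1 \in unitmx by rewrite unit_mk2 mulr1 mulr0 subr0 oppr_eq0 oner_neq0.
  exists (fun x => if x == 1%g then 1%:M else mk2 (-1) 0 0 1); split.
  - move=> x _; apply/(is_autP _ (sizedR rg)); case: eqP => _; split=> //; first exact: unitmx1.
    exact: crel1.
  - have DD : mk2 (-1) 0 0 1 *m mk2 (-1) 0 0 1 = 1%:M.
      by rewrite mul_mk2 -mk2_1; congr mk2; ring.
    move=> x y _ _; have cases (z : 'Z_2) : z = 1%g \/ z = 1%R.
      by case: z => [[|[|]]] // i; [left|right]; apply/val_inj.
    case: (cases x) => ->; case: (cases y) => ->; rewrite ?mulg1 ?mul1g ?eqxx ?mul1mx ?mulmx1 /=; try exact: pgl_refl.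
    by rewrite DD; exact: pgl_refl.
  move=> x _; case: eqP => // _ [e en0]; rewrite -mk2_1 mk2Z => /mk2_inj[e1 _ _ e4].
  have : e = - e by rewrite -[in RHS](mulr1 e) -e4 -[LHS]mulr1 -e1.
  by move/eqP; rewrite eq_sym eqNr (negbTE en0).
case=> -[rf [a [b [ab c]]]].
  apply: (key _ (rat_mapC2 ab) _ rf c); apply: (crel_mk (e := 1)) => [|x y]; first exact: oner_neq0.
  by hevsimp (ev_mapC2 a b x y); rewrite ev_mapC2; congr cv; ring.
apply: (key _ (rat_mapC2' ab) _ rf c); apply: (crel_mk (e := -1)) => [|x y].
  by rewrite oppr_eq0 oner_neq0.
by hevsimp (ev_mapC2' a b x y); rewrite ev_mapC2'; congr cv; ring.
Qed.

Lemma Z3_cases (x : 'Z_3) : [\/ x = 0, x = 1 | x = 2%:R].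
Proof.
by case: x => [[|[|[|]]]] // i; [constructor 1|constructor 2|constructor 3]; apply/val_inj.
Qed.

Lemma locus_C3P f : aut_locus 3 grpC3 f <-> image_in_moduli 3 dom_ne0 famC3 f.
Proof.
rewrite imC3P; split.
  move=> H; have rf : is_rat 3 f by case: H.
  have gn1 : (1%R : 'Z_3) != 1%g by [].
  have [A [autA nA _ A3]] := locus_cyclic H (in_setT (1%R : 'Z_3)) gn1.
  have ggg : ((1%R : 'Z_3) * 1%R * 1%R)%g = 1%g by apply/val_inj.
  by split=> //; apply: (aut3_mapC3 rf autA (A3 ggg) nA).
case=> rf [a an0 c]; apply: (aut_locus_conj rf c); have ra := rat_mapC3 an0; split=> //.
have [w we] := omega_exists; have w3 := omega3 we.
have wn0 : w != 0 by apply: contraNneq (oner_neq0 k) => w0; rewrite -we w0; apply/eqP; ring.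
have w1 : w != 1 by apply: contraPneq we => ->; rewrite expr1n => /eqP; exact/negP/three_neq0.
have w2 : w ^+ 2 != 1 by apply: contraNneq w1 => h; rewrite -w3 exprS h mulr1.
pose D (n : nat) := mk2 (w ^+ n) 0 0 1.
exists (fun x : 'Z_3 => D x); split.
- move=> x _; apply/(is_autP _ (sizedR ra)); split.
    by rewrite unit_mk2 mulr1 mulr0 subr0 expf_neq0.
  have wx3 : (w ^+ x) ^+ 3 = 1 by rewrite -exprM mulnC exprM w3 expr1n.
  apply: (crel_mk (e := (w ^+ x) ^+ 2)); first by rewrite !expf_neq0.
  move=> u v; hevsimp (ev_mapC3 a u v); rewrite ev_mapC3; congr cv; last by ring.
  transitivity ((w ^+ x) ^+ 3 * u ^+ 3 + a * v ^+ 3); first by ring.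
  transitivity ((w ^+ x) ^+ 3 * (u ^+ 3 + a * v ^+ 3)); last by ring.
  by rewrite wx3; ring.
- move=> x y _ _; exists 1; rewrite ?oner_neq0 // scale1r mul_mk2.
  have -> : D (x * y)%g = mk2 (w ^+ x * w ^+ y) 0 0 1.
    have e : w ^+ (x * y)%g = w ^+ x * w ^+ y by rewrite -exprD -[RHS](expr_mod _ w3).
    by rewrite /D e.
  by congr mk2; ring.
move=> x _ [e en0]; rewrite -mk2_1 mk2Z => /mk2_inj[e1 _ _ e4].
have wx : w ^+ x = 1 by rewrite e1 -e4.
case: (Z3_cases x) wx => -> //=; first by rewrite expr1 => e'; rewrite e' eqxx in w1.
by move=> e'; rewrite e' eqxx in w2.
Qed.

Lemma D4_struct : exists x y : 'D_4, [/\ x != 1%g, y != 1%g & x != y] /\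
  [/\ forall g : 'D_4, (g * g)%g = 1%g, forall g h : 'D_4, (g * h)%g = (h * g)%g &
  forall g : 'D_4, [\/ g = 1%g, g = x, g = y | g = (x * y)%g]].
Proof.
(* The order 4 is written 2 ^ 2 to match the lemmas on dihedral 2-groups. *)
have isoG : [set: 'D_(2 ^ 2)] \isog [set: 'D_(2 ^ 2)] by exact: isog_refl.
have [[x y] gen [oy _]] := @generators_2dihedral _ [set: 'D_(2 ^ 2)]%G 2 isT isoG.
have [_ _ _ _ abel] := @dihedral2_structure _ [set: 'D_(2 ^ 2)]%G 2 x y isT gen isoG.
have cG := @card_2dihedral 2 isT.
have /(abelemP (isT : prime 2))[/centsP comm exp2] := abel.
have [_ _ ox yx] := gen; move: yx; rewrite inE => /andP[yx _].
have xn1 : x != 1%g by rewrite -order_eq1 ox.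
have yn1 : y != 1%g by apply: contraNneq yx => ->; exact: group1.
have xy : x != y by apply: contraNneq yx => <-; exact: cycle_id.
have sq (g : 'D_(2 ^ 2)) : (g * g = 1)%g by have := exp2 g (in_setT g); rewrite expgS expg1.
have xyn1 : (x * y)%g != 1%g.
  by apply: contraNneq xy => e; apply/eqP/(mulgI x); rewrite sq e.
have xyx : (x * y)%g != x by apply: contraNneq yn1 => e; apply/eqP/(mulgI x); rewrite e mulg1.
have xyy : (x * y)%g != y by apply: contraNneq xn1 => e; apply/eqP/(mulIg y); rewrite e mul1g.
exists x, y; split=> //; split=> //; first by move=> g h; exact: comm (in_setT g) _ (in_setT h).
pose s := [:: 1%g; x; y; (x * y)%g].
have us : uniq s.
  by rewrite /= !inE !negb_or ![1%g == _]eq_sym xn1 yn1 xyn1 xy ![_ == (x * y)%g]eq_sym xyx xyy.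
have e : #|s| = #|[set: 'D_(2 ^ 2)]| by rewrite cG (card_uniqP us).
have /(subset_cardP e) H : s \subset [set: 'D_(2 ^ 2)] by apply/subsetP => g _; rewrite inE.
move=> g; have := H g; rewrite in_setT !inE => /or4P[] /eqP ->;
  [constructor 1|constructor 2|constructor 3|constructor 4] => //.
Qed.

(** Once [A] is diagonal, [B] becomes antidiagonal, which forces equal parameters in normal form
    (4), and equal or opposite ones in (5). The line a = b of (4) is carried to that of (5). *)
Lemma aut_klein f A B : is_rat 3 f -> is_aut 3 f A -> is_aut 3 f B ->
  pgl_eq (A *m A) 1%:M -> pgl_eq (B *m B) 1%:M -> pgl_eq (A *m B) (B *m A) ->
  ~ pgl_eq A 1%:M -> ~ pgl_eq B 1%:M -> ~ pgl_eq B A ->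
  image_in_moduli 3 dom_ne1 famD2 f \/ image_in_moduli 3 dom_ne1 famD2' f.
Proof.
move=> rf autA autB A2 B2 AB nA nB nAB; have sf := sizedR rf.
have [Q [g [be [uQ HQ ben0 AQ [a0 [b0 [ab gE]]]]]]] := aut2_normal rf autA A2 nA.
have rg : is_rat 3 g by case: gE => ->; [exact: rat_mapC2 | exact: rat_mapC2'].
have cg : conjugate 3 g f.
  by apply/(conjugateP _ sf); exists (invmx Q); [rewrite unitmx_inv | exact: crelV].
have [uB HB] := (is_autP _ sf).1 autB.
have HB' := crel_conj uQ HQ HB.
pose C M := invmx Q *m M *m Q.
have CM M N : C (M *m N) = C M *m C N.
  by rewrite /C !mulmxA mulmxK // -!mulmxA.
have Ceq M N : pgl_eq M N -> pgl_eq (C M) (C N).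
  by move=> H; apply: pgl_mul (pgl_mul (pgl_refl _) H) (pgl_refl _).
have Ceq' M N : pgl_eq (C M) (C N) -> pgl_eq M N.
  have CK M' : Q *m C M' *m invmx Q = M' by rewrite /C !mulmxA mulmxV // mul1mx mulmxK.
  by move=> H; rewrite -(CK M) -(CK N); apply: pgl_mul (pgl_mul (pgl_refl _) H) (pgl_refl _).
have C1 : C 1%:M = 1%:M by rewrite /C mulmx1 mulVmx.
have CA : C A = mk2 (- be) 0 0 be by rewrite /C -mulmxA AQ mulKmx.
have uC : C B \in unitmx by rewrite !unitmx_mul unitmx_inv uQ uB.
have c1 := Ceq _ _ AB; rewrite !CM CA in c1.
have c2 := Ceq _ _ B2; rewrite CM C1 in c2.
have c3 : ~ pgl_eq (C B) 1%:M by rewrite -C1 => /Ceq'.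
have c4 : ~ pgl_eq (C B) (mk2 (- be) 0 0 be) by rewrite -CA => /Ceq'.
move: HB' uC c1 c2 c3 c4; rewrite -/(C B) (mk2E (C B)).
move: (C B 0 0) (C B 0 1) (C B 1 0) (C B 1 1) => a b c d HB' uC c1 c2 c3 c4.
have [a1 d1 bn0 cn0] := commuting_involution ben0 uC c1 c2 c3 c4.
rewrite a1 d1 in HB'.
case: gE => gE; rewrite gE in HB' cg rg.
  have e := antidiag_mapC2 bn0 cn0 HB'; left; apply/imD2P; split=> //.
  rewrite e in cg rg; have b1 : b0 != 1 by apply: contraNneq ab => z; rewrite e z mulr1.
  have cc := conj_C2_diag b1; set t := - (b0 + 3) / (b0 - 1) in cc.
  exists t; first by apply: rat_mapC2'_inv; exact: (conjugate_is_rat _ rg cc).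
  apply: (conjugate_trans (sized_mapC2 _ _) sf _ cg).
  by apply: conjugate_sym cc; [exact: sized_mapC2 | exact: sized_mapC2'].
case: (antidiag_mapC2' bn0 cn0 HB') => e; [left|right].
  rewrite e in cg ab; apply/imD2P; split=> //; by exists b0.
have e' : b0 = - a0 by rewrite e opprK.
rewrite e' in cg ab; apply/imD2'_C2'; split=> //; exists a0 => //; by rewrite -mulrN.
Qed.

Lemma locus_klein (gT : finGroupType) (G : {group gT}) f (x y : gT) : aut_locus 3 G f ->
  x \in G -> y \in G -> (x * x)%g = 1%g -> (y * y)%g = 1%g -> (x * y)%g = (y * x)%g ->
  x != 1%g -> y != 1%g -> x != y ->
  image_in_moduli 3 dom_ne1 famD2 f \/ image_in_moduli 3 dom_ne1 famD2' f.
Proof.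
case=> rf [rho [Ha Hm Hi]] xG yG xx yy xy xn1 yn1 nxy; have r1 := rho1 Ha Hm.
have sq g : g \in G -> (g * g)%g = 1%g -> pgl_eq (rho g *m rho g) 1%:M.
  by move=> gG gg; apply: pgl_trans (pgl_sym (Hm g g gG gG)) _; rewrite gg.
apply: (aut_klein rf (Ha x xG) (Ha y yG) (sq x xG xx) (sq y yG yy)).
- apply: pgl_trans (pgl_sym (Hm _ _ xG yG)) _; rewrite xy; exact: Hm.
- by move/(Hi x xG)/eqP; rewrite (negbTE xn1).
- by move/(Hi y yG)/eqP; rewrite (negbTE yn1).
move=> BA; have : (x * y)%g = 1%g.
  apply: Hi; first by rewrite groupM.
  apply: pgl_trans (Hm _ _ xG yG) _; apply: pgl_trans (sq x xG xx).
  exact: pgl_mul (pgl_refl _) BA.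
by move=> e; case/eqP: nxy; apply: (mulgI x); rewrite xx e.
Qed.

(** The Klein four-group generated by - z and 1 / (c z); products of the chosen representatives
    agree up to factors 1, -1, c or - c. *)
Lemma D2_locus g c : is_rat 3 g -> c != 0 -> crel 3 (mk2 (-1) 0 0 1) g g ->
  crel 3 (mk2 0 1 c 0) g g -> aut_locus 3 grpD2 g.
Proof.
move=> rg cn0 HD HB; split=> //.
have [x [y [[xn1 yn1 nxy] [sq comm cases]]]] := D4_struct.
pose D := mk2 (-1) 0 0 1; pose B := mk2 0 1 c 0; pose E := mk2 0 (-1) c 0.
pose r (z : 'D_4) := if z == 1%g then 1%:M else if z == x then D else if z == y then B else E.
have uD : D \in unitmx by rewrite unit_mk2 mulr1 mulr0 subr0 oppr_eq0 oner_neq0.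
have uB : B \in unitmx by rewrite unit_mk2 mul0r sub0r mul1r oppr_eq0.
have DB : D *m B = E by rewrite mul_mk2; congr mk2; ring.
have r1 : r 1%g = 1%:M by rewrite /r eqxx.
have rx : r x = D by rewrite /r (negbTE xn1) eqxx.
have ry : r y = B by rewrite /r (negbTE yn1) eq_sym (negbTE nxy) eqxx.
have xyn1 : (x * y)%g != 1%g by apply: contraNneq nxy => e; apply/eqP/(mulgI x); rewrite sq e.
have xyx : (x * y)%g != x by apply: contraNneq yn1 => e; apply/eqP/(mulgI x); rewrite e mulg1.
have xyy : (x * y)%g != y by apply: contraNneq xn1 => e; apply/eqP/(mulIg y); rewrite e mul1g.
have rxy : r (x * y)%g = E by rewrite /r (negbTE xyn1) (negbTE xyx) (negbTE xyy).
have xxy : (x * (x * y))%g = y by rewrite mulgA sq mul1g.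
have yxy : (y * (x * y))%g = x by rewrite (comm x y) mulgA sq mul1g.
have xyx' : (x * y * x)%g = y by rewrite comm xxy.
have xyy' : (x * y * y)%g = x by rewrite -mulgA sq mulg1.
exists r; split.
- move=> z _; apply/(is_autP _ (sizedR rg)).
  case: (cases z) => ->; rewrite ?r1 ?rx ?ry ?rxy.
  + by split; [exact: unitmx1 | exact: crel1].
  + by [].
  + by [].
  by rewrite -DB; split; [rewrite unitmx_mul uD uB | exact: crelM HD HB].
- move=> z t _ _; apply: pgl_sym.
  have s1 M N : M = N -> pgl_eq M N by move=> ->; exact: pgl_refl.
  have sN M N : M = -1 *: N -> pgl_eq M N by move=> ->; exists (-1); rewrite ?oppr_eq0 ?oner_neq0.
  have sc M N : M = c *: N -> pgl_eq M N by move=> ->; exists c.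
  have sNc M N : M = - c *: N -> pgl_eq M N by move=> ->; exists (- c); rewrite ?oppr_eq0.
  case: (cases z) => ->; case: (cases t) => ->;
    rewrite ?mul1g ?mulg1 ?sq ?xxy ?yxy ?xyx' ?xyy' ?(comm y x) ?r1 ?rx ?ry ?rxy ?mul1mx ?mulmx1 ?mul_mk2 -?mk2_1;
    try exact: pgl_refl;
    first [ by apply: s1; rewrite /D /B /E ?mul_mk2; congr mk2; ring
          | by apply: sN; rewrite /D /B /E ?mul_mk2 mk2Z; congr mk2; ring
          | by apply: sc; rewrite /D /B /E ?mul_mk2 mk2Z; congr mk2; ring
          | by apply: sNc; rewrite /D /B /E ?mul_mk2 mk2Z; congr mk2; ring ].
move=> z _; case: (cases z) => -> //; rewrite ?rx ?ry ?rxy => -[e en0]; rewrite -mk2_1 mk2Z => /mk2_inj[e1 e2 e3 e4].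
- have : e = - e by rewrite -[in RHS](mulr1 e) -e4 -[LHS]mulr1 -e1.
  by move/eqP; rewrite eq_sym eqNr (negbTE en0).
- by move/eqP: e2; rewrite mulr0 oner_eq0.
by move/eqP: e2; rewrite mulr0 oppr_eq0 oner_eq0.
Qed.

Lemma locus_D2P f : aut_locus 3 grpD2 f <->
  image_in_moduli 3 dom_ne1 famD2 f \/ image_in_moduli 3 dom_ne1 famD2' f.
Proof.
split.
  move=> H; have [x [y [[xn1 yn1 nxy] [sq comm _]]]] := D4_struct.
  exact: (locus_klein H (in_setT x) (in_setT y) (sq x) (sq y) (comm x y) xn1 yn1 nxy).
have HD a b : crel 3 (mk2 (-1) 0 0 1) (mapC2' a b) (mapC2' a b).
  apply: (crel_mk (e := -1)) => [|x y]; first by rewrite oppr_eq0 oner_neq0.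
  by hevsimp (ev_mapC2' a b x y); rewrite ev_mapC2'; congr cv; ring.
case=> [/imD2P|/imD2'_C2'] [rf [a an c]].
  apply: (aut_locus_conj rf c); apply: (D2_locus (c := 1)) (HD _ _) _; rewrite ?oner_neq0 ?rat_mapC2' //.
  apply: (crel_mk (e := 1)) => [|x y]; first exact: oner_neq0.
  by hevsimp (ev_mapC2' a a x y); rewrite ev_mapC2'; congr cv; ring.
apply: (aut_locus_conj rf c); apply: (D2_locus (c := 'i)) (HD _ _) _; rewrite ?neq0Ci ?rat_mapC2' ?mulrN //.
apply: (crel_mk (e := - 'i)) => [|x y]; first by rewrite oppr_eq0 neq0Ci.
hevsimp (ev_mapC2' a (- a) x y); rewrite ev_mapC2'; congr cv.
  transitivity (a * 'i * x * y ^+ 2 + ('i * 'i) * 'i * x ^+ 3); first by ring.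
  by rewrite i2; ring.
transitivity (y ^+ 3 - a * ('i * 'i) * x ^+ 2 * y); first by ring.
transitivity (- ('i * 'i) * (a * x ^+ 2 * y + y ^+ 3)); last by ring.
by rewrite i2; ring.
Qed.

(** * Multiplier spectra of the families, and the tetrahedral map *)

Lemma sigma1_spectrum f s : perm_eq (multipliers 3 1 f) s -> size s = 4 ->
  sigma1_123 f = \row_(i < 3) es i.+1 s.
Proof.
move=> H sz; apply/rowP => i; rewrite !mxE; apply: sigma_es H _.
by rewrite sz; case: i => [[|[|[|]]]].
Qed.

Lemma spectrumC3 f (a : k) : a != 0 -> sized 3 f -> conjugate 3 (mapC3 a) f ->
  perm_eq (multipliers 3 1 f) [:: a; 3%:R / a - 2%:R; 3%:R / a - 2%:R; 3%:R / a - 2%:R].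
Proof.
move=> an0 sf c; have [s ms <-] := mapC3_mdata an0.
exact: (multipliers1_conj (sized_mapC3 a) sf c ms).
Qed.

Lemma spectrumC2 f (a b : k) : a * b != 1 -> sized 3 f -> conjugate 3 (mapC2 a b) f ->
  let u := (3%:R - 2%:R * a - 2%:R * b + a * b) / (1 - a * b) in
  perm_eq (multipliers 3 1 f) [:: a; b; u; u].
Proof.
move=> an0 sf c; have [s ms /= <-] := mapC2_mdata an0.
exact: (multipliers1_conj (sized_mapC2 a b) sf c ms).
Qed.

Lemma spectrumC2' f (a b : k) : a * b != 1 -> sized 3 f -> conjugate 3 (mapC2' a b) f ->
  exists u v w1 w2,
  [/\ u + v = 2%:R - 2%:R * kap a b /\ u * v = 1 + 2%:R * kap a b,
      w1 + w2 = eta a b + 6%:R - 2%:R * kap a b /\ w1 * w2 = w1 + w2 + 3%:R,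
      perm_eq (multipliers 3 1 f) [:: u; u; v; v] &
      perm_eq (multipliers 3 2 f)
        [:: a * b; a * b; u * u; u * u; v * v; v * v; w1 * w1; w1 * w1; w2 * w2; w2 * w2]].
Proof.
move=> ab sf c; have [u [v [w1 [w2 [H1 H2 [s ms e] [s' ms' e']]]]]] := mapC2'_mdata ab.
exists u, v, w1, w2; split=> //.
  by rewrite -e; exact: (multipliers1_conj (sized_mapC2' a b) sf c ms).
by rewrite -e'; exact: (multipliers2_conj (sized_mapC2' a b) sf c ms').
Qed.

(** On the left every value occurs an even number of times. *)
Lemma perm_eq_pairs (u v a t : k) : perm_eq [:: u; u; v; v] [:: a; t; t; t] -> a = t.
Proof.
move=> p; apply/eqP/negP => /negP at_.
have /seq.permP/(_ (pred1 a)) := p; rewrite /= eqxx !addn0 ![t == a]eq_sym (negbTE at_) /=.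
by case: (u == a); case: (v == a).
Qed.

Lemma kapD2 (a : k) : kap a a = 4%:R / (1 - a * a).
Proof. by rewrite /kap subrr expr0n addr0. Qed.

Lemma kapD2' (a : k) : - (a * a) != 1 -> kap a (- a) = 4%:R.
Proof.
move=> an; have h : 1 + a * a != 0 by rewrite addrC -[1]opprK subr_eq0 -eqr_oppLR.
rewrite /kap mulrN !opprK (_ : _ + (a + a) ^+ 2 = 4%:R * (1 + a * a)); last by ring.
by rewrite mulfK.
Qed.

(** A spectrum of two pairs equals one of the shape a, t, t, t, so a = t = 3 / a - 2 and a is 1 or -
    3. If a = 1 all multipliers are 1, which means kap = 0, and this does not occur on the two
    lines. *)
Lemma mapC3_D2 f (a : k) : is_rat 3 f -> a != 0 -> conjugate 3 (mapC3 a) f ->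
  image_in_moduli 3 dom_ne1 famD2 f \/ image_in_moduli 3 dom_ne1 famD2' f -> a = - 3%:R.
Proof.
move=> rf an0 c H; have sf := sizedR rf; have p := spectrumC3 an0 sf c.
have [a0 [b0 [ab cg kn0]]] : exists a0 b0,
    [/\ a0 * b0 != 1, conjugate 3 (mapC2' a0 b0) f & kap a0 b0 != 0].
  case: H => [/imD2P|/imD2'_C2'] [_ [x xn cx]].
    exists x, x; split=> //; rewrite kapD2 mulf_neq0 ?natrS_neq0 // invr_eq0 subr_eq0 eq_sym //.
  exists x, (- x); split=> //; first by rewrite mulrN.
  by rewrite kapD2' // natrS_neq0.
have [u [v [_ [_ [[uv _] _ p' _]]]]] := spectrumC2' ab sf cg.
have p2 : perm_eq [:: u; u; v; v] [:: a; 3%:R / a - 2%:R; 3%:R / a - 2%:R; 3%:R / a - 2%:R].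
  by rewrite -(permPl p').
have at_ := perm_eq_pairs p2.
have : (a - 1) * (a + 3%:R) = 0.
  have e : 3%:R / a * a = 3%:R by rewrite divfK.
  transitivity ((a - (3%:R / a - 2%:R)) * a + (3%:R / a * a - 3%:R)); first by ring.
  by rewrite -at_ e !subrr mul0r addr0.
move/eqP; rewrite mulf_eq0 subr_eq0 addr_eq0 => /orP[/eqP a1|/eqP //].
have all1 x : x \in [:: u; u; v; v] -> x = 1.
  rewrite (perm_mem p2) -at_ a1 !inE; by case/or4P => /eqP.
have u1 : u = 1 by apply: all1; rewrite inE eqxx.
have v1 : v = 1 by apply: all1; rewrite !inE eqxx ?orbT.
case/eqP: kn0; move: uv; rewrite u1 v1 => uv.
have : 2%:R * kap a0 b0 = 0 by rewrite -[RHS](subrr (1 + 1 : k)) {2}uv; ring.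
by move/eqP; rewrite mulf_eq0 (negbTE (natrS_neq0 1)) => /eqP.
Qed.

(** * Even permutations of four points and the tetrahedral map *)

Definition o0 : 'I_4 := ord0.
Definition o1 : 'I_4 := Ordinal (isT : 1 < 4)%N.
Definition o2 : 'I_4 := Ordinal (isT : 2 < 4)%N.
Definition o3 : 'I_4 := Ordinal (isT : 3 < 4)%N.

Definition kx : {perm 'I_4} := (tperm o0 o1 * tperm o2 o3)%g.
Definition ky : {perm 'I_4} := (tperm o0 o2 * tperm o1 o3)%g.
Definition kc : {perm 'I_4} := (tperm o1 o3 * tperm o1 o2)%g.

Lemma I4_cases (i : 'I_4) : [\/ i = o0, i = o1, i = o2 | i = o3].
Proof.
case: i => [[|[|[|[|]]]]] // p; [constructor 1|constructor 2|constructor 3|constructor 4];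
  exact/val_inj.
Qed.

Lemma kxE : [/\ kx o0 = o1, kx o1 = o0, kx o2 = o3 & kx o3 = o2].
Proof. by split; rewrite /kx permM !permE. Qed.
Lemma kyE : [/\ ky o0 = o2, ky o1 = o3, ky o2 = o0 & ky o3 = o1].
Proof. by split; rewrite /ky permM !permE. Qed.
Lemma kcE : [/\ kc o0 = o0, kc o1 = o3, kc o2 = o1 & kc o3 = o2].
Proof. by split; rewrite /kc permM !permE. Qed.

Lemma kxx : (kx * kx)%g = 1%g.
Proof.
have [x0 x1 x2 x3] := kxE.
by apply/perm.permP => i; rewrite permM perm1; case: (I4_cases i) => ->; rewrite ?x0 ?x1 ?x2 ?x3 ?x0.
Qed.

Lemma kyy : (ky * ky)%g = 1%g.
Proof.
have [x0 x1 x2 x3] := kyE.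
by apply/perm.permP => i; rewrite permM perm1; case: (I4_cases i) => ->; rewrite ?x0 ?x1 ?x2 ?x3 ?x0 ?x1.
Qed.

Lemma kxy : (kx * ky)%g = (ky * kx)%g.
Proof.
have [x0 x1 x2 x3] := kxE; have [y0 y1 y2 y3] := kyE.
apply/perm.permP => i; rewrite (permM kx ky) (permM ky kx); case: (I4_cases i) => ->.
- by rewrite x0 y1 y0 x2.
- by rewrite x1 y0 y1 x3.
- by rewrite x2 y3 y2 x0.
by rewrite x3 y2 y3 x1.
Qed.

Lemma kccc : (kc * kc * kc)%g = 1%g.
Proof.
have [x0 x1 x2 x3] := kcE.
apply/perm.permP => i; rewrite (permM (kc * kc)%g kc) (permM kc kc) perm1; case: (I4_cases i) => ->.
- by rewrite !x0.
- by rewrite x1 x3 x2.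
- by rewrite x2 x1 x3.
by rewrite x3 x2 x1.
Qed.

Lemma kxA4 : kx \in grpA4. Proof. by rewrite /= Alt_even odd_permM !odd_tperm. Qed.
Lemma kyA4 : ky \in grpA4. Proof. by rewrite /= Alt_even odd_permM !odd_tperm. Qed.
Lemma kcA4 : kc \in grpA4. Proof. by rewrite /= Alt_even odd_permM !odd_tperm. Qed.

Lemma A4_mapC3 f : aut_locus 3 grpA4 f -> is_rat 3 f /\ conjugate 3 (mapC3 (- 3%:R)) f.
Proof.
move=> H; have rf : is_rat 3 f by case: H.
have [x0 _ _ _] := kxE; have [y0 _ _ _] := kyE; have [_ c1 _ _] := kcE.
have xn1 : kx != 1%g by apply/eqP => e; move: x0; rewrite e perm1.
have yn1 : ky != 1%g by apply/eqP => e; move: y0; rewrite e perm1.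
have xy : kx != ky by apply/eqP => e; move: y0; rewrite -e x0.
have cn1 : kc != 1%g by apply/eqP => e; move: c1; rewrite e perm1.
have D := locus_klein H kxA4 kyA4 kxx kyy kxy xn1 yn1 xy.
have [A [autA nA _ A3]] := locus_cyclic H kcA4 cn1.
have [a an0 ca] := aut3_mapC3 rf autA (A3 kccc) nA.
by split=> //; rewrite -(mapC3_D2 rf an0 ca D).
Qed.

(** [kx] and [kc] generate the group: multiplying by them on the right one makes a permutation fix
    [o0], then [o1], and an even permutation fixing both is trivial. *)
Lemma A4_ind (P : {perm 'I_4} -> Prop) : P 1%g -> P kx -> P kc ->
  (forall g h, P g -> P h -> P (g * h)%g) -> forall g, g \in grpA4 -> P g.
Proof.
move=> P1 Px Pc PM.
have [x0 x1 x2 x3] := kxE; have [c0 c1 c2 c3] := kcE.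
have red_x g : P (g * kx)%g -> P g by move=> H; rewrite -[g]mulg1 -kxx mulgA; exact: PM.
have red_c (g : {perm 'I_4}) : P (g * kc)%g -> P g.
  have E : (g * kc * kc * kc)%g = g.
    by rewrite -(mulgA (g * kc)%g kc kc) -(mulgA g kc (kc * kc)%g) (mulgA kc kc kc) kccc mulg1.
  by move=> H; rewrite -E; apply: (PM _ _ (PM _ _ H Pc) Pc).
have Ax g : g \in grpA4 -> (g * kx)%g \in grpA4 by move=> gA; rewrite groupM // kxA4.
have Ac g : g \in grpA4 -> (g * kc)%g \in grpA4 by move=> gA; rewrite groupM // kcA4.
have F2 g : g \in grpA4 -> g o0 = o0 -> g o1 = o1 -> P g.
  move=> gA g0 g1.
  have gn i j : i != j -> g i != g j by rewrite (inj_eq perm_inj).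
  case: (I4_cases (g o2)) => g2.
  - by have := gn o2 o0 isT; rewrite g2 g0.
  - by have := gn o2 o1 isT; rewrite g2 g1.
  - case: (I4_cases (g o3)) => g3.
    + by have := gn o3 o0 isT; rewrite g3 g0.
    + by have := gn o3 o1 isT; rewrite g3 g1.
    + by have := gn o3 o2 isT; rewrite g3 g2.
    suff -> : g = 1%g by [].
    by apply/perm.permP => i; rewrite perm1; case: (I4_cases i) => ->.
  case: (I4_cases (g o3)) => g3.
  - by have := gn o3 o0 isT; rewrite g3 g0.
  - by have := gn o3 o1 isT; rewrite g3 g1.
  - have e : g = tperm o2 o3.
      by apply/perm.permP => i; case: (I4_cases i) => ->; rewrite ?g0 ?g1 ?g2 ?g3 permE.
    by move: gA; rewrite /= Alt_even e odd_tperm.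
  by have := gn o3 o2 isT; rewrite g3 g2.
have F1 g : g \in grpA4 -> g o0 = o0 -> P g.
  move=> gA g0; case: (I4_cases (g o1)) => g1.
  - by have := inj_eq (@perm_inj _ g) o1 o0; rewrite g1 g0.
  - exact: F2.
  - by apply: red_c; apply: F2; rewrite ?Ac // permM ?g0 ?c0 // g1 c2.
  apply: (red_c); apply: (red_c); apply: F2; rewrite ?Ac // (permM (g * kc)%g kc) (permM g kc) ?g0 ?c0 // g1 c3 c2 //.
have F01 g : g \in grpA4 -> g o0 = o1 -> P g.
  by move=> gA g0; apply: red_x; apply: F1; rewrite ?Ax // permM g0 x1.
move=> g gA; case: (I4_cases (g o0)) => g0; first exact: F1.
- exact: F01.
- by apply: red_c; apply: F01; rewrite ?Ac // permM g0 c2.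
by apply: (red_c); apply: (red_c); apply: F01; rewrite ?Ac // (permM (g * kc)%g kc) (permM g kc) g0 c3 c2.
Qed.

(* Conjugate to [mapC3 (- 3)], scaled so that its fixed points are infinity and the cube roots of
   unity; [grpA4] acts by the even permutations of these. *)
Definition tetra_map : ratmap := ('X^3 - 4%:R%:P, - 3%:R *: 'X^2).

Lemma ev_tetra x y : ev 3 tetra_map (cv x y) = cv (x ^+ 3 - 4%:R * y ^+ 3) (- 3%:R * x ^+ 2 * y).
Proof. by rewrite ev_cv !hev3E /= !coefsE /=; congr cv; ring. Qed.

Lemma sized_tetra : sized 3 tetra_map.
Proof. by apply: sizedP => j; rewrite !coefsE /=; ring. Qed.

Lemma rat_tetra : is_rat 3 tetra_map.
Proof.
apply: (is_ratP_cv sized_tetra) => x y; hevsimp (ev_tetra x y).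
move=> e1 /eqP; rewrite mulf_eq0 => /orP[]; last first.
  move=> /eqP y0; split=> //; apply: cube0; move: e1; rewrite y0 expr0n mulr0 subr0 //.
rewrite mulf_eq0 oppr_eq0 (negbTE (natrS_neq0 2)) /= expf_eq0 /= => /eqP z; rewrite z in e1 *; split=> //.
apply: cube0; move/eqP: e1; rewrite expr0n sub0r oppr_eq0 mulf_eq0 (negbTE (natrS_neq0 3)) /=.
by move/eqP.
Qed.

Section Tetra.
Variable w : k.
Hypothesis we : w ^+ 2 + w + 1 = 0.

Definition tpt (i : 'I_4) : 'cV[k]_2 := tnth [tuple cv 1 0; cv 1 1; cv w 1; cv (w ^+ 2) 1] i.

(** The matrix undoes [g] on the four points. Permutations compose from left to right, so with this
    orientation products correspond to products in the same order. *)
Definition tlin (g : {perm 'I_4}) (M : 'M[k]_2) : Prop :=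
  forall i, exists2 l, l != 0 & M *m tpt (g i) = l *: tpt i.

Definition trep (g : {perm 'I_4}) (M : 'M[k]_2) : Prop := is_aut 3 tetra_map M /\ tlin g M.

Lemma w_neq : [/\ w != 0, w != 1, w ^+ 2 != 1 & w ^+ 2 != w].
Proof.
have w3 := omega3 we.
have w1 : w != 1 by apply: contraPneq we => ->; rewrite expr1n => /eqP; exact/negP/three_neq0.
have w0 : w != 0 by apply: contraNneq (oner_neq0 k) => w0; rewrite -we w0; apply/eqP; ring.
split=> //; first by apply: contraNneq w1 => h; rewrite -w3 exprS h mulr1.
by apply: contraNneq w1 => h; apply/eqP/(mulIf w0); rewrite mul1r -expr2.
Qed.

Lemma tpt_neq i j : i != j -> detc (tpt i) (tpt j) != 0.
Proof.
have [n0 n1 n2 n3] := w_neq.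
case: (I4_cases i) => ->; case: (I4_cases j) => -> // _;
  rewrite /tpt !(tnth_nth 0) /= detc_cv ?mulr1 ?mul1r ?mulr0 ?mul0r ?subr0 ?sub0r ?oppr_eq0 ?oner_neq0 //;
  rewrite subr_eq0 // eq_sym //.
Qed.

Lemma tlinM g h M N : tlin g M -> tlin h N -> tlin (g * h)%g (M *m N).
Proof.
move=> Hg Hh i; rewrite permM; have [l ln0 e] := Hh (g i); have [l' ln0' e'] := Hg i.
by exists (l * l'); rewrite ?mulf_neq0 // -mulmxA e -scalemxAr e' scalerA.
Qed.

(** A Moebius transformation fixing the three points infinity, 1 and w is the identity. *)
Lemma tlin_uniq g M N : N \in unitmx -> tlin g M -> tlin g N -> pgl_eq M N.
Proof.
move=> uN HM HN; pose L := invmx N *m M.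
have HL i : exists l, L *m tpt i = l *: tpt i.
  have [l _ e] := HM ((g^-1)%g i); have [l' ln0 e'] := HN ((g^-1)%g i).
  rewrite permKV in e e'; exists (l / l').
  rewrite /L -mulmxA e -(mulKmx uN (tpt i)) e' -!scalemxAr !scalerA.
  by rewrite divfK // -scalemxAr.
have [_ n1 _ _] := w_neq.
have [l0] := HL o0; have [l1] := HL o1; have [l2] := HL o2.
rewrite /tpt !(tnth_nth 0) /= (mk2E L) !mul_mk2_cv !cvZ.
move: (L 0 0) (L 0 1) (L 1 0) (L 1 1) (mk2E L) => a b c d LE.
move=> /cv_inj[h1 h2] /cv_inj[h3 h4] /cv_inj[h5 h6].
have c0 : c = 0 by move: h6; rewrite mulr1 mulr0 addr0 mulr0.
have dl2 : d = l2 by move: h2; rewrite c0 mul0r add0r !mulr1.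
have dl1 : d = l1 by move: h4; rewrite c0 mul0r add0r !mulr1.
have ab : a + b = d by rewrite dl1 -[RHS]mulr1 -h3 !mulr1.
have b0 : b = 0.
  have : b * (1 - w) = 0.
    transitivity (a * w + b * 1 - (a + b) * w); first by ring.
    by rewrite h1 ab dl2 subrr.
  by move/eqP; rewrite mulf_eq0 => /orP[/eqP //|]; rewrite subr_eq0 eq_sym (negbTE n1).
have ad : a = d by rewrite -ab b0 addr0.
have LZ : L = d *: 1%:M by rewrite LE c0 b0 ad -mk2_1 mk2Z mulr1 mulr0.
have ML : M = d *: N by rewrite -[LHS](mulKVmx uN) -/L LZ -scalemxAr mulmx1.
exists d => //; apply/eqP => d0; case: (HM o0) => l ln0; rewrite ML d0 scale0r mul0mx => /esym/eqP; rewrite scaler_eq0 (negbTE ln0) /=.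
by rewrite /tpt (tnth_nth 0) /= cv_eq0 oner_eq0.
Qed.

Lemma trep_ex g : g \in grpA4 -> exists M, trep g M.
Proof.
have w3 := omega3 we; have [n0 n1 n2 n3] := w_neq.
have [x0 x1 x2 x3] := kxE; have [c0 c1 c2 c3] := kcE.
have w2 : w ^+ 2 = - w - 1 by apply/eqP; rewrite -subr_eq0 -we; apply/eqP; ring.
move: g; apply: A4_ind.
- exists 1%:M; split; first by apply/(is_autP _ sized_tetra); split; [exact: unitmx1|exact: crel1].
  by move=> i; exists 1; rewrite ?oner_neq0 // perm1 mul1mx scale1r.
(* (z + 2) / (z - 1) exchanges infinity with 1 and w with w ^ 2. *)
- exists (mk2 1 2%:R 1 (-1)); split.
    apply/(is_autP _ sized_tetra); split.
      rewrite unit_mk2 (_ : _ - _ = - 3%:R); last by ring.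
      by rewrite oppr_eq0 natrS_neq0.
    apply: (crel_mk (e := - 3%:R)) => [|x y]; first by rewrite oppr_eq0 natrS_neq0.
    by hevsimp (ev_tetra x y); rewrite ev_tetra; congr cv; ring.
  move=> i; case: (I4_cases i) => ->; rewrite ?x0 ?x1 ?x2 ?x3 /tpt !(tnth_nth 0) /= mul_mk2_cv.
  + by exists 3%:R; rewrite ?natrS_neq0 // cvZ; congr cv; ring.
  + by exists 1; rewrite ?oner_neq0 // cvZ; congr cv; ring.
  + exists (w ^+ 2 - 1); rewrite ?subr_eq0 // cvZ; congr cv; last by ring.
    by rewrite mulrBl -exprSr w3 w2; ring.
  exists (w - 1); rewrite ?subr_eq0 // cvZ; congr cv; last by ring.
  by rewrite mulrBl -exprS w3 w2; ring.
- exists (mk2 w 0 0 1); split.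
    apply/(is_autP _ sized_tetra); split; first by rewrite unit_mk2 mulr1 mulr0 subr0.
    apply: (crel_mk (e := w ^+ 2)) => [|x y]; first by rewrite expf_neq0.
    hevsimp (ev_tetra x y); rewrite ev_tetra; congr cv; last by ring.
    transitivity (w ^+ 3 * x ^+ 3 - 4%:R * y ^+ 3); first by ring.
    transitivity (w ^+ 3 * (x ^+ 3 - 4%:R * y ^+ 3)); last by ring.
    by rewrite w3; ring.
  move=> i; case: (I4_cases i) => ->; rewrite ?c0 ?c1 ?c2 ?c3 /tpt !(tnth_nth 0) /= mul_mk2_cv.
  + by exists w; rewrite // cvZ; congr cv; ring.
  + exists 1; rewrite ?oner_neq0 // cvZ; congr cv; last by ring.
    by rewrite -exprS w3; ring.
  + by exists 1; rewrite ?oner_neq0 // cvZ; congr cv; ring.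
  by exists 1; rewrite ?oner_neq0 // cvZ; congr cv; ring.
move=> g h [M [/(is_autP _ sized_tetra)[uM HM] LM]] [N [/(is_autP _ sized_tetra)[uN HN] LN]].
exists (M *m N); split; last exact: tlinM.
by apply/(is_autP _ sized_tetra); split; [rewrite unitmx_mul uM uN | exact: crelM HM HN].
Qed.

(** Any choice of representatives is multiplicative by [tlin_uniq]; it is injective because the four
    points are pairwise distinct. *)
Lemma tetra_locus : aut_locus 3 grpA4 tetra_map.
Proof.
split; first exact: rat_tetra.
have ex g : exists M, g \in grpA4 -> trep g M.
  case gA : (g \in grpA4); last by exists 1%:M.
  by have [M HM] := trep_ex gA; exists M.
pose rho g := sval (constructive_indefinite_description _ (ex g)).
have Hr g : g \in grpA4 -> trep g (rho g).
  exact: svalP (constructive_indefinite_description _ (ex g)).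
have ur g : g \in grpA4 -> rho g \in unitmx by case/Hr=> -[].
exists rho; split.
- by move=> g /Hr[].
- move=> g h gA hA; apply: (@tlin_uniq (g * h)%g).
  + by rewrite unitmx_mul !ur.
  + by case: (Hr (g * h)%g (groupM gA hA)).
  by apply: tlinM; [case: (Hr g gA) | case: (Hr h hA)].
move=> g gA [c cn0 e]; have [_ L] := Hr g gA; apply/perm.permP => i; rewrite perm1.
have [l ln0] := L i; rewrite e -scalemxAl mul1mx => E.
apply/eqP/negP => /negP/tpt_neq/eqP; apply; apply: (mulfI cn0).
rewrite -detcZl E detcZl mulr0 /detc; ring.
Qed.

End Tetra.

Lemma A4_nonempty : exists f, aut_locus 3 grpA4 f.
Proof. by have [w we] := omega_exists; exists tetra_map; exact: tetra_locus we. Qed.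

(** * Irreducible components of the automorphism loci *)

Lemma mpoly_nonvanishing n (p : {mpoly k[n]}) : p != 0 -> exists x : 'rV[k]_n, p.@[x 0] != 0.
Proof.
move=> pn0; apply: NNPP => H; case/eqP: pn0; apply: mpoly_eq0_fun => v.
apply/eqP/negP => /negP pv; apply: H; exists (\row_i v i).
by rewrite (_ : p.@[_] = p.@[v]) //; apply: mpoly.meval_eq => i; rewrite mxE.
Qed.

(** A closed set missing part of the image pulls back to a nonzero polynomial in the parameters. A
    parameter at which the polynomials of [Z1] and [Z2] and also [u] are nonzero would escape the
    cover. *)
Lemma irreducible_image m (U : 'rV[k]_m -> Prop) (fam : 'rV[k]_m -> ratmap)
    (u : {mpoly k[m]}) (c1 c2 : 'I_4 -> {mpoly k[m]}) : u != 0 ->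
  (forall x, U x <-> u.@[x 0] != 0) -> (forall x (i : 'I_4), (fam x).1`_i = (c1 i).@[x 0]) ->
  (forall x (i : 'I_4), (fam x).2`_i = (c2 i).@[x 0]) ->
  (forall x, U x -> is_rat 3 (fam x)) ->
  irreducible_set (moduli_closed 3) (image_in_moduli 3 U fam).
Proof.
move=> un0 HU Hc1 Hc2 rat.
pose c (i : 'I_8) := match @split 4 4 i with inl j => c1 j | inr j => c2 j end.
have Hc x i : coefs 3 (fam x) 0 i = (c i).@[x 0].
  by rewrite /coefs /c mxE; case: split => j; rewrite mxE; [exact: Hc1|exact: Hc2].
have inT x : U x -> image_in_moduli 3 U fam (fam x).
  by move=> ux; split; [exact: rat | exists x => //; exact/conjugate_refl/sizedR/rat].
split; first by have [x ux] := mpoly_nonvanishing un0; exists (fam x); exact/inT/HU.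
move=> Z1 Z2 C1 C2 cover; apply: NNPP => /not_or_and[N1 N2].
have sep Z : moduli_closed 3 Z -> ~ (forall f, image_in_moduli 3 U fam f -> Z f) ->
    exists2 G : {mpoly k[m]}, G != 0 & forall x, U x -> Z (fam x) -> G.@[x 0] = 0.
  move=> [inv [E HE]] /not_all_ex_not nT; case: nT => f nT.
  have [[rf [x0 ux0 cf]] nZ] := imply_to_and _ _ nT.
  have nZ0 : ~ Z (fam x0) by move=> z; apply: nZ; exact: inv (rat _ ux0) rf cf z.
  have [F [EF Fn0]] : exists F, E F /\ F.@[coefs 3 (fam x0) 0] <> 0.
    apply: NNPP => H; apply: nZ0; apply/(HE _ (rat _ ux0)) => F EF.
    by apply: NNPP => H'; apply: H; exists F.
  pose G := F \mPo [tuple c i | i < 8].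
  have FG (x : 'rV[k]_m) : G.@[x 0] = F.@[coefs 3 (fam x) 0].
    by rewrite comp_mpoly_meval; apply: mpoly.meval_eq => i; rewrite tnth_mktuple Hc.
  exists G; first by apply/eqP => G0; apply: Fn0; rewrite -FG G0 meval0.
  by move=> x ux zx; rewrite FG; exact: (HE _ (rat _ ux)).1 zx F EF.
have [G1 G1n0 H1] := sep _ C1 N1; have [G2 G2n0 H2] := sep _ C2 N2.
have [x] := mpoly_nonvanishing (mulf_neq0 un0 (mulf_neq0 G1n0 G2n0)).
rewrite !mevalM !mulf_eq0 !negb_or => /and3P[/HU ux /eqP g1 /eqP g2].
by case: (cover _ (inT x ux)) => [/(H1 x ux)|/(H2 x ux)].
Qed.

(** * Conjugation-invariant closed conditions *)

Definition cpoly (h : ratmap -> k) : Prop :=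
  exists F : {mpoly k[8]}, forall f, h f = F.@[coefs 3 f 0].

Lemma cpolyC c : cpoly (fun=> c).
Proof. by exists c%:MP => f; rewrite mevalC. Qed.

Lemma cpolyD h h' : cpoly h -> cpoly h' -> cpoly (fun f => h f + h' f).
Proof. by case=> F HF [G HG]; exists (F + G) => f; rewrite mevalD HF HG. Qed.

Lemma cpolyM h h' : cpoly h -> cpoly h' -> cpoly (fun f => h f * h' f).
Proof. by case=> F HF [G HG]; exists (F * G) => f; rewrite mevalM HF HG. Qed.

Lemma cpolyN h : cpoly h -> cpoly (fun f => - h f).
Proof. by case=> F HF; exists (- F) => f; rewrite mevalN HF. Qed.

Lemma cpolyX h n : cpoly h -> cpoly (fun f => h f ^+ n).
Proof. by case=> F HF; exists (F ^+ n) => f; rewrite rmorphXn /= HF. Qed.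

Lemma cpoly_num (i : 'I_4) : cpoly (fun f => f.1`_i).
Proof.
exists 'X_(lshift 4 i) => f; rewrite mevalXU /coefs.
by rewrite (row_mxEl (\row_i f.1`_i) (\row_i f.2`_i)) mxE.
Qed.

Lemma cpoly_den (i : 'I_4) : cpoly (fun f => f.2`_i).
Proof.
exists 'X_(rshift 4 i) => f; rewrite mevalXU /coefs.
by rewrite (row_mxEr (\row_i f.1`_i) (\row_i f.2`_i)) mxE.
Qed.

Ltac cpoly_tac := repeat first
  [ exact: cpolyC | exact: (cpoly_num (Ordinal (isT : 0 < 4)%N))
  | exact: (cpoly_num (Ordinal (isT : 1 < 4)%N)) | exact: (cpoly_num (Ordinal (isT : 2 < 4)%N))
  | exact: (cpoly_num (Ordinal (isT : 3 < 4)%N)) | exact: (cpoly_den (Ordinal (isT : 0 < 4)%N))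
  | exact: (cpoly_den (Ordinal (isT : 1 < 4)%N)) | exact: (cpoly_den (Ordinal (isT : 2 < 4)%N))
  | exact: (cpoly_den (Ordinal (isT : 3 < 4)%N))
  | apply: cpolyD | apply: cpolyM | apply: cpolyN | apply: cpolyX ].

Lemma closed_equations (s : seq (ratmap -> k)) : (forall i, cpoly (nth (fun=> 0) s i)) ->
  (forall f g, sized 3 f -> sized 3 g -> conjugate 3 f g ->
    [seq h f | h <- s] = nseq (size s) 0 -> [seq h g | h <- s] = nseq (size s) 0) ->
  moduli_closed 3 (fun f => [seq h f | h <- s] = nseq (size s) 0).
Proof.
move=> pol inv; split; first by move=> f g /sizedR sf /sizedR sg; exact: inv.
have nthE f i : nth (fun=> 0) s i f = [seq h f | h <- s]`_i.
  by elim: s i {pol inv} => [|h s IH] [|i] //=; rewrite nth_nil.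
exists (fun F => exists i, forall f, nth (fun=> 0) s i f = F.@[coefs 3 f 0]) => f _; split.
  by move=> H F [i <-]; rewrite nthE H nth_nseq if_same.
move=> H; apply: (@eq_from_nth _ 0) => [|i _]; first by rewrite size_map size_nseq.
by rewrite -nthE nth_nseq if_same; have [F HF] := pol i; rewrite HF; apply: H; exists i.
Qed.

(* The coefficients of the quartic form [y F1 - x F2] and of the divergence of [(F1, F2)]. *)
Definition q4 (f : ratmap) : k := - f.2`_3.
Definition q3 (f : ratmap) : k := f.1`_3 - f.2`_2.
Definition q2 (f : ratmap) : k := f.1`_2 - f.2`_1.
Definition q1 (f : ratmap) : k := f.1`_1 - f.2`_0.
Definition q0 (f : ratmap) : k := f.1`_0.
Definition g2 (f : ratmap) : k := 3%:R * f.1`_3 + f.2`_2.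
Definition g1 (f : ratmap) : k := 2%:R * (f.1`_2 + f.2`_1).
Definition g0 (f : ratmap) : k := f.1`_1 + 3%:R * f.2`_0.

Definition quartic (a b c d e x y : k) : k :=
  a * x ^+ 4 + b * x ^+ 3 * y + c * x ^+ 2 * y ^+ 2 + d * x * y ^+ 3 + e * y ^+ 4.
Definition quadric (a b c x y : k) : k := a * x ^+ 2 + b * x * y + c * y ^+ 2.

Lemma quartic_inj a b c d e a' b' c' d' e' :
  (forall x y, quartic a b c d e x y = quartic a' b' c' d' e' x y) ->
  [/\ a = a', b = b', c = c', d = d' & e = e'].
Proof.
move=> H.
pose p := (e - e')%:P + (d - d') *: 'X + (c - c') *: 'X^2 + (b - b') *: 'X^3 + (a - a') *: 'X^4.
have p0 : p = 0.
  apply: poly_eq0_fun => x; have := H x 1; rewrite /quartic /p => /eqP; rewrite -subr_eq0 => /eqP h.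
  rewrite !(hornerD, hornerZ, hornerXn, hornerX, hornerC) -[RHS]h; ring.
have E i : p`_i = 0 by rewrite p0 coef0.
have := (E 0%N, E 1%N, E 2%N, E 3%N, E 4%N); rewrite /p !coefsE /=.
rewrite !(mulr0, mulr1, addr0, add0r) => -[[[[/eqP e0 /eqP d0] /eqP c0] /eqP b0] /eqP a0].
by move: e0 d0 c0 b0 a0; rewrite !subr_eq0 => /eqP-> /eqP-> /eqP-> /eqP-> /eqP->.
Qed.

Lemma quadric_inj a b c a' b' c' :
  (forall x y, quadric a b c x y = quadric a' b' c' x y) -> [/\ a = a', b = b' & c = c'].
Proof.
move=> H; have [] := @quartic_inj 0 0 a b c 0 0 a' b' c' _.
  by move=> x y; have := H x y; rewrite /quartic /quadric => h; rewrite !mul0r !add0r;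
     transitivity (y ^+ 2 * (a * x ^+ 2 + b * x * y + c * y ^+ 2)); [ring|rewrite h; ring].
by move=> _ _ -> -> ->.
Qed.

Lemma detc_quartic f x y : detc (ev 3 f (cv x y)) (cv x y) =
  quartic (q4 f) (q3 f) (q2 f) (q1 f) (q0 f) x y.
Proof.
by rewrite ev_cv detc_cv !hev3E /quartic /q4 /q3 /q2 /q1 /q0; ring.
Qed.

Lemma trace_mk2 a b c d : \tr (mk2 a b c d) = a + d.
Proof. by rewrite /mxtrace !big_ord_recl big_ord0 addr0 !mxE. Qed.

Lemma tr_jac_quadric f x y : \tr (jac 2 f (cv x y)) = quadric (g2 f) (g1 f) (g0 f) x y.
Proof.
have h2 p : hev 2 p x y = p`_0 * y ^+ 2 + p`_1 * x * y + p`_2 * x ^+ 2.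
  rewrite /hev !big_ord_recl big_ord0 /= /bump /= !expr0 !expr1 !mulr1 addr0 !addrA.
  by rewrite !addn0 ?add1n.
rewrite /jac cv0 cv1 trace_mk2 !h2 !coef_deriv !coef_dyp // /quadric /g2 /g1 /g0.
rewrite !subSS !subn0 !mulr1n; ring.
Qed.

(** The coefficients after x |-> p x + q y, y |-> r x + s y, spelled out so that the invariance
    statements become ring identities. *)
Definition sub4 p q r s (a b c d e : k) : k * k * k * k * k :=
  (quartic a b c d e p r,
   4%:R * a * p ^+ 3 * q + b * (p ^+ 3 * s + 3%:R * p ^+ 2 * q * r)
   + c * (2%:R * p ^+ 2 * r * s + 2%:R * p * q * r ^+ 2)
   + d * (3%:R * p * r ^+ 2 * s + q * r ^+ 3) + 4%:R * e * r ^+ 3 * s,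
   6%:R * a * p ^+ 2 * q ^+ 2 + b * (3%:R * p ^+ 2 * q * s + 3%:R * p * q ^+ 2 * r)
   + c * (p ^+ 2 * s ^+ 2 + 4%:R * p * q * r * s + q ^+ 2 * r ^+ 2)
   + d * (3%:R * p * r * s ^+ 2 + 3%:R * q * r ^+ 2 * s) + 6%:R * e * r ^+ 2 * s ^+ 2,
   4%:R * a * p * q ^+ 3 + b * (3%:R * p * q ^+ 2 * s + q ^+ 3 * r)
   + c * (2%:R * p * q * s ^+ 2 + 2%:R * q ^+ 2 * r * s)
   + d * (p * s ^+ 3 + 3%:R * q * r * s ^+ 2) + 4%:R * e * r * s ^+ 3,
   quartic a b c d e q s).

Definition sub2 p q r s (a b c : k) : k * k * k :=
  (quadric a b c p r, 2%:R * a * p * q + b * (p * s + q * r) + 2%:R * c * r * s, quadric a b c q s).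

Lemma sub4E p q r s a b c d e : exists a' b' c' d' e',
  sub4 p q r s a b c d e = (a', b', c', d', e') /\
  forall x y, quartic a' b' c' d' e' x y = quartic a b c d e (p * x + q * y) (r * x + s * y).
Proof. by do 5!eexists; split; [reflexivity | move=> x y; rewrite /quartic; ring]. Qed.

Lemma sub2E p q r s a b c : exists a' b' c',
  sub2 p q r s a b c = (a', b', c') /\
  forall x y, quadric a' b' c' x y = quadric a b c (p * x + q * y) (r * x + s * y).
Proof. by do 3!eexists; split; [reflexivity | move=> x y; rewrite /quadric; ring]. Qed.

(** The quartic is the fixed-point form det(F v, v), which picks up the determinant of the matrix;
    the quadratic form is the trace of the Jacobian matrix, which is unchanged by similarity. The
    scalar [c] of the conjugation enters both. *)
Lemma conj_forms f g : sized 3 f -> sized 3 g -> conjugate 3 f g -> exists p q r s c,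
  [/\ p * s - q * r != 0, c != 0,
    let t := c * (p * s - q * r) in
    sub4 p q r s (q4 f) (q3 f) (q2 f) (q1 f) (q0 f) =
      (t * q4 g, t * q3 g, t * q2 g, t * q1 g, t * q0 g) &
    sub2 p q r s (g2 f) (g1 f) (g0 f) = (c * g2 g, c * g1 g, c * g0 g)].
Proof.
move=> sf sg /(conjugateP _ sg)[A uA [c cn0 HA]].
have Hd v : detc (ev 3 f (A *m v)) (A *m v) = c * \det A * detc (ev 3 g v) v.
  by rewrite HA detcZl detc_mul mulrA.
have Ht v : \tr (jac 2 f (A *m v)) = c * \tr (jac 2 g v).
  by rewrite (jac_crel uA HA) mxtraceZ mxtrace_mulC mulmxA mulVmx // mul1mx.
move: uA Hd Ht; rewrite {HA} (mk2E A); move: (A 0 0) (A 0 1) (A 1 0) (A 1 1) => p q r s.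
rewrite unit_mk2 det_mk2 => uA Hd Ht; exists p, q, r, s, c; split=> //=.
  have [a' [b' [c' [d' [e' [-> E]]]]]] := sub4E p q r s (q4 f) (q3 f) (q2 f) (q1 f) (q0 f).
  set t := c * (p * s - q * r) in Hd *.
  have [] := @quartic_inj a' b' c' d' e' (t * q4 g) (t * q3 g) (t * q2 g) (t * q1 g) (t * q0 g).
    move=> x y; rewrite E -detc_quartic -mul_mk2_cv Hd detc_quartic /quartic.
    by clearbody t; ring.
  by move=> -> -> -> -> ->.
have [a' [b' [c' [-> E]]]] := sub2E p q r s (g2 f) (g1 f) (g0 f).
have [] := @quadric_inj a' b' c' (c * g2 g) (c * g1 g) (c * g0 g).
  move=> x y; rewrite E -tr_jac_quadric -mul_mk2_cv Ht tr_jac_quadric /quadric.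
  by ring.
by move=> -> -> ->.
Qed.

(** The cubic invariant of a binary quartic; for distinct roots it vanishes when their cross-ratio
    is harmonic. *)
Definition J4 (a b c d e : k) : k :=
  72%:R * a * c * e + 9%:R * b * c * d - 27%:R * a * d ^+ 2 - 27%:R * e * b ^+ 2 - 2%:R * c ^+ 3.
Definition Jinv f := J4 (q4 f) (q3 f) (q2 f) (q1 f) (q0 f).

(* The joint invariant of weight 4 of a quartic and the square of a quadric. *)
Definition K4 (a b c d e u v w : k) : k :=
  6%:R * a * w ^+ 2 - 3%:R * b * v * w + c * (2%:R * u * w + v ^+ 2) - 3%:R * d * u * v
  + 6%:R * e * u ^+ 2.
Definition Kinv f := K4 (q4 f) (q3 f) (q2 f) (q1 f) (q0 f) (g2 f) (g1 f) (g0 f).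

(* The second transvectant of a quartic and a quadric. *)
Definition trans (a b c d e u v w : k) : k * k * k :=
  (12%:R * a * w - 3%:R * b * v + 2%:R * c * u, 6%:R * b * w - 4%:R * c * v + 6%:R * d * u,
   2%:R * c * w - 3%:R * d * v + 12%:R * e * u).
Definition Tcov f := trans (q4 f) (q3 f) (q2 f) (q1 f) (q0 f) (g2 f) (g1 f) (g0 f).

Definition minors (x y : k * k * k) : seq k :=
  [:: x.1.1 * y.1.2 - x.1.2 * y.1.1; x.1.1 * y.2 - x.2 * y.1.1; x.1.2 * y.2 - x.2 * y.1.2].

Lemma J4_sub p q r s a b c d e a' b' c' d' e' : sub4 p q r s a b c d e = (a', b', c', d', e') ->
  J4 a' b' c' d' e' = (p * s - q * r) ^+ 6 * J4 a b c d e.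
Proof. by case=> <- <- <- <- <-; rewrite /J4 /quartic; ring. Qed.

Lemma K4_sub p q r s a b c d e a' b' c' d' e' u v w u' v' w' :
  sub4 p q r s a b c d e = (a', b', c', d', e') -> sub2 p q r s u v w = (u', v', w') ->
  K4 a' b' c' d' e' u' v' w' = (p * s - q * r) ^+ 4 * K4 a b c d e u v w.
Proof.
by case=> <- <- <- <- <- [<- <- <-]; rewrite /K4 /quartic /quadric; ring.
Qed.

Lemma trans_sub p q r s a b c d e a' b' c' d' e' u v w u' v' w' :
  sub4 p q r s a b c d e = (a', b', c', d', e') -> sub2 p q r s u v w = (u', v', w') ->
  let t := trans a b c d e u v w in
  let m := (p * s - q * r) ^+ 2 in
  let t' := sub2 p q r s t.1.1 t.1.2 t.2 in
  trans a' b' c' d' e' u' v' w' = (m * t'.1.1, m * t'.1.2, m * t'.2).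
Proof.
case=> <- <- <- <- <- [<- <- <-] /=; rewrite /trans /quartic /quadric.
by congr (_, _, _); ring.
Qed.

(** Substitution acts linearly on quadratic forms, so the new minors are linear combinations of the
    old ones. *)
Lemma minors_sub p q r s u v w a b c : minors (u, v, w) (a, b, c) = [:: 0; 0; 0] ->
  minors (sub2 p q r s u v w) (sub2 p q r s a b c) = [:: 0; 0; 0].
Proof.
case=> m1 m2 m3; rewrite /minors /sub2 /quadric /=; congr [:: _; _; _].
- transitivity ((u * b - v * a) * (p ^+ 2 * (p * s + q * r) - 2%:R * p ^+ 2 * q * r)
    + 2%:R * (u * c - w * a) * (p ^+ 2 * r * s - p * q * r ^+ 2)
    + (v * c - w * b) * (2%:R * p * r * r * s - r ^+ 2 * (p * s + q * r))); first by ring.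
  by rewrite m1 m2 m3; ring.
- transitivity ((u * b - v * a) * (p ^+ 2 * q * s - p * r * q ^+ 2)
    + (u * c - w * a) * (p ^+ 2 * s ^+ 2 - q ^+ 2 * r ^+ 2)
    + (v * c - w * b) * (p * r * s ^+ 2 - r ^+ 2 * q * s)); first by ring.
  by rewrite m1 m2 m3; ring.
transitivity ((u * b - v * a) * (2%:R * p * q * q * s - q ^+ 2 * (p * s + q * r))
  + 2%:R * (u * c - w * a) * (p * q * s ^+ 2 - q ^+ 2 * r * s)
  + (v * c - w * b) * (s ^+ 2 * (p * s + q * r) - 2%:R * r * s * q * s)); first by ring.
by rewrite m1 m2 m3; ring.
Qed.

Lemma minorsZ l m u v w a b c : l != 0 -> m != 0 ->
  minors (l * u, l * v, l * w) (m * a, m * b, m * c) = [:: 0; 0; 0] ->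
  minors (u, v, w) (a, b, c) = [:: 0; 0; 0].
Proof.
move=> ln0 mn0; rewrite /minors /= => -[m1 m2 m3].
have lm : l * m != 0 by rewrite mulf_neq0.
have E x : l * m * x = 0 -> x = 0 by move/eqP; rewrite mulf_eq0 (negbTE lm) => /eqP.
by congr [:: _; _; _]; apply: E; [rewrite -[RHS]m1|rewrite -[RHS]m2|rewrite -[RHS]m3]; ring.
Qed.

Lemma Jinv_conj f g : sized 3 f -> sized 3 g -> conjugate 3 f g -> Jinv f = 0 -> Jinv g = 0.
Proof.
move=> sf sg /(conj_forms sf sg)[p [q [r [s [c [dn0 cn0 /J4_sub + _]]]]]].
rewrite -/(Jinv f) => H J0; rewrite J0 mulr0 in H.
have tn0 : (c * (p * s - q * r)) ^+ 3 != 0 by rewrite expf_neq0 // mulf_neq0.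
by apply: (mulfI tn0); rewrite mulr0 -H /Jinv /J4; ring.
Qed.

Lemma Kinv_conj f g : sized 3 f -> sized 3 g -> conjugate 3 f g -> Kinv f = 0 -> Kinv g = 0.
Proof.
move=> sf sg /(conj_forms sf sg)[p [q [r [s [c [dn0 cn0 h4 h2]]]]]].
have H := K4_sub h4 h2; rewrite -/(Kinv f) in H => J0; rewrite J0 mulr0 in H.
have tn0 : (c * (p * s - q * r)) * c ^+ 2 != 0 by rewrite mulf_neq0 ?expf_neq0 // mulf_neq0.
by apply: (mulfI tn0); rewrite mulr0 -H /Kinv /K4; ring.
Qed.

Lemma div0_conj f g : sized 3 f -> sized 3 g -> conjugate 3 f g ->
  [:: g2 f; g1 f; g0 f] = [:: 0; 0; 0] -> [:: g2 g; g1 g; g0 g] = [:: 0; 0; 0].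
Proof.
move=> sf sg /(conj_forms sf sg)[p [q [r [s [c [dn0 cn0 _ h2]]]]]] [z2 z1 z0].
move: h2; rewrite z2 z1 z0 /sub2 /quadric !mulr0 !mul0r !addr0 => -[e2 e1 e0].
by congr [:: _; _; _]; apply: (mulfI cn0); rewrite mulr0.
Qed.

Lemma minors_conj f g : sized 3 f -> sized 3 g -> conjugate 3 f g ->
  minors (g2 f, g1 f, g0 f) (Tcov f) = [:: 0; 0; 0] ->
  minors (g2 g, g1 g, g0 g) (Tcov g) = [:: 0; 0; 0].
Proof.
move=> sf sg /(conj_forms sf sg)[p [q [r [s [c [dn0 cn0 h4 h2]]]]]].
have H := trans_sub h4 h2; cbv zeta in H; rewrite -/(Tcov f) in H.
have : forall x y, minors x y = [:: 0; 0; 0] ->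
    minors (sub2 p q r s x.1.1 x.1.2 x.2) (sub2 p q r s y.1.1 y.1.2 y.2) = [:: 0; 0; 0].
  by move=> [[? ?] ?] [[? ?] ?]; exact: minors_sub.
move=> msub /msub; rewrite h2; move: H.
move: (sub2 p q r s (Tcov f).1.1 (Tcov f).1.2 (Tcov f).2) => [[u2 u1] u0] H M.
set t := c * (p * s - q * r) in H; set m := (p * s - q * r) ^+ 2 in H.
have tn0 : t != 0 by rewrite mulf_neq0.
have E : trans (t * q4 g) (t * q3 g) (t * q2 g) (t * q1 g) (t * q0 g) (c * g2 g) (c * g1 g) (c * g0 g) =
    (t * c * (Tcov g).1.1, t * c * (Tcov g).1.2, t * c * (Tcov g).2).
  by rewrite /Tcov /trans /=; congr (_, _, _); clearbody t; ring.
have [E2 E1 E0] := etrans (esym E) H.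
have {M} M : minors (c * g2 g, c * g1 g, c * g0 g) (m * u2, m * u1, m * u0) = [:: 0; 0; 0].
  by case: M => M1 M2 M3; rewrite /minors /=; congr [:: _; _; _];
    rewrite -[RHS](mulr0 m); [rewrite -[X in _ = _ * X]M1|rewrite -[X in _ = _ * X]M2|rewrite -[X in _ = _ * X]M3];
    clearbody m; ring.
rewrite -E2 -E1 -E0 in M.
have tc : t * c != 0 by rewrite mulf_neq0.
exact: (minorsZ cn0 tc M).
Qed.

Lemma closed_J : moduli_closed 3 (fun f => [:: Jinv f] = [:: 0]).
Proof.
apply: (@closed_equations [:: Jinv]) => [[|i] /=|f g sf sg c []].
- rewrite /Jinv /J4 /q4 /q3 /q2 /q1 /q0; cpoly_tac.
- by rewrite nth_nil; exact: cpolyC.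
by move=> h /=; rewrite (Jinv_conj sf sg c h).
Qed.

Lemma closed_JK : moduli_closed 3 (fun f => [:: Jinv f; Kinv f] = [:: 0; 0]).
Proof.
apply: (@closed_equations [:: Jinv; Kinv]) => [[|[|i]] /=|f g sf sg c []].
- rewrite /Jinv /J4 /q4 /q3 /q2 /q1 /q0; cpoly_tac.
- rewrite /Kinv /K4 /q4 /q3 /q2 /q1 /q0 /g2 /g1 /g0; cpoly_tac.
- by rewrite nth_nil; exact: cpolyC.
by move=> h h' /=; rewrite (Jinv_conj sf sg c h) (Kinv_conj sf sg c h').
Qed.

Lemma closed_div0 : moduli_closed 3 (fun f => [:: g2 f; g1 f; g0 f] = [:: 0; 0; 0]).
Proof.
apply: (@closed_equations [:: g2; g1; g0]) => [[|[|[|i]]] /=|f g]; last exact: div0_conj.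
- rewrite /g2; cpoly_tac.
- rewrite /g1; cpoly_tac.
- rewrite /g0; cpoly_tac.
by rewrite nth_nil; exact: cpolyC.
Qed.

Lemma closed_minors : moduli_closed 3 (fun f => minors (g2 f, g1 f, g0 f) (Tcov f) = [:: 0; 0; 0]).
Proof.
apply: (@closed_equations [:: fun f => g2 f * (Tcov f).1.2 - g1 f * (Tcov f).1.1;
    fun f => g2 f * (Tcov f).2 - g0 f * (Tcov f).1.1;
    fun f => g1 f * (Tcov f).2 - g0 f * (Tcov f).1.2]) => [[|[|[|i]]] /=|f g]; last exact: minors_conj.
- rewrite /Tcov /trans /= /q4 /q3 /q2 /q1 /q0 /g2 /g1 /g0; cpoly_tac.
- rewrite /Tcov /trans /= /q4 /q3 /q2 /q1 /q0 /g2 /g1 /g0; cpoly_tac.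
- rewrite /Tcov /trans /= /q4 /q3 /q2 /q1 /q0 /g2 /g1 /g0; cpoly_tac.
by rewrite nth_nil; exact: cpolyC.
Qed.

(** * Values of the invariants on the families, and the components *)

Lemma formsC2' (a b : k) (f := mapC2' a b) :
  [/\ q4 f = -1, q3 f = 0, q2 f = a - b & q1 f = 0] /\
  [/\ q0 f = 1, g2 f = 0, g1 f = 2%:R * (a + b) & g0 f = 0].
Proof.
by rewrite /f /q4 /q3 /q2 /q1 /q0 /g2 /g1 /g0 /=; split; split; rewrite !coefsE /=; ring.
Qed.

Lemma formsC2 (a b : k) (f := mapC2 a b) :
  [/\ q4 f = 0, q3 f = 1 - b, q2 f = 0 & q1 f = a - 1] /\
  [/\ q0 f = 0, g2 f = 3%:R + b, g1 f = 0 & g0 f = a + 3%:R].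
Proof.
by rewrite /f /q4 /q3 /q2 /q1 /q0 /g2 /g1 /g0 /=; split; split; rewrite !coefsE /=; ring.
Qed.

Lemma Jinv_C2' a b : Jinv (mapC2' a b) = - 2%:R * (a - b) * (36%:R + (a - b) ^+ 2).
Proof.
have [[e4 e3 e2 e1] [e0 _ _ _]] := formsC2' a b.
by rewrite /Jinv e4 e3 e2 e1 e0 /J4; ring.
Qed.

Lemma Kinv_C2' a b : Kinv (mapC2' a b) = 4%:R * (a - b) * (a + b) ^+ 2.
Proof.
have [[e4 e3 e2 e1] [e0 h2 h1 h0]] := formsC2' a b.
by rewrite /Kinv e4 e3 e2 e1 e0 h2 h1 h0 /K4; ring.
Qed.

Lemma Jinv_C2 a b : Jinv (mapC2 a b) = 0.
Proof.
have [[e4 e3 e2 e1] [e0 _ _ _]] := formsC2 a b.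
by rewrite /Jinv e4 e3 e2 e1 e0 /J4; ring.
Qed.

Lemma Kinv_C2 a b : Kinv (mapC2 a b) = 0.
Proof.
have [[e4 e3 e2 e1] [e0 h2 h1 h0]] := formsC2 a b.
by rewrite /Kinv e4 e3 e2 e1 e0 h2 h1 h0 /K4; ring.
Qed.

Lemma minors_C2' a b (f := mapC2' a b) : minors (g2 f, g1 f, g0 f) (Tcov f) = [:: 0; 0; 0].
Proof.
have [[e4 e3 e2 e1] [e0 h2 h1 h0]] := formsC2' a b.
by rewrite /f /Tcov e4 e3 e2 e1 e0 h2 h1 h0 /minors /trans /=; congr [:: _; _; _]; ring.
Qed.

Lemma minors_C2 a b (f := mapC2 a b) : minors (g2 f, g1 f, g0 f) (Tcov f) = [:: 0; 0; 0] ->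
  (a - b) * (3%:R + b) = 0 /\ (a - b) * (a + 3%:R) = 0.
Proof.
have [[e4 e3 e2 e1] [e0 h2 h1 h0]] := formsC2 a b.
rewrite /f /Tcov e4 e3 e2 e1 e0 h2 h1 h0 /minors /trans /= => -[m1 _ m3].
have n24 : 24%:R != 0 :> k by exact: natrS_neq0.
have n24' : - 24%:R != 0 :> k by rewrite oppr_eq0.
by split; [apply: (mulfI n24); rewrite mulr0 -[RHS]m1|apply: (mulfI n24'); rewrite mulr0 -[RHS]m3]; ring.
Qed.

(** An irreducible set between [T] and [S] lies in the union of [Z] and [Z'], hence in one of them;
    the point of [T] outside [Z'] leaves only [Z], and points of [T'] in [Z] already belong to
    [T]. *)
Lemma component (S T T' Z Z' : ratmap -> Prop) : (forall f, S f <-> T f \/ T' f) ->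
  irreducible_set (moduli_closed 3) T -> moduli_closed 3 Z -> moduli_closed 3 Z' ->
  (forall f, T f -> Z f) -> (forall f, T' f -> Z' f) -> (forall f, T' f -> Z f -> T f) ->
  (exists2 f, T f & ~ Z' f) -> irreducible_component (moduli_closed 3) S T.
Proof.
move=> ST irrT cZ cZ' TZ TZ' sep [f0 Tf0 nZ'].
split=> //; first by move=> f Tf; apply/ST; left.
move=> T0 [_ irr] TT0 T0S f T0f.
case: (irr Z Z' cZ cZ') => [x /T0S /ST[/TZ|/TZ']|H|H]; [by left|by right| |].
  by have [//|T'f] := (ST f).1 (T0S f T0f); exact: sep T'f (H f T0f).
by case: nZ'; exact/H/TT0.
Qed.

Lemma div_C2' a b : [:: g2 (mapC2' a b); g1 (mapC2' a b); g0 (mapC2' a b)] = [:: 0; 0; 0] <->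
  a + b = 0.
Proof.
have [_ [_ -> -> ->]] := formsC2' a b; split=> [[/eqP]|->]; last by rewrite mulr0.
by rewrite mulf_eq0 (negbTE (natrS_neq0 1)) => /eqP.
Qed.

Lemma D2_J f : image_in_moduli 3 dom_ne1 famD2 f -> [:: Jinv f] = [:: 0].
Proof.
case/imD2P => rf [a an c]; congr [:: _].
apply: (Jinv_conj (sized_mapC2' a a) (sizedR rf) c).
by rewrite Jinv_C2' subrr mulr0 mul0r.
Qed.

Lemma D2'_div f : image_in_moduli 3 dom_ne1 famD2' f -> [:: g2 f; g1 f; g0 f] = [:: 0; 0; 0].
Proof.
case/imD2'_C2' => rf [a an c]; apply: (div0_conj (sized_mapC2' a (- a)) (sizedR rf) c).
by apply/div_C2'; rewrite subrr.
Qed.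

Lemma D2'_0 : conjugate 3 (mapD2' 0) (mapC2' 0 0).
Proof.
have [l l4] := exists_root4; apply: conjugate_sym; [exact: sized_mapC2'|exact: sized_mapD2'|].
by have := conj_C2'_D2' 0 l4; rewrite oppr0 mul0r.
Qed.

(** On family (3) the invariant J vanishes only for a = 0, 3, - 3. These three parameters give
    conjugate maps, and a = 0 belongs to (2) as well. *)
Lemma D2'_J f : image_in_moduli 3 dom_ne1 famD2' f -> [:: Jinv f] = [:: 0] ->
  image_in_moduli 3 dom_ne1 famD2 f.
Proof.
move=> /imD2'P[rf [a an c]] [J0]; apply/imD2P; split=> //.
suff H : conjugate 3 (mapC2' 0 0) f by exists 0; rewrite // mul0r eq_sym oner_neq0.
have sf := sizedR rf; have s0 := sized_mapD2'.
suff H : conjugate 3 (mapD2' 0) f.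
  apply: (conjugate_trans (s0 0) sf _ H).
  by apply: conjugate_sym D2'_0; [exact: s0 | exact: sized_mapC2'].
have a9 : a = 0 \/ a ^+ 2 = 9%:R.
  have [m mm c'] := D2'_diag a; have cc := conjugate_trans (s0 a) sf c' c.
  have := Jinv_conj sf (sized_mapC2' _ _) (conjugate_sym (sized_mapC2' _ _) sf cc) J0.
  rewrite Jinv_C2' opprK => J1.
  have : a * (a ^+ 2 - 9%:R) = 0.
    have [->|an0] := eqVneq a 0; first by rewrite mul0r.
    have mn0 : m != 0 by apply: contraNneq an0 => m0; rewrite -sqrf_eq0 expr2 -mm m0 mulr0 oppr0.
    have n16 : 16%:R * m != 0 by rewrite mulf_neq0 // natrS_neq0.
    apply: (mulfI n16); rewrite mulr0 -[RHS](mulr0 a) -J1.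
    transitivity (16%:R * m * a * (a * a - 9%:R)); first by ring.
    by rewrite -mm; ring.
  by move/eqP; rewrite mulf_eq0 subr_eq0 => /orP[/eqP|/eqP]; [left|right].
case: a9 => a9; first by rewrite -a9.
have rot3 : conjugate 3 (mapD2' 0) (mapD2' (- 3%:R)).
  have := @conj_D2'_rot 0; rewrite eq_sym oner_neq0 => /(_ isT).
  by rewrite add0r sub0r invrN1 mulrN1.
have rot3' : conjugate 3 (mapD2' 0) (mapD2' 3%:R).
  by apply: (conjugate_trans (s0 _) (s0 _) rot3); have := conj_D2'_neg (- 3%:R); rewrite opprK.
have : (a - 3%:R) * (a + 3%:R) = 0.
  by transitivity (a ^+ 2 - 9%:R); [ring | rewrite a9 subrr].
move/eqP; rewrite mulf_eq0 subr_eq0 addr_eq0 => /orP[/eqP e|/eqP e]; rewrite e in c.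
  exact: (conjugate_trans (s0 _) sf rot3' c).
exact: (conjugate_trans (s0 _) sf rot3 c).
Qed.

Lemma D2_div f : image_in_moduli 3 dom_ne1 famD2 f -> [:: g2 f; g1 f; g0 f] = [:: 0; 0; 0] ->
  image_in_moduli 3 dom_ne1 famD2' f.
Proof.
move=> /imD2P[rf [a an c]] gz; apply/imD2'P; split=> //; exists 0; first by rewrite mul0r eq_sym oner_neq0.
have sf := sizedR rf; have sa := sized_mapC2' a a.
have /div_C2' : [:: g2 (mapC2' a a); g1 (mapC2' a a); g0 (mapC2' a a)] = [:: 0; 0; 0].
  exact: (div0_conj sf sa (conjugate_sym sa sf c) gz).
rewrite -mulr2n => /eqP; rewrite mulrn_eq0 /= => /eqP a0; rewrite a0 in c.
exact: (conjugate_trans (sized_mapC2' _ _) sf D2'_0 c).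
Qed.

Lemma C2_C2'_diag (a : k) : a * a != 1 -> a != -1 -> exists2 b, b != 1 & - (b + 3%:R) / (b - 1) = a.
Proof.
move=> aa a1; have n0 : a + 1 != 0 by rewrite addr_eq0.
have n4 : 4%:R != 0 :> k by exact: natrS_neq0.
exists ((a - 3%:R) / (a + 1)).
  rewrite -subr_eq0 (_ : _ - 1 = - 4%:R / (a + 1)); last by field.
  by rewrite mulf_neq0 ?invr_eq0 ?oppr_eq0.
have d : (a - 3%:R) / (a + 1) - 1 = - 4%:R / (a + 1) by field.
by rewrite d; field; rewrite ?n0 ?oppr_eq0 ?n4.
Qed.

Lemma D2_C2 f : image_in_moduli 3 dom_ne1 famD2 f -> image_in_moduli 3 dom_ab famC2 f.
Proof.
move=> /imD2P[rf [a an c]]; apply/imC2P; split=> //; have sf := sizedR rf.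
have a1 : a != -1 by apply: contraNneq an => ->; rewrite mulrNN mulr1.
have [b b1 e] := C2_C2'_diag an a1; have cb := conj_C2_diag b1; rewrite e in cb.
have cf : conjugate 3 (mapC2 b b) f := conjugate_trans (sized_mapC2' _ _) sf cb c.
exists b, b; split=> //; apply: rat_mapC2_inv.
apply: conjugate_is_rat rf (conjugate_sym _ sf cf) => //; exact: sized_mapC2.
Qed.

(** On (5) the joint invariant is 4 (a - b) (a + b) ^ 2. The line a = b is (2), contained in (4); on
    a = - b, which is (3), J = 0 leads back to (2). *)
Lemma C2'_JK f : image_in_moduli 3 dom_ab famC2' f -> [:: Jinv f; Kinv f] = [:: 0; 0] ->
  image_in_moduli 3 dom_ab famC2 f.
Proof.
move=> /imC2'P[rf [a [b [ab c]]]] [J0 K0]; apply: D2_C2; have sf := sizedR rf.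
have sab := sized_mapC2' a b; have c' := conjugate_sym sab sf c.
have := Kinv_conj sf sab c' K0; rewrite Kinv_C2' => /eqP; rewrite mulf_eq0 expf_eq0 /=.
rewrite mulf_eq0 (negbTE (natrS_neq0 3)) /= subr_eq0 => /orP[/eqP e|].
  by apply/imD2P; split=> //; exists b; rewrite -{1}e.
rewrite addr_eq0 => /eqP e; apply: D2'_J; last by rewrite J0.
have e' : b = - a by rewrite e opprK.
by rewrite e' in ab c; apply/imD2'_C2'; split=> //; exists a => //; rewrite -mulrN.
Qed.

(** If a and b differ, the minors would make both equal to - 3; so a = b, and the map lies in
    (2). *)
Lemma C2_minors f : image_in_moduli 3 dom_ab famC2 f ->
  minors (g2 f, g1 f, g0 f) (Tcov f) = [:: 0; 0; 0] -> image_in_moduli 3 dom_ab famC2' f.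
Proof.
move=> /imC2P[rf [a [b [ab c]]]] M; apply/imC2'P; have sf := sizedR rf.
have sab := sized_mapC2 a b; have c' := conjugate_sym sab sf c.
have [h1 h2] := minors_C2 (minors_conj sf sab c' M).
have e : a = b.
  apply/eqP/negP => /negP abn; have n0 : a - b != 0 by rewrite subr_eq0.
  have h := mulfI n0 (etrans h1 (esym h2)); case/eqP: n0.
  by transitivity ((a + 3%:R) - (3%:R + b)); [ring | rewrite h subrr].
rewrite e in ab c; have b1 : b != 1 by apply: contraNneq ab => ->; rewrite mulr1.
have cb := conj_C2_diag b1; set t := _ / _ in cb.
have ct := conjugate_trans (sized_mapC2 _ _) sf (conjugate_sym (sized_mapC2 _ _) (sized_mapC2' _ _) cb) c.
split=> //; exists t, t; split=> //; apply: rat_mapC2'_inv.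
apply: conjugate_is_rat rf (conjugate_sym _ sf ct) => //; exact: sized_mapC2'.
Qed.

Lemma C2_JK f : image_in_moduli 3 dom_ab famC2 f -> [:: Jinv f; Kinv f] = [:: 0; 0].
Proof.
move=> /imC2P[rf [a [b [ab c]]]]; have sf := sizedR rf; have sab := sized_mapC2 a b.
by congr [:: _; _]; [apply: (Jinv_conj sab sf c (Jinv_C2 a b)) | apply: (Kinv_conj sab sf c (Kinv_C2 a b))].
Qed.

Lemma C2'_minors f : image_in_moduli 3 dom_ab famC2' f ->
  minors (g2 f, g1 f, g0 f) (Tcov f) = [:: 0; 0; 0].
Proof.
move=> /imC2'P[rf [a [b [ab c]]]].
exact: (minors_conj (sized_mapC2' a b) (sizedR rf) c (minors_C2' a b)).
Qed.

Lemma in_C2 (a b : k) : a * b != 1 -> image_in_moduli 3 dom_ab famC2 (mapC2 a b).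
Proof.
move=> ab; apply/imC2P; split; first exact: rat_mapC2.
by exists a, b; split=> //; exact/conjugate_refl/sized_mapC2.
Qed.

Lemma in_C2' (a b : k) : a * b != 1 -> image_in_moduli 3 dom_ab famC2' (mapC2' a b).
Proof.
move=> ab; apply/imC2'P; split; first exact: rat_mapC2'.
by exists a, b; split=> //; exact/conjugate_refl/sized_mapC2'.
Qed.

Lemma irreducible_D2 (fam : 'rV[k]_1 -> ratmap) (s1 s2 : seq {mpoly k[1]}) :
  (forall x i, (i < 4)%N -> (fam x).1`_i = (s1`_i).@[x 0]) ->
  (forall x i, (i < 4)%N -> (fam x).2`_i = (s2`_i).@[x 0]) ->
  (forall x, dom_ne1 x -> is_rat 3 (fam x)) ->
  irreducible_set (moduli_closed 3) (image_in_moduli 3 dom_ne1 fam).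
Proof.
move=> H1 H2 rat; pose X : {mpoly k[1]} := 'X_0.
apply: (@irreducible_image _ _ _ ((X - 1) * (X + 1)) (fun i => s1`_i) (fun i => s2`_i)).
- apply/eqP => e; have := congr1 (fun p => p.@[fun=> 0]) e.
  rewrite mevalM mevalB mevalD mevalXU meval1 meval0 sub0r add0r mulr1 => /eqP.
  by rewrite oppr_eq0 oner_eq0.
- move=> x; rewrite /dom_ne1 /param1 mevalM mevalB mevalD mevalXU meval1 mulf_eq0 negb_or.
  by rewrite subr_eq0 addr_eq0; split=> [[-> ->]|/andP[]].
- by move=> x i; exact/H1/ltn_ord.
- by move=> x i; exact/H2/ltn_ord.
exact: rat.
Qed.

Lemma irreducible_C2 (fam : 'rV[k]_2 -> ratmap) (s1 s2 : seq {mpoly k[2]}) :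
  (forall x i, (i < 4)%N -> (fam x).1`_i = (s1`_i).@[x 0]) ->
  (forall x i, (i < 4)%N -> (fam x).2`_i = (s2`_i).@[x 0]) ->
  (forall x, dom_ab x -> is_rat 3 (fam x)) ->
  irreducible_set (moduli_closed 3) (image_in_moduli 3 dom_ab fam).
Proof.
move=> H1 H2 rat.
apply: (@irreducible_image _ _ _ ('X_0 * 'X_1 - 1) (fun i => s1`_i) (fun i => s2`_i)).
- apply/eqP => e; have := congr1 (fun p => p.@[fun=> 0]) e.
  rewrite mevalB mevalM !mevalXU meval1 meval0 mul0r sub0r => /eqP.
  by rewrite oppr_eq0 oner_eq0.
- by move=> x; rewrite /dom_ab mevalB mevalM !mevalXU meval1 subr_eq0.
- by move=> x i; exact/H1/ltn_ord.
- by move=> x i; exact/H2/ltn_ord.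
exact: rat.
Qed.

Ltac coef_tac := move=> x [|[|[|[|i]]]] //= _;
  rewrite ?coefsE /= ?mevalXU ?mevalN ?meval1 ?meval0 ?mevalXU /param1; ring.

Lemma rat_D2 x : dom_ne1 x -> is_rat 3 (famD2 x).
Proof. by case=> u1 u2; apply: rat_mapC2'; exact: sqr_neq1. Qed.

Lemma rat_D2' x : dom_ne1 x -> is_rat 3 (famD2' x).
Proof. by case=> u1 u2; apply: rat_mapD2'; exact: sqr_neq1. Qed.

Lemma rat_C2 x : dom_ab x -> is_rat 3 (famC2 x).
Proof. exact: rat_mapC2. Qed.

Lemma rat_C2' x : dom_ab x -> is_rat 3 (famC2' x).
Proof. exact: rat_mapC2'. Qed.

Lemma D2_component : irreducible_component (moduli_closed 3) (aut_locus 3 grpD2)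
  (image_in_moduli 3 dom_ne1 famD2).
Proof.
apply: (component locus_D2P _ closed_J closed_div0 D2_J D2'_div D2'_J).
  by apply: (@irreducible_D2 _ [:: 1; 0; 'X_0; 0] [:: 0; 'X_0; 0; 1]) rat_D2; coef_tac.
have n41 : 2%:R * 2%:R != 1 :> k by rewrite -natrM (eqr_nat _ 4 1).
exists (mapC2' 2%:R 2%:R).
  apply/imD2P; split; first exact: rat_mapC2'.
  by exists 2%:R => //; exact/conjugate_refl/sized_mapC2'.
by move/div_C2'/eqP; rewrite -natrD (eqr_nat _ 4 0).
Qed.

Lemma D2'_component : irreducible_component (moduli_closed 3) (aut_locus 3 grpD2)
  (image_in_moduli 3 dom_ne1 famD2').
Proof.
have locus f : aut_locus 3 grpD2 f <->
    image_in_moduli 3 dom_ne1 famD2' f \/ image_in_moduli 3 dom_ne1 famD2 f.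
  by rewrite locus_D2P or_comm.
apply: (component locus _ closed_div0 closed_J D2'_div D2_J D2_div).
  by apply: (@irreducible_D2 _ [:: -1; 0; 'X_0; 0] [:: 0; - 'X_0; 0; 1]) rat_D2'; coef_tac.
have n11 : - (1 * 1) != 1 :> k.
  by rewrite mulr1 eq_sym -subr_eq0 opprK (natrS_neq0 1).
exists (mapC2' 1 (- 1)).
  apply/imD2'_C2'; split; first by apply: rat_mapC2'; rewrite mulrN.
  by exists 1 => //; exact/conjugate_refl/sized_mapC2'.
case; rewrite Jinv_C2' opprK => /eqP.
rewrite (_ : _ * _ = - 160%:R); last by ring.
by rewrite oppr_eq0 (negbTE (natrS_neq0 159)).
Qed.

Lemma C2_component : irreducible_component (moduli_closed 3) (aut_locus 3 grpC2)
  (image_in_moduli 3 dom_ab famC2).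
Proof.
apply: (component locus_C2P _ closed_JK closed_minors C2_JK C2'_minors C2'_JK).
  by apply: (@irreducible_C2 _ [:: 0; 'X_0; 0; 1] [:: 1; 0; 'X_1; 0]) rat_C2; coef_tac.
exists (mapC2 1 0); first by apply: in_C2; rewrite mulr0 eq_sym oner_neq0.
case/minors_C2 => + _; rewrite subr0 mul1r addr0 => /eqP.
by rewrite (negbTE (natrS_neq0 2)).
Qed.

Lemma C2'_component : irreducible_component (moduli_closed 3) (aut_locus 3 grpC2)
  (image_in_moduli 3 dom_ab famC2').
Proof.
have locus f : aut_locus 3 grpC2 f <->
    image_in_moduli 3 dom_ab famC2' f \/ image_in_moduli 3 dom_ab famC2 f.
  by rewrite locus_C2P or_comm.
apply: (component locus _ closed_minors closed_JK C2'_minors C2_JK C2_minors).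
  by apply: (@irreducible_C2 _ [:: 1; 0; 'X_0; 0] [:: 0; 'X_1; 0; 1]) rat_C2'; coef_tac.
exists (mapC2' 1 0); first by apply: in_C2'; rewrite mulr0 eq_sym oner_neq0.
case=> _; rewrite Kinv_C2' => /eqP; rewrite (_ : _ * _ = 4%:R); last by ring.
by rewrite (negbTE (natrS_neq0 3)).
Qed.

(** * Fibres of the families *)

Lemma par1_inj : injective par1.
Proof. by move=> a b /(congr1 param1); rewrite !par1E. Qed.

Lemma par1K x : x = par1 (param1 x).
Proof. by apply/rowP => i; rewrite mxE /param1 (ord1 i). Qed.

Lemma row2K (x : 'rV[k]_2) : x = row2 (x 0 0) (x 0 1).
Proof.
by apply/rowP => -[[|[|//]] i]; rewrite mxE /=; congr (x _ _); apply/val_inj.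
Qed.

Lemma row2_inj a b c d : row2 a b = row2 c d -> a = c /\ b = d.
Proof. by move=> e; move: (row20 a b) (row21 a b); rewrite e row20 row21. Qed.

(** Each of a, b occurs in the spectrum of the other. If they differ then a b = 3 - 2 b and a b = 3
    - 2 a, a contradiction. *)
Lemma C3_one_to_one : one_to_one 3 dom_ne0 famC3.
Proof.
move=> x y ux uy; rewrite (par1K x) (par1K y); move: ux uy; rewrite /dom_ne0.
move: (param1 x) (param1 y) => a b an0 bn0; rewrite !famC3E !par1E => c; congr par1.
have sb := sized_mapC3 b.
have p1 := spectrumC3 an0 sb c; have p2 := spectrumC3 bn0 sb (conjugate_refl sb).
have p : perm_eq [:: a; 3%:R / a - 2%:R; 3%:R / a - 2%:R; 3%:R / a - 2%:R]
    [:: b; 3%:R / b - 2%:R; 3%:R / b - 2%:R; 3%:R / b - 2%:R] by rewrite -(permPl p1).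
have inv3 (t s : k) : s != 0 -> t = 3%:R / s - 2%:R -> s * t = 3%:R - 2%:R * s.
  by move=> sn0 ->; rewrite mulrBr mulrCA divff // mulr1 mulrC.
have ma := perm_mem p a; have mb := perm_mem p b.
rewrite !inE eqxx /= !orbb in ma; rewrite !inE eqxx /= !orbb in mb.
case/esym/orP: ma => [/eqP //|/eqP /(inv3 _ _ bn0) e1].
case/orP: mb => [/eqP //|/eqP /(inv3 _ _ an0) e2].
apply: (mulfI (natrS_neq0 1)).
by transitivity (3%:R - (3%:R - 2%:R * a)); [ring | rewrite -e2 mulrC e1; ring].
Qed.

Lemma kap_conj (a b a' b' : k) : a * b != 1 -> a' * b' != 1 ->
  conjugate 3 (mapC2' a b) (mapC2' a' b') -> kap a b = kap a' b'.
Proof.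
move=> ab ab' c; have sb := sized_mapC2' a' b'.
have [u [v [_ [_ [[e _] _ p _]]]]] := spectrumC2' ab sb c.
have [u' [v' [_ [_ [[e' _] _ p' _]]]]] := spectrumC2' ab' sb (conjugate_refl sb).
have : es 1 [:: u; u; v; v] = es 1 [:: u'; u'; v'; v'] by apply: es_perm; rewrite -(permPl p).
rewrite /= => E; have n4 : - 4%:R != 0 :> k by rewrite oppr_eq0 natrS_neq0.
apply: (mulfI n4).
transitivity (2%:R * (u + v) - 4%:R); first by rewrite e; ring.
transitivity (2%:R * (u' + v') - 4%:R); last by rewrite e'; ring.
congr (_ - _); transitivity (0 + v * 1 + v * 1 + u * 1 + u * 1); first by ring.
by rewrite E; ring.
Qed.

Lemma dom_ne1P a : dom_ne1 (par1 a) <-> a * a != 1.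
Proof.
rewrite /dom_ne1 par1E; split=> [[]|h]; first exact: sqr_neq1.
by split; apply: contraNneq h => ->; rewrite ?mulrNN mulr1.
Qed.

Lemma D2_two_to_one : n_to_one 2 3 dom_ne1 famD2.
Proof.
exists 'X_0.
  by apply/eqP => /(congr1 (fun p => p.@[fun=> 1])); rewrite mevalXU meval0 => /eqP; rewrite oner_eq0.
move=> x; rewrite (par1K x) mevalXU; move: (param1 x) => a; rewrite mxE => ux an0.
exists [:: par1 a; par1 (- a)]; split=> // [|y].
  rewrite /= inE andbT (inj_eq par1_inj) -subr_eq0 opprK -mulr2n mulrn_eq0 /=; exact: an0.
rewrite (par1K y); move: (param1 y) => b; rewrite !inE !(inj_eq par1_inj) !famD2E !par1E !dom_ne1P.
move/dom_ne1P: ux => aa; split=> [/orP[]/eqP->|[bb c]].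
- by split=> //; exact/conjugate_refl/sized_mapC2'.
- by split; [rewrite mulrNN | exact: conj_C2'_neg].
have := kap_conj aa bb c; rewrite !kapD2.
have ha : 1 - a * a != 0 by rewrite subr_eq0 eq_sym.
move=> /(mulfI (natrS_neq0 3)) /invr_inj e.
have : (b - a) * (b + a) = 0.
  by transitivity ((1 - a * a) - (1 - b * b)); [ring | rewrite e subrr].
by move/eqP; rewrite mulf_eq0 subr_eq0 addr_eq0.
Qed.

(** Odd in a and invariant under a |-> - (a + 3) / (a - 1), of order three. Its square, of degree
    six, is thus the quotient coordinate for the group acting on the parameter of (3). *)
Definition Tinv (a : k) : k := a * (9%:R - a ^+ 2) / (1 - a * a).

(** Here kap = 4, so all four fixed-point multipliers are - 3 and only period 2 carries information;
    this is where the four entries 9 come from. *)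
Lemma spectrumD2' f (a : k) : a * a != 1 -> sized 3 f -> conjugate 3 (mapD2' a) f -> exists x y z,
  [/\ perm_eq (multipliers 3 2 f)
        [:: x; x; 9%:R; 9%:R; 9%:R; 9%:R; y; y; z; z],
      x + y + z = Tinv a ^+ 2 + 18%:R,
      x * y + x * z + y * z = 81%:R + 2%:R * Tinv a ^+ 2 &
      x * y * z = Tinv a ^+ 2].
Proof.
move=> aa sf cf; have [m mm c'] := D2'_diag a.
have {}c' := conjugate_trans (sized_mapD2' a) sf c' cf.
have mn : m * - m != 1 by rewrite mulrN mm.
have [u [v [w1 [w2 [[e1 e2] [e3 e4] _ p]]]]] := spectrumC2' mn sf c'.
rewrite kapD2' ?mm // in e1 e2 e3.
have u3 : (u + 3%:R) ^+ 2 = 0.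
  transitivity (u * (u + v) - u * v + 6%:R * u + 9%:R); first by ring.
  by rewrite e1 e2; ring.
have {}u3 : u = - 3%:R by move/eqP: u3; rewrite expf_eq0 /= addr_eq0 => /eqP.
have v3 : v = - 3%:R by transitivity ((u + v) - u); [ring | rewrite e1 u3; ring].
have d0 : 1 - a * a != 0 by rewrite subr_eq0 eq_sym.
have et : eta m (- m) = 8%:R / (1 - a * a) by rewrite /eta mulrN mm.
rewrite et in e3.
have S2 : w1 + w2 = (6%:R + 2%:R * a * a) / (1 - a * a) by rewrite e3; field.
have P2 : w1 * w2 = (9%:R - a ^+ 2) / (1 - a * a) by rewrite e4 S2; field.
have Q : w1 * w1 + w2 * w2 =
    ((6%:R + 2%:R * a * a) / (1 - a * a)) ^+ 2 - 2%:R * ((9%:R - a ^+ 2) / (1 - a * a)).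
  by rewrite -S2 -P2; ring.
exists (a * a), (w1 * w1), (w2 * w2); split.
- move: p; rewrite u3 v3 mulrN mm mulrNN (_ : 3%:R * 3%:R = 9%:R) //; first by ring.
- by rewrite -addrA Q /Tinv; field.
- transitivity (a * a * (w1 * w1 + w2 * w2) + (w1 * w2) ^+ 2); first by ring.
  by rewrite Q P2 /Tinv; field.
transitivity (a * a * (w1 * w2) ^+ 2); first by ring.
by rewrite P2 /Tinv; field.
Qed.

Lemma Tinv_conj (a b : k) : a * a != 1 -> b * b != 1 ->
  conjugate 3 (mapD2' a) (mapD2' b) -> Tinv a ^+ 2 = Tinv b ^+ 2.
Proof.
move=> aa bb c; have sb := sized_mapD2' b.
have [x [y [z [p e _ _]]]] := spectrumD2' aa sb c.
have [x' [y' [z' [p' e' _ _]]]] := spectrumD2' bb sb (conjugate_refl sb).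
have : es 1 [:: x; x; 9%:R; 9%:R; 9%:R; 9%:R; y; y; z; z] =
       es 1 [:: x'; x'; 9%:R; 9%:R; 9%:R; 9%:R; y'; y'; z'; z'].
  by apply: es_perm; rewrite -(permPl p).
rewrite /= => Es; apply: (mulfI (natrS_neq0 1)).
apply: (addIr (36%:R + 36%:R)).
transitivity (2%:R * (x + y + z) + 36%:R); first by rewrite e; ring.
transitivity (2%:R * (x' + y' + z') + 36%:R); last by rewrite e'; ring.
transitivity (0 + z * 1 + z * 1 + y * 1 + y * 1 + 9%:R * 1 + 9%:R * 1 + 9%:R * 1 + 9%:R * 1
  + x * 1 + x * 1); first by ring.
by rewrite Es; ring.
Qed.

Lemma neq_by (x y e : k) : x - y = e -> e != 0 -> x != y.
Proof. by move=> <-; rewrite subr_eq0. Qed.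

Lemma D2'_six_to_one : n_to_one 6 3 dom_ne1 famD2'.
Proof.
pose X : {mpoly k[1]} := 'X_0.
(* The zeros are the parameters at which two of the six values a, - a, r, - r, q, - q coincide. *)
exists (X * (X ^+ 2 - 9%:R%:MP) * (X ^+ 2 + 3%:R%:MP)).
  apply/eqP => /(congr1 (fun p => p.@[fun=> 1])).
  rewrite !(mevalM, mevalB, mevalD, mevalC, rmorphXn, mevalXU, meval0) /= ?mevalXU.
  rewrite (_ : _ * _ = - 32%:R); last by ring.
  by move/eqP; rewrite oppr_eq0 (negbTE (natrS_neq0 31)).
move=> x; rewrite (par1K x) !(mevalM, mevalB, mevalD, mevalC, rmorphXn, mevalXU) /= ?mevalXU.
move: (param1 x) => a; rewrite mxE => ux; rewrite !mulf_eq0 !negb_or -andbA => /and3P[n0 n9 n5].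
have [n1 n2] : a - 1 != 0 /\ a + 1 != 0.
  by case: ux; rewrite par1E subr_eq0 addr_eq0.
have [n3 n4] : a - 3%:R != 0 /\ a + 3%:R != 0.
  by apply/andP; rewrite -negb_or -mulf_eq0 (_ : _ * _ = a ^+ 2 - 9%:R) //; ring.
have t2 := natrS_neq0 1; have t8 := natrS_neq0 7.
pose r := (a + 3%:R) / (a - 1); pose q := (a - 3%:R) / (a + 1).
have nN (z : k) : z != 0 -> - z != 0 by rewrite oppr_eq0.
have dr (z : k) : z != 0 -> z / (a - 1) != 0 by move=> zn; rewrite mulf_neq0 ?invr_eq0.
have dq (z : k) : z != 0 -> z / (a + 1) != 0 by move=> zn; rewrite mulf_neq0 ?invr_eq0.
have m2 (z w : k) : z != 0 -> w != 0 -> z * w != 0 by exact: mulf_neq0.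
exists [seq par1 b | b <- [:: a; - a; r; - r; q; - q]]; split=> // [|y].
  rewrite (map_inj_uniq par1_inj) /= !inE !negb_or -!andbA andbT.
  apply/and5P; split; [| | | |apply/and5P; split; [| | | |apply/and5P; split; [| | | |]]].
  - by apply: (@neq_by _ _ (2%:R * a)); [ring | exact: m2].
  - by apply: (@neq_by _ _ ((a - 3%:R) * (a + 1) / (a - 1))); [rewrite /r; field | exact/dr/m2].
  - by apply: (@neq_by _ _ ((a ^+ 2 + 3%:R) / (a - 1))); [rewrite /r; field | exact/dr].
  - by apply: (@neq_by _ _ ((a ^+ 2 + 3%:R) / (a + 1))); [rewrite /q; field | exact/dq].
  - by apply: (@neq_by _ _ ((a + 3%:R) * (a - 1) / (a + 1))); [rewrite /q; field | exact/dq/m2].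
  - by apply: (@neq_by _ _ (- ((a ^+ 2 + 3%:R) / (a - 1)))); [rewrite /r; field | exact/nN/dr].
  - by apply: (@neq_by _ _ (- ((a - 3%:R) * (a + 1) / (a - 1)))); [rewrite /r; field | exact/nN/dr/m2].
  - by apply: (@neq_by _ _ (- ((a + 3%:R) * (a - 1) / (a + 1)))); [rewrite /q; field | exact/nN/dq/m2].
  - by apply: (@neq_by _ _ (- ((a ^+ 2 + 3%:R) / (a + 1)))); [rewrite /q; field | exact/nN/dq].
  - by apply: (@neq_by _ _ (2%:R * (a + 3%:R) / (a - 1))); [rewrite /r; field | exact/dr/m2].
  - by apply: (@neq_by _ _ (8%:R * a / (a - 1) / (a + 1)));
      [rewrite /r /q; field; rewrite ?n1 ?n2 | exact/dq/dr/m2].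
  - by apply: (@neq_by _ _ (2%:R * (a ^+ 2 + 3%:R) / (a - 1) / (a + 1)));
      [rewrite /r /q; field; rewrite ?n1 ?n2 | exact/dq/dr/m2].
  - apply/and3P; split.
    + by apply: (@neq_by _ _ (- (2%:R * (a ^+ 2 + 3%:R) / (a - 1) / (a + 1))));
        [rewrite /r /q; field; rewrite ?n1 ?n2 | exact/nN/dq/dr/m2].
    + by apply: (@neq_by _ _ (- (8%:R * a / (a - 1) / (a + 1))));
        [rewrite /r /q; field; rewrite ?n1 ?n2 | exact/nN/dq/dr/m2].
    by apply: (@neq_by _ _ (2%:R * (a - 3%:R) / (a + 1))); [rewrite /q; field | exact/dq/m2].
rewrite (par1K y); move: (param1 y) => b; rewrite (mem_map par1_inj) !famD2'E !par1E dom_ne1P.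
move/dom_ne1P: ux => aa.
have a1 : a != 1 by rewrite -subr_eq0.
have a1' : - a != 1 by rewrite eqr_oppLR -subr_eq0 opprK.
have s0 := sized_mapD2'.
have cr : conjugate 3 (mapD2' a) (mapD2' r) by exact: conj_D2'_rot.
have cq : conjugate 3 (mapD2' a) (mapD2' q).
  apply: (conjugate_trans (s0 _) (s0 _) (conj_D2'_neg a)).
  have := conj_D2'_rot a1'; rewrite (_ : (- a + 3%:R) / (- a - 1) = q) //.
  rewrite (_ : - a + 3%:R = - (a - 3%:R)); last by ring.
  by rewrite -opprD invrN mulrNN.
have neg z : conjugate 3 (mapD2' a) (mapD2' z) -> conjugate 3 (mapD2' a) (mapD2' (- z)).
  by move=> cz; apply: (conjugate_trans (s0 _) (s0 _) cz (conj_D2'_neg z)).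
have rr : r * r != 1.
  apply: (@neq_by _ _ (8%:R * (a + 1) / (a - 1) / (a - 1))); last exact/dr/dr/m2.
  by rewrite /r; field.
have qq : q * q != 1.
  apply: (@neq_by _ _ (- (8%:R * (a - 1) / (a + 1) / (a + 1)))); last exact/nN/dq/dq/m2.
  by rewrite /q; field.
split=> [|[bb c]].
  rewrite !inE => /orP[/eqP->|/orP[/eqP->|/orP[/eqP->|/orP[/eqP->|/orP[/eqP->|/eqP->]]]]].
  - by split=> //; exact/conjugate_refl.
  - by rewrite mulrNN; split=> //; exact/neg/conjugate_refl.
  - by [].
  - by rewrite mulrNN; split=> //; exact: neg.
  - by [].
  by rewrite mulrNN; split=> //; exact: neg.
(* Cleared of denominators, the equation is cubic in z, with roots a, - r and q. *)
have key (z : k) : z * z != 1 -> Tinv z = Tinv a -> z \in [:: a; - r; q].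
  move=> zz; rewrite /Tinv => e.
  have ha : 1 - a * a != 0 by rewrite subr_eq0 eq_sym.
  have hz : 1 - z * z != 0 by rewrite subr_eq0 eq_sym.
  have : (z - a) * ((z + r) * (z - q)) = 0.
    apply: (mulfI (mulf_neq0 n1 n2)); rewrite mulr0.
    transitivity ((z * (9%:R - z ^+ 2) / (1 - z * z) - a * (9%:R - a ^+ 2) / (1 - a * a))
       * ((1 - z * z) * (1 - a * a))); last by rewrite e subrr mul0r.
    transitivity (z * (9%:R - z ^+ 2) * (1 - a * a) - a * (9%:R - a ^+ 2) * (1 - z * z)).
      by rewrite /r /q; field; rewrite n1 n2.
    by field; rewrite ha hz.
  by move/eqP; rewrite !mulf_eq0 !subr_eq0 addr_eq0 !inE.
have /eqP : Tinv b ^+ 2 = Tinv a ^+ 2 by rewrite (Tinv_conj aa bb c).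
rewrite eqf_sqr => /orP[/eqP/(key b bb)|/eqP e].
  by rewrite !inE => /or3P[] ->; rewrite ?orbT.
have : - b \in [:: a; - r; q].
  by apply: key; rewrite ?mulrNN // -[RHS]opprK -e /Tinv mulrNN sqrrN !mulNr.
by rewrite !inE eqr_opp eqr_oppLR [- b == q]eqr_oppLR => /or3P[] ->; rewrite ?orbT.
Qed.

Lemma perm_eq2 (a b c d : k) : perm_eq [:: a; b] [:: c; d] -> c = a /\ d = b \/ c = b /\ d = a.
Proof.
move=> p; have : c \in [:: a; b] by rewrite (perm_mem p) inE eqxx.
rewrite !inE => /orP[/eqP e|/eqP e]; rewrite e in p *; [left|right]; split=> //.
  by move: p; rewrite perm_cons => /perm_mem/(_ d); rewrite !inE eqxx => /eqP.
have : perm_eq [:: b; a] [:: b; d] by rewrite -(permPr p); apply/seq.permP => f /=; rewrite !addn0 addnC.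
by rewrite perm_cons => /perm_mem/(_ d); rewrite !inE eqxx => /eqP.
Qed.

(** On the left only u occurs at least twice, so v = u and the pair can be cancelled. *)
Lemma perm_eq_doubled (a b u c d v : k) : a != b -> a != u -> b != u ->
  perm_eq [:: a; b; u; u] [:: c; d; v; v] -> perm_eq [:: a; b] [:: c; d].
Proof.
move=> ab au bu p; have cnt := seq.permP p (pred1 v).
have uv : u = v.
  apply/eqP; move: cnt; rewrite /= eqxx !addn0; case: (u == v) => //.
  case: (eqVneq a v) => [av|_] /=.
    by rewrite -av [b == a]eq_sym (negbTE ab); case: (c == a); case: (d == a).
  by case: (b == v); case: (c == v); case: (d == v).
by move: p; rewrite uv -[X in perm_eq X]/([:: a; b] ++ [:: v; v]) -[X in perm_eq _ X]/([:: c; d] ++ [:: v; v]) perm_cat2r.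
Qed.

Lemma C2_two_to_one : n_to_one 2 3 dom_ab famC2.
Proof.
pose A : {mpoly k[2]} := 'X_0; pose B : {mpoly k[2]} := 'X_1.
(* The numerator of the double multiplier u; the polynomial below is nonzero where a, b and u are
   pairwise distinct. *)
pose N := 3%:R%:MP - 2%:R%:MP * A - 2%:R%:MP * B + A * B.
exists ((A - B) * (A * (1 - A * B) - N) * (B * (1 - A * B) - N)).
  apply/eqP => /(congr1 (fun p => p.@[fun i => if i == 0 then 2%:R else 0])).
  rewrite !(mevalM, mevalB, mevalD, mevalC, meval1, meval0, mevalXU) /=.
  rewrite (_ : _ * _ = 6%:R); last by ring.
  by move/eqP; rewrite (negbTE (natrS_neq0 5)).
move=> x; rewrite (row2K x) !(mevalM, mevalB, mevalD, mevalC, meval1, mevalXU) /= !row20 !row21.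
rewrite /dom_ab row20 row21; move: (x 0 0) (x 0 1) => a b ux.
rewrite !mulf_eq0 !negb_or -andbA => /and3P[n1 n2 n3].
have d0 : 1 - a * b != 0 by rewrite subr_eq0 eq_sym.
exists [:: row2 a b; row2 b a]; split=> // [|y].
  rewrite /= inE andbT; apply/eqP => /row2_inj[e _]; by rewrite e subrr eqxx in n1.
rewrite (row2K y) !famC2E !row20 !row21; move: (y 0 0) (y 0 1) => c d; rewrite !inE; split.
  case/orP=> /eqP /row2_inj[-> ->]; split=> //.
  - exact/conjugate_refl/sized_mapC2.
  - by rewrite mulrC.
  exact: conj_C2_swap.
case=> cd cc; have sc := sized_mapC2 c d.
have p1 := spectrumC2 ux sc cc; have p2 := spectrumC2 cd sc (conjugate_refl sc).
set u := _ / _ in p1; set v := _ / _ in p2.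
have p : perm_eq [:: a; b; u; u] [:: c; d; v; v] by rewrite -(permPl p1).
have ab : a != b by rewrite -subr_eq0.
have au : a != u by apply: contraNneq n2 => e; rewrite {1}e subr_eq0 /u divfK.
have bu : b != u by apply: contraNneq n3 => e; rewrite {1}e subr_eq0 /u divfK.
by case: (perm_eq2 (perm_eq_doubled ab au bu p)) => [[-> ->]|[-> ->]]; rewrite eqxx ?orbT.
Qed.

(** The divergence is 2 (a + b) x y, so for a + b != 0 a conjugation preserves the pair 0, infinity
    and its matrix is diagonal or antidiagonal. Comparing the quartics then leaves a sign m and a
    possible exchange. *)
Lemma C2'_conj (a b c d : k) : a + b != 0 -> conjugate 3 (mapC2' a b) (mapC2' c d) ->
  exists2 m, m ^+ 2 = 1 & c = m * a /\ d = m * b \/ c = m * b /\ d = m * a.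
Proof.
move=> ab /(conj_forms (sized_mapC2' _ _) (sized_mapC2' _ _))[p [q [r [s [t [dn0 tn0]]]]]].
have [[-> -> -> ->] [-> -> -> ->]] := formsC2' a b.
have [[-> -> -> ->] [-> -> -> ->]] := formsC2' c d => h4 h2.
have n2 := natrS_neq0 1.
have [H1 H2 H3] : [/\ p * r = 0, (a + b) * (p * s + q * r) = t * (c + d) & q * s = 0].
  case: h2 => e1 e2 e3; split.
  - by apply: (mulfI (mulf_neq0 n2 ab)); rewrite mulr0 -[RHS](mulr0 t) -e1 /quadric; ring.
  - by apply: (mulfI n2); transitivity (t * (2%:R * (c + d))); [rewrite -e2; ring | ring].
  by apply: (mulfI (mulf_neq0 n2 ab)); rewrite mulr0 -[RHS](mulr0 t) -e3 /quadric; ring.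
have [E4 E2 E0] : [/\ - p ^+ 4 + (a - b) * p ^+ 2 * r ^+ 2 + r ^+ 4 = - (t * (p * s - q * r)),
     - (6%:R * p ^+ 2 * q ^+ 2) + (a - b) * (p ^+ 2 * s ^+ 2 + 4%:R * p * q * r * s + q ^+ 2 * r ^+ 2)
       + 6%:R * r ^+ 2 * s ^+ 2 = t * (p * s - q * r) * (c - d) &
     - q ^+ 4 + (a - b) * q ^+ 2 * s ^+ 2 + s ^+ 4 = t * (p * s - q * r)].
  case: h4 => e4 _ e2 _ e0; split.
  - by transitivity (t * (p * s - q * r) * -1); [rewrite -e4 /quartic; ring | ring].
  - by rewrite -e2; ring.
  by transitivity (t * (p * s - q * r) * 1); [rewrite -e0 /quartic; ring | ring].
have [[p0 s0]|[q0 r0]] : p = 0 /\ s = 0 \/ q = 0 /\ r = 0.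
  move/eqP: H1; rewrite mulf_eq0 => /orP[/eqP p0|/eqP r0].
    left; split=> //; apply/eqP; move/eqP: H3; rewrite mulf_eq0 => /orP[/eqP q0|//].
    by case/eqP: dn0; rewrite p0 q0 !mul0r subrr.
  right; split=> //; apply/eqP; move/eqP: H3; rewrite mulf_eq0 => /orP[//|/eqP s0].
  by case/eqP: dn0; rewrite r0 s0 !mulr0 subrr.
- rewrite p0 s0 in dn0 H2 E4 E2 E0.
  have dn1 : q * r != 0 by apply: contraNneq dn0 => h; rewrite h mul0r subrr.
  pose m := (q * r) / t.
  have tm : t * m = q * r by rewrite /m mulrC divfK.
  have F4 : r ^+ 4 = t * (q * r) by transitivity (- (t * (0 * 0 - q * r))); [rewrite -E4|]; ring.
  have F0 : q ^+ 4 = t * (q * r) by apply: oppr_inj; transitivity (t * (0 * 0 - q * r)); [rewrite -E0|]; ring.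
  have m2 : m ^+ 2 = 1.
    apply: (mulfI (expf_neq0 2 (mulf_neq0 tn0 dn1))); rewrite mulr1.
    transitivity ((t * m) ^+ 2 * (q * r) ^+ 2); first by ring.
    by rewrite tm; transitivity (q ^+ 4 * r ^+ 4); [ring | rewrite F0 F4; ring].
  have G1 : c + d = m * (a + b).
    by apply: (mulfI tn0); rewrite -H2 mulrA tm; ring.
  have G2 : c - d = - (m * (a - b)).
    apply: (mulfI (mulf_neq0 tn0 dn1)).
    transitivity (- (t * (0 * 0 - q * r) * (c - d))); first by ring.
    rewrite -E2; transitivity (- (a - b) * (q * r) * (t * m)); last by ring.
    by rewrite tm; ring.
  exists m => //; right; split; apply: (mulfI n2).
    by transitivity ((c + d) + (c - d)); [ring | rewrite G1 G2; ring].
  by transitivity ((c + d) - (c - d)); [ring | rewrite G1 G2; ring].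
rewrite q0 r0 in dn0 H2 E4 E2 E0.
have dn1 : p * s != 0 by apply: contraNneq dn0 => h; rewrite h mul0r subrr.
pose m := (p * s) / t.
have tm : t * m = p * s by rewrite /m mulrC divfK.
have F4 : p ^+ 4 = t * (p * s) by apply: oppr_inj; transitivity (- (t * (p * s - 0 * 0))); [rewrite -E4|]; ring.
have F0 : s ^+ 4 = t * (p * s) by transitivity (t * (p * s - 0 * 0)); [rewrite -E0|]; ring.
have m2 : m ^+ 2 = 1.
  apply: (mulfI (expf_neq0 2 (mulf_neq0 tn0 dn1))); rewrite mulr1.
  transitivity ((t * m) ^+ 2 * (p * s) ^+ 2); first by ring.
  by rewrite tm; transitivity (p ^+ 4 * s ^+ 4); [ring | rewrite F0 F4; ring].
have G1 : c + d = m * (a + b).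
  by apply: (mulfI tn0); rewrite -H2 mulrA tm; ring.
have G2 : c - d = m * (a - b).
  apply: (mulfI (mulf_neq0 tn0 dn1)).
  transitivity (t * (p * s - 0 * 0) * (c - d)); first by ring.
  rewrite -E2; transitivity ((a - b) * (p * s) * (t * m)); last by ring.
  by rewrite tm; ring.
exists m => //; left; split; apply: (mulfI n2).
  by transitivity ((c + d) + (c - d)); [ring | rewrite G1 G2; ring].
by transitivity ((c + d) - (c - d)); [ring | rewrite G1 G2; ring].
Qed.

Lemma C2'_four_to_one : n_to_one 4 3 dom_ab famC2'.
Proof.
pose A : {mpoly k[2]} := 'X_0; pose B : {mpoly k[2]} := 'X_1.
exists ((A + B) * (A - B)).
  apply/eqP => /(congr1 (fun p => p.@[fun i => if i == 0 then 1 else 0])).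
  rewrite !(mevalM, mevalB, mevalD, meval0, mevalXU) /= addr0 subr0 mulr1 => /eqP.
  by rewrite oner_eq0.
move=> x; rewrite (row2K x) !(mevalM, mevalB, mevalD, mevalXU) /= !row20 !row21.
rewrite /dom_ab row20 row21; move: (x 0 0) (x 0 1) => a b ux.
rewrite mulf_eq0 negb_or => /andP[n1 n2]; have t2 := natrS_neq0 1.
have row_neq (c d e f : k) : (c != e) || (d != f) -> row2 c d != row2 e f.
  by move=> h; apply/eqP => /row2_inj[e1 e2]; rewrite e1 e2 !eqxx in h.
have aNb : a != - b by rewrite -subr_eq0 opprK.
have ab : a != b by rewrite -subr_eq0.
have neg0 (z : k) : z = - z -> z = 0.
  by move/eqP; rewrite -subr_eq0 opprK -mulr2n mulrn_eq0 /= => /eqP.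
have nn (c d : k) : c + d != 0 -> (c != - c) || (d != - d).
  move=> h; rewrite -negb_and; apply: contraNN h => /andP[/eqP/neg0 -> /eqP/neg0 ->].
  by rewrite addr0.
have ba : b * a != 1 by rewrite mulrC.
exists [:: row2 a b; row2 (- a) (- b); row2 b a; row2 (- b) (- a)]; split=> // [|y].
  rewrite /= !inE !negb_or -!andbA andbT.
  apply/and5P; split; [apply/row_neq/nn|apply/row_neq|apply/row_neq|apply/row_neq|apply/andP; split; apply/row_neq] => //;
    rewrite ?ab ?aNb ?eqr_opp ?ab //.
  - by rewrite eqr_oppLR aNb.
  by apply: (nn b a); rewrite addrC.
rewrite (row2K y) !famC2'E !row20 !row21; move: (y 0 0) (y 0 1) => c d; rewrite !inE; split.
  case/or4P=> /eqP /row2_inj[-> ->]; rewrite ?mulrNN; split=> //.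
  - exact/conjugate_refl/sized_mapC2'.
  - exact: conj_C2'_neg.
  - exact: conj_C2'_swap.
  apply: (conjugate_trans (sized_mapC2' _ _) (sized_mapC2' _ _) (conj_C2'_swap a b)).
  exact: conj_C2'_neg.
case=> cd cc; have [m /eqP] := C2'_conj n1 cc.
rewrite -subr_eq0 subr_sqr_1 mulf_eq0 subr_eq0 addr_eq0 => /orP[]/eqP -> [[-> ->]|[-> ->]];
  by rewrite ?mul1r ?mulN1r eqxx ?orbT.
Qed.

(** * Parametrized varieties with a rational inverse *)

(** A pointwise inversion formula becomes an identity in [K] once denominators are cleared, both
    sides being polynomials in the parameters. *)
Lemma gvar_inverse n m (p : 'I_n -> {mpoly k[m]}) (q : {mpoly k[m]}) (qn0 : q != 0)
    (K : fieldType) (tf : {rmorphism {mpoly k[m]} -> K}) (gphi : {rmorphism {mpoly k[n]} -> K})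
    (F G : {mpoly k[n]}) (i : 'I_m) :
  (forall a, (tf a == 0) = (a == 0)) -> (forall c, gphi c%:MP = tf c%:MP) ->
  (forall i, gphi 'X_i = tf (p i) / tf q) ->
  (exists2 x, q.@[x] != 0 & G.@[gpt p q x 0] != 0) ->
  (forall x, q.@[x] != 0 -> x i * G.@[gpt p q x 0] = F.@[gpt p q x 0]) ->
  gphi G != 0 /\ tf 'X_i = gphi F / gphi G.
Proof.
move=> tf0 gC gX [x0 qx0 Gx0] inv.
have Gn0 : gphi G != 0.
  apply: contraNneq Gx0 => /(gphi_eq0 qn0 tf0 gC gX)/vanishes_gvar/(_ x0 qx0) ->; exact: eqxx.
split=> //; apply: (mulIf Gn0); rewrite divfK //.
have [N [P [H1 H2]]] := clear_denom qn0 tf0 gC gX F.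
have [N' [P' [H1' H2']]] := clear_denom qn0 tf0 gC gX G.
have qN : tf q ^+ (N + N') != 0 by rewrite expf_neq0 // tf0.
apply: (mulIf qN).
transitivity (tf 'X_i * (gphi G * tf q ^+ N') * tf q ^+ N); first by rewrite exprD; ring.
transitivity (gphi F * tf q ^+ N * tf q ^+ N'); last by rewrite exprD; ring.
rewrite H2 H2' -!rmorphXn -!rmorphM; congr (tf _).
apply/eqP; rewrite -subr_eq0; apply/eqP; apply: mpoly_eq0_open qn0 _ => x qx.
rewrite mevalB !mevalM !rmorphXn /= mevalXU -H1 // -H1' // mulrA inv //; ring.
Qed.

Lemma gvar_rational n m (p : 'I_n -> {mpoly k[m]}) (q : {mpoly k[m]}) (F G : 'I_m -> {mpoly k[n]}) :
  q != 0 -> has_dim (gvar p q) m ->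
  (forall i, exists2 x, q.@[x] != 0 & (G i).@[gpt p q x 0] != 0) ->
  (forall i x, q.@[x] != 0 -> x i * (G i).@[gpt p q x 0] = (F i).@[gpt p q x 0]) ->
  rational_variety (gvar p q).
Proof.
move=> qn0 dim Gn0 inv; exists m; split=> //.
have [phi [phiC phiX]] := gphi_exists p q; exists phi; split=> //.
apply: (@gvar_function_field _ _ _ _ qn0 _ (@tofrac _) (@tofrac_eq0 _) (@fracE _) _ phiC phiX F G).
by move=> i; exact: (@gvar_inverse _ _ p q qn0 _ (@tofrac _) phi (F i) (G i) i (@tofrac_eq0 _) phiC phiX (Gn0 i) (inv i)).
Qed.

Definition mp (p : {poly k}) : {mpoly k[1]} := (map_poly (@mpolyC 1 k) p).['X_0].

Lemma mpC c : mp c%:P = c%:MP.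
Proof. by rewrite /mp map_polyC hornerC. Qed.

Lemma mpX : mp 'X = 'X_0.
Proof. by rewrite /mp map_polyX hornerX. Qed.

Lemma mpD p q : mp (p + q) = mp p + mp q.
Proof. by rewrite /mp rmorphD hornerD. Qed.

Lemma mpM p q : mp (p * q) = mp p * mp q.
Proof. by rewrite /mp rmorphM hornerM. Qed.

Lemma meval_mp p x : (mp p).@[x] = p.[x 0].
Proof.
elim/poly_ind: p => [|p c IH]; first by rewrite -[0 in LHS]/(0%:P) mpC mevalC horner0.
by rewrite mpD mpM mpC mpX mevalD mevalM mevalXU mevalC IH hornerMXaddC.
Qed.

Lemma mp_surj (a : {mpoly k[1]}) : exists p, a = mp p.
Proof.
elim/mpoly_ring_ind: a => [c|i|a b [p ->] [q ->]|a b [p ->] [q ->]].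
- by exists c%:P; rewrite mpC.
- by exists 'X; rewrite mpX (ord1 i).
- by exists (p + q); rewrite mpD.
by exists (p * q); rewrite mpM.
Qed.

Lemma mp_eq0 p : (mp p == 0) = (p == 0).
Proof.
apply/eqP/eqP => [H|->]; last by rewrite -[0 in LHS]/(0%:P) mpC mpolyC0.
by apply: poly_eq0_fun => x; have := meval_mp p (fun=> x); rewrite H meval0.
Qed.

Lemma genus0_field (K : fieldType) (tf : {rmorphism {mpoly k[1]} -> K}) (iota : {rmorphism k -> K}) :
  (forall a, (tf a == 0) = (a == 0)) -> (forall x : K, exists a b, b != 0 /\ x = tf a / tf b) ->
  (forall c, iota c = tf c%:MP) -> has_genus iota 0.
Proof.
move=> tf0 tff io.
have E p : (map_poly iota p).[tf 'X_0] = tf (mp p).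
  rewrite /mp -horner_map -map_poly_comp; congr (_.[_]); apply: eq_map_poly => c /=; exact: io.
apply: (@has_genus0 K iota (tf 'X_0)) => [p|x].
  by rewrite E => /eqP; rewrite tf0 mp_eq0 => /eqP.
have [a [b [bn0 ->]]] := tff x; have [p ap] := mp_surj a; have [q bq] := mp_surj b.
by exists p, q; rewrite !E -ap -bq -mp_eq0 -bq.
Qed.

Lemma gvar_genus0 n (p : 'I_n -> {mpoly k[1]}) (q : {mpoly k[1]}) (F G : {mpoly k[n]}) :
  q != 0 -> (exists2 x, q.@[x] != 0 & G.@[gpt p q x 0] != 0) ->
  (forall x, q.@[x] != 0 -> x 0 * G.@[gpt p q x 0] = F.@[gpt p q x 0]) ->
  curve_genus (gvar p q) 0.
Proof.
move=> qn0 Gn0 inv; have [phi [phiC phiX]] := gphi_exists p q.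
exists _, phi; split.
  apply: (@gvar_function_field _ _ _ _ qn0 _ (@tofrac _) (@tofrac_eq0 _) (@fracE _) _ phiC phiX (fun=> F) (fun=> G)).
  by move=> i; rewrite (ord1 i); exact: (@gvar_inverse _ _ p q qn0 _ (@tofrac _) phi F G 0 (@tofrac_eq0 _) phiC phiX Gn0 inv).
exact: (@genus0_field _ (@tofrac _) (phi \o @mpolyC n k) (@tofrac_eq0 _) (@fracE _) phiC).
Qed.

Lemma variety_gvar n m (s : ratmap -> 'rV[k]_n) T (p : 'I_n -> {mpoly k[m]}) q :
  (forall P, (exists2 f, T f & P = s f) <-> gimage p q P) -> variety_of s T = gvar p q.
Proof. by move=> /predext H; rewrite /variety_of H. Qed.

Definition dder n (P v : 'rV[k]_n) (F : {mpoly k[n]}) : k := \sum_i v 0 i * (F^`M(i)).@[P 0].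

Section Dder.
Variables (n : nat) (P v : 'rV[k]_n).

Lemma dderC c : dder P v c%:MP = 0.
Proof. by rewrite /dder big1 // => i _; rewrite mderivC meval0 mulr0. Qed.

Lemma dderX i : dder P v 'X_i = v 0 i.
Proof.
rewrite /dder (bigD1 i) //= big1 => [|j ji].
  rewrite mderivX mnmE eqxx scale1r (_ : (U_(i) - U_(i))%MM = 0%MM).
    by rewrite mpolyX0 meval1 mulr1 addr0.
  by apply/mnmP => j; rewrite mnmBE subnn mnm0E.
by rewrite mderivX mnmE eq_sym (negbTE ji) scale0r meval0 mulr0.
Qed.

Lemma dderD F G : dder P v (F + G) = dder P v F + dder P v G.
Proof. by rewrite /dder -big_split; apply: eq_bigr => i _; rewrite mderivD mevalD mulrDr. Qed.

Lemma dderM F G : dder P v (F * G) = dder P v F * G.@[P 0] + F.@[P 0] * dder P v G.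
Proof.
rewrite /dder mulr_suml mulr_sumr -big_split; apply: eq_bigr => i _ /=.
by rewrite mderivM mevalD !mevalM; ring.
Qed.

Lemma dderN F : dder P v (- F) = - dder P v F.
Proof. by rewrite -mulN1r -[-1]mpolyCN dderM dderC mul0r add0r mevalC mulN1r. Qed.

End Dder.

Lemma dder_lin n (P u v : 'rV[k]_n) c F : dder P (u - c *: v) F = dder P u F - c * dder P v F.
Proof.
rewrite /dder mulr_sumr -sumrN -big_split; apply: eq_bigr => i _ /=.
by rewrite !mxE; ring.
Qed.

(** F serves as a local coordinate: its differential is injective on tangent vectors, so the tangent
    space is the line spanned by w. *)
Lemma smooth_at_coord n (V : 'rV[k]_n -> Prop) P w F : V P -> has_dim V 1 -> tangent V P w ->
  dder P w F != 0 -> (forall u, tangent V P u -> dder P u F = 0 -> u = 0) -> smooth_at V P.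
Proof.
move=> VP dV Tw Fw uniq; apply: (smooth_at1 VP dV _ Tw) => [|v Tv].
  by apply: contraNneq Fw => ->; rewrite /dder big1 // => i _; rewrite mxE mul0r.
exists (dder P v F / dder P w F); apply/eqP; rewrite -subr_eq0; apply/eqP; apply: uniq.
  move=> H /[dup] /Tv + /Tw; rewrite -!/(dder _ _ _) dder_lin => -> ->.
  by rewrite mulr0 subrr.
by rewrite dder_lin divfK // subrr.
Qed.

(** The vector is the velocity at t0 multiplied by Q(t0) ^ 2. After the shift of t0 to 0 this is
    [tangent_curve] with e = 1. *)
Lemma tangent_rat n (V : 'rV[k]_n -> Prop) (c : 'I_n -> {poly k}) (Q h : {poly k}) t0 :
  h != 0 -> Q.[t0] != 0 ->
  (forall t, Q.[t] != 0 -> h.[t] != 0 -> V (\row_i ((c i).[t] / Q.[t]))) ->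
  tangent V (\row_i ((c i).[t0] / Q.[t0]))
    (\row_i ((c i)^`().[t0] * Q.[t0] - (c i).[t0] * Q^`().[t0])).
Proof.
move=> hn0 Q0 HV; pose sh (p : {poly k}) := p \Po ('X + t0%:P).
have shE p t : (sh p).[t] = p.[t + t0].
  by rewrite horner_comp hornerD hornerX hornerC.
have shd p : (sh p)^`().[0] = p^`().[t0].
  rewrite deriv_comp derivD derivX derivC addr0 mulr1 horner_comp hornerD hornerX hornerC.
  by rewrite add0r.
have /fin_all_exists[w Hw] : forall i, exists w : {poly k},
    Q.[t0] *: sh (c i) - (c i).[t0] *: sh Q = w * 'X.
  move=> i; have /factor_theorem[w Hw] : root (Q.[t0] *: sh (c i) - (c i).[t0] *: sh Q) 0.
    by rewrite /root hornerD hornerN !hornerZ !shE !add0r mulrC subrr.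
  by exists w; rewrite polyC0 subr0 in Hw.
have wE i : (w i)`_0 = (c i)^`().[t0] * Q.[t0] - (c i).[t0] * Q^`().[t0].
  have := congr1 (fun p => p^`().[0]) (Hw i).
  rewrite derivD derivN !derivZ hornerD hornerN !hornerZ !shd derivM derivX hornerD !hornerM.
  by rewrite hornerX hornerC mulr0 add0r mulr1 [Q.[t0] * _]mulrC => ->; rewrite horner_coef0.
rewrite (_ : (\row_i (_ - _)) = \row_i (w i)`_0); last by apply/rowP => i; rewrite !mxE wE.
apply: (@tangent_curve n V _ w (Q.[t0] *: sh Q) (sh h) 1) => //.
- apply: contraNneq hn0 => h0; apply/eqP; apply: poly_eq0_fun => x.
  by have := congr1 (fun p => p.[x - t0]) h0; rewrite shE subrK horner0.
- by rewrite hornerZ shE add0r mulf_neq0.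
move=> t; rewrite hornerZ !shE mulf_eq0 negb_or => /andP[_ Qt] ht.
have := HV _ Qt ht.
rewrite (_ : \row_i ((c i).[t + t0] / Q.[t + t0]) = \row_i ((\row_i0 ((c i0).[t0] / Q.[t0])) 0 i
  + t ^+ 1 * ((w i).[t] / (Q.[t0] * Q.[t + t0])))) //.
apply/rowP => i; rewrite !mxE expr1.
have := congr1 (fun p => p.[t]) (Hw i); rewrite hornerD hornerN !hornerZ hornerM hornerX !shE => H.
have -> : t * ((w i).[t] / (Q.[t0] * Q.[t + t0])) = (w i).[t] * t / (Q.[t0] * Q.[t + t0]) by ring.
by rewrite -H; field; rewrite Q0 Qt.
Qed.

Lemma tangent_param n (V : 'rV[k]_n -> Prop) (c : 'I_n -> {poly k}) (h : {poly k}) t0 :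
  h != 0 -> (forall t, h.[t] != 0 -> V (\row_i (c i).[t])) ->
  tangent V (\row_i (c i).[t0]) (\row_i (c i)^`().[t0]).
Proof.
move=> hn0 HV; have := @tangent_rat n V c 1 h t0 hn0 _ _.
rewrite (_ : (\row_i (_ / _)) = \row_i (c i).[t0]); last by apply/rowP => i; rewrite !mxE hornerC divr1.
rewrite (_ : (\row_i (_ - _)) = \row_i (c i)^`().[t0]); last first.
  by apply/rowP => i; rewrite !mxE hornerC derivC hornerC mulr0 subr0 mulr1.
apply; first by rewrite hornerC oner_neq0.
move=> t _ /HV; rewrite (_ : (\row_i (_ / _)) = \row_i (c i).[t]) //.
by apply/rowP => i; rewrite !mxE hornerC divr1.
Qed.

(* First-order jets: [a] and [b] are the value and the derivative of [p] at [t]. *)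
Definition val_der (t : k) (p : {poly k}) (a b : k) : Prop := p.[t] = a /\ p^`().[t] = b.

Section ValDer.
Variable t : k.
Implicit Types (p q : {poly k}) (a b c d : k).

Lemma val_derC c : val_der t c%:P c 0.
Proof. by split; rewrite ?derivC hornerC. Qed.

Lemma val_der_nat n : val_der t n%:R n%:R 0.
Proof. by rewrite -polyC_natr; exact: val_derC. Qed.

Lemma val_derX : val_der t 'X t 1.
Proof. by split; rewrite ?derivX ?hornerX ?hornerC. Qed.

Lemma val_derD p q a b c d : val_der t p a b -> val_der t q c d -> val_der t (p + q) (a + c) (b + d).
Proof. by case=> <- <- [<- <-]; split; rewrite ?derivD hornerD. Qed.

Lemma val_derN p a b : val_der t p a b -> val_der t (- p) (- a) (- b).
Proof. by case=> <- <-; split; rewrite ?derivN hornerN. Qed.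

Lemma val_derM p q a b c d : val_der t p a b -> val_der t q c d ->
  val_der t (p * q) (a * c) (b * c + a * d).
Proof. by case=> <- <- [<- <-]; split; rewrite ?derivM ?hornerD !hornerM. Qed.

Lemma val_der_sqr p a b : val_der t p a b -> val_der t (p ^+ 2) (a ^+ 2) (b * a + a * b).
Proof. by move=> H; rewrite !expr2; exact: val_derM. Qed.

Lemma val_der_cube p a b : val_der t p a b ->
  val_der t (p ^+ 3) (a ^+ 3) (b * a ^+ 2 + a * (b * a + a * b)).
Proof. by move=> H; rewrite !(exprS _ 2); exact/val_derM/val_der_sqr. Qed.

Lemma val_der_eq p a b c : val_der t p a b -> b = c -> p^`().[t] = c.
Proof. by case=> _ -> ->. Qed.

End ValDer.

Ltac val_der_tac := repeat lazymatch goal with |- val_der _ ?p _ _ =>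
  lazymatch p with
  | 'X => exact: val_derX
  | _%:P => exact: val_derC
  | 1 => exact: (val_der_nat _ 1)
  | _%:R => exact: val_der_nat
  | _ ^+ 2 => eapply val_der_sqr
  | _ ^+ 3 => eapply val_der_cube
  | _ + _ => eapply val_derD
  | - _ => eapply val_derN
  | _ * _ => eapply val_derM
  end end.

Section GraphCurve.
Variables (n : nat) (T : 'I_n -> {poly k}) (h : {poly k}) (i0 : 'I_n) (c d : k).
Hypothesis hn0 : h != 0.
Hypothesis dn0 : d != 0.
Hypothesis T0 : T i0 = c%:P + d *: 'X.

(** The factor [h] only removes its zeros from the parameter line. As the coordinate [i0] is affine
    in the parameter, the closure stays inside the graph of polynomials in that coordinate. *)
Definition graph_curve : 'rV[k]_n -> Prop := gvar (fun i => mp (T i * h)) (mp h).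

Let qn0 : mp h != 0. Proof. by rewrite mp_eq0. Qed.

Let gptE x : (mp h).@[x] != 0 -> gpt (fun i => mp (T i * h)) (mp h) x = \row_i (T i).[x 0].
Proof.
move=> hx; apply/rowP => i; rewrite !mxE !meval_mp hornerM mulfK //.
by rewrite -(meval_mp h x).
Qed.

Lemma graph_curve_image P : gimage (fun i => mp (T i * h)) (mp h) P <->
  exists2 t, h.[t] != 0 & P = \row_i (T i).[t].
Proof.
split=> [[x hx ->]|[t ht ->]].
  by exists (x 0); [rewrite -(meval_mp h x) | rewrite gptE].
by exists (fun=> t); rewrite ?gptE ?meval_mp.
Qed.

Let L : {mpoly k[n]} := d^-1%:MP * ('X_i0 - c%:MP).

Let LE (P : 'rV[k]_n) : L.@[P 0] = d^-1 * (P 0 i0 - c).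
Proof. by rewrite mevalM mevalB !mevalC mevalXU. Qed.

Let LT t : L.@[(\row_i (T i).[t]) 0] = t.
Proof. by rewrite LE mxE T0 hornerD hornerZ hornerX hornerC addrC addKr mulKf. Qed.

Lemma graph_curve_dim : has_dim graph_curve 1.
Proof.
apply: (gvar_has_dim qn0 (F := fun=> L) qn0) => y hy; exists y => // i.
by rewrite gptE // LT (ord1 i).
Qed.

Lemma graph_curve_irreducible : irreducible_curve graph_curve.
Proof. by split; [exact: gvar_irreducible_variety | exact: graph_curve_dim]. Qed.

Lemma graph_curve_genus0 : curve_genus graph_curve 0.
Proof.
apply: (@gvar_genus0 _ _ _ L 1 qn0) => [|x hx]; last by rewrite meval1 mulr1 gptE // LT.
by have [x hx] := mpoly_nonvanishing qn0; exists (x 0); rewrite ?meval1 ?oner_neq0.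
Qed.

Let pL (p : {poly k}) : {mpoly k[n]} := (map_poly (@mpolyC n k) p).[L].

Let pL_cons p a : pL (p * 'X + a%:P) = pL p * L + a%:MP.
Proof. by rewrite /pL rmorphD rmorphM /= map_polyX map_polyC hornerMXaddC. Qed.

Let pL0 : pL 0 = 0. Proof. by rewrite /pL rmorph0 horner0. Qed.

Let pLE p (P : 'rV[k]_n) : (pL p).@[P 0] = p.[L.@[P 0]].
Proof.
elim/poly_ind: p => [|p a IH]; first by rewrite pL0 meval0 horner0.
by rewrite pL_cons mevalD mevalM IH mevalC hornerMXaddC.
Qed.

Let pL_dder p P v : dder P v L = 0 -> dder P v (pL p) = 0.
Proof.
move=> L0; elim/poly_ind: p => [|p a IH].
  by rewrite pL0 -mpolyC0 dderC.
by rewrite pL_cons dderD dderM dderC IH L0 mul0r mulr0 !addr0.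
Qed.

Let eqn i : vanishes_on graph_curve ('X_i - pL (T i)).
Proof.
apply/vanishes_gvar => x hx; rewrite mevalB mevalXU pLE gptE // LT mxE; exact: subrr.
Qed.

Let on_graph P : graph_curve P -> P = \row_i (T i).[L.@[P 0]].
Proof.
move=> VP; apply/rowP => i; rewrite mxE.
by have /eqP := eqn i VP; rewrite mevalB mevalXU pLE subr_eq0 => /eqP.
Qed.

Lemma graph_curve_smooth : smooth graph_curve.
Proof.
move=> P VP; have PE := on_graph VP; set t := L.@[P 0] in PE.
have Tw : tangent graph_curve P (\row_i (T i)^`().[t]).
  rewrite PE; apply: (tangent_param (h := h)) => // u hu.
  by have := @gvar_gpt _ _ (fun i => mp (T i * h)) (mp h) (fun=> u); rewrite gptE !meval_mp //; apply.
have Lv v : dder P v L = d^-1 * v 0 i0.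
  by rewrite dderM dderC mul0r add0r mevalC dderD dderX dderN dderC subr0.
apply: (smooth_at_coord VP graph_curve_dim Tw (F := L)).
  rewrite Lv mxE T0 derivD derivC derivZ derivX add0r hornerZ hornerC mulr1 mulVf //.
  exact: oner_neq0.
move=> u Tu Lu; apply/rowP => i; have := Tu _ (eqn i).
by rewrite -/(dder _ _ _) dderD dderN dderX pL_dder // subr0 mxE.
Qed.

End GraphCurve.

(** * The five varieties *)

Lemma monic_cubic_root (a b c : k) : exists x, x ^+ 3 = a + b * x + c * x ^+ 2.
Proof.
have [x e] := @solve_monicpoly k 3 (fun i => [:: a; b; c]`_i) isT; exists x.
by rewrite e !big_ord_recl big_ord0 /= /bump /= expr0 expr1 mulr1 addr0 addrA.
Qed.

Lemma monic_quartic_root (a b c d : k) : exists x, x ^+ 4 = a + b * x + c * x ^+ 2 + d * x ^+ 3.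
Proof.
have [x e] := @solve_monicpoly k 4 (fun i => [:: a; b; c; d]`_i) isT; exists x.
by rewrite e !big_ord_recl big_ord0 /= /bump /= expr0 expr1 mulr1 addr0 !addrA.
Qed.

Definition hE := (hornerD, hornerN, hornerM, hornerZ, horner_exp, hornerXn, hornerX, hornerC).

Lemma row3P (P Q : 'rV[k]_3) : P 0 0 = Q 0 0 -> P 0 1 = Q 0 1 -> P 0 2 = Q 0 2 -> P = Q.
Proof.
move=> e0 e1 e2; apply/rowP => -[[|[|[|//]]] i].
- by rewrite (_ : Ordinal i = 0) //; exact/val_inj.
- by rewrite (_ : Ordinal i = 1) //; exact/val_inj.
by rewrite (_ : Ordinal i = 2) //; exact/val_inj.
Qed.

(** * The curves of families (2) and (3) *)

Definition kapT (i : 'I_3) : {poly k} :=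
  [:: 4%:R%:P + (- 4%:R) *: 'X; 4%:R *: 'X^2 - 4%:R *: 'X + 6%:R%:P;
      (2%:R%:P + 4%:R *: 'X) * (2%:R%:P - 2%:R *: 'X)]`_i.

Lemma sigma1_C2' f (a b : k) : a * b != 1 -> sized 3 f -> conjugate 3 (mapC2' a b) f ->
  sigma1_123 f = \row_i (kapT i).[kap a b].
Proof.
move=> ab sf c; have [u [v [_ [_ [[E1 E2] _ p _]]]]] := spectrumC2' ab sf c.
rewrite (sigma1_spectrum p) //; apply/rowP => -[[|[|[|//]]] i]; rewrite !mxE /kapT /= !hE.
- transitivity (2%:R * (u + v)); first by ring.
  by rewrite E1; ring.
- transitivity ((u + v) ^+ 2 + 2%:R * (u * v)); first by ring.
  by rewrite E1 E2; ring.
transitivity (2%:R * (u * v) * (u + v)); first by ring.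
by rewrite E1 E2; ring.
Qed.

(** On the line a = b, kap = 4 / (1 - a^2) takes every value except 0, whence the polynomial
    ['X]. *)
Lemma variety_D2 : variety_of sigma1_123 (image_in_moduli 3 dom_ne1 famD2) = graph_curve kapT 'X.
Proof.
apply: variety_gvar => P; rewrite graph_curve_image; split=> [[f /imD2P[rf [a aa c]] ->]|[t]].
  exists (kap a a); last exact: sigma1_C2' aa (sizedR rf) c.
  by rewrite hornerX kapD2 mulf_neq0 ?natrS_neq0 // invr_eq0 subr_eq0 eq_sym.
rewrite hornerX => tn0 ->; have [a ae] := sqrt_exists (1 - 4%:R / t).
have d : 1 - a * a = 4%:R / t by rewrite -expr2 ae opprB addrC subrK.
have aa : a * a != 1.
  by rewrite eq_sym -subr_eq0 d mulf_neq0 ?natrS_neq0 ?invr_eq0.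
have sa := sized_mapC2' a a; exists (mapC2' a a).
  apply/imD2P; split; first exact: rat_mapC2'.
  by exists a => //; exact: conjugate_refl.
rewrite (sigma1_C2' aa sa (conjugate_refl sa)) kapD2 d invf_div mulrCA divff ?natrS_neq0 //.
by rewrite mulr1.
Qed.

Lemma D2_curve (V := variety_of sigma1_123 (image_in_moduli 3 dom_ne1 famD2)) :
  [/\ irreducible_curve V, smooth V & curve_genus V 0].
Proof.
have n4 : - 4%:R != 0 :> k by rewrite oppr_eq0 natrS_neq0.
have h0 : 'X != 0 :> {poly k} by rewrite polyX_eq0.
rewrite /V variety_D2; split.
- exact: (graph_curve_irreducible h0 n4 (i0 := 0) (c := 4%:R)).
- exact: (graph_curve_smooth h0 n4 (i0 := 0) (c := 4%:R)).
exact: (graph_curve_genus0 h0 n4 (i0 := 0) (c := 4%:R)).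
Qed.

Definition tauT (i : 'I_3) : {poly k} :=
  let s := 'X + 18%:R%:P in let p := 81%:R%:P + 2%:R *: 'X in
  [:: 72%:R%:P + 2%:R *: 'X; 486%:R%:P + 72%:R *: s + s ^+ 2 + 2%:R *: p;
      2916%:R%:P + 972%:R *: s + 36%:R *: s ^+ 2 + 72%:R *: p + 2%:R *: 'X + 2%:R *: (s * p)]`_i.

Lemma sigma2_D2' f (a : k) : a * a != 1 -> sized 3 f -> conjugate 3 (mapD2' a) f ->
  sigma2_123 f = \row_i (tauT i).[Tinv a ^+ 2].
Proof.
move=> aa sf c; have [x [y [z [p E1 E2 E3]]]] := spectrumD2' aa sf c.
set T := Tinv a ^+ 2 in E1 E2 E3 *.
apply/rowP => -[[|[|[|//]]] i]; rewrite !mxE (sigma_es p) // /tauT !hE.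
- transitivity (2%:R * (x + y + z) + 36%:R); first by rewrite /=; ring.
  by rewrite E1; clearbody T; ring.
- transitivity (486%:R + 72%:R * (x + y + z) + (x + y + z) ^+ 2 + 2%:R * (x * y + x * z + y * z)).
    by rewrite /=; ring.
  by rewrite E1 E2; clearbody T; ring.
transitivity (2916%:R + 972%:R * (x + y + z) + 36%:R * (x + y + z) ^+ 2
  + 72%:R * (x * y + x * z + y * z) + 2%:R * (x * y * z)
  + 2%:R * ((x + y + z) * (x * y + x * z + y * z))); first by rewrite /=; ring.
by rewrite E1 E2 E3; clearbody T; ring.
Qed.

(** Tinv a = s is a monic cubic equation in a, and none of its roots has a^2 = 1, since that would
    give 8 a = 0. So every value of the parameter is attained. *)
Lemma variety_D2' : variety_of sigma2_123 (image_in_moduli 3 dom_ne1 famD2') = graph_curve tauT 1.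
Proof.
apply: variety_gvar => P; rewrite graph_curve_image; split=> [[f /imD2'P[rf [a aa c]] ->]|[t _ ->]].
  exists (Tinv a ^+ 2); first by rewrite hornerC oner_neq0.
  exact: sigma2_D2' aa (sizedR rf) c.
have [s se] := sqrt_exists t; have [a ae] := monic_cubic_root (- s) 9%:R s.
have aa : a * a != 1.
  apply/eqP => aa; have : a * 8%:R = 0.
    transitivity (- a ^+ 3 + 9%:R * a + a * (a * a - 1)); first by ring.
    by rewrite ae aa expr2 aa; ring.
  move/eqP; rewrite mulf_eq0 (negbTE (natrS_neq0 7)) orbF => /eqP a0.
  by move/eqP: aa; rewrite a0 mul0r eq_sym oner_eq0.
have sa := sized_mapD2' a; exists (mapD2' a).
  apply/imD2'P; split; first exact: rat_mapD2'.
  by exists a => //; exact: conjugate_refl.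
rewrite (sigma2_D2' aa sa (conjugate_refl sa)).
have d0 : 1 - a * a != 0 by rewrite subr_eq0 eq_sym.
have -> : Tinv a = s.
  rewrite /Tinv; apply: (mulIf d0); rewrite divfK //.
  transitivity (9%:R * a - a ^+ 3); first by ring.
  by rewrite ae; ring.
by rewrite se.
Qed.

Lemma D2'_curve (V := variety_of sigma2_123 (image_in_moduli 3 dom_ne1 famD2')) :
  [/\ irreducible_curve V, smooth V & curve_genus V 0].
Proof.
have n2 := natrS_neq0 1; have h0 : 1 != 0 :> {poly k} by exact: oner_neq0.
rewrite /V variety_D2'; split.
- exact: (graph_curve_irreducible h0 n2 (i0 := 0) (c := 72%:R)).
- exact: (graph_curve_smooth h0 n2 (i0 := 0) (c := 72%:R)).
exact: (graph_curve_genus0 h0 n2 (i0 := 0) (c := 72%:R)).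
Qed.

(** * The cuspidal curve of family (1) *)

(* In terms of X = 3 / a + 1 the fixed-point multipliers of [mapC3 a] are 3 / (X - 1) and, three
   times, X - 3. *)
Definition C3num (i : 'I_3) : {poly k} :=
  let p0 := 3%:R *: 'X^2 - 12%:R *: ('X - 1) in
  [:: p0; (3%:R *: 'X^2 - 18%:R%:P) * ('X - 1) - 6%:R *: p0;
      ('X^3 - 9%:R *: 'X^2 + 36%:R%:P) * ('X - 1) + 12%:R *: p0]`_i.

Definition C3pt (X : k) : 'rV[k]_3 := \row_i ((C3num i).[X] / ('X - 1).[X]).
Definition C3var := gvar (fun i => mp (C3num i)) (mp ('X - 1)).

Lemma C3den0 : mp ('X - 1) != 0.
Proof. by rewrite mp_eq0 -[1]/(1%:P) polyXsubC_eq0. Qed.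

Lemma C3den X : ('X - 1 : {poly k}).[X] = X - 1.
Proof. by rewrite !hE. Qed.

Lemma C3gpt x : gpt (fun i => mp (C3num i)) (mp ('X - 1)) x = C3pt (x 0).
Proof. by apply/rowP => i; rewrite !mxE !meval_mp. Qed.

Lemma C3pt_var X : X != 1 -> C3var (C3pt X).
Proof.
move=> X1; have := @gvar_gpt _ _ (fun i => mp (C3num i)) (mp ('X - 1)) (fun=> X).
by rewrite C3gpt meval_mp C3den subr_eq0; exact.
Qed.

Lemma sigma1_C3 f (a : k) : a != 0 -> sized 3 f -> conjugate 3 (mapC3 a) f ->
  sigma1_123 f = C3pt (3%:R / a + 1).
Proof.
move=> an0 sf c; rewrite (sigma1_spectrum (spectrumC3 an0 sf c)) //.
have n3 := natrS_neq0 2.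
have X1 : (3%:R / a + 1) - 1 = 3%:R / a by rewrite addrK.
apply/rowP => -[[|[|[|//]]] i]; rewrite !mxE C3den X1 /C3num /= !hE X1; field; rewrite ?an0 ?n3 //.
Qed.

Lemma variety_C3 : variety_of sigma1_123 (aut_locus 3 grpC3) = C3var.
Proof.
apply: variety_gvar => P; split=> [[f /locus_C3P /imC3P[rf [a an0 c]] ->]|[x]].
  exists (fun=> 3%:R / a + 1); last by rewrite C3gpt; exact: sigma1_C3 an0 (sizedR rf) c.
  by rewrite meval_mp C3den addrK mulf_neq0 ?natrS_neq0 // invr_eq0.
rewrite meval_mp C3den C3gpt; move: (x 0) => X X1 ->.
have an0 : 3%:R / (X - 1) != 0 :> k by rewrite mulf_neq0 ?natrS_neq0 ?invr_eq0.
have sa := sized_mapC3 (3%:R / (X - 1)); exists (mapC3 (3%:R / (X - 1))).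
  apply/locus_C3P/imC3P; split; first exact: rat_mapC3.
  by exists (3%:R / (X - 1)) => //; exact: conjugate_refl.
rewrite (sigma1_C3 an0 sa (conjugate_refl sa)) invf_div mulrCA divff ?natrS_neq0 //.
by rewrite mulr1 subrK.
Qed.

(* The coordinates 3 X^2 / (X - 1), X^2 and X^3. *)
Definition cS : {mpoly k[3]} := 'X_0 + 12%:R%:MP.
Definition cY : {mpoly k[3]} := 3%:R^-1%:MP * ('X_1 + 6%:R%:MP * 'X_0 + 18%:R%:MP).
Definition cZ : {mpoly k[3]} := 'X_2 + 9%:R%:MP * cY - 36%:R%:MP - 12%:R%:MP * 'X_0.

Lemma cYE (P : 'rV[k]_3) : cY.@[P 0] = (P 0 1 + 6%:R * P 0 0 + 18%:R) / 3%:R.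
Proof. by rewrite /cY !(mevalM, mevalD, mevalC, mevalXU) mulrC. Qed.

Lemma cSE (P : 'rV[k]_3) : cS.@[P 0] = P 0 0 + 12%:R.
Proof. by rewrite /cS !(mevalD, mevalC, mevalXU). Qed.

Lemma cZE (P : 'rV[k]_3) : cZ.@[P 0] = P 0 2 + 9%:R * cY.@[P 0] - 36%:R - 12%:R * P 0 0.
Proof. by rewrite /cZ !(mevalM, mevalB, mevalD, mevalC, mevalXU). Qed.

Lemma C3ptE X : X != 1 -> [/\ cS.@[(C3pt X) 0] = 3%:R * X ^+ 2 / (X - 1),
  cY.@[(C3pt X) 0] = X ^+ 2 & cZ.@[(C3pt X) 0] = X ^+ 3].
Proof.
move=> X1; have d : X - 1 != 0 by rewrite subr_eq0.
have n3 := natrS_neq0 2.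
by rewrite cZE cYE cSE !mxE C3den /C3num /= !hE; split; field; rewrite ?d ?n3.
Qed.

Lemma C3coord_inj (P Q : 'rV[k]_3) : cS.@[P 0] = cS.@[Q 0] -> cY.@[P 0] = cY.@[Q 0] ->
  cZ.@[P 0] = cZ.@[Q 0] -> P = Q.
Proof.
rewrite !cSE => /addIr e0; rewrite !cZE => /[dup] eY -> /eqP.
rewrite e0 (inj_eq (addIr _)) (inj_eq (addIr _)) (inj_eq (addIr _)) => /eqP e2.
move: eY; rewrite !cYE e0 => /(mulIf _) e1.
have n3 : 3%:R^-1 != 0 :> k by rewrite invr_eq0 natrS_neq0.
have /addIr/addIr e1' := e1 n3.
exact: row3P.
Qed.

Section Relations.
Variables S Y Z : {mpoly k[3]}.

(** With Y = X^2, Z = X^3 and S = 3 X^2 / (X - 1): the cuspidal cubic, the equation defining S times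
    X^2, and the square of S X = S + 3 X^2. The last one forces S = 0 where Y = Z = 0. *)
Definition rel1 := Z * Z - Y * Y * Y.
Definition rel2 := S * (Z - Y) - 3%:R%:MP * (Y * Y).
Definition rel3 := (S + 3%:R%:MP * Y) * (S + 3%:R%:MP * Y) - S * S * Y.

Variables (P v : 'rV[k]_3).
Let s := S.@[P 0].
Let y := Y.@[P 0].
Let z := Z.@[P 0].

Lemma rel1E : rel1.@[P 0] = z * z - y * y * y.
Proof. by rewrite mevalB !mevalM. Qed.

Lemma rel2E : rel2.@[P 0] = s * (z - y) - 3%:R * (y * y).
Proof. by rewrite mevalB !mevalM mevalB mevalC. Qed.

Lemma rel3E : rel3.@[P 0] = (s + 3%:R * y) * (s + 3%:R * y) - s * s * y.
Proof. by rewrite mevalB !mevalM mevalD mevalM mevalC. Qed.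

Lemma dder_rel1 : dder P v Y = 0 -> dder P v rel1 = 2%:R * z * dder P v Z.
Proof. by move=> Y0; rewrite dderD dderN !dderM Y0 -/z -/y; ring. Qed.

Lemma dder_rel2 : dder P v Y = 0 -> dder P v Z = 0 -> dder P v rel2 = dder P v S * (z - y).
Proof.
by move=> Y0 Z0; rewrite dderD dderN !dderM dderC dderD dderN Y0 Z0 mevalB -/z -/y; ring.
Qed.

End Relations.

Lemma C3_relations : [/\ vanishes_on C3var (rel1 cY cZ), vanishes_on C3var (rel2 cS cY cZ) &
  vanishes_on C3var (rel3 cS cY)].
Proof.
split; apply/vanishes_gvar => x; rewrite meval_mp C3den subr_eq0 C3gpt => X1;
  have [eS eY eZ] := C3ptE X1; have d : x 0 - 1 != 0 by rewrite subr_eq0.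
- by rewrite rel1E eY eZ; ring.
- by rewrite rel2E eS eY eZ; field.
by rewrite rel3E eS eY; field.
Qed.

(** The closure adds no point: where Y != 0 the parameter is Z / Y, and where Y = 0 the relations
    leave only the point X = 0. *)
Lemma C3_points P : C3var P -> exists2 X, X != 1 & P = C3pt X.
Proof.
have [V1 V2 V3] := C3_relations => VP.
move: (V1 P VP) (V2 P VP) (V3 P VP).
rewrite rel1E rel2E rel3E.
set s := cS.@[_]; set y := cY.@[_]; set z := cZ.@[_] => h1 h2 h3.
have z2 : z * z = y * y * y by apply/eqP; rewrite -subr_eq0 h1.
have [y0|yn0] := eqVneq y 0.
  have z0 : z = 0 by apply/eqP; move/eqP: z2; rewrite y0 !mulr0 mulf_eq0 orbb.
  have s0 : s = 0.
    by apply/eqP; move/eqP: h3; rewrite y0 !mulr0 addr0 subr0 mulf_eq0 orbb.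
  have z1 : (0 : k) != 1 by rewrite eq_sym oner_neq0.
  exists 0 => //; have [eS eY eZ] := C3ptE z1.
  by apply: C3coord_inj; rewrite ?eS ?eY ?eZ -/s -/y -/z ?s0 ?y0 ?z0 ?expr0n ?mulr0 ?mul0r.
pose X := z / y; have Xy : X * y = z by rewrite /X divfK.
have X2 : X ^+ 2 = y.
  apply: (mulIf (mulf_neq0 yn0 yn0)); transitivity ((X * y) * (X * y)); first by ring.
  by rewrite Xy z2; ring.
have X3 : X ^+ 3 = z by rewrite exprSr X2 mulrC.
have sX : s * (X - 1) = 3%:R * X ^+ 2.
  apply: (mulIf yn0); apply/eqP; rewrite -subr_eq0 -h2 X2 -Xy; apply/eqP; ring.
have X1 : X != 1.
  apply/eqP => X1; move/eqP: sX; rewrite X1 subrr mulr0 eq_sym expr1n mulr1.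
  by rewrite (negbTE (natrS_neq0 2)).
exists X => //; have [eS eY eZ] := C3ptE X1.
apply: C3coord_inj; rewrite ?eS ?eY ?eZ //.
by rewrite -sX mulfK // subr_eq0.
Qed.

Lemma C3_dim : has_dim C3var 1.
Proof.
apply: (gvar_has_dim C3den0 (F := fun=> cY) (h := 'X_0 - 1)).
  apply/eqP => /(congr1 (fun p => p.@[fun=> 0])).
  by rewrite mevalB mevalXU meval1 meval0 sub0r => /eqP; rewrite oppr_eq0 oner_eq0.
move=> y; rewrite mevalB mevalXU meval1 subr_eq0 => y1.
have [X Xe] := sqrt_exists (y 0).
have X1 : X != 1 by apply: contraNneq y1 => X1; rewrite -Xe X1 expr1n.
exists (fun=> X); first by rewrite meval_mp C3den subr_eq0.
by move=> i; rewrite C3gpt (ord1 i); have [_ -> _] := C3ptE X1.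
Qed.

Lemma C3_genus0 : curve_genus C3var 0.
Proof.
have m1 : -1 != 1 :> k by rewrite eq_sym -subr_eq0 opprK (natrS_neq0 1).
apply: (gvar_genus0 (F := cZ) (G := cY) C3den0) => [|x].
  exists (fun=> -1); first by rewrite meval_mp C3den subr_eq0.
  by rewrite C3gpt; have [_ -> _] := C3ptE m1; rewrite sqrrN expr1n oner_neq0.
rewrite meval_mp C3den subr_eq0 C3gpt => X1; have [_ -> ->] := C3ptE X1.
by rewrite exprS.
Qed.

(** For X != 0 the function Y = X^2 is a local coordinate: the first two relations determine the
    differentials of Z and S from that of Y. *)
Lemma C3_smooth X : X != 1 -> X != 0 -> smooth_at C3var (C3pt X).
Proof.
move=> X1 X0; have d : X - 1 != 0 by rewrite subr_eq0.
have [eS eY eZ] := C3ptE X1; have n3 := natrS_neq0 2; have n2 := natrS_neq0 1.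
have Tw : tangent C3var (C3pt X)
    (\row_i ((C3num i)^`().[X] * ('X - 1).[X] - (C3num i).[X] * ('X - 1)^`().[X])).
  apply: (tangent_rat (h := 1)); rewrite ?oner_neq0 ?C3den // => t t1 _.
  by apply: C3pt_var; rewrite -subr_eq0 -C3den.
have dS v : dder (C3pt X) v cS = v 0 0 by rewrite dderD dderC dderX addr0.
have dY v : dder (C3pt X) v cY = (v 0 1 + 6%:R * v 0 0) / 3%:R.
  rewrite dderM dderC mul0r add0r mevalC !dderD dderC addr0 dderM dderC mul0r add0r mevalC.
  by rewrite !dderX mulrC.
have dZ v : dder (C3pt X) v cZ = v 0 2 + 9%:R * dder (C3pt X) v cY - 12%:R * v 0 0.
  rewrite !dderD !dderN dderC subr0 !dderM !dderC !mul0r !add0r !mevalC !dderX //.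
apply: (smooth_at_coord (C3pt_var X1) C3_dim Tw (F := cY)).
  rewrite dY !mxE C3den /C3num /= !derivE !hE.
  set e := (X in X != 0); have -> : e = 2%:R * X * (X - 1) ^+ 2 by rewrite /e; field.
  by rewrite !mulf_neq0 // expf_neq0.
move=> u Tu Y0; have [V1 V2 _] := C3_relations.
have := Tu _ V1; rewrite -/(dder _ _ _) dder_rel1 // eZ => /eqP.
have c0 : 2%:R * X ^+ 3 != 0 by rewrite mulf_neq0 ?expf_neq0.
rewrite mulf_eq0 (negbTE c0) /= => /eqP Z0.
have := Tu _ V2; rewrite -/(dder _ _ _) dder_rel2 // eY eZ => /eqP.
rewrite mulf_eq0 dS (_ : X ^+ 3 - X ^+ 2 = X ^+ 2 * (X - 1)); last by ring.
rewrite mulf_eq0 expf_eq0 (negbTE X0) (negbTE d) /= orbF => /eqP u0.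
move: Z0; rewrite dZ Y0 u0 !mulr0 addr0 subr0 => u2.
move/eqP: Y0; rewrite dY u0 mulr0 addr0 mulf_eq0 invr_eq0 (negbTE n3) orbF => /eqP u1.
by apply: row3P; rewrite mxE.
Qed.

(* The parametrization has a cusp at X = 0. *)
Lemma C3_singular : singular_at C3var (C3pt 0).
Proof.
have z1 : (0 : k) != 1 by rewrite eq_sym oner_neq0.
(* The point of parameter t differs from that of 0 by t^2 w(t) / (t - 1); the constant and linear
   coefficients of w are independent tangent vectors. *)
pose w (i : 'I_3) : {poly k} := [:: 3%:R%:P; 3%:R *: 'X - 21%:R%:P; 'X^2 - 10%:R *: 'X + 45%:R%:P]`_i.
have Tw j : (j < 2)%N -> tangent C3var (C3pt 0) (\row_i (w i)`_j).
  apply: (@tangent_curve _ _ _ w ('X - 1) 1 2); rewrite ?oner_neq0 ?C3den //.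
    by rewrite sub0r oppr_eq0 oner_neq0.
  move=> t; rewrite C3den subr_eq0 => t1 _; have := C3pt_var t1.
  rewrite (_ : C3pt t = \row_i (C3pt 0 0 i + t ^+ 2 * ((w i).[t] / (t - 1)))) //.
  have d : t - 1 != 0 by rewrite subr_eq0.
  have d' : 0 - 1 != 0 :> k by rewrite subr_eq0.
  apply/rowP => -[[|[|[|//]]] i]; rewrite !mxE !C3den /C3num /w /= !hE; field; rewrite ?d ?d' //.
apply: (@singular_atP _ _ _ 1 (\matrix_(i < 2) (\row_l (w l)`_i)) (C3pt_var z1) C3_dim).
  apply: inj_row_free => v /rowP v0.
  have := v0 0; have := v0 1; rewrite !mxE !big_ord_recl !big_ord0 !mxE /w /= !coefsE /=.
  move=> h1 h0.
  have n3 := natrS_neq0 2.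
  have e0 : v 0 ord0 = 0.
    apply: (mulIf n3); rewrite mul0r -[RHS]h0; ring.
  have e1 : v 0 (lift ord0 ord0) = 0.
    by apply: (mulIf n3); rewrite mul0r -[RHS]h1 e0; ring.
  by apply/rowP => -[[|[|//]] i]; [move: e0|move: e1]; rewrite mxE => <-; congr (v _ _); apply/val_inj.
by move=> i; rewrite rowK; apply: Tw; exact: ltn_ord.
Qed.

Lemma C3_curve (V := variety_of sigma1_123 (aut_locus 3 grpC3)) :
  [/\ irreducible_curve V, curve_genus V 0, (exists! P, singular_at V P) &
      forall P, singular_at V P <-> exists2 f, aut_locus 3 grpA4 f & P = sigma1_123 f].
Proof.
have z1 : (0 : k) != 1 by rewrite eq_sym oner_neq0.
have uniq P : singular_at C3var P -> P = C3pt 0.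
  case=> /C3_points[X X1 ->] ns; have [->//|X0] := eqVneq X 0.
  by case: ns; exact: C3_smooth.
have A4 f : aut_locus 3 grpA4 f -> sigma1_123 f = C3pt 0.
  case/A4_mapC3 => rf c; have n3 : - 3%:R != 0 :> k by rewrite oppr_eq0 natrS_neq0.
  by rewrite (sigma1_C3 n3 (sizedR rf) c) invrN mulrN divff ?natrS_neq0 // addrC subrr.
rewrite /V variety_C3; split.
- by split; [exact: gvar_irreducible_variety C3den0 | exact: C3_dim].
- exact: C3_genus0.
- by exists (C3pt 0); split; [exact: C3_singular | move=> P /uniq].
move=> P; split=> [/uniq ->|[f /A4 e ->]].
  by have [f Hf] := A4_nonempty; exists f => //; rewrite A4.
by rewrite e; exact: C3_singular.
Qed.

(** * The surface of family (4) *)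

Definition pair_fun (a b : k) : 'I_2 -> k := fun i => if i == 0 then a else b.

Lemma I2_neq0 (i : 'I_2) : i != 0 -> i = 1.
Proof. by case: i => [[|[|//]] i] // _; exact/val_inj. Qed.

Section Surface4.
Variable R : comNzRingType.
Implicit Types U r : R.

(* With n_i = 1 - m_i for the fixed-point multipliers m_i of [mapC2 a b], put r = (a b - 1) / 2 and
   U = 1 - u, u the double multiplier; then s_i is the i-th elementary symmetric function of the
   n_i, and the entries below are those of the m_i. *)
Definition uvS U r : seq R :=
  let s1 := r * (U - 2%:R) + 2%:R * U in
  let s2 := U ^+ 2 + r * (2%:R * U ^+ 2 - 3%:R * U) in
  let s3 := r * U ^+ 3 in
  [:: 4%:R - s1; 6%:R - 3%:R * s1 + s2; 4%:R - 3%:R * s1 + 2%:R * s2 - s3].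

(* Eliminating r leaves two polynomial relations for U; their gcd is uvH U - uvG. *)
Definition uvH (s1 s2 s3 : R) : R :=
  (12%:R * s1 - 2%:R * s2) * (8%:R * s2 - 3%:R * s3)
  - (s1 - 16%:R) * ((4%:R + 2%:R * s1) * s3 - 6%:R * s1 * s2).
Definition uvG (s1 s2 s3 : R) : R :=
  (s1 - 16%:R) * (4%:R * s2 ^+ 2 - (s2 + 3%:R * s1) * s3)
  - (3%:R * s3 - 8%:R * s2) * (8%:R * s2 - 3%:R * s3).

End Surface4.

Lemma uvS_morph (R S : comNzRingType) (f : {rmorphism R -> S}) U r i :
  f (uvS U r)`_i = (uvS (f U) (f r))`_i.
Proof.
by case: i => [|[|[|i]]]; rewrite /uvS /= ?nth_nil ?rmorph0 //
  ?(rmorph_nat, rmorphXn, rmorphB, rmorphD, rmorphM).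
Qed.

Lemma uvH_morph (R S : comNzRingType) (f : {rmorphism R -> S}) s1 s2 s3 :
  f (uvH s1 s2 s3) = uvH (f s1) (f s2) (f s3).
Proof. by rewrite /uvH ?(rmorph_nat, rmorphXn, rmorphB, rmorphD, rmorphM). Qed.

Lemma uvG_morph (R S : comNzRingType) (f : {rmorphism R -> S}) s1 s2 s3 :
  f (uvG s1 s2 s3) = uvG (f s1) (f s2) (f s3).
Proof. by rewrite /uvG ?(rmorph_nat, rmorphXn, rmorphB, rmorphD, rmorphM). Qed.

Definition C2num (i : 'I_3) : {mpoly k[2]} := (uvS 'X_0 'X_1)`_i * 'X_1.
Definition C2pt (U r : k) : 'rV[k]_3 := \row_i (uvS U r)`_i.
Definition C2var := gvar C2num 'X_1.

Lemma mpolyX_neq0 n (i : 'I_n) : 'X_i != 0 :> {mpoly k[n]}.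
Proof.
apply/eqP => /(congr1 (fun p => p.@[fun=> 1])); rewrite mevalXU meval0 => /eqP.
by rewrite oner_eq0.
Qed.

Lemma C2gpt x : x 1 != 0 -> gpt C2num 'X_1 x = C2pt (x 0) (x 1).
Proof.
move=> x1; apply/rowP => i; rewrite !mxE mevalM mevalXU mulfK //.
by rewrite (uvS_morph (mpoly.meval x)) /= !mevalXU.
Qed.

Lemma C2pt_var U r : r != 0 -> C2var (C2pt U r).
Proof.
move=> r0; have := @gvar_gpt _ _ C2num 'X_1 (pair_fun U r).
by rewrite mevalXU C2gpt //; apply.
Qed.

Lemma sigma1_C2 f (a b : k) : a * b != 1 -> sized 3 f -> conjugate 3 (mapC2 a b) f ->
  let r := (a * b - 1) / 2%:R in sigma1_123 f = C2pt ((1 - a) * (1 - b) / r) r.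
Proof.
move=> ab sf c r; rewrite (sigma1_spectrum (spectrumC2 ab sf c)) //.
have d : a * b - 1 != 0 by rewrite subr_eq0.
have d' : 1 - a * b != 0 by rewrite subr_eq0 eq_sym.
have n2 := natrS_neq0 1.
have r0 : r != 0 by rewrite mulf_neq0 ?invr_eq0.
set u := _ / (1 - a * b); set U := _ / r.
have uU : u = 1 - U by rewrite /u /U /r; field; rewrite ?d ?d' ?n2.
have rU : r * U = (1 - a) * (1 - b) by rewrite mulrC divfK.
have r2 : 2%:R * r = a * b - 1 by rewrite mulrC divfK.
have e1 : r * (U - 2%:R) = 2%:R - a - b.
  by transitivity (r * U - 2%:R * r); [ring | rewrite rU r2; ring].
have e2 : r * (2%:R * U ^+ 2 - 3%:R * U) = U * (r * U) + U * (r * (U - 2%:R)) - r * U by ring.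
have e3 : r * U ^+ 3 = (r * U) * U ^+ 2 by ring.
have e4 : U * (a * b - 1) = 2%:R * ((1 - a) * (1 - b)) by rewrite -r2 -rU; ring.
clearbody u U r.
apply: row3P; rewrite !mxE /uvS /= uU.
- by rewrite e1; ring.
- rewrite e2 e1 rU; apply/eqP; rewrite -subr_eq0; apply/eqP.
  by transitivity (2%:R * ((1 - a) * (1 - b)) - U * (a * b - 1)); [ring | rewrite e4 subrr].
rewrite e2 e3 e1 rU; apply/eqP; rewrite -subr_eq0; apply/eqP.
transitivity ((2%:R - U) * (2%:R * ((1 - a) * (1 - b)) - U * (a * b - 1))); first by ring.
by rewrite e4 subrr mulr0.
Qed.

(** 1 - a and 1 - b have sum r (U - 2) and product r U. *)
Lemma C2pt_attained (U r : k) : r != 0 -> exists a b, [/\ a * b != 1, (a * b - 1) / 2%:R = r &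
  (1 - a) * (1 - b) / r = U].
Proof.
move=> r0; have [z [w [e1 e2]]] := quad_exists (r * (U - 2%:R)) (r * U).
have n2 := natrS_neq0 1.
have E : (1 - z) * (1 - w) = 1 + 2%:R * r.
  transitivity (1 - (z + w) + z * w); first by ring.
  by rewrite e1 e2; ring.
exists (1 - z), (1 - w); rewrite E; split.
- by rewrite -subr_eq0 addrC addKr mulf_neq0.
- by rewrite addrC addKr mulrC mulKf.
by rewrite !opprB ![1 + _]addrC !subrK e2 mulrC mulKf.
Qed.

Lemma variety_C2 : variety_of sigma1_123 (image_in_moduli 3 dom_ab famC2) = C2var.
Proof.
apply: variety_gvar => P; split=> [[f /imC2P[rf [a [b [ab c]]]] ->]|[x]].
  have d : (a * b - 1) / 2%:R != 0.
    by rewrite mulf_neq0 ?invr_eq0 ?natrS_neq0 // subr_eq0.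
  exists (pair_fun ((1 - a) * (1 - b) / ((a * b - 1) / 2%:R)) ((a * b - 1) / 2%:R)).
    by rewrite mevalXU.
  by rewrite C2gpt //; exact: sigma1_C2 ab (sizedR rf) c.
rewrite mevalXU => x1; rewrite C2gpt // => ->.
have [a [b [ab er eU]]] := C2pt_attained (x 0) x1.
exists (mapC2 a b); first exact: in_C2.
have sa := sized_mapC2 a b.
by rewrite (sigma1_C2 ab sa (conjugate_refl sa)) er eU.
Qed.

Section Coordinates4.

(** The symmetric functions s_i of the n_i = 1 - m_i, recovered from those of the multipliers
    m_i. *)
Definition m1 : {mpoly k[3]} := 4%:R - 'X_0.
Definition m2 : {mpoly k[3]} := 'X_1 - 6%:R + 3%:R * m1.
Definition m3 : {mpoly k[3]} := 4%:R - 3%:R * m1 + 2%:R * m2 - 'X_2.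

Lemma m_pt U r (P := C2pt U r) : [/\ m1.@[P 0] = r * (U - 2%:R) + 2%:R * U,
  m2.@[P 0] = U ^+ 2 + r * (2%:R * U ^+ 2 - 3%:R * U) & m3.@[P 0] = r * U ^+ 3].
Proof.
have E1 : m1.@[P 0] = 4%:R - P 0 0 by rewrite rmorphB rmorph_nat /= mevalXU.
have E2 : m2.@[P 0] = P 0 1 - 6%:R + 3%:R * m1.@[P 0].
  by rewrite !(rmorph_nat, rmorphB, rmorphD, rmorphM) /= mevalXU.
have E3 : m3.@[P 0] = 4%:R - 3%:R * m1.@[P 0] + 2%:R * m2.@[P 0] - P 0 2.
  by rewrite rmorphB /= mevalXU; congr (_ - _); rewrite rmorphD rmorphB !rmorphM !rmorph_nat.
by rewrite E3 E2 E1 !mxE /uvS /=; split; ring.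
Qed.

End Coordinates4.

(** Prescribing s1 and s3 != 0 gives r = s3 / U^3 and then a quartic equation for U with nonzero
    constant term. *)
Lemma C2_dim : has_dim C2var 2.
Proof.
pose F (i : 'I_2) := if i == 0 then m1 else m3.
apply: (gvar_has_dim (mpolyX_neq0 1) (F := F) (h := 'X_1)); first exact: mpolyX_neq0.
move=> y; rewrite mevalXU => y1.
have n2 := natrS_neq0 1.
have [U Ue] := monic_quartic_root (y 1) (- (y 1 / 2%:R)) 0 (y 0 / 2%:R).
have U0 : U != 0.
  by apply: contraNneq y1 => U0; move/eqP: Ue; rewrite U0 !expr0n !mulr0 !addr0 eq_sym.
have U3 : U ^+ 3 != 0 by rewrite expf_neq0.
have [e1 _ e3] := m_pt U (y 1 / U ^+ 3).
have r0 : y 1 / U ^+ 3 != 0 by rewrite mulf_neq0 ?invr_eq0.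
exists (pair_fun U (y 1 / U ^+ 3)); first by rewrite mevalXU.
move=> i; rewrite C2gpt // /F; case: (eqVneq i 0) => [->|i0].
  rewrite e1; apply: (mulIf U3).
  transitivity (y 1 * (U - 2%:R) / U ^+ 3 * U ^+ 3 + 2%:R * U ^+ 4); first by ring.
  by rewrite divfK // Ue; field.
by rewrite e3 divfK // (I2_neq0 i0).
Qed.

Lemma uv_inverse (U r : k) :
  let s1 := r * (U - 2%:R) + 2%:R * U in
  let s2 := U ^+ 2 + r * (2%:R * U ^+ 2 - 3%:R * U) in
  let s3 := r * U ^+ 3 in
  U * uvH s1 s2 s3 = uvG s1 s2 s3.
Proof. by rewrite /uvG /uvH /=; ring. Qed.

(** U is the quotient of [uvG] by [uvH], and r = s3 / U^3. The value 54 at U = r = 1 shows that the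
    denominators do not vanish identically. *)
Lemma C2_rational : rational_variety C2var.
Proof.
pose G (i : 'I_2) := if i == 0 then uvH m1 m2 m3 else uvG m1 m2 m3 ^+ 3.
pose F (i : 'I_2) := if i == 0 then uvG m1 m2 m3 else m3 * uvH m1 m2 m3 ^+ 3.
have HE U r : (uvH m1 m2 m3).@[(C2pt U r) 0] =
    uvH (r * (U - 2%:R) + 2%:R * U) (U ^+ 2 + r * (2%:R * U ^+ 2 - 3%:R * U)) (r * U ^+ 3).
  by rewrite uvH_morph /=; have [-> -> ->] := m_pt U r.
have GE U r : (uvG m1 m2 m3).@[(C2pt U r) 0] = U * (uvH m1 m2 m3).@[(C2pt U r) 0].
  by rewrite HE uv_inverse uvG_morph /=; have [-> -> ->] := m_pt U r.
have H54 : (uvH m1 m2 m3).@[(C2pt 1 1) 0] = 54%:R by rewrite HE /uvH; ring.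
have r1 := oner_neq0 k.
apply: (gvar_rational (F := F) (G := G) (mpolyX_neq0 1) C2_dim) => [i|i x].
  exists (pair_fun 1 1); first by rewrite mevalXU.
  rewrite C2gpt // /G; case: ifP => _; first by rewrite H54 natrS_neq0.
  by rewrite rmorphXn /= GE H54 mul1r expf_neq0 // natrS_neq0.
rewrite mevalXU => x1; rewrite C2gpt // /G /F; case: (eqVneq i 0) => [->|i0]; first by rewrite GE.
rewrite (I2_neq0 i0) rmorphXn rmorphM rmorphXn /= GE; have [_ _ ->] := m_pt (x 0) (x 1); ring.
Qed.

Lemma singular_at3 n (V : 'rV[k]_n -> Prop) P (r0 r1 r2 : 'rV[k]_n) : V P -> has_dim V 2 ->
  tangent V P r0 -> tangent V P r1 -> tangent V P r2 ->
  (forall a b c, (forall j, a * r0 0 j + b * r1 0 j + c * r2 0 j = 0) -> [/\ a = 0, b = 0 & c = 0]) ->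
  singular_at V P.
Proof.
move=> VP dV T0 T1 T2 ind.
apply: (@singular_atP _ _ _ 2 (\matrix_(i < 3) [:: r0; r1; r2]`_i) VP dV); last first.
  by move=> i; rewrite rowK; case: i => [[|[|[|//]]] i].
apply: inj_row_free => v /rowP v0.
have [j|e0 e1 e2] := ind (v 0 0) (v 0 1) (v 0 2).
  have := v0 j; rewrite !mxE !big_ord_recl big_ord0 !mxE /= addr0 addrA => H.
  by rewrite -[RHS]H; congr (_ * _ + _ * _ + _ * _); congr (v _ _); apply/val_inj.
by apply: row3P; rewrite mxE.
Qed.

(** Two parameter points map to [P]; they come from a = b = 0 and a = b = 3, both giving the class
    of z^3 with multipliers 0, 0, 3, 3. The first sheet contributes the derivatives in r and U, the
    second its derivative in r. *)
Lemma C2_singular : singular C2var.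
Proof.
have n2 := natrS_neq0 1; have m0 : - (2%:R^-1) != 0 :> k by rewrite oppr_eq0 invr_eq0.
pose L (a b c : k) : 'rV[k]_3 := \row_i [:: a; b; c]`_i.
pose P := L 6%:R 9%:R 0.
have P1 : C2pt (- 2%:R) (- (2%:R^-1)) = P.
  by apply: row3P; rewrite !mxE /uvS /=; field.
have P2 : C2pt 1 4%:R = P by apply: row3P; rewrite !mxE /uvS /=; ring.
have param (u r : {poly k}) t : r != 0 ->
    tangent C2var (C2pt u.[t] r.[t]) (\row_(i < 3) ((uvS u r)`_i)^`().[t]).
  move=> r0; have hE x (i : 'I_3) : ((uvS u r)`_i).[x] = (uvS u.[x] r.[x])`_i.
    exact: (uvS_morph (horner_eval x)).
  have := @tangent_param _ C2var (fun i : 'I_3 => (uvS u r)`_i) r t r0.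
  rewrite (_ : \row_i ((uvS u r)`_i).[t] = C2pt u.[t] r.[t]); last first.
    by apply/rowP => i; rewrite !mxE hE.
  apply=> x rx; rewrite (_ : \row_i ((uvS u r)`_i).[x] = C2pt u.[x] r.[x]); first exact: C2pt_var.
  by apply/rowP => i; rewrite !mxE hE.
have T0 : tangent C2var P (L 4%:R 26%:R 48%:R).
  have := @param (- 2%:R)%:P 'X (- (2%:R^-1)).
  rewrite polyX_eq0 => /(_ isT); rewrite hornerC hornerX P1.
  rewrite (_ : \row_i _ = L 4%:R 26%:R 48%:R) //.
  by apply: row3P; rewrite !mxE /uvS /=; (eapply val_der_eq; [val_der_tac | ring]).
have T1 : tangent C2var P (L (- (3%:R / 2%:R)) (- 3%:R) (9%:R / 2%:R)).
  have := @param 'X (- (2%:R^-1))%:P (- 2%:R).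
  rewrite polyC_eq0 => /(_ m0); rewrite hornerC hornerX P1.
  rewrite (_ : \row_i _ = L (- (3%:R / 2%:R)) (- 3%:R) (9%:R / 2%:R)) //.
  by apply: row3P; rewrite !mxE /uvS /=; (eapply val_der_eq; [val_der_tac | field]).
have T2 : tangent C2var P (L 1 2%:R 0).
  have := @param 1%:P 'X 4%:R.
  rewrite polyX_eq0 => /(_ isT); rewrite hornerC hornerX P2.
  rewrite (_ : \row_i _ = L 1 2%:R 0) //.
  by apply: row3P; rewrite !mxE /uvS /=; (eapply val_der_eq; [val_der_tac | ring]).
exists P; apply: (singular_at3 _ C2_dim T0 T1 T2); first by rewrite -P2; exact: C2pt_var (natrS_neq0 3).
move=> a b c H; have := (H 0, H 1, H 2); rewrite !mxE /= => -[[h0 h1] h2].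
have a0 : a = 0.
  apply: (mulfI (natrS_neq0 17)); rewrite mulr0.
  transitivity ((a * 26%:R + b * (- 3%:R) + c * 2%:R)
    - 2%:R * (a * 4%:R + b * (- (3%:R / 2%:R)) + c * 1)); first by field.
  by rewrite h0 h1; ring.
have b0 : b = 0.
  apply: (mulfI (natrS_neq0 8)); rewrite mulr0.
  transitivity (2%:R * (a * 48%:R + b * (9%:R / 2%:R) + c * 0) - 96%:R * a); first by field.
  by rewrite h2 a0; ring.
by split=> //; rewrite -[LHS]mulr1 -[RHS]h0 a0 b0; ring.
Qed.

Lemma C2_surface (V := variety_of sigma1_123 (image_in_moduli 3 dom_ab famC2)) :
  [/\ irreducible_surface V, rational_variety V & singular V].
Proof.
rewrite /V variety_C2; split; [split|exact: C2_rational|exact: C2_singular].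
  exact: gvar_irreducible_variety (mpolyX_neq0 1).
exact: C2_dim.
Qed.

(** * The surface of family (5) *)

Section Surface5.
Variable R : comNzRingType.
Implicit Types x y : R.

(* At (kap, eta) = (x, y), with w = 1 / y.  The period-2 multipliers of [mapC2' a b] are, twice each,
   A = a b = 1 - 8 / y, u^2, v^2, w1^2, w2^2; B, B' and C, C' are the sums and products of the
   pairs u^2, v^2 and w1^2, w2^2. *)
Definition keS x y w : seq R :=
  let A := 1 - 8%:R * w in
  let B := 4%:R * x ^+ 2 - 12%:R * x + 2%:R in
  let B' := (1 + 2%:R * x) ^+ 2 in
  let S := y + 6%:R - 2%:R * x in
  let C := S ^+ 2 - 2%:R * S - 6%:R in
  let C' := (S + 3%:R) ^+ 2 in
  [:: 4%:R - 4%:R * x; 4%:R * x ^+ 2 - 4%:R * x + 6%:R; (2%:R + 4%:R * x) * (2%:R - 2%:R * x);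
      2%:R * (A + B + C); (A + B + C) ^+ 2 + 2%:R * (A * (B + C) + B * C + B' + C')].

(* The same, multiplied by y ^+ 2 to clear denominators. *)
Definition keN x y : seq R :=
  let A := y - 8%:R in
  let B := 4%:R * x ^+ 2 - 12%:R * x + 2%:R in
  let B' := (1 + 2%:R * x) ^+ 2 in
  let S := y + 6%:R - 2%:R * x in
  let C := S ^+ 2 - 2%:R * S - 6%:R in
  let C' := (S + 3%:R) ^+ 2 in
  [:: (4%:R - 4%:R * x) * y ^+ 2; (4%:R * x ^+ 2 - 4%:R * x + 6%:R) * y ^+ 2;
      (2%:R + 4%:R * x) * (2%:R - 2%:R * x) * y ^+ 2;
      2%:R * y * (A + y * (B + C));
      (A + y * (B + C)) ^+ 2 + 2%:R * (y * A * (B + C) + y ^+ 2 * (B * C + B' + C'))].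

End Surface5.

Lemma keS_morph (R S : comNzRingType) (f : {rmorphism R -> S}) x y w i :
  f (keS x y w)`_i = (keS (f x) (f y) (f w))`_i.
Proof.
by case: i => [|[|[|[|[|i]]]]]; rewrite /keS /= ?nth_nil ?rmorph0 //
  ?(rmorph_nat, rmorphXn, rmorphB, rmorphD, rmorphM, rmorph1).
Qed.

Lemma keN_morph (R S : comNzRingType) (f : {rmorphism R -> S}) x y i :
  f (keN x y)`_i = (keN (f x) (f y))`_i.
Proof.
by case: i => [|[|[|[|[|i]]]]]; rewrite /keN /= ?nth_nil ?rmorph0 //
  ?(rmorph_nat, rmorphXn, rmorphB, rmorphD, rmorphM, rmorph1).
Qed.

Lemma row5P (P Q : 'rV[k]_5) :
  [/\ P 0 0 = Q 0 0, P 0 1 = Q 0 1, P 0 2 = Q 0 2, P 0 3 = Q 0 3 & P 0 4 = Q 0 4] -> P = Q.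
Proof.
case=> e0 e1 e2 e3 e4; apply/rowP => -[[|[|[|[|[|//]]]]] i].
- by rewrite (_ : Ordinal i = 0) //; exact/val_inj.
- by rewrite (_ : Ordinal i = 1) //; exact/val_inj.
- by rewrite (_ : Ordinal i = 2) //; exact/val_inj.
- by rewrite (_ : Ordinal i = 3) //; exact/val_inj.
by rewrite (_ : Ordinal i = 4) //; exact/val_inj.
Qed.

Definition C2'num (i : 'I_5) : {mpoly k[2]} := (keN 'X_0 'X_1)`_i.
Definition C2'pt (x y : k) : 'rV[k]_5 := \row_i (keS x y y^-1)`_i.
Definition C2'var := gvar C2'num ('X_1 ^+ 2).

Lemma C2'den0 : 'X_1 ^+ 2 != 0 :> {mpoly k[2]}.
Proof. by rewrite expf_neq0 // mpolyX_neq0. Qed.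

Lemma C2'denE x : ('X_1 ^+ 2 : {mpoly k[2]}).@[x] = x 1 ^+ 2.
Proof. by rewrite rmorphXn /= mevalXU. Qed.

Lemma C2'gpt x : x 1 != 0 -> gpt C2'num ('X_1 ^+ 2) x = C2'pt (x 0) (x 1).
Proof.
move=> x1; have E (i : 'I_5) : (C2'num i).@[x] = (keN (x 0) (x 1))`_i.
  by rewrite (keN_morph (mpoly.meval x)) /= !mevalXU.
by apply: row5P; split; rewrite !mxE E C2'denE /keN /keS /=; field.
Qed.

Lemma C2'pt_var x y : y != 0 -> C2'var (C2'pt x y).
Proof.
move=> y0; have := @gvar_gpt _ _ C2'num ('X_1 ^+ 2) (pair_fun x y).
by rewrite C2'denE C2'gpt // expf_neq0 //; apply.
Qed.

Lemma sigma_C2' f (a b : k) : a * b != 1 -> sized 3 f -> conjugate 3 (mapC2' a b) f ->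
  sigma1_123_sigma2_12 f = C2'pt (kap a b) (eta a b).
Proof.
move=> ab sf c; have d : 1 - a * b != 0 by rewrite subr_eq0 eq_sym.
have := sigma1_C2' ab sf c; have [u [v [w1 [w2 [[E1 E2] [E3 E4] _ p]]]]] := spectrumC2' ab sf c.
have Ew : a * b = 1 - 8%:R * (eta a b)^-1.
  by rewrite /eta invf_div mulrCA divff ?natrS_neq0 // mulr1; ring.
move: (kap a b) (eta a b) E1 E2 E3 E4 Ew => x y E1 E2 E3 E4 Ew S1.
have B1 : u ^+ 2 + v ^+ 2 = 4%:R * x ^+ 2 - 12%:R * x + 2%:R.
  transitivity ((u + v) ^+ 2 - 2%:R * (u * v)); first by ring.
  by rewrite E1 E2; ring.
have B2 : u ^+ 2 * v ^+ 2 = (1 + 2%:R * x) ^+ 2 by rewrite -exprMn E2.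
have S : w1 + w2 = y + 6%:R - 2%:R * x by rewrite E3.
have C1 : w1 ^+ 2 + w2 ^+ 2 = (w1 + w2) ^+ 2 - 2%:R * (w1 + w2) - 6%:R.
  transitivity ((w1 + w2) ^+ 2 - 2%:R * (w1 * w2)); first by ring.
  by rewrite E4; ring.
have C2 : w1 ^+ 2 * w2 ^+ 2 = (w1 + w2 + 3%:R) ^+ 2 by rewrite -exprMn E4.
have e1 (i : 'I_3) : sigma 3 1 i.+1 f = (kapT i).[x].
  by move/rowP: S1 => /(_ i); rewrite !mxE.
apply: row5P; split; rewrite !mxE /=.
- by rewrite (e1 0) /kapT /keS /= !hE; ring.
- by rewrite (e1 1) /kapT /keS /= !hE; ring.
- by rewrite (e1 2) /kapT /keS /= !hE; ring.
- rewrite (sigma_es p) // /keS /= -Ew -S -B1 -C1; ring.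
rewrite (sigma_es p) // /keS /= -Ew -S -B1 -B2 -C1 -C2; ring.
Qed.

Lemma C2'_attained (x y : k) : y != 0 -> exists a b, [/\ a * b != 1, kap a b = x & eta a b = y].
Proof.
move=> y0; have n8 := natrS_neq0 7.
have [d de] := sqrt_exists (x * (8%:R / y) - 4%:R).
(* [b] is the negative of the second parameter: [d] is the difference of the parameters, and their
   product is 1 - 8 / y. *)
have [a [b [e1 e2]]] := quad_exists d (8%:R / y - 1).
have ab : 1 - a * - b = 8%:R / y by rewrite mulrN e2; ring.
have q0 : 8%:R / y != 0 by rewrite mulf_neq0 ?invr_eq0.
exists a, (- b); split.
- by rewrite eq_sym -subr_eq0 ab.
- by rewrite /kap ab opprK e1 de addrC subrK mulfK.
by rewrite /eta ab invf_div mulrCA divff // mulr1.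
Qed.

Lemma variety_C2' :
  variety_of sigma1_123_sigma2_12 (image_in_moduli 3 dom_ab famC2') = C2'var.
Proof.
apply: variety_gvar => P; split=> [[f /imC2'P[rf [a [b [ab c]]]] ->]|[x]].
  have e0 : eta a b != 0.
    by rewrite mulf_neq0 ?natrS_neq0 // invr_eq0 subr_eq0 eq_sym.
  exists (pair_fun (kap a b) (eta a b)); first by rewrite C2'denE expf_neq0.
  by rewrite C2'gpt //; exact: sigma_C2' ab (sizedR rf) c.
rewrite C2'denE expf_eq0 /= => x1; rewrite C2'gpt // => ->.
have [a [b [ab ex ey]]] := C2'_attained (x 0) x1.
exists (mapC2' a b); first exact: in_C2'.
have sa := sized_mapC2' a b.
by rewrite (sigma_C2' ab sa (conjugate_refl sa)) ex ey.
Qed.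

(** The first coordinate determines kap; prescribing the fourth is then a cubic equation for eta
    with constant term 8, so eta != 0. *)
Lemma C2'_dim : has_dim C2'var 2.
Proof.
have n2 := natrS_neq0 1; have n4 := natrS_neq0 3.
pose F (i : 'I_2) : {mpoly k[5]} := if i == 0 then 4%:R^-1%:MP * (4%:R%:MP - 'X_0) else 'X_3.
apply: (gvar_has_dim C2'den0 (F := F) (h := 1)); first exact: oner_neq0.
move=> z _; pose x := z 0; pose K := 6%:R - 2%:R * x.
pose B := 4%:R * x ^+ 2 - 12%:R * x + 2%:R.
have [y ye] := monic_cubic_root 8%:R (- (1 + B + K ^+ 2 - 2%:R * K - 6%:R - z 1 / 2%:R))
  (- (2%:R * K - 2%:R)).
have y0 : y != 0.
  apply/eqP => y0; move/eqP: ye; rewrite y0 !expr0n !mulr0 !addr0 eq_sym.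
  by rewrite (negbTE (natrS_neq0 7)).
exists (pair_fun x y); first by rewrite C2'denE expf_neq0.
have [p0 p1] : pair_fun x y 0 = x /\ pair_fun x y 1 = y by [].
move=> i; rewrite C2'gpt // p0 p1 /F; case: (eqVneq i 0) => [->|i0].
  rewrite mevalM mevalB !mevalC mevalXU mxE /keS /= -/x.
  by transitivity (4%:R^-1 * (4%:R * x)); [ring | rewrite mulKf].
rewrite (I2_neq0 i0) mevalXU mxE /keS /= -/x.
apply: (mulIf y0).
transitivity (2%:R * (y ^+ 3 - 8%:R + (1 + B + K ^+ 2 - 2%:R * K - 6%:R) * y + (2%:R * K - 2%:R) * y ^+ 2)).
  by rewrite /B /K; field.
by rewrite ye; field.
Qed.

(** The derivative of [keS] in kap, with eta = y fixed, at kap = 4. *)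
Definition keD (y : k) : seq k :=
  let A := 1 - 8%:R / y in let S := y - 2%:R in let C := S ^+ 2 - 2%:R * S - 6%:R in
  let D := 32%:R - 4%:R * y in
  [:: - 4%:R; 28%:R; - 60%:R; 2%:R * D;
      2%:R * (A + 18%:R + C) * D
      + 2%:R * (A * D + 20%:R * C + 18%:R * (12%:R - 4%:R * y) + 36%:R - 4%:R * (y + 1))].

Lemma C2'_tangent (y : k) : y != 0 ->
  tangent C2'var (C2'pt 4%:R y) (\row_(i < 5) (keD y)`_i).
Proof.
move=> y0; pose c (i : 'I_5) : {poly k} := (keS 'X y%:P (y^-1)%:P)`_i.
have cE t (i : 'I_5) : (c i).[t] = (keS t y y^-1)`_i.
  have -> : (c i).[t] = (keS 'X.[t] y%:P.[t] (y^-1)%:P.[t])`_i.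
    exact: (keS_morph (horner_eval t)).
  by rewrite hornerX !hornerC.
have := @tangent_param _ C2'var c 1 4%:R (oner_neq0 _).
rewrite (_ : \row_i (c i).[_] = C2'pt 4%:R y); last by apply/rowP => i; rewrite !mxE cE.
rewrite (_ : \row_i (c i)^`().[_] = \row_(i < 5) (keD y)`_i).
  apply=> t _; rewrite (_ : \row_i (c i).[_] = C2'pt t y); first exact: C2'pt_var.
  by apply/rowP => i; rewrite !mxE cE.
by apply: row5P; split; rewrite !mxE /c /keS /keD /=; (eapply val_der_eq; [val_der_tac | rewrite ?mulr1 ?mul0r ?mulr0 ?mul1r ?add0r ?addr0 ?oppr0; ring]).
Qed.

(* Over kap = 4 the points with eta = 9, - 1 / 3 and - 8 / 3 have the same image. *)
Lemma C2'_singular : singular C2'var.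
Proof.
have n3 := natrS_neq0 2; have n8 := natrS_neq0 7; have n9 := natrS_neq0 8.
have q1 : - (3%:R^-1) != 0 :> k by rewrite oppr_eq0 invr_eq0.
have q2 : - (8%:R / 3%:R) != 0 :> k by rewrite oppr_eq0 mulf_neq0 ?invr_eq0.
(* kap = 4 is the line b = - a, that is, family (3), where eta = 8 / (1 - a^2) for the parameter a
   of [mapD2']. The conjugate parameters 1 / 3, - 5 and - 2 give the three values of eta. *)
have E1 : C2'pt 4%:R (- (3%:R^-1)) = C2'pt 4%:R 9%:R.
  by apply: row5P; split; rewrite !mxE /keS /=; field.
have E2 : C2'pt 4%:R (- (8%:R / 3%:R)) = C2'pt 4%:R 9%:R.
  by apply: row5P; split; rewrite !mxE /keS /=; field.
have T0 := C2'_tangent n9; have T1 := C2'_tangent q1; have T2 := C2'_tangent q2.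
rewrite E1 in T1; rewrite E2 in T2.
exists (C2'pt 4%:R 9%:R); apply: (singular_at3 _ C2'_dim T0 T1 T2); first exact: C2'pt_var.
move=> a b c H; have := (H 0, H 3, H 4); rewrite !mxE /keD /= => -[[h0 h1] h2].
have F0 : a + b + c = 0.
  apply: (mulfI (natrS_neq0 3)); rewrite mulr0 -[RHS]oppr0 -[in RHS]h0; ring.
have F1 : - 24%:R * a + 200%:R * b + 256%:R * c = 0.
  by rewrite -[RHS](mulr0 3%:R) -[in RHS]h1; field.
have F2 : - 2424%:R * a + 149000%:R * b + 169216%:R * c = 0.
  by rewrite -[RHS](mulr0 27%:R) -[in RHS]h2; field.
have G1 : 224%:R * b + 280%:R * c = 0.
  by rewrite -[RHS](addr0 0) -{1}F1 -[X in _ = _ + X](mulr0 24%:R) -F0; ring.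
have G2 : 151424%:R * b + 171640%:R * c = 0.
  by rewrite -[RHS](addr0 0) -{1}F2 -[X in _ = _ + X](mulr0 2424%:R) -F0; ring.
(* 676 = 151424 / 224 eliminates [b] and leaves 17640 times [c]. *)
have c0 : c = 0.
  apply: (mulfI (natrS_neq0 17639)); rewrite mulr0.
  transitivity (676%:R * (224%:R * b + 280%:R * c) - (151424%:R * b + 171640%:R * c)); first by ring.
  by rewrite G1 G2; ring.
have b0 : b = 0 by apply: (mulfI (natrS_neq0 223)); rewrite mulr0 -[RHS]G1 c0; ring.
by split=> //; rewrite -[RHS]F0 b0 c0 !addr0.
Qed.

Lemma C2'_surface
    (V := variety_of sigma1_123_sigma2_12 (image_in_moduli 3 dom_ab famC2')) :
  irreducible_surface V /\ singular V.
Proof.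
rewrite /V variety_C2'; split; last exact: C2'_singular.
by split; [exact: gvar_irreducible_variety C2'den0 | exact: C2'_dim].
Qed.

Theorem theorem1p4 :
  (* (1) *)
  [/\ (forall x, dom_ne0 x -> is_rat 3 (famC3 x)),
      one_to_one 3 dom_ne0 famC3,
      (forall f, image_in_moduli 3 dom_ne0 famC3 f <-> aut_locus 3 grpC3 f) &
      let V := variety_of sigma1_123 (aut_locus 3 grpC3) in
      [/\ irreducible_curve V,
          curve_genus V 0,
          (exists! P, singular_at V P) &
          forall P, singular_at V P <->
            exists2 f, aut_locus 3 grpA4 f & P = sigma1_123 f]] /\
  (* (2) *)
  [/\ (forall x, dom_ne1 x -> is_rat 3 (famD2 x)),
      n_to_one 2 3 dom_ne1 famD2,
      irreducible_component (moduli_closed 3) (aut_locus 3 grpD2)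
        (image_in_moduli 3 dom_ne1 famD2) &
      let V := variety_of sigma1_123 (image_in_moduli 3 dom_ne1 famD2) in
      [/\ irreducible_curve V, smooth V & curve_genus V 0]] /\
  (* (3) *)
  [/\ (forall x, dom_ne1 x -> is_rat 3 (famD2' x)),
      n_to_one 6 3 dom_ne1 famD2',
      irreducible_component (moduli_closed 3) (aut_locus 3 grpD2)
        (image_in_moduli 3 dom_ne1 famD2') &
      let V := variety_of sigma2_123 (image_in_moduli 3 dom_ne1 famD2') in
      [/\ irreducible_curve V, smooth V & curve_genus V 0]] /\
  (* (4) *)
  [/\ (forall x, dom_ab x -> is_rat 3 (famC2 x)),
      n_to_one 2 3 dom_ab famC2,
      irreducible_component (moduli_closed 3) (aut_locus 3 grpC2)
        (image_in_moduli 3 dom_ab famC2) &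
      let V := variety_of sigma1_123 (image_in_moduli 3 dom_ab famC2) in
      [/\ irreducible_surface V, rational_variety V & singular V]] /\
  (* (5) *)
  [/\ (forall x, dom_ab x -> is_rat 3 (famC2' x)),
      n_to_one 4 3 dom_ab famC2',
      irreducible_component (moduli_closed 3) (aut_locus 3 grpC2)
        (image_in_moduli 3 dom_ab famC2') &
      let V := variety_of sigma1_123_sigma2_12
                 (image_in_moduli 3 dom_ab famC2') in
      irreducible_surface V /\ singular V].
Proof.
split.
  split; [by move=> x; exact: rat_mapC3 | exact: C3_one_to_one | |exact: C3_curve].
  by move=> f; rewrite locus_C3P.
split; first by split; [exact: rat_D2 | exact: D2_two_to_one | exact: D2_component | exact: D2_curve].
split; first by split; [exact: rat_D2' | exact: D2'_six_to_one | exact: D2'_component | exact: D2'_curve].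
split; first by split; [exact: rat_C2 | exact: C2_two_to_one | exact: C2_component | exact: C2_surface].
by split; [exact: rat_C2' | exact: C2'_four_to_one | exact: C2'_component | exact: C2'_surface].
Qed.
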